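(* Let $i:X\hookrightarrow(M,\pi)$ be a coregular pre-Poisson submanifold of a Poisson manifold. Let $TM|_X=(TX^{\perp_\pi}\cap TX)\oplus H\oplus W$ be a splitting with $$TX^{\perp_\pi}=(TX^{\perp_\pi}\cap TX)\oplus H\quad\text{and}\quad \pi^\sharp\big((H+W)^\circ\big)\subset W.$$ Then the quadruple $$\Big(H,\;W,\;i^!L_\pi,\;\big(W^\circ/(H+W)^\circ,\pi\big)\Big)$$ determines a neighborhood of $X$ in its local Poisson saturation, up to Poisson diffeomorphism.
   Context: $\pi^\sharp:T^*M\to TM$ is given by $\langle\pi^\sharp(\alpha),\beta\rangle=\pi(\alpha,\beta)$. For an embedded submanifold $i:X\hookrightarrow M$, $(\cdot)^\circ$ denotes annihilators in $T^*M|_X$ and $TX^{\perp_\pi}:=\pi^\sharp(TX^\circ)$. $X$ is coregular if $\mathrm{pr}\circ\pi^\sharp:T^*M|_X\to TM|_X/TX$ has constant rank; equivalently $TX^{\perp_\pi}$ has constant rank. $X$ is pre-Poisson if $TX+TX^{\perp_\pi}$ has constant rank. If $X$ is coregular pre-Poisson, then $TX^{\perp_\pi}\cap TX$ has constant rank, and splittings as in the claim exist. The condition $\pi^\sharp((H+W)^\circ)\subset W$ gives $\pi((H+W)^\circ,W^\circ)=0$, so $\pi$ restricted to $W^\circ$ descends to a bilinear form on $W^\circ/(H+W)^\circ$, also denoted $\pi$. A Poisson submanifold is a submanifold $P$ with $\pi^\sharp(T^*M|_P)\subset TP$; it has an induced Poisson structure $\pi_P$. $L_\pi=\{\pi^\sharp(\alpha)+\alpha:\alpha\in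 T^*M\}$ is the Dirac structure of $\pi$, and $i^!L_\pi=\{v+(\mathrm{d}i)^*\beta: \mathrm{d}i(v)+\beta\in L_\pi\}$ its pullback, which for coregular $X$ is a smooth Dirac structure on $X$. Local Poisson saturation. A Poisson spray is a vector field $\chi$ on $T^*M$ with $\mathrm{d}\mathrm{pr}(\chi(\xi))=\pi^\sharp(\xi)$ for all $\xi\in T^*M$ and $m_t^*\chi=t\chi$ for all $t>0$, where $\mathrm{pr}:T^*M\to M$ is the projection and $m_t$ is fiberwise multiplication by $t$. On a neighborhood $\Sigma\subset T^*M$ of the zero section its flow $\phi^t_\chi$ is defined for $t\in[0,1]$, and $\exp_\chi:\Sigma\to M$, $\exp_\chi(\xi)=\mathrm{pr}(\phi^1_\chi(\xi))$. Choosing a complement to $TX^{\perp_\pi}$ in $TM|_X$ gives an inclusion $(TX^{\perp_\pi})^*\hookrightarrow T^*M|_X$; for $\Sigma$ small enough, $P:=\exp_\chi((TX^{\perp_\pi})^*\cap\Sigma)$ is an embedded Poisson submanifold containing $X$, it equals $\exp_\chi(\Sigma|_X)$, and (after shrinking) it is the union of the symplectic leaves of $(V,\pi|_V)$ meeting $X$ for some open neighborhood $V$ of $X$. $(P,\pi_P)$ is called the local Poisson saturation of $X$. *)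

(* Defs.v *)
From HB Require Import structures.
From mathcomp Require Import all_boot all_order all_algebra.
From mathcomp Require Import all_classical all_reals all_analysis.
Set Implicit Arguments.
Unset Strict Implicit.
Unset Printing Implicit Defensive.
Import Order.TTheory GRing.Theory Num.Theory.
Import numFieldNormedType.Exports.
Local Open Scope classical_set_scope.
Local Open Scope ring_scope.

Fixpoint Ck (R : realType) (n : nat) (V : normedModType R) (k : nat)
    (U : set 'rV[R]_n) (f : 'rV[R]_n -> V) : Prop :=
  match k with
  | 0 => forall y, U y -> {for y, continuous f}
  | k'.+1 => (forall y v, U y -> derivable f y v) /\
             (forall v, Ck k' U (fun y => 'D_v f y))
  end.

(* Meaningful for open [U]; only the values of [f] on [U] matter. *)
Definition smooth_on (R : realType) (n : nat) (V : normedModType R)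
    (U : set 'rV[R]_n) (f : 'rV[R]_n -> V) : Prop :=
  forall k, Ck k U f.

(* [cto] is relevant on [cdom], [cof] on [cto @` cdom]. *)
Record chart (R : realType) (T : Type) (n : nat) := Chart {
  cdom : set T;
  cto : T -> 'rV[R]_n;
  cof : 'rV[R]_n -> T }.

(* The atlas is the family of the [chart_at p].  The topology is the one
   generated by the charts, see [mopen]. *)
Record charted (R : realType) := Charted {
  pt :> Type;
  mdim : nat;
  chart_at : pt -> chart R pt mdim }.

Arguments chart_at {R c}.

Section Manifolds.
Variable R : realType.
Implicit Types M N X : charted R.

Definition cimg T n (c : chart R T n) : set 'rV[R]_n := cto c @` cdom c.

Definition mopen M (O : set M) : Prop :=
  forall p : M, open (cto (chart_at p) @` (cdom (chart_at p) `&` O)).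

Record is_manifold M : Prop := IsManifold {
  chart_at_mem : forall p : M, cdom (chart_at p) p;
  chart_inj : forall p x : M, cdom (chart_at p) x ->
    cof (chart_at p) (cto (chart_at p) x) = x;
  chart_open : forall p : M, open (cimg (chart_at p));
  chart_compat : forall p q : M,
    let D := cto (chart_at p) @` (cdom (chart_at p) `&` cdom (chart_at q)) in
    open D /\ smooth_on D (cto (chart_at q) \o cof (chart_at p));
  hausdorff_mfd : forall p q : M, p <> q -> exists U V : set M,
    [/\ mopen U, mopen V, U p, V q & U `&` V = set0];
  second_countable_mfd : exists A : set M, countable A /\
    \bigcup_(p in A) cdom (chart_at p) = [set: M] }.

(* A tangent vector at [p] is the row of its components in [chart_at p], a
   covector at [p] the row of its components in the dual frame; the pairing of
   the covector a with the vector v is v *m a^T.  Subspaces are row spaces. *)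

(* Jacobian at [p] of the change of coordinates from [c] to [c']: a vector with
   components v in [c] has components v *m cchange c c' p in [c']. *)
Definition cchange T n (c c' : chart R T n) (p : T) : 'M[R]_n :=
  jacobian (cto c' \o cof c) (cto c p).

Definition smooth_fun M (f : M -> R) : Prop :=
  forall p : M, smooth_on (cimg (chart_at p)) (f \o cof (chart_at p)).

Definition smooth_map_on M N (U : set M) (f : M -> N) : Prop :=
  forall (p : M) (q : N),
    let D := cto (chart_at p) @`
      (cdom (chart_at p) `&` U `&` f @^-1` cdom (chart_at q)) in
    open D /\ smooth_on D (cto (chart_at q) \o f \o cof (chart_at p)).

Definition smooth_map M N (f : M -> N) : Prop := smooth_map_on [set: M] f.

(* The differential of [f] at [p], acting on row vectors from the right. *)
Definition tmap M N (f : M -> N) (p : M) : 'M[R]_(mdim M, mdim N) :=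
  jacobian (cto (chart_at (f p)) \o f \o cof (chart_at p)) (cto (chart_at p) p).

Definition dfun M (f : M -> R) (p : M) : 'rV[R]_(mdim M) :=
  \row_j 'D_(delta_mx 0 j) (f \o cof (chart_at p)) (cto (chart_at p) p).

Record is_embedding M N (f : M -> N) : Prop := IsEmbedding {
  emb_smooth : smooth_map f;
  emb_inj : injective f;
  emb_immersion : forall p, row_free (tmap f p);
  emb_topology : forall O : set M, mopen O ->
    exists O' : set N, mopen O' /\ O = f @^-1` O' }.

(* Smoothness on [U] of k-tuples of sections of i^*TM. *)
Definition smooth_along X M (i : X -> M) (U : set X) k
    (s : X -> 'M[R]_(k, mdim M)) : Prop :=
  forall (p : X) (q : M),
    smooth_on (cto (chart_at p) @`
        (cdom (chart_at p) `&` U `&` i @^-1` cdom (chart_at q)))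
      (fun y => let x := cof (chart_at p) y in
         s x *m cchange (chart_at (i x)) (chart_at q) (i x)).

Definition smooth_vector_field M (v : M -> 'rV[R]_(mdim M)) : Prop :=
  smooth_along (@id M) [set: M] v.

(* Smooth subbundles of TM|_X = i^*TM. *)
Definition subbundle X M (i : X -> M) (E : X -> 'M[R]_(mdim M)) : Prop :=
  exists r : nat, (forall x, \rank (E x) = r) /\
    forall x0 : X, exists U : set X, [/\ mopen U, U x0 &
      exists s : X -> 'M[R]_(r, mdim M),
        smooth_along i U s /\ forall x, U x -> (s x :=: E x)%MS].

(* Smooth vector bundle maps i1^*TM -> i2^*TN over the identity of X. *)
Definition smooth_bundle_map X M N (i1 : X -> M) (i2 : X -> N)
    (Phi : X -> 'M[R]_(mdim M, mdim N)) : Prop :=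
  forall (p : X) (q1 : M) (q2 : N),
    smooth_on (cto (chart_at p) @` (cdom (chart_at p) `&`
        i1 @^-1` cdom (chart_at q1) `&` i2 @^-1` cdom (chart_at q2)))
      (fun y => let x := cof (chart_at p) y in
         cchange (chart_at q1) (chart_at (i1 x)) (i1 x) *m Phi x *m
         cchange (chart_at (i2 x)) (chart_at q2) (i2 x)).

(* The annihilator, in the dual space, of the row space of [A]. *)
Definition ann m n (A : 'M[R]_(m, n)) : 'M[R]_n := kermx A^T.

Definition bivec M := M -> 'M[R]_(mdim M).

Definition bform M (pi : bivec M) (p : M) (a b : 'rV[R]_(mdim M)) : R :=
  (a *m pi p *m b^T) 0 0.

(* <sharp a, b> = pi(a, b) *)
Definition sharp M (pi : bivec M) (p : M) (a : 'rV[R]_(mdim M)) :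
  'rV[R]_(mdim M) := a *m pi p.

Definition bracket M (pi : bivec M) (f g : M -> R) : M -> R :=
  fun p => bform pi p (dfun f p) (dfun g p).

Record is_poisson M (pi : bivec M) : Prop := IsPoisson {
  poisson_antisym : forall p, (pi p)^T = - pi p;
  poisson_smooth : forall q : M, smooth_on (cimg (chart_at q))
    (fun y => let p := cof (chart_at q) y in
       let J := cchange (chart_at p) (chart_at q) p in J^T *m pi p *m J);
  poisson_jacobi : forall f g h : M -> R,
    smooth_fun f -> smooth_fun g -> smooth_fun h -> forall p,
      bracket pi f (bracket pi g h) p + bracket pi g (bracket pi h f) p +
      bracket pi h (bracket pi f g) p = 0 }.

Definition poisson_at M N (pi : bivec M) (pi' : bivec N) (f : M -> N) (p : M) :
    Prop :=
  (tmap f p)^T *m pi p *m tmap f p = pi' (f p).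

(* (P, piP) is, via [j], an embedded Poisson submanifold of (M, pi) with its
   induced structure: the range of sharp at [j p] is the row space of
   [pi (j p)]. *)
Definition poisson_submanifold M (pi : bivec M) (P : charted R) (j : P -> M)
    (piP : bivec P) : Prop :=
  [/\ is_embedding j, forall p, (pi (j p) <= tmap j p)%MS &
      forall p, poisson_at piP pi j p].

(* TX is the row space of [tmap i x]. *)
Definition Tperp X M (pi : bivec M) (i : X -> M) (x : X) : 'M[R]_(mdim M) :=
  ann (tmap i x) *m pi (i x).

(* [cokermx A] has kernel the row space of [A], hence represents the projection
   pr : TM|_X -> TM|_X/TX up to an injective map. *)
Definition coregular X M (pi : bivec M) (i : X -> M) : Prop :=
  exists r : nat, forall x : X,
    \rank (pi (i x) *m cokermx (tmap i x)) = r.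

Definition pre_poisson X M (pi : bivec M) (i : X -> M) : Prop :=
  exists r : nat, forall x : X, \rank (tmap i x + Tperp pi i x)%MS = r.

Definition TTperp X M (pi : bivec M) (i : X -> M) (x : X) : 'M[R]_(mdim M) :=
  (Tperp pi i x :&: tmap i x)%MS.

Record splitting X M (pi : bivec M) (i : X -> M)
    (H W : X -> 'M[R]_(mdim M)) : Prop := Splitting {
  split_H : subbundle i H;
  split_W : subbundle i W;
  split_direct : forall x, mxdirect (TTperp pi i x + H x + W x);
  split_full : forall x, (TTperp pi i x + H x + W x :=: 1%:M)%MS;
  split_Tperp : forall x, (Tperp pi i x :=: TTperp pi i x + H x)%MS;
  split_sharp : forall x, (ann (H x + W x)%MS *m pi (i x) <= W x)%MS }.

(* L_pi at [p], as a set of pairs (vector, covector). *)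
Definition dirac_of M (pi : bivec M) (p : M) :
    set ('rV[R]_(mdim M) * 'rV[R]_(mdim M)) :=
  [set va | exists a, va = (sharp pi p a, a)].

(* i^! L; the transpose of a differential acts on covectors by b *m (tmap i x)^T. *)
Definition dirac_pullback X M (i : X -> M)
    (L : forall p : M, set ('rV[R]_(mdim M) * 'rV[R]_(mdim M))) (x : X) :
    set ('rV[R]_(mdim X) * 'rV[R]_(mdim X)) :=
  [set va | exists b, L (i x) (va.1 *m tmap i x, b) /\
                      va.2 = b *m (tmap i x)^T].

(* The two submanifolds (same X) have the same quadruple
   (H, W, i^! L_pi, (W°/(H+W)°, pi)).  H and W are data inside TM|_X, which
   contains TX, so they are compared by means of an isomorphism [Phi] of the
   bundles TM_k|_X that is the identity on TX.  Since (H+W)° is in the kernel of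
   pi on W°, the comparison of the forms on W°/(H+W)° is made on
   representatives in W°; the dual of [Phi] is a |-> a *m (Phi x)^T. *)
Record same_quadruple X M1 M2
    (pi1 : bivec M1) (i1 : X -> M1) (H1 W1 : X -> 'M[R]_(mdim M1))
    (pi2 : bivec M2) (i2 : X -> M2) (H2 W2 : X -> 'M[R]_(mdim M2))
    (Phi : X -> 'M[R]_(mdim M1, mdim M2)) : Prop := SameQuadruple {
  sq_smooth : smooth_bundle_map i1 i2 Phi;
  sq_iso : forall x, row_free (Phi x) && row_full (Phi x);
  sq_TX : forall x, tmap i1 x *m Phi x = tmap i2 x;
  sq_H : forall x, (H1 x *m Phi x :=: H2 x)%MS;
  sq_W : forall x, (W1 x *m Phi x :=: W2 x)%MS;
  sq_dirac : forall x,
    dirac_pullback i1 (dirac_of pi1) x = dirac_pullback i2 (dirac_of pi2) x;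
  sq_form : forall x a b, (a <= ann (W2 x))%MS -> (b <= ann (W2 x))%MS ->
    bform pi1 (i1 x) (a *m (Phi x)^T) (b *m (Phi x)^T) = bform pi2 (i2 x) a b }.

(* In the bundle chart over [c], the components of a covector [a.2] at [a.1]
   are obtained by passing from [chart_at a.1] to [c]. *)
Definition cotangent_chart M (c : chart R M (mdim M)) :
    chart R (M * 'rV[R]_(mdim M)) (mdim M + mdim M) :=
  Chart [set a | cdom c a.1]
    (fun a => row_mx (cto c a.1)
       (a.2 *m (cchange c (chart_at a.1) a.1)^T))
    (fun y => let q := cof c (lsubmx y) in
       (q, rsubmx y *m (cchange (chart_at q) c q)^T)).

Definition cotangent M : charted R :=
  Charted (fun a : M * 'rV[R]_(mdim M) => cotangent_chart (chart_at a.1)).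

Definition cotangent_proj M : cotangent M -> M := fun a => a.1.

Definition cotangent_scale M (t : R) : cotangent M -> cotangent M :=
  fun a => (a.1, t *: a.2).

(* m_t^*chi = t chi is written after applying the differential of m_t. *)
Record poisson_spray M (pi : bivec M)
    (chi : cotangent M -> 'rV[R]_(mdim (cotangent M))) : Prop := PoissonSpray {
  spray_smooth : smooth_vector_field chi;
  spray_proj : forall a : cotangent M,
    chi a *m tmap (@cotangent_proj M) a = sharp pi a.1 a.2;
  spray_homog : forall (t : R) (a : cotangent M), 0 < t ->
    chi (cotangent_scale t a) = (t *: chi a) *m tmap (cotangent_scale t) a }.

(* [g] restricts to an integral curve of [v] on a neighborhood of [0, 1]. *)
Definition integral_curve M (v : M -> 'rV[R]_(mdim M)) (g : R -> M) : Prop :=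
  exists e : R, 0 < e /\ forall t : R, - e < t < 1 + e ->
    (\forall s \near t, cdom (chart_at (g t)) (g s)) /\
    is_derive t 1 (fun s => cto (chart_at (g t)) (g s)) (v (g t)).

(* exp_chi, only defined where the flow is, is given by its graph. *)
Definition exp_spray M (chi : cotangent M -> 'rV[R]_(mdim (cotangent M)))
    (a : cotangent M) (p : M) : Prop :=
  exists g : R -> cotangent M,
    [/\ integral_curve chi g, g 0 = a & cotangent_proj (g 1) = p].

(* A complement [C] of TX^perp in TM|_X embeds (TX^perp)^* in T^*M|_X as the
   annihilator of [C]. *)
Definition local_poisson_saturation X M (pi : bivec M) (i : X -> M)
    (P : charted R) (j : P -> M) (piP : bivec P) : Prop :=
  exists chi (Sigma : set (cotangent M)) (C : X -> 'M[R]_(mdim M)),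
    [/\ poisson_spray pi chi,
        [/\ mopen Sigma, forall p : M, Sigma (p, 0) &
            forall a, Sigma a -> exists p, exp_spray chi a p],
        [/\ subbundle i C, forall x, mxdirect (Tperp pi i x + C x) &
            forall x, (Tperp pi i x + C x :=: 1%:M)%MS],
        range j = [set p | exists (x : X) (xi : 'rV[R]_(mdim M)),
          [/\ (xi <= ann (C x))%MS, Sigma (i x, xi) &
              exp_spray chi (i x, xi) p]] &
        [/\ is_manifold P, poisson_submanifold pi j piP &
            range i `<=` range j]].

Record poisson_diffeo M N (pi : bivec M) (pi' : bivec N)
    (U : set M) (V : set N) (f : M -> N) (g : N -> M) : Prop := PoissonDiffeo {
  pd_openU : mopen U;
  pd_openV : mopen V;
  pd_maps : forall p, U p -> V (f p) /\ g (f p) = p;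
  pd_invmaps : forall q, V q -> U (g q) /\ f (g q) = q;
  pd_smooth : smooth_map_on U f;
  pd_invsmooth : smooth_map_on V g;
  pd_poisson : forall p, U p -> poisson_at pi pi' f p }.

End Manifolds.

(* Main.v *)
Require Import Defs.
From HB Require Import structures.
From mathcomp Require Import all_boot all_order all_algebra.
From mathcomp Require Import all_classical all_reals all_analysis.
From mathcomp Require Import ring lra zify.
From mathcomp Require finmap.
Set Implicit Arguments.
Unset Strict Implicit.
Unset Printing Implicit Defensive.
Import Order.TTheory GRing.Theory Num.Theory.
Import numFieldNormedType.Exports.
Local Open Scope classical_set_scope.
Local Open Scope ring_scope.

(** In charts, the time-one map of the spray on covectors annihilating W_k (frames
    matched by the quadruple) identifies Z = X x R^r with P_k near X. Along cotangent
    paths a, the pulled-back bivectors Q_k on Z are the gauge transform of i^!L_pi by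
    d Theta_k, where Theta_k = int <a, dq>. So Q_2 is the gauge transform of Q_1 by
    d eta, eta = Theta_2 - Theta_1, and equality of the quadruples makes eta and d eta
    vanish on X: Moser's flow gives a Poisson diffeomorphism fixing X. Its germ along
    X does not depend on the charts, so the local pieces glue. The saturation is a
    countable union of Lipschitz images of R^(m + r), which bounds dim P (Baire and a
    pigeonhole count) and makes the coordinates on P_k local diffeomorphisms. *)

(** * Smooth maps *)

(** [W] is a complement of [TX^perp], so its annihilator is a model of the dual of [TX^perp], and r
    is its rank. The saturation is given with some other complement [C], which serves to bound dim
    P; after that everything is rebuilt from frames of the annihilator of [W]. A frame is chosen for
    the second submanifold and carried to the first by the dual of [Phi], so one parameter space
    serves both. Along X, d Theta_k has just two ingredients: the pairing of the frame with TX and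
    the matrix of pi on the frame. Both agree because [Phi] is the identity on TX and preserves the
    form; this is why d eta, and not only eta, vanishes on X. Moser's field is then zero on X at all
    times in [0, 1], which gives curves up to time 1 nearby. The two sprays are unrelated, so the
    time-one maps are compared only through the bivectors. The obstacle to gluing is that each piece
    is tied to charts and frames: changing them acts on X x R^r by a fibrewise linear map, under
    which Theta, the bivectors and Moser's field must all be shown to be natural. *)

Section Norm.
Variable R : realType.

Lemma mx_entry_le m n (x : 'M[R]_(m, n)) i j : `|x i j| <= `|x|.
Proof.
rewrite [leRHS]/Num.Def.normr/= mx_normrE.
exact: (le_bigmax _ (fun p : 'I_m * 'I_n => `|x p.1 p.2|) (i, j)).
Qed.

Lemma mx_norm_le m n (x : 'M[R]_(m, n)) e : 0 <= e ->
 (forall i j, `|x i j| <= e) -> `|x| <= e.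
Proof.
move=> e0 H; rewrite [leLHS]/Num.Def.normr/= mx_normrE.
by apply: bigmax_le => // -[i j] _; exact: H.
Qed.

Lemma cvg_mxP (T : Type) (F : set_system T) (FF : Filter F) m n
  (f : T -> 'M[R]_(m, n)) (l : 'M[R]_(m, n)) :
 (f x @[x --> F] --> l) <-> forall i j, (f x i j @[x --> F] --> l i j).
Proof.
split => [h i j|h].
 apply/cvgrPdist_lt => e e0; move/cvgrPdist_lt: h => /(_ e e0).
 apply: filterS => x; apply: le_lt_trans.
 by apply: le_trans (mx_entry_le _ i j); rewrite !mxE.
apply/cvgrPdist_le => e e0.
have : \forall x \near F, forall p : 'I_m * 'I_n, `|l p.1 p.2 - f x p.1 p.2| <= e.
 apply: filter_forall => -[i j] /=.
 by move/cvgrPdist_le: (h i j) => /(_ e e0).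
apply: filterS => x hx; apply: mx_norm_le; first exact: ltW.
by move=> i j; have := hx (i, j); rewrite !mxE.
Qed.

Lemma continuous_mxP (T : topologicalType) m n (f : T -> 'M[R]_(m, n)) (y : T) :
 {for y, continuous f} <-> forall i j, {for y, continuous (fun x => f x i j)}.
Proof. exact: cvg_mxP. Qed.

End Norm.

Section Seg.
Variable R : realType.

Lemma derivable_line (V W : normedModType R) (f : V -> W) (y v : V) (s : R) :
 derivable f (y + s *: v) v ->
 is_derive s 1 (fun h : R => f (y + h *: v)) ('D_v f (y + s *: v)).
Proof.
move=> df.
have E : (fun h => h^-1 *: (f (y + (h *: (1 : R) + s) *: v) - f (y + s *: v))) =
  (fun h : R => h^-1 *: (f (h *: v + (y + s *: v)) - f (y + s *: v))).
 by apply/funext => h; congr (_ *: (f _ - _)); rewrite scalerDl [h *: 1]mulr1 addrCA.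
by split; rewrite /derivable /derive /= E.
Qed.

(** The step [a] may have either sign: the classical theorem is applied on [0, 1] to h -> f (y + (h
    * a) *: v), so no case distinction is needed. *)
Lemma MVT_line (V : normedModType R) (f : V -> R) (y v : V) (a : R) :
 (forall s : R, 0 <= s <= 1 -> derivable f (y + (s * a) *: v) v) ->
 exists c : R, 0 <= c <= 1 /\ f (y + a *: v) - f y = a * 'D_v f (y + (c * a) *: v).
Proof.
move=> df.
have dg (s : R) : 0 <= s <= 1 ->
  is_derive s 1 (fun h : R => f (y + (h * a) *: v)) (a * 'D_v f (y + (s * a) *: v)).
 move=> s01; have := derivable_line (df s s01).
 move=> H; have := @is_derive1_comp R (fun h : R => f (y + h *: v)) (fun h => h * a) s
   ('D_v f (y + (s * a) *: v)) a.
 move=> /(_ H) K; rewrite [a * _]mulrC; apply: K.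
 have := @is_deriveM R _ (id : R -> R) (cst a) s 1 1 0.
 by move=> /(_ _ _); rewrite scaler0 add0r [a *: 1]mulr1; apply.
have [||c c01] := @MVT R (fun h : R => f (y + (h * a) *: v))
  (fun s => a * 'D_v f (y + (s * a) *: v)) 0 1 ltr01.
- by move=> x /[!in_itv]/= /andP[x0 x1]; apply: dg; rewrite !ltW.
- apply: derivable_within_continuous => x /[!in_itv]/= x01.
 by have [] := dg x x01.
rewrite subr0 mulr1 mul1r mul0r scale0r addr0 => E.
exists c; split => //; move: c01; rewrite in_itv/= => /andP[c0 c1].
by rewrite !ltW.
Qed.

End Seg.

Section C1.
Variable R : realType.

Lemma differentiable_lin_approx (V W : normedModType R) (f : V -> W) (y : V)
  (L : {linear V -> W}) : continuous L ->
 (forall e : R, 0 < e -> \forall h \near (0 : V), `|f (h + y) - f y - L h| <= e * `|h|) ->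
 differentiable f y.
Proof.
move=> Lc H.
have E : f \o shift y = cst (f y) + L +o_ (0 : V) id.
 apply/eqaddoP => e e0; near=> h; rewrite /= !fctE opprD addrA.
 by near: h; exact: H.
by apply/diff_locallyP; rewrite (diff_unique Lc E).
Unshelve. all: by end_near. Qed.

Lemma near_forall (T : Type) (F : set_system T) (FF : Filter F) (I : finType)
  (P : I -> T -> Prop) :
 (forall i, \forall x \near F, P i x) -> \forall x \near F, forall i, P i x.
Proof. by move=> H; apply: filter_forall => i; exact: H. Qed.

Definition E_ n (j : 'I_n) : 'rV[R]_n := delta_mx 0 j.

Lemma row_sum n (v : 'rV[R]_n) : v = \sum_j v 0 j *: E_ j.
Proof. exact: row_sum_delta. Qed.

(** The points y + trunc h k lead from y to y + h by changing one coordinate at a time. *)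
Definition trunc n (h : 'rV[R]_n) (k : nat) : 'rV[R]_n :=
 \row_j (if (j < k)%N then h 0 j else 0).

Lemma trunc0 n (h : 'rV[R]_n) : trunc h 0 = 0.
Proof. by apply/rowP => j; rewrite !mxE. Qed.

Lemma truncn n (h : 'rV[R]_n) : trunc h n = h.
Proof. by apply/rowP => j; rewrite !mxE ltn_ord. Qed.

Lemma truncS n (h : 'rV[R]_n) (k : 'I_n) :
 trunc h k.+1 = trunc h k + h 0 k *: E_ k.
Proof.
apply/rowP => j; rewrite !mxE eqxx /= ltnS leq_eqVlt.
have [->|jk] := eqVneq j k; first by rewrite eqxx ltnn mulr1 add0r.
by rewrite -val_eqE in jk; rewrite (negPf jk) /= mulr0 addr0.
Qed.

Lemma trunc_norm n (h : 'rV[R]_n) k (c : R) (l : 'I_n): 0 <= c <= 1 -> k = l ->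
 `|trunc h k + (c * h 0 l) *: E_ l| <= `|h|.
Proof.
move=> /andP[c0 c1] ->; apply: mx_norm_le => // i j; rewrite !mxE ord1 eqxx /=.
have [->|jk] := eqVneq j l.
 rewrite ltnn add0r mulr1 normrM ger0_norm//.
 by apply: le_trans (mx_entry_le h 0 l); rewrite ler_piMl.
rewrite mulr0 addr0; case: ifP => _; first exact: mx_entry_le.
by rewrite normr0.
Qed.

(** The increment of [f] is telescoped along the points y + trunc h k. Each difference is an
    increment in one variable, handled by the mean value theorem, and continuity of the partial
    derivatives at [y] compares it with h_k times the partial derivative at [y]. *)
Lemma C1_differentiable n (f : 'rV[R]_n -> R) (y : 'rV[R]_n) :
 (\forall z \near y, forall j, derivable f z (E_ j)) ->
 (forall j, {for y, continuous (fun z => 'D_(E_ j) f z)}) ->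
 differentiable f y.
Proof.
move=> df cf.
pose L (h : 'rV[R]_n) : R := \sum_j h 0 j * 'D_(E_ j) f y.
have L_lin : linear L.
 move=> a u v; rewrite /L scaler_sumr -big_split /=; apply: eq_bigr => j _.
 by rewrite !mxE mulrDl -mulrA.
pose Lm := GRing.isLinear.Build _ _ _ _ L L_lin.
pose LL : {linear 'rV[R]_n -> R} := HB.pack L Lm.
have Lc : continuous LL.
 apply: (@linear_bounded_continuous R _ _ LL).1.
 apply/linear_boundedP; exists (\sum_j `|'D_(E_ j) f y|).
 split; first exact: num_real.
 move=> M HM x; rewrite /= /L (le_trans (ler_norm_sum _ _ _)) //.
 apply: (@le_trans _ _ (\sum_j `|x| * `|'D_(E_ j) f y|)).
  by apply: ler_sum => j _; rewrite normrM ler_wpM2r// mx_entry_le.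
 by rewrite -mulr_sumr mulrC ler_wpM2r // ltW.
apply: (differentiable_lin_approx (L := LL)) => // e e0.
 (* Each of the n coordinates may contribute e / (n + 1); the successor avoids a division by zero
    when n = 0. *)
 have en0 : 0 < e / n.+1%:R by rewrite divr_gt0.
 have cc : \forall z \near y, (forall j, derivable f z (E_ j)) /\
   forall j, `|'D_(E_ j) f y - 'D_(E_ j) f z| <= e / n.+1%:R.
  apply: filterI => //.
  by apply: (near_forall _ (fun j => (cvgrPdist_le _ _).1 (cf j) _ en0)).
 move: cc => /nbhs_ballP[d /= d0 dd].
 have N0 : \forall h \near (0 : 'rV[R]_n), `|h| < d by exact: nbhs0_lt.
 apply: filterS N0 => h hd.
 have step (k : 'I_n) : `|f (y + trunc h k.+1) - f (y + trunc h k) -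
   h 0 k * 'D_(E_ k) f y| <= `|h| * (e / n.+1%:R).
  have inb (s : R) : 0 <= s <= 1 -> ball y d (y + trunc h k + (s * h 0 k) *: E_ k).
   move=> s01; rewrite -ball_normE /ball_ /= -addrA opprD addrA subrr sub0r normrN.
   by apply: le_lt_trans hd; exact: trunc_norm.
  have [s s01|c [c01]] := @MVT_line R _ f (y + trunc h k) (E_ k) (h 0 k).
   by have [+ _] := dd _ (inb s s01); apply.
  rewrite -addrA -truncS => ->; rewrite -mulrBr normrM.
  apply: ler_pM => //; first exact: mx_entry_le.
  by rewrite distrC; have [_] := dd _ (inb c c01); apply.
 have -> : f (h + y) - f y - LL h =
   \sum_(k < n) (f (y + trunc h k.+1) - f (y + trunc h k) - h 0 k * 'D_(E_ k) f y).
  rewrite sumrB -(big_mkord xpredT (fun k => f (y + trunc h k.+1) - f (y + trunc h k))).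
  rewrite telescope_sumr // truncn trunc0 addr0 /= [h + y]addrC.
  by [].
 apply: (le_trans (ler_norm_sum _ _ _)).
 apply: (@le_trans _ _ (\sum_(k < n) `|h| * (e / n.+1%:R))).
  by apply: ler_sum => k _.
 rewrite sumr_const card_ord -[_ *+ n]mulr_natr mulrC mulrA mulrC -mulrA.
 by rewrite ler_pM2l// mulrA ler_piMl// mulrC ler_pdivrMr// mul1r ler_nat.
Qed.

End C1.

(** * C^k maps through iterated directional derivatives *)

Section Ck.
Variables (R : realType) (n : nat).
Implicit Types (U : set 'rV[R]_n).

Lemma Ck_ext (V : normedModType R) k U (f g : 'rV[R]_n -> V) : open U ->
 (forall y, U y -> f y = g y) -> Ck k U f -> Ck k U g.
Proof.
move=> oU; have near_eq (f0 g0 : 'rV[R]_n -> V) y :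
  (forall y, U y -> f0 y = g0 y) -> U y -> \forall z \near y, f0 z = g0 z.
 by move=> fg Uy; apply: filterS fg _; exact: open_nbhs_nbhs.
elim: k f g => [|k IH] f g fg /=.
 move=> cf y Uy; have := cf y Uy; rewrite /prop_for /continuous_at -(fg y Uy).
 by move=> h; apply: cvg_trans h; apply: near_eq_cvg (near_eq f g y fg Uy).
move=> [df Df]; split.
 by move=> y v Uy; apply: (near_eq_derivable (near_eq _ _ _ fg Uy)); exact: df.
move=> v; apply: (IH (fun y => 'D_v f y)); last exact: Df.
by move=> y Uy; apply: near_eq_derive; exact: near_eq.
Qed.

Lemma Ck_sub (V : normedModType R) k U U' (f : 'rV[R]_n -> V) :
 U' `<=` U -> Ck k U f -> Ck k U' f.
Proof.
move=> UU; elim: k f => [|k IH] f /=; first by move=> h y /UU; exact: h.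
by move=> [df Df]; split => [y v /UU|v]; [exact: df | exact: IH].
Qed.

Lemma smooth_ext (V : normedModType R) U (f g : 'rV[R]_n -> V) : open U ->
 (forall y, U y -> f y = g y) -> smooth_on U f -> smooth_on U g.
Proof. by move=> oU fg sf k; exact: Ck_ext (sf k). Qed.

Lemma smooth_sub (V : normedModType R) U U' (f : 'rV[R]_n -> V) :
 U' `<=` U -> smooth_on U f -> smooth_on U' f.
Proof. by move=> UU sf k; exact: Ck_sub (sf k). Qed.

Lemma smooth_cont (V : normedModType R) U (f : 'rV[R]_n -> V) y :
 smooth_on U f -> U y -> {for y, continuous f}.
Proof. by move=> /(_ 0%N); exact. Qed.

Lemma smooth_derivable (V : normedModType R) U (f : 'rV[R]_n -> V) y v :
 smooth_on U f -> U y -> derivable f y v.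
Proof. by move=> /(_ 1%N) [+ _]; exact. Qed.

Lemma smooth_D (V : normedModType R) U (f : 'rV[R]_n -> V) v :
 smooth_on U f -> smooth_on U (fun y => 'D_v f y).
Proof. by move=> sf k; have [_] := sf k.+1; exact. Qed.

Lemma smooth_local (V : normedModType R) U (f : 'rV[R]_n -> V) :
 (forall y, U y -> exists U', [/\ open U', U' y & smooth_on U' f]) ->
 smooth_on U f.
Proof.
move=> H k.
have {}H y : U y -> exists U', U' y /\ Ck k U' f.
 by move=> /H [U' [_ ? /(_ k) ?]]; exists U'.
elim: k f H => [|k IH] f H /=; first by move=> y /H [U' [? ]]; exact.
split; first by move=> y v /H [U' [? [+ _]]]; exact.
by move=> v; apply: IH => y /H [U' [? [_ D]]]; exists U'; split; last exact: D.
Qed.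

Lemma Ck_mx k U m l (F : 'rV[R]_n -> 'M[R]_(m, l)) : open U ->
 (Ck k U F <-> forall i j, Ck k U (fun y => F y i j)).
Proof.
move=> oU; elim: k F => [|k IH] F /=.
 by split=> [h i j y /h /continuous_mxP|h y Uy]; [|apply/continuous_mxP => i j; exact: h].
split=> [[df Df] i j|h].
 split => [y v Uy|v]; first by move: (df y v Uy) => /derivable_mxP.
 have /IH/(_ i j) := Df v; apply: Ck_ext => // y Uy.
 by rewrite derive_mx ?mxE//; exact: df.
have df y v : U y -> derivable F y v.
 by move=> Uy; apply/derivable_mxP => i j; exact: (h i j).1.
split => // v; apply/IH => i j.
by apply: Ck_ext ((h i j).2 v) => // y Uy; rewrite derive_mx ?mxE//; exact: df.
Qed.

Lemma smooth_mx U m l (F : 'rV[R]_n -> 'M[R]_(m, l)) : open U ->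
 (smooth_on U F <-> forall i j, smooth_on U (fun y => F y i j)).
Proof.
move=> oU; split=> [h i j k|h k].
 by have /Ck_mx := h k; apply.
by apply/Ck_mx => // i j; exact: h.
Qed.

(** At a successor, [Ck] records directional derivatives only and does not mention continuity of
    [f]; it comes from continuity of the partial derivatives, which makes the map differentiable. *)
Lemma Ck_mono k U (f : 'rV[R]_n -> R) : open U -> Ck k.+1 U f -> Ck k U f.
Proof.
move=> oU; elim: k f => [|k IH] f.
 move=> [df cf] y Uy; apply: differentiable_continuous.
 apply: C1_differentiable; last by move=> j; exact: cf.
 by apply: filterS (open_nbhs_nbhs (conj oU Uy)) => z Uz j; exact: df.
by move=> [df Df]; split => // v; apply: IH; exact: Df.
Qed.

Lemma Ck_differentiable k U (f : 'rV[R]_n -> R) y : open U -> Ck k.+1 U f -> U y ->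
 differentiable f y.
Proof.
move=> oU; elim: k => [|k IH]; last by move=> /Ck_mono -/(_ oU); exact: IH.
move=> [df cf] Uy; apply: C1_differentiable; last by move=> j; exact: cf.
by apply: filterS (open_nbhs_nbhs (conj oU Uy)) => z Uz j; exact: df.
Qed.

Lemma differentiable_mxP m l (F : 'rV[R]_n -> 'M[R]_(m, l)) y :
 (forall i j, differentiable (fun y => F y i j) y) -> differentiable F y.
Proof.
move=> H.
have -> : F = \sum_i \sum_j (fun y => F y i j *: (delta_mx i j : 'M[R]_(m, l))).
 apply/funext => z; rewrite fct_sumE [LHS]matrix_sum_delta.
 by apply: eq_bigr => i _; rewrite fct_sumE.
apply: differentiable_sum => i; apply: differentiable_sum => j.
exact: differentiableZl.
Qed.

Lemma smooth_diff U m l (F : 'rV[R]_n -> 'M[R]_(m, l)) y : open U ->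
 smooth_on U F -> U y -> differentiable F y.
Proof.
move=> oU sF Uy; apply: differentiable_mxP => i j.
by apply: (@Ck_differentiable 0 U) => //; have /smooth_mx := sF; apply.
Qed.

Lemma smooth_diffR U (f : 'rV[R]_n -> R) y : open U ->
 smooth_on U f -> U y -> differentiable f y.
Proof. by move=> oU sF Uy; apply: (@Ck_differentiable 0 U). Qed.

Lemma Ck_cst (V : normedModType R) k U (c : V) : open U -> Ck k U (fun=> c).
Proof.
move=> oU; elim: k c => [|k IH] c /=; first by move=> y _; exact: cst_continuous.
split=> [y v _|v]; first exact: derivable_cst.
by apply: (@Ck_ext _ k U (fun=> 0)) => // y _; rewrite derive_cst.
Qed.

Lemma Ck_add (V : normedModType R) k U (f g : 'rV[R]_n -> V) : open U ->
 Ck k U f -> Ck k U g -> Ck k U (fun y => f y + g y).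
Proof.
move=> oU; elim: k f g => [|k IH] f g /=.
 by move=> cf cg y Uy; apply: continuousD; [exact: cf|exact: cg].
move=> [df Df] [dg Dg]; split=> [y v Uy|v]; first by apply: derivableD; [exact: df|exact: dg].
apply: Ck_ext (IH _ _ (Df v) (Dg v)) => // y Uy.
by rewrite deriveD//; [exact: df | exact: dg].
Qed.

Lemma Ck_mul k U (f g : 'rV[R]_n -> R) : open U ->
 Ck k U f -> Ck k U g -> Ck k U (fun y => f y * g y).
Proof.
move=> oU; elim: k f g => [|k IH] f g.
 by move=> cf cg y Uy; apply: continuousM; [exact: cf|exact: cg].
move=> cf cg; have [df Df] := cf; have [dg Dg] := cg.
split=> [y v Uy|v]; first by apply: derivableM; [exact: df|exact: dg].
apply: Ck_ext (Ck_add oU (IH _ _ (Ck_mono oU cf) (Dg v)) (IH _ _ (Ck_mono oU cg) (Df v))) => //.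
by move=> y Uy; rewrite deriveM//; [exact: df | exact: dg].
Qed.

Lemma Ck_inv k U (f : 'rV[R]_n -> R) : open U -> (forall y, U y -> f y != 0) ->
 Ck k U f -> Ck k U (fun y => (f y)^-1).
Proof.
move=> oU f0; elim: k => [|k IH].
 by move=> cf y Uy; apply: continuousV; [exact: f0 | exact: cf].
move=> cf; have [df Df] := cf.
have ci := IH (Ck_mono oU cf).
split=> [y v Uy|v]; first by apply: derivableV; [exact: f0|exact: df].
apply: (@Ck_ext _ k U (fun y => (-1) * (((f y)^-1 * (f y)^-1) * 'D_v f y))) => //.
 move=> y Uy; rewrite deriveV ?f0//; last exact: df.
 by rewrite /GRing.scale/= mulN1r expr2 invfM mulNr.
apply: Ck_mul => //; first exact: Ck_cst.
by apply: (Ck_mul oU (Ck_mul oU ci ci)); exact: Df.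
Qed.

Lemma Ck_sum (I : Type) (r : seq I) (P : pred I) k U (f : I -> 'rV[R]_n -> R) : open U ->
 (forall i, Ck k U (f i)) -> Ck k U (fun y => \sum_(i <- r | P i) f i y).
Proof.
move=> oU H; elim: r => [|i r IH].
 by apply: Ck_ext (Ck_cst k 0 oU) => // y _; rewrite big_nil.
case Pi : (P i); first by apply: Ck_ext (Ck_add oU (H i) IH) => // y _; rewrite big_cons Pi.
by apply: Ck_ext IH => // y _; rewrite big_cons Pi.
Qed.

Lemma Ck_coord k U i j : open U -> Ck k U (fun y : 'rV[R]_n => y i j).
Proof.
move=> oU; case: k => [|k]; first by move=> y _; exact: coord_continuous.
have d (y : 'rV[R]_n) v : is_derive y v (fun y : 'rV[R]_n => y i j) (v i j).
 have [h1 h2] := (@derivable_id R _ y v, derive_mx (@derivable_id R _ y v)).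
 move/derivable_mxP: (h1) => /(_ i j) h; split => //.
 by move: h2; rewrite derive_id => /matrixP/(_ i j); rewrite mxE => <-.
split=> [y v _|v]; first by have [] := d y v.
by apply: Ck_ext (Ck_cst k (v i j) oU) => // y _; have [_ ->] := d y v.
Qed.

End Ck.

Section Comp.
Variable R : realType.

Lemma derive_comp n m (f : 'rV[R]_n -> 'rV[R]_m) (W : normedModType R)
  (g : 'rV[R]_m -> W) y v :
 differentiable f y -> differentiable g (f y) ->
 'D_v (g \o f) y = 'D_('D_v f y) g (f y).
Proof.
move=> df dg; rewrite deriveE; last exact: differentiable_comp.
by rewrite diff_comp//= [in RHS]deriveE // deriveE.
Qed.

Lemma derive_basis n (W : normedModType R) (g : 'rV[R]_n -> W) y v :
 differentiable g y -> 'D_v g y = \sum_j v 0 j *: 'D_(E_ R j) g y.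
Proof.
move=> dg; rewrite deriveE // {1}(row_sum v) raddf_sum; apply: eq_bigr => j _.
rewrite deriveE //; move: (v 0 j) (E_ R j) => a b; first [exact: linearZZ | exact: linearZ | exact: (linearZ_LR (GRing.Linear.clone _ _ _ _ ('d g y) _))].
Qed.

(** Induction on k for all [g]: D_v (g o f) is the sum over j of (D_v f)_j times (D_j g) o f, and
    the induction hypothesis applies to each D_j g once [f] is lowered by one order. *)
Lemma Ck_comp n m k (U : set 'rV[R]_n) (W : set 'rV[R]_m) (f : 'rV[R]_n -> 'rV[R]_m)
  (g : 'rV[R]_m -> R) : open U -> open W -> (forall y, U y -> W (f y)) ->
 Ck k U f -> Ck k W g -> Ck k U (fun y => g (f y)).
Proof.
move=> oU oW fUW; elim: k g => [|k IH] g.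
 move=> cf cg y Uy; apply: continuous_comp; first exact: cf.
 by apply: cg; exact: fUW.
move=> cf cg.
have df y : U y -> differentiable f y.
 move=> Uy; apply: differentiable_mxP => i j; apply: (@Ck_differentiable _ _ k U) => //.
 by move/Ck_mx: cf; apply.
have dg y : U y -> differentiable g (f y).
 by move=> /fUW Wy; apply: (@Ck_differentiable _ _ k W).
split=> [y v Uy|v].
 by apply: diff_derivable; apply: differentiable_comp; [exact: df|exact: dg].
have {}IH (g' : 'rV[R]_m -> R) : Ck k W g' -> Ck k U (fun y => g' (f y)).
 move=> h; apply: IH => //; apply/Ck_mx => // i j; apply: Ck_mono => //.
 by move/Ck_mx: cf; apply.
apply: (@Ck_ext _ _ _ k U (fun y => \sum_j ('D_v f y) 0 j * 'D_(E_ R j) g (f y))) => //.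
 by move=> y Uy; rewrite -derive_basis -?derive_comp //; [exact: df|exact: dg|exact: dg].
apply: Ck_sum => // j; apply: Ck_mul => //; last exact: (IH _ (cg.2 (E_ R j))).
by have /(Ck_mx _ _ oU) := cf.2 v; apply.
Qed.

Lemma smooth_comp n m p q (U : set 'rV[R]_n) (W : set 'rV[R]_m)
  (f : 'rV[R]_n -> 'rV[R]_m) (g : 'rV[R]_m -> 'M[R]_(p, q)) :
  open U -> open W -> (forall y, U y -> W (f y)) ->
 smooth_on U f -> smooth_on W g -> smooth_on U (fun y => g (f y)).
Proof.
move=> oU oW fUW sf sg k; apply/Ck_mx => // i j.
apply: (Ck_comp oU oW fUW (sf k) (g := fun z => g z i j)).
by have /(Ck_mx _ _ oW) := sg k; apply.
Qed.

Lemma smooth_compR n m (U : set 'rV[R]_n) (W : set 'rV[R]_m)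
  (f : 'rV[R]_n -> 'rV[R]_m) (g : 'rV[R]_m -> R) :
  open U -> open W -> (forall y, U y -> W (f y)) ->
 smooth_on U f -> smooth_on W g -> smooth_on U (fun y => g (f y)).
Proof. by move=> oU oW fUW sf sg k; exact: (Ck_comp oU oW fUW). Qed.

End Comp.

Section EpsDelta.
Variables (R : realType) (n : nat).

Lemma nbhs_rV (y : 'rV[R]_n) (P : set 'rV[R]_n) :
 nbhs y P <-> exists2 d : R, 0 < d & forall z : 'rV[R]_n, `|z - y| < d -> P z.
Proof.
split=> [/nbhs_ballP[d /= d0 dP]|[d d0 dP]].
 by exists d => // z zd; apply: dP; rewrite -ball_normE /ball_ /= distrC.
apply/nbhs_ballP; exists d => // z; rewrite -ball_normE /ball_ /= distrC; exact: dP.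
Qed.

Lemma open_rV (U : set 'rV[R]_n) :
 open U <-> forall y, U y -> exists2 d : R, 0 < d & forall z : 'rV[R]_n, `|z - y| < d -> U z.
Proof.
split=> [oU y Uy|H]; first by apply/nbhs_rV; exact: open_nbhs_nbhs.
by rewrite openE => y /H /nbhs_rV.
Qed.

Lemma open_nball (c : 'rV[R]_n) (r : R) : open [set y : 'rV[R]_n | `|y - c| < r].
Proof.
apply/open_rV => y yr; exists (r - `|y - c|); first by rewrite subr_gt0.
by move=> z; have := ler_distD y z c; move: yr => /=; lra.
Qed.

Lemma cont_rV (V : normedModType R) (f : 'rV[R]_n -> V) (y : 'rV[R]_n) :
 {for y, continuous f} <->
 forall e : R, 0 < e -> exists2 d : R, 0 < d & forall z : 'rV[R]_n, `|z - y| < d -> `|f z - f y| < e.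
Proof.
split=> [cf e e0|H].
 have /cvgrPdist_lt/(_ e e0)/nbhs_rV[d d0 dH] := cf.
 by exists d => // z /dH; rewrite distrC.
apply/(@cvgrPdist_lt _ _ _ _ (nbhs_filter y)) => e e0; apply/nbhs_rV; have [d d0 dH] := H e e0.
by exists d => // z /dH; rewrite distrC.
Qed.

End EpsDelta.

(** * Symmetry of second derivatives *)

Section Symmetry.
Variables (R : realType) (n : nat).

Lemma second_difference (U : set 'rV[R]_n) (f : 'rV[R]_n -> R) (y v w : 'rV[R]_n) (h : R) :
 open U -> smooth_on U f ->
 (forall a b : R, 0 <= a <= 1 -> 0 <= b <= 1 -> U (y + (a * h) *: v + (b * h) *: w)) ->
 exists a b : R, [/\ 0 <= a <= 1, 0 <= b <= 1 &
  f (y + h *: v + h *: w) - f (y + h *: v) - (f (y + h *: w) - f y) =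
  h * (h * 'D_w (fun z => 'D_v f z) (y + (a * h) *: v + (b * h) *: w))].
Proof.
move=> oU sf HU.
have U1 (a : R) : 0 <= a <= 1 -> U (y + (a * h) *: v).
 by move=> a01; have := HU a 0 a01; rewrite mul0r scale0r addr0; apply; rewrite lexx ler01.
have U2 (a : R) : 0 <= a <= 1 -> U (y + (a * h) *: v + h *: w).
 by move=> a01; have := HU a 1 a01; rewrite mul1r; apply; rewrite lexx ler01.
pose g z := f (z + h *: w) - f z.
have shiftd z : U (z + h *: w) -> derivable (fun z => f (z + h *: w)) z v /\
  'D_v (fun z => f (z + h *: w)) z = 'D_v f (z + h *: w).
 move=> Uz; have d : derivable f (z + h *: w) v by exact: smooth_derivable sf Uz.
 have E : (fun k : R => k^-1 *: (f (k *: v + z + h *: w) - f (z + h *: w))) =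
      (fun k : R => k^-1 *: (f (k *: v + (z + h *: w)) - f (z + h *: w))).
  by apply/funext => k; rewrite addrA.
 by split; rewrite /derivable /derive /= E.
have [s s01|a [a01 Ea]] := @MVT_line R _ g y v h.
 apply: derivableB; first by have [] := shiftd _ (U2 _ s01).
 by apply: smooth_derivable sf _; exact: U1.
have [s s01|b [b01 Eb]] := @MVT_line R _ (fun z => 'D_v f z) (y + (a * h) *: v) w h.
 by apply: smooth_derivable (smooth_D v sf) _; exact: HU.
exists a, b; split => //; rewrite -Eb -[LHS]/(g (y + h *: v) - g y) Ea.
congr (_ * _); rewrite deriveB; last by apply: smooth_derivable sf _; exact: U1.
 by have [_ ->] := shiftd _ (U2 _ a01).
by have [] := shiftd _ (U2 _ a01).
Qed.

Lemma norm_squeeze (P A B e : R) : `|P - A| < e / 2 -> `|P - B| < e / 2 -> `|A - B| <= e.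
Proof.
by rewrite !ltr_norml ler_norml => /andP[? ?] /andP[? ?]; apply/andP; split; lra.
Qed.

Lemma D_sym (U : set 'rV[R]_n) (f : 'rV[R]_n -> R) (y v w : 'rV[R]_n) :
 open U -> smooth_on U f -> U y ->
 'D_w (fun z => 'D_v f z) y = 'D_v (fun z => 'D_w f z) y.
Proof.
move=> oU sf Uy.
set A := 'D_w _ y; set B := 'D_v _ y.
have cA := smooth_cont (smooth_D w (smooth_D v sf)) Uy.
have cB := smooth_cont (smooth_D v (smooth_D w sf)) Uy.
apply/eqP; rewrite -subr_eq0 -normr_le0; apply/ler_addgt0Pr => e e0; rewrite add0r.
have e2 : 0 < e / 2 by rewrite divr_gt0.
have [d d0 dd] : exists2 d : R, 0 < d & forall z : 'rV[R]_n, `|z - y| < d -> [/\ U z,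
  `|'D_w (fun z => 'D_v f z) z - A| < e / 2 & `|'D_v (fun z => 'D_w f z) z - B| < e / 2].
 have [d1 d10 h1] := (open_rV _).1 oU y Uy.
 have [d2 d20 h2] := (cont_rV _ _).1 cA _ e2.
 have [d3 d30 h3] := (cont_rV _ _).1 cB _ e2.
 exists (Num.min d1 (Num.min d2 d3)); first by rewrite !lt_min d10 d20.
 move=> z; rewrite !lt_min => /and3P[z1 z2 z3].
 by split; [exact: h1 | exact: h2 | exact: h3].
(* With the resulting [h], all points y + a h v + b h w with a, b in [0, 1] lie within d / 2 of [y];
   the summand 1 keeps [N] positive. *)
pose N := `|v| + `|w| + 1.
have N0 : 0 < N by rewrite ltr_wpDl// addr_ge0.
pose h := d / 2 / N.
have h0 : 0 < h by rewrite !divr_gt0.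
have inb (a b : R) : 0 <= a <= 1 -> 0 <= b <= 1 ->
  `|y + (a * h) *: v + (b * h) *: w - y| < d.
 move=> /andP[a0 a1] /andP[b0 b1].
 rewrite addrAC [y + _ - y]addrAC subrr add0r.
 apply: (@le_lt_trans _ _ (`|a * h| * `|v| + `|b * h| * `|w|)).
  by rewrite -!normrZ ler_normD.
 rewrite (normrM a h) (normrM b h) (ger0_norm a0) (ger0_norm b0) (gtr0_norm h0).
 have hN : h * N = d / 2 by rewrite /h divfK// gt_eqF.
 have : a * h * `|v| + b * h * `|w| <= h * N.
  rewrite /N !mulrDr mulr1 -addrA lerD//.
   by rewrite -mulrA ler_piMl// mulr_ge0// ltW.
  have : b * h * `|w| <= h * `|w| by rewrite -mulrA ler_piMl// mulr_ge0// ltW.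
  by move=> /le_trans; apply; rewrite lerDl ltW.
 by rewrite hN => /le_lt_trans; apply; rewrite ltr_pdivrMr// ltr_pMr// ltr1n.
have inb' (a b : R) : 0 <= a <= 1 -> 0 <= b <= 1 ->
  `|y + (a * h) *: w + (b * h) *: v - y| < d.
 by move=> a01 b01; rewrite (addrAC y); exact: inb.
have [|a [b [a01 b01 E1]]] := @second_difference U f y v w h oU sf.
 by move=> a b a01 b01; have [] := dd _ (inb a b a01 b01).
have [|a' [b' [a'01 b'01 E2]]] := @second_difference U f y w v h oU sf.
 by move=> a' b' a'01 b'01; have [] := dd _ (inb' a' b' a'01 b'01).
have E : 'D_w (fun z => 'D_v f z) (y + (a * h) *: v + (b * h) *: w) =
  'D_v (fun z => 'D_w f z) (y + (a' * h) *: w + (b' * h) *: v).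
 have hn : h != 0 by rewrite gt_eqF.
 have gen (P Q : R) :
   f (y + h *: v + h *: w) - f (y + h *: v) - (f (y + h *: w) - f y) = h * (h * P) ->
   f (y + h *: w + h *: v) - f (y + h *: w) - (f (y + h *: v) - f y) = h * (h * Q) ->
   P = Q.
  move=> g1 g2; apply: (mulfI hn); apply: (mulfI hn); rewrite -g1 -g2.
  by rewrite [y + h *: w + h *: v]addrAC; ring.
 exact: gen E1 E2.
have [_ k1 _] := dd _ (inb a b a01 b01).
have [_ _ k2] := dd _ (inb' a' b' a'01 b'01).
rewrite E in k1.
exact: norm_squeeze k1 k2.
Qed.

End Symmetry.

Section Tools.
Variables (R : realType) (n : nat) (U : set 'rV[R]_n).
Hypothesis oU : open U.

Lemma smooth_cst (V : normedModType R) (c : V) : smooth_on U (fun=> c).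
Proof. by move=> k; exact: Ck_cst. Qed.
Lemma smooth_add (V : normedModType R) (f g : 'rV[R]_n -> V) :
 smooth_on U f -> smooth_on U g -> smooth_on U (fun y => f y + g y).
Proof. by move=> sf sg k; exact: Ck_add. Qed.
Lemma smooth_mulR (f g : 'rV[R]_n -> R) :
 smooth_on U f -> smooth_on U g -> smooth_on U (fun y => f y * g y).
Proof. by move=> sf sg k; exact: Ck_mul. Qed.
Lemma smooth_invR (f : 'rV[R]_n -> R) : (forall y, U y -> f y != 0) ->
 smooth_on U f -> smooth_on U (fun y => (f y)^-1).
Proof. by move=> f0 sf k; exact: Ck_inv. Qed.
Lemma smooth_sum (I : Type) (r : seq I) (P : pred I) (f : I -> 'rV[R]_n -> R) :
 (forall i, smooth_on U (f i)) -> smooth_on U (fun y => \sum_(i <- r | P i) f i y).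
Proof. by move=> H k; apply: Ck_sum => // i; exact: H. Qed.
Lemma smooth_prod (I : Type) (r : seq I) (P : pred I) (f : I -> 'rV[R]_n -> R) :
 (forall i, smooth_on U (f i)) -> smooth_on U (fun y => \prod_(i <- r | P i) f i y).
Proof.
move=> H; elim: r => [|i r IH].
 by apply: smooth_ext (smooth_cst (1 : R)) => // y _; rewrite big_nil.
case Pi : (P i); first by apply: smooth_ext (smooth_mulR (H i) IH) => // y _; rewrite big_cons Pi.
by apply: smooth_ext IH => // y _; rewrite big_cons Pi.
Qed.
Lemma smooth_coordR i j : smooth_on U (fun y : 'rV[R]_n => y i j).
Proof. by move=> k; exact: Ck_coord. Qed.
Lemma smooth_id : smooth_on U (fun y : 'rV[R]_n => y).
Proof. by apply/smooth_mx => // i j; exact: smooth_coordR. Qed.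

Lemma smooth_entry m l (F : 'rV[R]_n -> 'M[R]_(m, l)) i j :
 smooth_on U F -> smooth_on U (fun y => F y i j).
Proof. by move=> /(smooth_mx _ oU); exact. Qed.

Lemma smooth_mulmx m l p (F : 'rV[R]_n -> 'M[R]_(m, l)) (G : 'rV[R]_n -> 'M[R]_(l, p)) :
 smooth_on U F -> smooth_on U G -> smooth_on U (fun y => F y *m G y).
Proof.
move=> sF sG; apply/smooth_mx => // i j.
apply: (@smooth_ext _ _ _ U (fun y => \sum_k F y i k * G y k j)) => //.
 by move=> y _; rewrite mxE.
by apply: smooth_sum => k; apply: smooth_mulR; exact: smooth_entry.
Qed.

Lemma smooth_scale m l (f : 'rV[R]_n -> R) (G : 'rV[R]_n -> 'M[R]_(m, l)) :
 smooth_on U f -> smooth_on U G -> smooth_on U (fun y => f y *: G y).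
Proof.
move=> sF sG; apply/smooth_mx => // i j.
apply: (@smooth_ext _ _ _ U (fun y => f y * G y i j)) => //.
 by move=> y _; rewrite mxE.
by apply: smooth_mulR => //; exact: smooth_entry.
Qed.

Lemma smooth_opp m l (G : 'rV[R]_n -> 'M[R]_(m, l)) :
 smooth_on U G -> smooth_on U (fun y => - G y).
Proof.
move=> sG; apply: smooth_ext (smooth_scale (smooth_cst (-1 : R)) sG) => // y _.
by rewrite scaleN1r.
Qed.

Lemma smooth_oppR (G : 'rV[R]_n -> R) : smooth_on U G -> smooth_on U (fun y => - G y).
Proof.
move=> sG; apply: smooth_ext (smooth_mulR (smooth_cst (-1 : R)) sG) => // y _.
by rewrite mulN1r.
Qed.

Lemma smooth_sub_mx m l (F G : 'rV[R]_n -> 'M[R]_(m, l)) :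
 smooth_on U F -> smooth_on U G -> smooth_on U (fun y => F y - G y).
Proof. by move=> sF sG; apply: smooth_add => //; exact: smooth_opp. Qed.

Lemma smooth_tr m l (G : 'rV[R]_n -> 'M[R]_(m, l)) :
 smooth_on U G -> smooth_on U (fun y => (G y)^T).
Proof.
move=> sG; apply/smooth_mx => // i j.
by apply: smooth_ext (smooth_entry j i sG) => // y _; rewrite mxE.
Qed.

Lemma smooth_row_mx m l1 l2 (F : 'rV[R]_n -> 'M[R]_(m, l1)) (G : 'rV[R]_n -> 'M[R]_(m, l2)) :
 smooth_on U F -> smooth_on U G -> smooth_on U (fun y => row_mx (F y) (G y)).
Proof.
move=> sF sG; apply/smooth_mx => // i j; rewrite -(splitK j).
case: (fintype.split j) => k /=.
 by apply: smooth_ext (smooth_entry i k sF) => // y _; rewrite row_mxEl.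
by apply: smooth_ext (smooth_entry i k sG) => // y _; rewrite row_mxEr.
Qed.

Lemma smooth_lsubmx m l1 l2 (F : 'rV[R]_n -> 'M[R]_(m, l1 + l2)) :
 smooth_on U F -> smooth_on U (fun y => lsubmx (F y)).
Proof.
move=> sF; apply/smooth_mx => // i j.
by apply: smooth_ext (smooth_entry i (lshift l2 j) sF) => // y _; rewrite mxE.
Qed.

Lemma smooth_rsubmx m l1 l2 (F : 'rV[R]_n -> 'M[R]_(m, l1 + l2)) :
 smooth_on U F -> smooth_on U (fun y => rsubmx (F y)).
Proof.
move=> sF; apply/smooth_mx => // i j.
by apply: smooth_ext (smooth_entry i (rshift l1 j) sF) => // y _; rewrite mxE.
Qed.

Lemma smooth_det m (F : 'rV[R]_n -> 'M[R]_m) :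
 smooth_on U F -> smooth_on U (fun y => \det (F y)).
Proof.
move=> sF; apply: smooth_sum => s; apply: smooth_mulR; first exact: smooth_cst.
by apply: smooth_prod => i; exact: smooth_entry.
Qed.

(** By Cramer's rule the inverse is the adjugate divided by the determinant, both polynomial in the
    entries. *)
Lemma smooth_invmx m (F : 'rV[R]_n -> 'M[R]_m) : (forall y, U y -> F y \in unitmx) ->
 smooth_on U F -> smooth_on U (fun y => invmx (F y)).
Proof.
move=> uF sF; apply: (@smooth_ext _ _ _ U (fun y => (\det (F y))^-1 *: \adj (F y))) => //.
 by move=> y Uy; rewrite /invmx uF.
apply: smooth_scale.
 by apply: smooth_invR; [move=> y /uF; rewrite unitmxE unitfE|exact: smooth_det].
apply/smooth_mx => // i j.
apply: (@smooth_ext _ _ _ U (fun y => cofactor (F y) j i)) => //.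
 by move=> y _; rewrite mxE.
apply: smooth_mulR; first exact: smooth_cst.
apply: smooth_det; apply/smooth_mx => // k l.
by apply: smooth_ext (smooth_entry (lift j k) (lift i l) sF) => // y _; rewrite !mxE.
Qed.

Lemma smooth_jac m (F : 'rV[R]_n -> 'rV[R]_m) :
 smooth_on U F -> smooth_on U (fun y => 'J F y).
Proof.
move=> sF; apply/smooth_mx => // i j.
apply: smooth_ext (smooth_entry 0 j (smooth_D (E_ R i) sF)) => // y Uy.
by rewrite deriveE ?mxE //; exact: smooth_diff sF Uy.
Qed.

End Tools.

Section Jac.
Variable R : realType.

Lemma jacE n m (F : 'rV[R]_n -> 'rV[R]_m) (y : 'rV[R]_n) i :
 differentiable F y -> row i ('J F y) = 'D_(E_ R i) F y.
Proof. by move=> dF; rewrite deriveEjacobian// rowE. Qed.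

Lemma jac_comp n m l (F : 'rV[R]_n -> 'rV[R]_m) (G : 'rV[R]_m -> 'rV[R]_l) (y : 'rV[R]_n) :
 differentiable F y -> differentiable G (F y) ->
 'J (G \o F) y = 'J F y *m 'J G (F y).
Proof.
move=> dF dG; apply/row_matrixP => i; rewrite row_mul !jacE//; last exact: differentiable_comp.
by rewrite derive_comp // deriveEjacobian.
Qed.

Lemma near_differentiable n m (F G : 'rV[R]_n -> 'rV[R]_m) (y : 'rV[R]_n) :
 (\forall z \near y, F z = G z) -> differentiable F y -> differentiable G y.
Proof.
move=> FG dF; have /diffP[cF aF] := dF.
apply: (differentiable_lin_approx (L := 'd F y)) => // e e0.
have FGy : F y = G y by exact: nbhs_singleton FG.
have FG0 : \forall h \near (0 : 'rV[R]_n), F (h + y) = G (h + y).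
 have /nbhs_rV[d d0 dH] := FG; apply/nbhs_rV; exists d => // h; rewrite subr0 => hd.
 by apply: dH; rewrite addrK.
have /diff_locallyP[_ /eqaddoP /(_ e e0)] := dF.
apply: filterS2 FG0 => h E; rewrite /= !fctE opprD addrA /= -FGy -E.
by [].
Qed.

Lemma near_jac n m (F G : 'rV[R]_n -> 'rV[R]_m) (y : 'rV[R]_n) :
 differentiable F y -> (\forall z \near y, F z = G z) -> 'J F y = 'J G y.
Proof.
move=> dF FG; have dG := near_differentiable FG dF.
apply/row_matrixP => i; apply: (eq_trans (jacE i dF)); apply: (eq_trans _ (esym (jacE i dG))).
by apply: near_eq_derive; exact: FG.
Qed.

Lemma jac_lin n m (A : 'M[R]_(n, m)) (b : 'rV[R]_m) (y : 'rV[R]_n) :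
 differentiable (fun z : 'rV[R]_n => z *m A + b) y /\
 'J (fun z : 'rV[R]_n => z *m A + b) y = A.
Proof.
have sm : smooth_on setT (fun z : 'rV[R]_n => z *m A + b).
 apply: smooth_add; [exact: openT| |apply: smooth_cst; exact: openT].
 by apply: smooth_mulmx; [exact: openT|apply: smooth_id|apply: smooth_cst]; exact: openT.
have d := smooth_diff openT sm (I : setT y).
split=> //; apply/row_matrixP => i; rewrite jacE// rowE.
rewrite /derive; apply: lim_near_cst => //.
near=> h; rewrite /= mulmxDl -[X in X - _]addrA addrK -scalemxAl scalerK ?rowE//.
by near: h; exact: nbhs_dnbhs_neq.
Unshelve. all: by end_near. Qed.

Lemma jac_id n (y : 'rV[R]_n) : 'J (fun z : 'rV[R]_n => z) y = 1%:M.
Proof.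
have [_ <-] := @jac_lin n n 1%:M 0 y; congr ('J _ _).
by apply/funext => z; rewrite mulmx1 addr0.
Qed.

End Jac.

(** * Ordinary differential equations *)

Section OneVar.
Variable R : realType.

Lemma is_derive_cont (V : normedModType R) (f : R -> V) (t : R) (d : V) :
 is_derive t 1 f d -> {for t, continuous f}.
Proof. by move=> [df _]; apply: differentiable_continuous; exact/derivable1_diffP. Qed.

Lemma is_derive_rV m n (c : R -> 'M[R]_(m, n)) (t : R) (v : 'M[R]_(m, n)) :
 is_derive t 1 c v <-> forall i j, is_derive t 1 (fun s => c s i j) (v i j).
Proof.
split=> [[d e] i j|H].
 have d' := (derivable_mxP _ _ _).1 d; split; first exact: d'.
 by move: e; rewrite derive_mx// => /matrixP/(_ i j); rewrite mxE.
have d : derivable c t 1 by apply/derivable_mxP => i j; have [] := H i j.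
by split=> //; rewrite derive_mx//; apply/matrixP => i j; rewrite mxE; have [] := H i j.
Qed.

Lemma der0_const (f : R -> R) (a b : R) : a <= b ->
 (forall t : R, a <= t <= b -> is_derive t 1 f 0) -> f a = f b.
Proof.
rewrite le_eqVlt => /predU1P[->//|ab] H.
have [||c _] := @MVT R f (cst 0) a b ab.
- by move=> x /[!in_itv]/= /andP[/ltW xa /ltW xb]; apply: H; rewrite xa.
- by apply: derivable_within_continuous => x /[!in_itv]/= /H [].
by rewrite mul0r => /eqP; rewrite subr_eq0 => /eqP.
Qed.

Lemma der_le (f g df dg : R -> R) (a b : R) : a <= b ->
 (forall t : R, a <= t <= b -> is_derive t 1 f (df t)) ->
 (forall t : R, a <= t <= b -> is_derive t 1 g (dg t)) ->
 (forall t : R, a <= t <= b -> df t <= dg t) ->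
 f b - f a <= g b - g a.
Proof.
rewrite le_eqVlt => /predU1P[->|ab] Hf Hg Hle; first by rewrite !subrr.
have Hd t : a <= t <= b -> is_derive t 1 (g - f) (dg t - df t).
 by move=> tab; apply: is_deriveB; [exact: Hg|exact: Hf].
have [||c cab] := @MVT R (g - f) (fun t => dg t - df t) a b ab.
- by move=> x /[!in_itv]/= /andP[/ltW xa /ltW xb]; apply: Hd; rewrite xa.
- by apply: derivable_within_continuous => x /[!in_itv]/= /Hd [].
move=> E; rewrite -subr_ge0.
have -> : g b - g a - (f b - f a) = (g - f) b - (g - f) a by rewrite !fctE; ring.
rewrite E; apply: mulr_ge0; last by rewrite subr_ge0 ltW.
rewrite subr_ge0; move: cab; rewrite in_itv/= => /andP[/ltW xa /ltW xb].
by apply: Hle; rewrite xa.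
Qed.

Lemma der_norm_le (f g df dg : R -> R) (a b : R) : a <= b ->
 (forall t : R, a <= t <= b -> is_derive t 1 f (df t)) ->
 (forall t : R, a <= t <= b -> is_derive t 1 g (dg t)) ->
 (forall t : R, a <= t <= b -> `|df t| <= dg t) ->
 `|f b - f a| <= g b - g a.
Proof.
move=> ab Hf Hg Hle; rewrite ler_norml; apply/andP; split.
 rewrite lerNl opprB.
 have := @der_le (- f) g (fun t => - df t) dg a b ab _ Hg.
 rewrite !fctE opprK addrC; apply.
  by move=> t tab; apply: is_deriveN; exact: Hf.
 by move=> t /Hle; rewrite ler_norml => /andP[h _]; rewrite lerNl.
apply: (der_le ab Hf Hg) => t /Hle; rewrite ler_norml => /andP[_]; exact.
Qed.

Lemma der_mx_bound m n (f df : R -> 'M[R]_(m, n)) (K a b : R) : a <= b -> 0 <= K ->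
 (forall t : R, a <= t <= b -> is_derive t 1 f (df t)) ->
 (forall t : R, a <= t <= b -> `|df t| <= K) -> `|f b - f a| <= K * (b - a).
Proof.
move=> ab K0 Hf HK; apply: mx_norm_le => [|i j].
 by rewrite mulr_ge0// subr_ge0.
rewrite !mxE mulrBr.
apply: (@der_norm_le (fun t => f t i j) (fun t => K * t) (fun t => df t i j) (fun=> K)) => //.
- by move=> t /Hf /is_derive_rV; exact.
- move=> t _; have := @is_deriveZ R _ _ (id : R -> R) K t 1 1 _.
 by rewrite /GRing.scale/= mulr1; apply.
- by move=> t /HK; apply: le_trans; exact: mx_entry_le.
Qed.

Lemma der_ext (V : normedModType R) (f g : R -> V) (t : R) (d : V) (e : R) : 0 < e ->
 (forall s, `|s - t| < e -> f s = g s) -> is_derive t 1 f d -> is_derive t 1 g d.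
Proof.
move=> e0 fg df; apply: near_eq_is_derive df.
by apply/nbhs_ballP; exists e => // s; rewrite -ball_normE /ball_ /= distrC => /fg.
Qed.

Lemma primitive_seg (g : R -> R) (N : R) : 0 < N -> continuous g ->
 exists G : R -> R, G 0 = 0 /\ forall t : R, - N < t < N -> is_derive t 1 G (g t).
Proof.
move=> N0 cg.
pose F x := (\int[lebesgue_measure]_(t in `[- N, x]) g t)%R.
have dF t : - N < t < N -> is_derive t 1 F (g t).
 move=> /andP[t1 t2].
 have I : lebesgue_measure.-integrable `[- N, N] (EFin \o g).
  apply: continuous_compact_integrable; first exact: segment_compact.
  exact: continuous_subspaceT.
 have [|d e] := continuous_FTC1_closed t2 I t1 _; first exact: cg.
 by split; [exact: d|rewrite -derive1E; exact: e].
exists (fun x => F x - F 0); split; first by rewrite subrr.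
move=> t tN; have := dF t tN => d.
by rewrite -[g t]subr0; apply: is_deriveB.
Qed.

(** Primitives on the segments ]-N, N[, normalised to vanish at 0, agree where both are defined, so
    they patch to a primitive on the line. *)
Lemma primitive_ex (g : R -> R) : continuous g ->
 exists G : R -> R, G 0 = 0 /\ forall t : R, is_derive t 1 G (g t).
Proof.
move=> cg.
have H (N : R) : exists G : R -> R, 0 < N ->
  G 0 = 0 /\ forall t : R, - N < t < N -> is_derive t 1 G (g t).
 have [N0|_] := boolP (0 < N); last by exists (cst 0).
 by have [G HG] := primitive_seg N0 cg; exists G.
have [G HG] := choice H.
have eqG (N M t : R) : `|t| < N -> `|t| < M -> G N t = G M t.
 move=> tN tM; have N0 : 0 < N := le_lt_trans (normr_ge0 _) tN.
 have M0 : 0 < M := le_lt_trans (normr_ge0 _) tM.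
 have [GN0 dN] := HG N N0; have [GM0 dM] := HG M M0.
 have d (s : R) : `|s| <= `|t| -> is_derive s 1 (G N - G M) 0.
  move=> st; rewrite -(subrr (g s)); apply: is_deriveB.
   by apply: dN; rewrite -ltr_norml; exact: le_lt_trans tN.
  by apply: dM; rewrite -ltr_norml; exact: le_lt_trans tM.
 have z : (G N - G M) 0 = 0 by rewrite !fctE GN0 GM0 subrr.
 suff : (G N - G M) t = 0 by rewrite !fctE => /eqP; rewrite subr_eq0 => /eqP.
 have [t0|t0] := leP 0 t.
  rewrite -z; apply/esym; apply: der0_const => // s /andP[s0 st].
  by apply: d; rewrite !ger0_norm.
 rewrite -z; apply: der0_const; first exact: ltW.
 move=> s /andP[s0 st]; apply: d; rewrite !ler0_norm ?lerN2//; exact: ltW.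
(* The primitive used at [t] is the one of radius |t| + 1. Nearby points use other radii, and [eqG]
   identifies the values. *)
exists (fun t => G (`|t| + 1) t); split.
 by rewrite normr0 add0r; have [] := HG 1 ltr01.
move=> t.
have N0 : 0 < `|t| + 2 by rewrite ltr_wpDl.
have [_ d] := HG _ N0.
have tN : - (`|t| + 2) < t < `|t| + 2 by rewrite -ltr_norml ltrDl.
apply: der_ext (d t tN); first exact: ltr01.
move=> s st; apply: eqG; last by rewrite ltrDl.
have : `|s| <= `|t| + `|s - t| by rewrite -{1}(subrK t s) addrC ler_normD.
move=> /le_lt_trans; apply; rewrite ltrD2l; apply: lt_trans st _.
by rewrite ltr1n.
Qed.

Lemma primitive_mx m n (g : R -> 'M[R]_(m, n)) (y : 'M[R]_(m, n)) : continuous g ->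
 exists G : R -> 'M[R]_(m, n), G 0 = y /\ forall t : R, is_derive t 1 G (g t).
Proof.
move=> cg.
have H (ij : 'I_m * 'I_n) : exists G : R -> R, G 0 = 0 /\ forall t : R, is_derive t 1 G (g t ij.1 ij.2).
 by apply: primitive_ex => t; move: (cg t) => /continuous_mxP; apply.
have [G HG] := choice H.
exists (fun t => y + \matrix_(i, j) G (i, j) t); split.
 by apply/matrixP => i j; rewrite !mxE; have [-> _] := HG (i, j); rewrite addr0.
move=> t; apply/is_derive_rV => i j.
have [_ d] := HG (i, j).
have -> : (fun s : R => (y + \matrix_(i0, j0) G (i0, j0) s) i j) = cst (y i j) + G (i, j).
 by apply/funext => s; rewrite !fctE !mxE.
by rewrite -[g t i j]add0r; apply: is_deriveD; exact: d.
Qed.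

Lemma der_scal (a : R) (f : R -> R) (t d : R) : is_derive t 1 f d ->
 is_derive t 1 (fun s => a * f s) (a * d).
Proof. by move=> df; have := @is_deriveZ R _ _ f a t 1 d df. Qed.

Lemma der_expM (a t : R) : is_derive t 1 (fun s => expR (a * s)) (a * expR (a * t)).
Proof.
have d1 : is_derive t 1 (fun s => a * s) a.
 by have := @der_scal a id t 1 _; rewrite mulr1; apply.
by rewrite [a * expR _]mulrC; apply: (is_derive1_comp (f := expR)).
Qed.

Lemma der_refl (V : normedModType R) (f : R -> V) (t : R) (d : V) :
 is_derive (- t) 1 f d -> is_derive t 1 (fun s => f (- s)) (- d).
Proof.
move=> [df ed].
have dd : is_diff (- t) f ('d f (- t)) by apply/differentiableP; exact/derivable1_diffP.
have d2 : differentiable (f \o (-%R : R -> R)) t.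
 by apply: differentiable_comp; [| case: dd].
split; first exact/derivable1_diffP.
rewrite deriveE//.
rewrite (_ : (fun s : R => f (- s)) = f \o (-%R : R -> R))// diff_comp//=.
rewrite -ed deriveE; last by case: dd.
rewrite -linearN; congr ('d f _ _).
have [_ <-] := @is_deriveNid R R t 1.
by rewrite deriveE.
Qed.

(** Integrating against e^(M|t|) gains a factor 1/M. In [picard] a weight of twice a Lipschitz bound
    makes every iteration contract by 1/2, on however long an interval. *)
Lemma exp_dom (f df : R -> R) (K M T : R) : 0 < M -> 0 <= K -> f 0 = 0 ->
 (forall t : R, is_derive t 1 f (df t)) ->
 (forall t : R, `|t| <= T -> `|df t| <= K * expR (M * `|t|)) ->
 forall t : R, `|t| <= T -> `|f t| <= K / M * expR (M * `|t|).
Proof.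
move=> M0 K0 f0 Hf Hd t tT.
have main (h dh : R -> R) : h 0 = 0 -> (forall t : R, is_derive t 1 h (dh t)) ->
  (forall t : R, `|t| <= T -> `|dh t| <= K * expR (M * `|t|)) ->
  forall t : R, 0 <= t -> `|t| <= T -> `|h t| <= K / M * expR (M * t).
 move=> h0 Hh Hdh s s0 sT.
 have := @der_norm_le h (fun s => K / M * expR (M * s)) dh
   (fun s => K / M * (M * expR (M * s))) 0 s s0.
 rewrite h0 subr0 => H; apply: le_trans (H _ _ _) _.
 - by move=> u _; apply: der_scal; exact: der_expM.
 - move=> u /andP[u0 us]; apply: le_trans (Hdh _ _) _.
   by rewrite ger0_norm//; apply: le_trans sT; rewrite ger0_norm.
  by rewrite ger0_norm// mulrA divfK// gt_eqF.
 - by rewrite lerBlDr lerDl mulr_ge0// ?expR_ge0// divr_ge0// ltW.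
have [t0|t0] := leP 0 t; first by rewrite [in leRHS]ger0_norm//; exact: main Hf Hd t t0 tT.
have := @main (fun s => f (- s)) (fun s => - df (- s)) _ _ _ (- t) _ _.
rewrite opprK [in `|t|]ltr0_norm//; apply.
- by rewrite oppr0.
- by move=> s; apply: der_refl; exact: Hf.
- by move=> s sT; rewrite normrN -(normrN s); apply: Hd; rewrite normrN.
- by rewrite oppr_ge0 ltW.
- by rewrite normrN.
Qed.

(** The intervals from u_k - c_k to u_k + c_k with c_k = 2 C / 2^k are nested, c_k being the tail of
    the geometric series; the limit is the supremum of the left ends. *)
Lemma geom_limit (u : nat -> R) (C : R) : 0 <= C ->
 (forall k, `|u k.+1 - u k| <= C / 2 ^+ k) ->
 exists l, forall k, `|l - u k| <= 2 * C / 2 ^+ k.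
Proof.
move=> C0 Hu.
pose c k : R := 2 * C / 2 ^+ k.
have cS k : c k = C / 2 ^+ k + c k.+1.
 rewrite /c exprS; field; by rewrite expf_neq0.
have c0 k : 0 <= c k by rewrite /c divr_ge0// ?mulr_ge0// exprn_ge0.
have Hu' k : u k.+1 - u k <= C / 2 ^+ k /\ u k - u k.+1 <= C / 2 ^+ k.
 by have := Hu k; rewrite ler_norml => /andP[h1 h2]; split => //; lra.
have inc m k : u k - c k <= u (m + k)%N - c (m + k)%N.
 elim: m => // m IH; apply: le_trans IH _; rewrite addSn.
 by have := cS (m + k)%N; have [] := Hu' (m + k)%N; lra.
have dec m k : u (m + k)%N + c (m + k)%N <= u k + c k.
 elim: m => // m; apply: le_trans; rewrite addSn.
 by have := cS (m + k)%N; have [] := Hu' (m + k)%N; lra.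
have le m k : u k - c k <= u m + c m.
 apply: (le_trans (inc m k)); apply: le_trans (dec k m); rewrite [(k + m)%N]addnC.
 by have := c0 (m + k)%N; lra.
pose S := [set x | exists k, x = u k - c k].
have hS : has_sup S.
 split; first by exists (u 0%N - c 0%N), 0%N.
 by exists (u 0%N + c 0%N) => _ [k ->]; exact: le.
exists (sup S) => k; rewrite ler_norml; apply/andP; split.
 have : u k - c k <= sup S by apply: ub_le_sup; [exact: hS.2|exists k].
 by rewrite -/(c k); lra.
have : sup S <= u k + c k by apply: ge_sup; [exact: hS.1|move=> _ [m ->]; exact: le].
by rewrite -/(c k); lra.
Qed.

(** The sup norm is not differentiable, so the estimate runs on E = sum_j D_j^2 + eps^2, which
    satisfies E' <= a E. [K] depends on n, L and T but not on the curve; this uniformity is what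
    yields continuity and differentiability in the initial value. *)
Lemma gronwall (n : nat) (L T : R) : 0 <= L -> exists K : R, 0 < K /\
 forall (D D' : R -> 'rV[R]_n) (eps T' : R), 0 <= eps -> T' <= T ->
 (forall t : R, 0 <= t <= T' -> is_derive t 1 D (D' t)) ->
 (forall t : R, 0 <= t <= T' -> `|D' t| <= L * `|D t| + eps) ->
 forall t : R, 0 <= t <= T' -> `|D t| <= K * (`|D 0| + eps).
Proof.
move=> L0; pose a := 2 * n%:R * (L + 1).
have a0 : 0 <= a by rewrite /a !mulr_ge0// addr_ge0.
(* The factor n + 1 bounds E(0) by the sup norm; K >= 1 allows K to be replaced by K^2 before square
   roots are taken. *)
pose K : R := n.+1%:R * expR (a * `|T|).
have e1 : 1 <= expR (a * `|T|) by rewrite -expR0 ler_expR mulr_ge0.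
have K1 : 1 <= K by rewrite /K -[X in X <= _]mulr1 ler_pM// ler1n.
exists K; split; first exact: lt_le_trans ltr01 K1.
move=> D D' eps T' eps0 T'T dD HD t tT.
pose E s := \sum_(j < n) D s 0 j * D s 0 j + eps * eps.
pose dE s := \sum_(j < n) (D s 0 j * D' s 0 j + D' s 0 j * D s 0 j).
have HE (s : R) : 0 <= s <= T' -> is_derive s 1 E (dE s).
 move=> /dD /is_derive_rV d.
 have -> : E = (\sum_(j < n) (fun s => D s 0 j * D s 0 j)) + cst (eps * eps).
  by apply/funext => u; rewrite /E !fctE fct_sumE.
 rewrite -[dE s]addr0; apply: is_deriveD; apply: is_derive_sum => j.
 rewrite addrC [X in X + _]mulrC [X in _ + X]mulrC.
 have := is_deriveM (d 0 j) (d 0 j); rewrite /GRing.scale/=.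
 by rewrite [X in _ + X]mulrC.
have DE (s : R) : `|D s| ^+ 2 <= \sum_(j < n) D s 0 j * D s 0 j.
 have [->|N0] := eqVneq (`|D s|) 0.
  by rewrite expr0n/=; apply: sumr_ge0 => j _; rewrite -expr2 sqr_ge0.
 have [[i j] ->] : exists ij : 'I_1 * 'I_n, `|D s| = `|D s ij.1 ij.2|.
  by apply: mx_norm_neq0.
 rewrite (bigD1 j)//= real_normK ?num_real// (ord1 i) expr2 lerDl.
 by apply: sumr_ge0 => l _; rewrite -expr2 sqr_ge0.
have bnd (s : R) : 0 <= s <= T' -> dE s <= a * E s.
 move=> sT; have hd := HD s sT.
 have N0 : 0 <= `|D s| by [].
 have step : dE s <= \sum_(j < n) 2 * (`|D s| * (L * `|D s| + eps)).
  apply: ler_sum => j _.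
  have : D s 0 j * D' s 0 j <= `|D s| * (L * `|D s| + eps).
   apply: le_trans (ler_norm _) _; rewrite normrM; apply: ler_pM => //.
    exact: mx_entry_le.
   by apply: le_trans hd; exact: mx_entry_le.
  by rewrite [D' s 0 j * _]mulrC => h; lra.
 apply: le_trans step _; rewrite sumr_const card_ord -[_ *+ n]mulr_natr /a.
 have h1 : `|D s| * (L * `|D s| + eps) <= (L + 1) * E s.
  have h2 := DE s; have h3 : `|D s| ^+ 2 + eps * eps <= E s by rewrite lerD2r.
  have : `|D s| * eps <= `|D s| ^+ 2 + eps * eps.
   by have := sqr_ge0 (`|D s| - eps); rewrite expr2; nra.
  have LE : L * `|D s| ^+ 2 <= L * E s.
   by rewrite ler_wpM2l//; apply: le_trans h3; rewrite lerDl mulr_ge0.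
  by rewrite mulrDl mul1r mulrDr mulrCA -expr2 => h; nra.
 have n0 : 0 <= n%:R :> R by [].
 by have := ler_wpM2l n0 h1; lra.
have mono : E t * expR (- a * t) <= E 0.
 have T0 : 0 <= t by case/andP: tT.
 have := @der_le (fun s => E s * expR (- a * s)) (cst 0)
  (fun s => E s * (- a * expR (- a * s)) + expR (- a * s) * dE s) (cst 0) 0 t T0.
 rewrite mulr0 expR0 mulr1 subrr subr_le0; apply.
 - move=> s /andP[s0 st].
  have d := HE s; have := @is_deriveM R _ E (fun s => expR (- a * s)) s 1 (dE s) (- a * expR (- a * s)).
  apply; last exact: der_expM.
  by apply: d; rewrite s0 (le_trans st)//; case/andP: tT.
 - move=> s /andP[s0 st] /=.
  have := bnd s; rewrite s0 (le_trans st) ?(andP tT).2// => /(_ isT) b.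
  have := expR_gt0 (- a * s); nra.
have Et : E t <= E 0 * expR (a * t).
 have := ler_wpM2r (expR_ge0 (a * t)) mono.
 by rewrite -mulrA -expRD mulNr addNr expR0 mulr1.
have Ea : E 0 <= n.+1%:R * (`|D 0| + eps) ^+ 2.
 have s1 : \sum_(j < n) D 0 0 j * D 0 0 j <= \sum_(j < n) `|D 0| ^+ 2.
  apply: ler_sum => j _; rewrite -expr2 -(real_normK (num_real _)).
  by rewrite lerXn2r ?nnegrE//; exact: mx_entry_le.
 rewrite sumr_const card_ord -mulr_natl in s1.
 rewrite /E -[n.+1]addn1 natrD mulrDl mul1r.
 have N0 : 0 <= `|D 0| by [].
 have n0 : 0 <= n%:R :> R by [].
 apply: lerD.
  by apply: le_trans s1 _; rewrite ler_wpM2l// lerXn2r ?nnegrE ?addr_ge0// lerDl.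
 by rewrite -expr2 lerXn2r ?nnegrE ?addr_ge0// lerDr.
have ET : expR (a * t) <= expR (a * `|T|).
 rewrite ler_expR ler_wpM2l//; case/andP: tT => _ h; apply: (le_trans (le_trans h T'T)).
 exact: ler_norm.
have fin : `|D t| ^+ 2 <= K * (`|D 0| + eps) ^+ 2.
 apply: le_trans (DE t) _; apply: (@le_trans _ _ (E t)).
  by rewrite /E lerDl mulr_ge0.
 apply: le_trans Et _; rewrite /K [leRHS]mulrAC.
 apply: ler_pM => //.
 by rewrite /E addr_ge0 ?mulr_ge0//; apply: sumr_ge0 => j _; rewrite -expr2 sqr_ge0.
have : `|D t| ^+ 2 <= (K * (`|D 0| + eps)) ^+ 2.
 apply: le_trans fin _; rewrite exprMn ler_wpM2r ?sqr_ge0// expr2.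
 by rewrite -[leLHS]mulr1 ler_wpM2l// ltW// (lt_le_trans ltr01).
by rewrite ler_sqr ?nnegrE// mulr_ge0 ?addr_ge0// ltW// (lt_le_trans ltr01).
Qed.

End OneVar.

(** * Picard iteration *)

Section Picard.
Variables (R : realType) (n : nat).
Implicit Types (c : R -> 'rV[R]_n).

Lemma cont_R (V : normedModType R) (f : R -> V) (t : R) :
 {for t, continuous f} <->
 forall e : R, 0 < e -> exists2 d : R, 0 < d & forall s : R, `|s - t| < d -> `|f s - f t| < e.
Proof.
split=> [cf e e0|H].
 have /cvgrPdist_lt/(_ e e0)/nbhs_ballP[d /= d0 dH] := cf.
 exists d => // s sd; rewrite distrC; apply: dH.
 by rewrite -ball_normE /ball_ /= distrC.
apply/cvgrPdist_lt => e e0; apply/nbhs_ballP; have [d d0 dH] := H e e0.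
exists d => // s hs; rewrite /= distrC; apply: dH.
by move: hs; rewrite /ball_ /= distrC.
Qed.

Lemma bounded_on_seg c (T : R) : continuous c ->
 exists B : R, 0 <= B /\ forall t : R, `|t| <= T -> `|c t| <= B.
Proof.
move=> cc; have [T0|T0] := ltP T 0.
 by exists 0; split=> // t /le_lt_trans/(_ T0); rewrite ltNge normr_ge0.
have ab : - T <= T by lra.
have cn : {within `[- T, T], continuous (fun t => `|c t|)}.
 apply: continuous_subspaceT => t; apply: continuous_comp; first exact: cc.
 exact: norm_continuous.
have [s _ Hs] := EVT_max ab cn.
exists `|c s|; split=> // t tT; apply: Hs.
by rewrite in_itv/= -ler_norml.
Qed.

Lemma pow2_small (C e : R) : 0 < e -> exists k : nat, C / 2 ^+ k < e.
Proof.
move=> e0; pose k := (Num.trunc (C / e)).+1; exists k.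
have h : C / e < 2 ^+ k.
 apply: lt_le_trans (truncnS_gt _) _.
 by rewrite -natrX ler_nat; exact: ltnW (ltn_expl _ _).
by rewrite ltr_pdivrMr ?exprn_gt0// mulrC -ltr_pdivrMr.
Qed.

(** The Lipschitz bound is global in space and uniform on bounded time intervals, so the solution
    exists for all times: on each such interval the iterates converge geometrically once weighted by
    e^(2 M |t|). *)
Theorem picard (F : R -> 'rV[R]_n -> 'rV[R]_n) (y : 'rV[R]_n) :
 (forall c, continuous c -> continuous (fun t => F t (c t))) ->
 (forall T : R, exists L : R, 0 <= L /\ forall (t : R) (x x' : 'rV[R]_n), `|t| <= T ->
   `|F t x - F t x'| <= L * `|x - x'|) ->
 exists c, c 0 = y /\ forall t : R, is_derive t 1 c (F t (c t)).
Proof.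
move=> Fc FL.
have HP c : exists c', continuous c ->
  c' 0 = y /\ forall t : R, is_derive t 1 c' (F t (c t)).
 have [cc|ncc] := pselect (continuous c); last by exists c.
 by have [G HG] := primitive_mx y (Fc c cc); exists G.
have {HP} [P HP] := choice HP.
pose xs k := iter k P (cst y).
have xsc k : continuous (xs k).
 elim: k => [|k IH]; first exact: cst_continuous.
 by move=> t; have [_ /(_ t)] := HP _ IH; exact: is_derive_cont.
have xs0 k : xs k 0 = y by case: k => // k; have [] := HP _ (xsc k).
have xsd k (t : R) : is_derive t 1 (xs k.+1) (F t (xs k t)) by have [_] := HP _ (xsc k); exact.
have bound (T : R) : exists C : R, 0 <= C /\ forall k (t : R), `|t| <= T ->
  `|xs k.+1 t - xs k t| <= C / 2 ^+ k.
 have [L [L0 HL]] := FL T.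
 pose M := L + 1; have M0 : 0 < M by rewrite ltr_wpDl.
 have [B [B0 HB]] := bounded_on_seg T (Fc _ (xsc 0%N)).
 pose D := B / (2 * M).
 have D0 : 0 <= D by rewrite divr_ge0// mulr_ge0// ltW.
 (* Each iteration halves the weighted distance. [B] bounds the field along the constant first
    iterate, which gives the starting value D = B / (2 M). *)
 have key k (t : R) : `|t| <= T -> `|xs k.+1 t - xs k t| <= D / 2 ^+ k * expR ((2 * M) * `|t|).
  have M20 : 0 < 2 * M by rewrite mulr_gt0.
  elim: k t => [|k IH] t tT.
   rewrite expr0 divr1; apply: mx_norm_le => [|i j]; first by rewrite mulr_ge0 ?expR_ge0.
   apply: (@exp_dom R (fun s => (xs 1%N s - xs 0%N s) i j) (fun s => F s (xs 0%N s) i j) B (2 * M) T) => //.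
   - by rewrite !mxE !xs0 subrr.
   - move=> s; have /is_derive_rV/(_ i j) d := xsd 0%N s.
    have -> : (fun s => (xs 1%N s - xs 0%N s) i j) = (fun s => xs 1%N s i j) - cst (y i j).
     by apply/funext => u; rewrite !mxE !fctE.
    by rewrite -[F _ _ i j]subr0; apply: is_deriveB.
   - move=> s sT; apply: le_trans (mx_entry_le _ _ _) _; apply: le_trans (HB s sT) _.
    by rewrite ler_peMr// -[X in X <= _]expR0 ler_expR mulr_ge0// ltW.
  have E : D / 2 ^+ k.+1 = (M * (D / 2 ^+ k)) / (2 * M).
   rewrite exprS; field; rewrite gt_eqF// expf_neq0//.
  have Dk0 : 0 <= M * (D / 2 ^+ k) by rewrite mulr_ge0 ?(ltW M0)// divr_ge0// exprn_ge0.
  rewrite E; apply: mx_norm_le => [|i j].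
   by rewrite mulr_ge0 ?expR_ge0// divr_ge0// ltW.
  apply: (@exp_dom R (fun s => (xs k.+2 s - xs k.+1 s) i j)
    (fun s => F s (xs k.+1 s) i j - F s (xs k s) i j) _ (2 * M) T) => //.
  - by rewrite !mxE !xs0 subrr.
  - move=> s; have /is_derive_rV/(_ i j) d1 := xsd k.+1 s.
   have /is_derive_rV/(_ i j) d2 := xsd k s.
   have -> : (fun s => (xs k.+2 s - xs k.+1 s) i j) =
     (fun s => xs k.+2 s i j) - (fun s => xs k.+1 s i j).
    by apply/funext => u; rewrite !mxE !fctE.
   exact: is_deriveB.
  - move=> s sT; have := mx_entry_le (F s (xs k.+1 s) - F s (xs k s)) i j.
   rewrite !mxE => /le_trans; apply; apply: le_trans (HL _ _ _ sT) _.
   rewrite -mulrA; apply: ler_pM => //; last exact: IH.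
   by rewrite lerDl.
 exists (D * expR ((2 * M) * `|T|)); split; first by rewrite mulr_ge0 ?expR_ge0.
 move=> k t tT; apply: le_trans (key k t tT) _; rewrite mulrAC.
 rewrite ler_wpM2r ?invr_ge0 ?exprn_ge0// ler_wpM2l// ler_expR ler_wpM2l//.
  by rewrite mulr_ge0// ltW.
 by apply: (le_trans tT); exact: ler_norm.
(* The limit at [t] is fixed once, from the bound for |t|. Uniqueness of limits shows that it
   satisfies the estimate of every other admissible constant, so that the bounds on larger intervals
   apply to it. *)
have lim_ex (t : R) : exists l : 'rV[R]_n, forall (C : R), 0 <= C ->
  (forall k, `|xs k.+1 t - xs k t| <= C / 2 ^+ k) ->
  forall k, `|l - xs k t| <= 2 * C / 2 ^+ k.
 have [C0 [C00 HC0]] := bound `|t|.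
 have H (j : 'I_n) : exists l : R, forall k, `|l - xs k t 0 j| <= 2 * C0 / 2 ^+ k.
  apply: geom_limit => // k.
  have := mx_entry_le (xs k.+1 t - xs k t) 0 j; rewrite !mxE => /le_trans; apply.
  exact: HC0.
 have [l Hl] := choice H.
 exists (\row_j l j) => C C0' HC k; apply: mx_norm_le => [|i j].
  by rewrite divr_ge0// ?mulr_ge0// exprn_ge0.
 rewrite !mxE (ord1 i).
 have [l' Hl'] : exists l' : R, forall k, `|l' - xs k t 0 j| <= 2 * C / 2 ^+ k.
  apply: geom_limit => // m.
  have := mx_entry_le (xs m.+1 t - xs m t) 0 j; rewrite !mxE => /le_trans; apply.
  exact: HC.
 suff -> : l j = l' by exact: Hl'.
 apply/eqP; rewrite -subr_eq0 -normr_le0; apply/ler_addgt0Pr => e e0; rewrite add0r.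
 have [m Hm] : exists m : nat, (2 * C0 + 2 * C) / 2 ^+ m <= e.
  by have [m /ltW] := pow2_small (2 * C0 + 2 * C) e0; exists m.
 apply: le_trans Hm; rewrite -(subrKA (xs m t 0 j)) mulrDl.
 apply: le_trans (ler_normD _ _) _; apply: lerD; first exact: Hl.
 by rewrite distrC; exact: Hl'.
have {lim_ex} [x Hx] := choice lim_ex.
have xk (T : R) : exists C : R, 0 <= C /\ forall k (t : R), `|t| <= T ->
  `|x t - xs k t| <= C / 2 ^+ k.
 have [C [C0 HC]] := bound T; exists (2 * C); split; first by rewrite mulr_ge0.
 by move=> k t tT; apply: (Hx t C C0) => m; exact: HC.
have xc : continuous x.
 move=> t; apply/cont_R => e e0.
 have [C [C0 HC]] := xk (`|t| + 1).
 have e3 : 0 < e / 3 by rewrite divr_gt0.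
 have [k Hk] := pow2_small C e3.
 have /cont_R/(_ _ e3)[d d0 dH] := xsc k t.
 exists (Num.min d 1); first by rewrite lt_min d0 ltr01.
 move=> s; rewrite lt_min => /andP[sd s1].
 have sT : `|s| <= `|t| + 1.
  rewrite -{1}(subrK t s) addrC; apply: le_trans (ler_normD _ _) _.
  by rewrite lerD2l ltW.
 have h1 := HC k s sT; have h2 : `|x t - xs k t| <= C / 2 ^+ k by apply: HC; rewrite lerDl.
 have h3 := dH s sd.
 have -> : x s - x t = (x s - xs k s) + (xs k s - xs k t) + (xs k t - x t).
  by rewrite !subrKA.
 have : `|(x s - xs k s) + (xs k s - xs k t) + (xs k t - x t)| <=
   `|x s - xs k s| + `|xs k s - xs k t| + `|x t - xs k t|.
  rewrite [`|x t - _|]distrC; apply: le_trans (ler_normD _ _) _.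
  by rewrite lerD2r ler_normD.
 lra.
have [G0 dG] := HP x xc.
(* The limit is a fixed point: x and P x are both close to the iterate k + 1, the latter by the
   Lipschitz bound integrated between 0 and t. *)
suff E : x = P x by exists x; rewrite {1 2}E; split=> // t; rewrite {1}E.
apply/funext => t.
apply/eqP; rewrite -subr_eq0 -normr_le0; apply/ler_addgt0Pr => e e0; rewrite add0r.
have [C [C0 HC]] := xk `|t|.
have [L [L0 HL]] := FL `|t|.
have [k Hk] := pow2_small (`|t| * L * C + C) e0.
have Pd : `|P x t - xs k.+1 t| <= L * (C / 2 ^+ k) * `|t|.
 pose h s := P x s - xs k.+1 s.
 have hd (s : R) : is_derive s 1 h (F s (x s) - F s (xs k s)).
  exact: is_deriveB.
 have h0 : h 0 = 0 by rewrite /h G0 xs0 subrr.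
 have K0 : 0 <= L * (C / 2 ^+ k) by rewrite mulr_ge0// divr_ge0// exprn_ge0.
 have hb (s : R) : `|s| <= `|t| -> `|F s (x s) - F s (xs k s)| <= L * (C / 2 ^+ k).
  move=> st; apply: le_trans (HL _ _ _ st) _; rewrite ler_wpM2l//; exact: HC.
 have [t0|t0] := leP 0 t.
  have := @der_mx_bound R 1 n h (fun s => F s (x s) - F s (xs k s)) _ 0 t t0 K0.
  rewrite h0 !subr0 (ger0_norm t0); apply => // s /andP[s0 st]; apply: hb.
  by rewrite !ger0_norm.
 have := @der_mx_bound R 1 n h (fun s => F s (x s) - F s (xs k s)) _ t 0 (ltW t0) K0.
 rewrite h0 !sub0r normrN (ltr0_norm t0); apply => // s /andP[s0 st]; apply: hb.
 by rewrite !ler0_norm ?lerN2// ltW.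
apply: le_trans (ltW Hk); rewrite -(subrKA (xs k.+1 t)) mulrDl.
apply: le_trans (ler_normD _ _) _; rewrite addrC; apply: lerD.
 rewrite distrC; apply: le_trans Pd _.
 by rewrite mulrC !mulrA.
apply: (le_trans (HC k.+1 t (lexx _))).
by rewrite ler_wpM2l// lef_pV2 ?posrE ?exprn_gt0// exprS ler_peMl ?exprn_ge0// ler1n.
Qed.

End Picard.

Section LocalBounds.
Variables (R : realType) (n : nat).

Lemma bounded_on_ball m l (g : 'rV[R]_n -> 'M[R]_(m, l)) (r : R) : continuous g ->
 exists B : R, 0 <= B /\ forall z : 'rV[R]_n, `|z| <= r -> `|g z| <= B.
Proof.
move=> cg; have [r0|r0] := ltP r 0.
 by exists 0; split=> // z /le_lt_trans/(_ r0); rewrite ltNge normr_ge0.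
pose A := [set z : 'rV[R]_n | `|z| <= r].
have cA : compact A.
 apply: bounded_closed_compact.
  exists r; split; first exact: num_real.
  by move=> M rM z Az; apply: le_trans Az _; exact: ltW.
 rewrite /A (_ : [set z | _] = (fun z : 'rV[R]_n => `|z|) @^-1` [set t | t <= r])//.
 apply: closed_comp; last exact: closed_le.
 by move=> z _; exact: norm_continuous.
have [||c _ Hc] := @EVT_max_rV R n (fun z => `|g z|) A _ cA.
 by exists 0; rewrite /A /= normr0.
 apply: continuous_subspaceT => z; apply: continuous_comp; first exact: cg.
 exact: norm_continuous.
exists `|g c|; split => // z zr; apply: Hc; rewrite inE.
exact: zr.
Qed.

Lemma seg_ball (z v : 'rV[R]_n) (r c : R) : `|z| <= r -> `|z + v| <= r ->
 0 <= c <= 1 -> `|z + c *: v| <= r.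
Proof.
move=> zr zvr /andP[c0 c1].
have -> : z + c *: v = (1 - c) *: z + c *: (z + v).
 by rewrite scalerBl scale1r scalerDr addrA subrK.
apply: le_trans (ler_normD _ _) _; rewrite !normrZ (ger0_norm c0) ger0_norm ?subr_ge0//.
have : (1 - c) * `|z| <= (1 - c) * r by rewrite ler_wpM2l// subr_ge0.
have : c * `|z + v| <= c * r by rewrite ler_wpM2l.
lra.
Qed.

Lemma smoothT_cont (V : normedModType R) (f : 'rV[R]_n -> V) : smooth_on setT f -> continuous f.
Proof. by move=> sf z; apply: smooth_cont sf _. Qed.

Lemma loc_lipR (f : 'rV[R]_n -> R) (r : R) : smooth_on setT f ->
 exists L : R, 0 <= L /\ forall z v : 'rV[R]_n, `|z| <= r -> `|z + v| <= r ->
  `|f (z + v) - f z| <= L * `|v|.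
Proof.
move=> sf.
have H (i : 'I_n) : exists B : R, 0 <= B /\ forall z : 'rV[R]_n, `|z| <= r -> `|'D_(E_ R i) f z| <= B.
 have [|B [B0 HB]] := @bounded_on_ball 1 1 (fun z => ('D_(E_ R i) f z)%:M) r _.
  move=> z; apply/continuous_mxP => a b; rewrite !ord1.
  have -> : (fun z => (('D_(E_ R i) f z)%:M : 'M[R]_1) ord0 ord0) = 'D_(E_ R i) f.
   by apply/funext => u; rewrite mxE eqxx mulr1n.
  by apply: smoothT_cont; exact: smooth_D.
 exists B; split=> // z /HB; apply: le_trans.
 by have := mx_entry_le ('D_(E_ R i) f z)%:M (ord0 : 'I_1) (ord0 : 'I_1); rewrite mxE eqxx mulr1n.
have [B HB] := choice H.
exists (\sum_i B i); split; first by apply: sumr_ge0 => i _; have [] := HB i.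
move=> z v zr zvr.
have [s s01|c [c01]] := @MVT_line R _ f z v 1.
 by apply: smooth_derivable sf _.
rewrite scale1r mul1r mulr1 => ->.
rewrite derive_basis; last exact: (smooth_diffR openT sf).
apply: le_trans (ler_norm_sum _ _ _) _; rewrite mulr_suml; apply: ler_sum => i _.
rewrite normrM mulrC; apply: ler_pM => //; last exact: mx_entry_le.
by have [_] := HB i; apply; exact: seg_ball.
Qed.

Lemma loc_lip m (f : 'rV[R]_n -> 'rV[R]_m) (r : R) : smooth_on setT f ->
 exists L : R, 0 <= L /\ forall z z' : 'rV[R]_n, `|z| <= r -> `|z'| <= r ->
  `|f z' - f z| <= L * `|z' - z|.
Proof.
move=> sf.
have H (j : 'I_m) : exists L : R, 0 <= L /\ forall z v : 'rV[R]_n, `|z| <= r -> `|z + v| <= r ->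
  `|f (z + v) 0 j - f z 0 j| <= L * `|v|.
 by apply: (loc_lipR (f := fun z => f z 0 j)); apply: smooth_entry => //; exact: openT.
have [L HL] := choice H.
have L0 : 0 <= \sum_j L j by apply: sumr_ge0 => j _; have [] := HL j.
exists (\sum_j L j); split => // z z' zr zr'.
apply: mx_norm_le => [|i j]; first by rewrite mulr_ge0.
rewrite (ord1 i) !mxE; have [_ /(_ z (z' - z) zr)] := HL j.
rewrite [z + _]addrC subrK => /(_ zr') /le_trans; apply; rewrite ler_wpM2r//.
by rewrite (bigD1 j)//= lerDl; apply: sumr_ge0 => l _; have [] := HL l.
Qed.

(** The remainder is a difference of first derivatives at two points of the segment, controlled by
    Lipschitz bounds of the partial derivatives on the ball. The constant is uniform in [z], as an
    estimate along a whole trajectory requires. *)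
Lemma taylor2 m (f : 'rV[R]_n -> 'rV[R]_m) (r : R) : smooth_on setT f ->
 exists K : R, 0 <= K /\ forall z v : 'rV[R]_n, `|z| <= r -> `|z + v| <= r ->
  `|f (z + v) - f z - v *m 'J f z| <= K * `|v| ^+ 2.
Proof.
move=> sf.
have H (p : 'I_m * 'I_n) : exists L : R, 0 <= L /\ forall z v : 'rV[R]_n, `|z| <= r ->
  `|z + v| <= r -> `|'D_(E_ R p.2) (fun z => f z 0 p.1) (z + v) -
    'D_(E_ R p.2) (fun z => f z 0 p.1) z| <= L * `|v|.
 apply: (loc_lipR (f := 'D_(E_ R p.2) (fun z => f z 0 p.1))); apply: smooth_D.
 by apply: smooth_entry => //; exact: openT.
have [L HL] := choice H.
have L0 : 0 <= \sum_p L p by apply: sumr_ge0 => j _; have [] := HL j.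
pose K := \sum_(i < n) \sum_p L p.
have K0 : 0 <= K by apply: sumr_ge0.
exists K; split => // z v zr zvr.
apply: mx_norm_le => [|i j]; first by rewrite mulr_ge0// sqr_ge0.
rewrite (ord1 i).
have sfj : smooth_on setT (fun z => f z 0 j) by apply: smooth_entry => //; exact: openT.
have [s s01|c [c01]] := @MVT_line R _ (fun z => f z 0 j) z v 1.
 by apply: smooth_derivable sfj _.
rewrite scale1r mul1r mulr1 => E.
have EJ : (v *m 'J f z) 0 j = 'D_v (fun z => f z 0 j) z.
 have df := smooth_diff openT sf (I : setT z).
 rewrite -(deriveEjacobian v df) derive_mx ?mxE//; exact: diff_derivable.
rewrite [X in `|X|]mxE [X in `|X + _|]mxE [X in `|_ + X + _|]mxE [X in `|_ + X|]mxE EJ E.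
rewrite !derive_basis; [|exact: (smooth_diffR openT sfj)..].
rewrite -sumrB; apply: le_trans (ler_norm_sum _ _ _) _.
rewrite /K mulr_suml; apply: ler_sum => k _.
rewrite -mulrBr normrM expr2 mulrA mulrC; apply: ler_pM => //; last exact: mx_entry_le.
have [Lp0 /(_ z (c *: v) zr)] := HL (j, k); move=> /(_ (seg_ball zr zvr c01)) /= h.
apply: le_trans h _; rewrite normrZ mulrA ler_wpM2r//.
apply: (@le_trans _ _ (L (j, k))).
 by case/andP: c01 => c0 c1; rewrite ger0_norm// ler_piMr.
by rewrite (bigD1 (j, k))//= lerDl; apply: sumr_ge0 => l _; have [] := HL l.
Qed.

End LocalBounds.

Section Exit.
Variable R : realType.

(** The supremum of the good times is reached and passed, since around each [q] the property passes
    from some good time just before [q] to all times just after it. It stands in for compactness of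
    [0, T] in the arguments along curves. *)
Lemma real_induction (P : R -> Prop) (T : R) : 0 <= T -> P 0 ->
 (forall q : R, 0 <= q <= T -> exists2 d : R, 0 < d & forall s s' : R, 0 <= s <= q -> q - d < s ->
   P s -> q <= s' -> s' < q + d -> s' <= T -> P s') -> P T.
Proof.
move=> T0 P0 H; pose S := [set s : R | 0 <= s <= T /\ P s].
have S0 : S 0 by split; rewrite ?lexx.
have hS : has_sup S by split; [exists 0|exists T => t [/andP[_ +] _]].
pose q := sup S.
have q0 : 0 <= q by apply: ub_le_sup; [exact: hS.2|].
have qT : q <= T by apply: ge_sup; [exact: hS.1|move=> t [/andP[_ +] _]].
have [|d d0 Hd] := H q; first by rewrite q0.
have [s [sT Ps] qs] := sup_adherent d0 hS.
have sq : s <= q by apply: ub_le_sup; [exact: hS.2|].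
have sb : 0 <= s <= q by case/andP: sT => ->.
have [Tq|qT'] := ltP T (q + d); first exact: (Hd s T sb qs Ps qT Tq (lexx _)).
have : S (q + d / 2).
 split; first by apply/andP; split; lra.
 by apply: (Hd s _ sb qs Ps); lra.
by move=> /(ub_le_sup hS.2); rewrite -/q; lra.
Qed.

(** Bootstrap principle: a bound that becomes strict whenever it has held so far cannot be lost. *)
Lemma first_exit (g : R -> R) (c T : R) : 0 <= T -> continuous g -> g 0 <= c ->
 (forall t : R, 0 <= t <= T -> (forall s : R, 0 <= s <= t -> g s <= c) -> g t < c) ->
 forall t : R, 0 <= t <= T -> g t <= c.
Proof.
move=> T0 cg g0 H.
pose S := [set t : R | 0 <= t <= T /\ forall s : R, 0 <= s <= t -> g s <= c].
have S0 : S 0.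
 by split; [rewrite lexx|move=> s /andP[h1 h2]; have -> : s = 0 by apply/eqP; rewrite eq_le h1 h2].
have hS : has_sup S by split; [exists 0|exists T => t [/andP[_ +] _]].
pose q := sup S.
have q0 : 0 <= q by apply: ub_le_sup; [exact: hS.2|].
have qT : q <= T by apply: ge_sup; [exact: hS.1|move=> t [/andP[_ +] _]].
have below (s : R) : 0 <= s -> s < q -> g s <= c.
 move=> s0 sq; have e0 : 0 < q - s by rewrite subr_gt0.
 have [t [tT Ht] st] := sup_adherent e0 hS.
 by apply: Ht; rewrite s0 /=; move: st; rewrite -/q opprB addrC subrK => /ltW.
have gq : g q <= c.
 have [->//|qn0] := eqVneq q 0.
 have qp : 0 < q by rewrite lt_neqAle eq_sym qn0.
 rewrite leNgt; apply/negP => cgq.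
 have e0 : 0 < g q - c by rewrite subr_gt0.
 have /cont_R/(_ _ e0)[d d0 dH] := cg q.
 pose s := q - Num.min (d / 2) q.
 have m0 : 0 < Num.min (d / 2) q by rewrite lt_min qp divr_gt0.
 have md : Num.min (d / 2) q <= d / 2 by rewrite ge_min lexx.
 have mq : Num.min (d / 2) q <= q by rewrite ge_min lexx orbT.
 have := dH s; rewrite /s addrC addrA addNr add0r normrN gtr0_norm// => /(_ _).
 have hd : Num.min (d / 2) q < d by apply: le_lt_trans md _; lra.
 move=> /(_ hd); have := below s; rewrite subr_ge0 mq ltrBlDr ltrDl m0 => /(_ isT isT).
 by rewrite /s addrC => h1; rewrite ltr_norml => /andP[h2 h3]; lra.
have allq (s : R) : 0 <= s <= q -> g s <= c.
 by move=> /andP[s0]; rewrite le_eqVlt => /predU1P[->//|]; exact: below.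
have [Tq|qT'] := leP T q.
 move=> t /andP[t0 tT]; apply: allq; rewrite t0 /=; exact: le_trans tT Tq.
have gqc : g q < c by apply: H => //; rewrite q0 qT.
have e0 : 0 < c - g q by rewrite subr_gt0.
have /cont_R/(_ _ e0)[d d0 dH] := cg q.
pose q' := Num.min (q + d / 2) T.
have qq' : q < q' by rewrite lt_min qT' andbT ltrDl divr_gt0.
have Sq' : S q'.
 split; first by rewrite ge_min lexx orbT andbT; exact: ltW (le_lt_trans q0 qq').
 move=> s /andP[s0 sq']; have [sq|qs] := leP s q; first by apply: allq; rewrite s0.
 have : s <= q + d / 2 by apply: le_trans sq' _; rewrite ge_min lexx.
 move=> h; have : `|s - q| < d by rewrite ger0_norm ?subr_ge0 ?(ltW qs)//; lra.
 by move=> /dH; rewrite ltr_norml => /andP[_]; lra.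
have : q' <= q by apply: ub_le_sup; [exact: hS.2|].
by rewrite leNgt qq'.
Qed.

End Exit.

(** * Smooth dependence of flows on the initial value *)

Section Family.
Variable R : realType.

(** The field is defined everywhere, but solutions are recorded for initial values in [O] only. The
    linearised field on pairs need not be globally Lipschitz, yet its solutions over [O] exist for
    all times, so the notion is stable under linearisation. *)
Definition flow_family n (f : 'rV[R]_n -> 'rV[R]_n) (O : set 'rV[R]_n)
  (x : R -> 'rV[R]_n -> 'rV[R]_n) : Prop :=
 [/\ smooth_on setT f, open O & forall y, O y -> x 0 y = y /\
  forall t : R, is_derive t 1 (x^~ y) (f (x t y))].

Definition variational n (f : 'rV[R]_n -> 'rV[R]_n) (c Z : R -> 'rV[R]_n) (w : 'rV[R]_n) :=
 Z 0 = w /\ forall t : R, is_derive t 1 Z (Z t *m 'J f (c t)).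

Lemma mulmx_norm m n p (A : 'M[R]_(m, n)) (B : 'M[R]_(n, p)) : `|A *m B| <= n%:R * `|A| * `|B|.
Proof.
apply: mx_norm_le => [|i j]; first by rewrite !mulr_ge0.
rewrite mxE; apply: le_trans (ler_norm_sum _ _ _) _.
apply: (@le_trans _ _ (\sum_(k < n) `|A| * `|B|)).
 by apply: ler_sum => k _; rewrite normrM; apply: ler_pM => //; exact: mx_entry_le.
by rewrite sumr_const card_ord -[_ *+ n]mulr_natl mulrA.
Qed.

Lemma continuous_sumR (T : topologicalType) (I : Type) (r : seq I) (F : I -> T -> R) (t : T) :
 (forall i, {for t, continuous (F i)}) -> {for t, continuous (fun x => \sum_(i <- r) F i x)}.
Proof.
move=> H; elim: r => [|i r IH].
 have -> : (fun x => \sum_(i <- [::]) F i x) = cst 0 by apply/funext => x; rewrite big_nil.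
 exact: cst_continuous.
have -> : (fun x => \sum_(j <- i :: r) F j x) = F i + (fun x => \sum_(j <- r) F j x).
 by apply/funext => x; rewrite big_cons.
exact: continuousD.
Qed.

Lemma linear_ode n (A : R -> 'M[R]_n) (w : 'rV[R]_n) : continuous A ->
 exists Z : R -> 'rV[R]_n, Z 0 = w /\ forall t : R, is_derive t 1 Z (Z t *m A t).
Proof.
move=> cA; apply: (@picard R n (fun t z => z *m A t)).
 move=> c cc t; apply/continuous_mxP => i j.
 have -> : (fun x => (c x *m A x) i j) = (fun x => \sum_(k < n) c x i k * A x k j).
  by apply/funext => s; rewrite mxE.
 apply: continuous_sumR => k; apply: continuousM.
  by move: (cc t) => /continuous_mxP; apply.
 by move: (cA t) => /continuous_mxP; apply.
move=> T; have [T0|T0] := ltP T 0.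
 by exists 0; split => // t x x' /le_lt_trans/(_ T0); rewrite ltNge normr_ge0.
have ab : - T <= T by lra.
have [|s _ Hs] := @EVT_max R (fun t => `|A t|) (- T) T ab.
 apply: continuous_subspaceT => t; apply: continuous_comp; first exact: cA.
 exact: norm_continuous.
exists (n%:R * `|A s|); split; first by rewrite mulr_ge0.
move=> t x x' tT; rewrite -mulmxBl; apply: le_trans (mulmx_norm _ _) _.
rewrite mulrAC ler_wpM2r// ler_wpM2l//; apply: Hs.
by rewrite in_itv/= -ler_norml.
Qed.

Lemma curve_continuous n (c d : R -> 'rV[R]_n) : (forall t : R, is_derive t 1 c (d t)) -> continuous c.
Proof. by move=> H t; exact: is_derive_cont (H t). Qed.

Lemma fam_variational n (f : 'rV[R]_n -> 'rV[R]_n) O x y w : flow_family f O x -> O y ->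
 exists Z, variational f (x^~ y) Z w.
Proof.
move=> [sf oO Hx] Oy; have [_ dx] := Hx y Oy.
apply: linear_ode => t; apply: continuous_comp; first exact: curve_continuous dx _.
by apply: (smoothT_cont _); apply: smooth_jac sf; exact: openT.
Qed.

(** Bootstrap: while the two solutions stay within distance 1, the Lipschitz constant on the ball of
    radius B + 1 applies, and Gronwall's estimate gives a deviation of at most K |y - y0| < 1. *)
Lemma fam_cont n (f : 'rV[R]_n -> 'rV[R]_n) O x (y0 : 'rV[R]_n) (T : R) :
 flow_family f O x -> O y0 -> 0 <= T ->
 exists d K : R, [/\ 0 < d, 0 < K & forall y : 'rV[R]_n, `|y - y0| < d ->
  O y /\ forall t : R, 0 <= t <= T -> `|x t y - x t y0| <= K * `|y - y0|].
Proof.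
move=> [sf oO Hx] Oy0 T0; have [x0 dx] := Hx y0 Oy0.
have [B [B0 HB]] := bounded_on_seg T (curve_continuous dx).
have [L [L0 HL]] := loc_lip (B + 1) sf.
have [K [K0 HK]] := gronwall n T L0.
have [d0 d00 Hd0] := (open_rV _).1 oO y0 Oy0.
exists (Num.min d0 (Num.min K^-1 1)), K; split => //.
 by rewrite !lt_min d00 invr_gt0 K0 ltr01.
move=> y; rewrite !lt_min => /and3P[yd yK y1].
have Oy := Hd0 y yd; have [xy dxy] := Hx y Oy; split => //.
have small : K * `|y - y0| < 1 by rewrite mulrC -ltr_pdivlMr// div1r.
pose D (t : R) := x t y - x t y0.
have dD (t : R) : is_derive t 1 D (f (x t y) - f (x t y0)) by exact: is_deriveB.
have cD : continuous D by exact: curve_continuous dD.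
have est (t : R) : 0 <= t <= T -> (forall s : R, 0 <= s <= t -> `|D s| <= 1) ->
  forall s : R, 0 <= s <= t -> `|D s| <= K * `|y - y0|.
 move=> /andP[t0 tT] D1 s st.
 have := HK D (fun t => f (x t y) - f (x t y0)) 0 t (lexx _) tT _ _ s st.
 rewrite /D xy x0 addr0; apply => u ut; rewrite ?addr0.
 have uT : `|x u y0| <= B.
  by apply: HB; case/andP: ut => u0 ut; rewrite ger0_norm// (le_trans ut).
 apply: HL; first by apply: le_trans uT _; rewrite lerDl.
 rewrite -[x u y](subrK (x u y0)); apply: le_trans (ler_normD _ _) _.
 by rewrite addrC lerD//; exact: D1.
have D1 : forall t : R, 0 <= t <= T -> `|D t| <= 1.
 apply: (@first_exit R (fun t => `|D t|)) => //.
 - by move=> t; apply: continuous_comp; [exact: cD | exact: norm_continuous].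
 - by rewrite /D xy x0; exact: ltW.
 - move=> t tT H; apply: le_lt_trans small; apply: (est t tT H).
  by case/andP: tT => -> _; rewrite lexx.
move=> t tT; apply: (est T) => //; by rewrite T0 lexx.
Qed.

(** First prolongation of [f]: its solutions are pairs of a solution and a solution of the
    linearised equation along it. *)
Definition tangent_field n (f : 'rV[R]_n -> 'rV[R]_n) (u : 'rV[R]_(n + n)) : 'rV[R]_(n + n) :=
 row_mx (f (lsubmx u)) (rsubmx u *m 'J f (lsubmx u)).

Lemma smooth_lsub n m (O : set 'rV[R]_n) : open O ->
 open (lsubmx @^-1` O : set 'rV[R]_(n + m)).
Proof.
move=> oO; apply/open_rV => u /= Ou; have [d d0 H] := (open_rV _).1 oO _ Ou.
exists d => // z zd; apply: H; apply: le_lt_trans zd.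
by apply: mx_norm_le => // i j; apply: le_trans (mx_entry_le _ i (lshift m j)); rewrite !mxE.
Qed.

Lemma tangent_smooth n (f : 'rV[R]_n -> 'rV[R]_n) :
 smooth_on setT f -> smooth_on setT (tangent_field f).
Proof.
move=> sf; have oT := @openT 'rV[R]_(n + n); have oT' := @openT 'rV[R]_n.
have sl : smooth_on setT (fun u : 'rV[R]_(n + n) => lsubmx u) by apply: smooth_lsubmx => //; exact: smooth_id.
have sr : smooth_on setT (fun u : 'rV[R]_(n + n) => rsubmx u) by apply: smooth_rsubmx => //; exact: smooth_id.
apply: smooth_row_mx => //; first exact: (smooth_comp oT oT').
apply: smooth_mulmx => //.
by apply: (smooth_comp oT oT' (g := fun y => 'J f y)) => //; exact: smooth_jac.
Qed.

Lemma is_derive_row_mx m n (c : R -> 'rV[R]_m) (d : R -> 'rV[R]_n) (t : R) (c' : 'rV[R]_m) (d' : 'rV[R]_n) :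
 is_derive t 1 c c' -> is_derive t 1 d d' -> is_derive t 1 (fun s => row_mx (c s) (d s)) (row_mx c' d').
Proof.
move=> /is_derive_rV Hc /is_derive_rV Hd; apply/is_derive_rV => i j.
rewrite -(splitK j); case: (fintype.split j) => k /=.
 rewrite row_mxEl; have -> : (fun s => row_mx (c s) (d s) i (lshift n k)) = (fun s => c s i k).
  by apply/funext => s; rewrite row_mxEl.
 exact: Hc.
rewrite row_mxEr; have -> : (fun s => row_mx (c s) (d s) i (rshift m k)) = (fun s => d s i k).
 by apply/funext => s; rewrite row_mxEr.
exact: Hd.
Qed.

Lemma tangent_family n (f : 'rV[R]_n -> 'rV[R]_n) O x : flow_family f O x ->
 exists Z : R -> 'rV[R]_n -> 'rV[R]_n -> 'rV[R]_n,
  (forall y w, O y -> variational f (x^~ y) (fun t => Z t y w) w) /\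
  flow_family (tangent_field f) (lsubmx @^-1` O)
   (fun t u => row_mx (x t (lsubmx u)) (Z t (lsubmx u) (rsubmx u))).
Proof.
move=> fam; have [sf oO Hx] := fam.
have H (yw : 'rV[R]_n * 'rV[R]_n) : exists Z, O yw.1 -> variational f (x^~ yw.1) Z yw.2.
 have [Oy|nOy] := pselect (O yw.1); last by exists 0.
 by have [Z HZ] := fam_variational yw.2 fam Oy; exists Z.
have [Z HZ] := choice H.
exists (fun t y w => Z (y, w) t); split; first by move=> y w Oy; exact: (HZ (y, w)).
split; [exact: tangent_smooth | exact: smooth_lsub |].
move=> u Ou; have [x0 dx] := Hx _ Ou; have [Z0 dZ] := HZ (lsubmx u, rsubmx u) Ou.
split; first by rewrite x0 Z0 hsubmxK.
move=> t; rewrite /tangent_field row_mxKl row_mxKr.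
exact: is_derive_row_mx (dx t) (dZ t).
Qed.

(** Gronwall's estimate is applied to r = x(y + h w) - x(y) - h Z: by Taylor's formula r' differs
    from r (J f) by O(h^2), and r starts at 0. *)
Lemma fam_derive n (f : 'rV[R]_n -> 'rV[R]_n) O x y w Z (t : R) : flow_family f O x -> O y ->
 variational f (x^~ y) Z w -> 0 <= t -> is_derive y w (x t) (Z t).
Proof.
move=> fam Oy [Z0 dZ] t0; have [sf oO Hx] := fam; have [x0 dx] := Hx y Oy.
have [d [K [d0 K0 Hd]]] := fam_cont fam Oy t0.
have [B [B0 HB]] := bounded_on_seg t (curve_continuous dx).
have [L [L0 HL]] := bounded_on_ball B (smoothT_cont (smooth_jac openT sf)).
have [T2 [T20 HT2]] := taylor2 (B + K * d) sf.
have L0' : 0 <= n%:R * L by rewrite mulr_ge0.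
have [K2 [K20 HK2]] := gronwall n t L0'.
pose C := K2 * (T2 * (K * `|w|) ^+ 2).
have C0 : 0 <= C by rewrite /C !mulr_ge0 ?sqr_ge0// ltW.
have est (h : R) : `|h| * `|w| < d -> `|x t (h *: w + y) - x t y - h *: Z t| <= C * `|h| ^+ 2.
 move=> hd; pose y' := h *: w + y.
 have yy : y' - y = h *: w by rewrite /y' addrK.
 have [|Oy' Hy'] := Hd y'; first by rewrite yy normrZ.
 have [x0' dx'] := Hx y' Oy'.
 pose r (s : R) := x s y' - x s y - h *: Z s.
 have dr (s : R) : is_derive s 1 r (f (x s y') - f (x s y) - h *: (Z s *m 'J f (x s y))).
  apply: is_deriveB; exact: is_deriveZ.
 have := HK2 r _ (T2 * (K * `|w|) ^+ 2 * `|h| ^+ 2) t _ (lexx t) (fun s _ => dr s) _ t _.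
 have -> : r 0 = 0 by rewrite /r x0 x0' Z0 yy subrr.
 rewrite normr0 add0r mulrA; apply; last by rewrite t0 lexx.
  by apply: mulr_ge0; [apply: mulr_ge0|]; rewrite ?sqr_ge0.
 move=> s /andP[s0 st].
 have xs : `|x s y| <= B by apply: HB; rewrite ger0_norm.
 have De : `|x s y' - x s y| <= K * (`|h| * `|w|).
  by have := Hy' s; rewrite yy normrZ s0 st; apply.
 have Kd0 : 0 <= K * d by rewrite mulr_ge0// ltW.
 have h1 : `|x s y' - x s y| <= K * d by apply: le_trans De _; rewrite ler_wpM2l ?ltW.
 have h2 : `|x s y + (x s y' - x s y)| <= B + K * d.
  by apply: le_trans (ler_normD _ _) _; exact: lerD.
 have h3 : `|x s y| <= B + K * d by apply: le_trans xs _; rewrite lerDl.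
 have := HT2 (x s y) (x s y' - x s y) h3 h2.
 rewrite [x s y + _]addrC subrK => h4.
 have -> : f (x s y') - f (x s y) - h *: (Z s *m 'J f (x s y)) =
   r s *m 'J f (x s y) + (f (x s y') - f (x s y) - (x s y' - x s y) *m 'J f (x s y)).
  rewrite /r mulmxBl -scalemxAl [RHS]addrC addrA subrK.
  by [].
 apply: le_trans (ler_normD _ _) _; apply: lerD.
  apply: le_trans (mulmx_norm _ _) _; rewrite mulrAC ler_wpM2r//.
  by rewrite ler_wpM2l//; exact: HL.
 apply: le_trans h4 _; rewrite -mulrA ler_wpM2l// -exprMn.
 rewrite lerXn2r ?nnegrE ?mulr_ge0// ?(ltW K0)//.
 by apply: le_trans De _; rewrite [`|h| * _]mulrC mulrA.
have lim : h^-1 *: (x t (h *: w + y) - x t y) @[h --> 0^'] --> Z t.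
 apply/cvgrPdist_le => e e0.
 have Cw : 0 < C + 1 by rewrite ltr_wpDl.
 have w1 : 0 < `|w| + 1 by rewrite ltr_wpDl.
 near=> h.
 have h0 : h != 0 by near: h; exact: nbhs_dnbhs_neq.
 have hd : `|h| < d / (`|w| + 1).
  by near: h; apply: dnbhs0_lt; rewrite divr_gt0.
 have he : `|h| < e / (C + 1).
  by near: h; apply: dnbhs0_lt; rewrite divr_gt0.
 rewrite distrC.
 have -> : h^-1 *: (x t (h *: w + y) - x t y) - Z t = h^-1 *: (x t (h *: w + y) - x t y - h *: Z t).
  by rewrite [RHS]scalerBr scalerK.
 have hw : `|h| * `|w| < d.
  move: hd; rewrite ltr_pdivlMr// => /(le_lt_trans _); apply.
  by rewrite ler_wpM2l// lerDl.
 have hp : 0 < `|h| by rewrite normr_gt0.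
 rewrite normrZ normfV ler_pdivrMl//; apply: le_trans (est h hw) _.
 rewrite expr2 mulrCA ler_wpM2l//.
 move: he; rewrite ltr_pdivlMr// => /ltW; apply: le_trans.
 by rewrite mulrC ler_wpM2l// lerDl.
split; first by apply/cvg_ex; exists (Z t).
exact: cvg_lim lim.
Unshelve. all: by end_near. Qed.

Lemma Ck_smooth_comp n m k p (U : set 'rV[R]_n) (W : set 'rV[R]_m) (f : 'rV[R]_n -> 'rV[R]_m)
  (g : 'rV[R]_m -> 'rV[R]_p) : open U -> open W -> (forall y, U y -> W (f y)) ->
 smooth_on U f -> Ck k W g -> Ck k U (fun y => g (f y)).
Proof.
move=> oU oW fUW sf cg; apply/Ck_mx => // i j.
apply: (Ck_comp oU oW fUW (sf k) (g := fun z => g z i j)).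
by move/(Ck_mx _ _ oW): cg; apply.
Qed.

(** Induction on k over all dimensions and fields at once: a directional derivative of the flow is a
    component of the flow of the prolonged field, to which the induction hypothesis applies. *)
Lemma fam_Ck k n (f : 'rV[R]_n -> 'rV[R]_n) O x (t : R) : flow_family f O x -> 0 <= t -> Ck k O (x t).
Proof.
move=> fam t0; elim: k n f O x fam => [|k IH] n f O x fam.
 move=> y Oy; apply/cont_rV => e e0; have [d [K [d0 K0 Hd]]] := fam_cont fam Oy t0.
 exists (Num.min d (e / K)); first by rewrite lt_min d0 divr_gt0.
 move=> z; rewrite lt_min => /andP[zd ze]; have [_ /(_ t)] := Hd z zd.
 rewrite t0 lexx => /(_ isT)/le_lt_trans; apply.
 by rewrite mulrC -ltr_pdivlMr.
have [Z [HZ tfam]] := tangent_family fam; have [_ oO _] := fam.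
split=> [y w Oy|w].
 by have [] := fam_derive fam Oy (HZ y w Oy) t0.
have C := IH _ _ _ _ tfam; have oT : open (lsubmx @^-1` O : set 'rV[R]_(n + n)) := smooth_lsub oO.
have sw : smooth_on O (fun y : 'rV[R]_n => row_mx y w).
 by apply: smooth_row_mx => //; [exact: smooth_id|exact: smooth_cst].
have C2 : Ck k O (fun y => row_mx (x t y) (Z t y w)).
 have := Ck_smooth_comp oO oT (f := fun y => row_mx y w) _ sw C.
 under eq_fun do rewrite row_mxKl row_mxKr.
 by apply => y Oy; rewrite /= row_mxKl.
apply: (@Ck_ext _ _ _ k O (fun y => rsubmx (row_mx (x t y) (Z t y w)))) => //.
 by move=> y Oy; rewrite row_mxKr; have [_ ->] := fam_derive fam Oy (HZ y w Oy) t0.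
apply/Ck_mx => // i j; move/(Ck_mx _ _ oO): C2 => /(_ i (rshift n j)) h.
by apply: (Ck_ext oO _ h) => y _; rewrite [RHS]mxE.
Qed.

Lemma fam_smooth n (f : 'rV[R]_n -> 'rV[R]_n) O x (t : R) : flow_family f O x -> 0 <= t -> smooth_on O (x t).
Proof. by move=> fam t0 k; exact: fam_Ck fam t0. Qed.

End Family.

(** * Bump functions and cut-offs *)

Section Bump.
Variable R : realType.

(** The family p(1/x) e^(-1/x), extended by 0, is closed under differentiation: p becomes X^2 (p -
    p'). Smoothness of all members thus follows from differentiability of each. *)
Definition flat (p : {poly R}) (x : R) : R := if 0 < x then p.[x^-1] * expR (- x^-1) else 0.

(** From u^(k+1) <= (k+1)! e^u with u = 1/x, applied to each monomial. *)
Lemma flat_small (p : {poly R}) : exists C : R, 0 <= C /\ forall x : R, 0 < x -> x <= 1 ->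
 `|p.[x^-1] * expR (- x^-1)| <= C * x.
Proof.
exists (\sum_(k < size p) `|p`_k| * (k.+1)`!%:R); split.
 by apply: sumr_ge0 => k _; rewrite mulr_ge0.
move=> x x0 x1; have u0 : 0 < x^-1 by rewrite invr_gt0.
rewrite horner_coef mulr_suml mulr_suml; apply: le_trans (ler_norm_sum _ _ _) _.
apply: ler_sum => k _; rewrite -mulrA normrM -mulrA ler_wpM2l//.
rewrite ger0_norm; last by rewrite mulr_ge0 ?expR_ge0// exprn_ge0// ltW.
have h := @expR_ge1Dxn R (x^-1) k (ltW u0).
have h2 : (x^-1) ^+ k.+1 <= (k.+1)`!%:R * expR (x^-1).
 rewrite -ler_pdivrMl ?ltr0n ?fact_gt0// mulrC; apply: le_trans h; rewrite lerDr//.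
have e0 := expR_gt0 (x^-1).
rewrite expRN -(ler_pM2r e0) divfK ?gt_eqF// mulrAC.
have -> : (x^-1) ^+ k = (x^-1) ^+ k.+1 * x by rewrite exprSr divfK// gt_eqF.
by rewrite ler_wpM2r// ltW.
Qed.

Lemma flat_derive (p : {poly R}) (x : R) :
 is_derive x 1 (flat p) (flat ('X^2 * (p - p^`())) x).
Proof.
have [x0|x0|<-] := ltgtP 0 x.
- have xn : x != 0 by rewrite gt_eqF.
 have dv : is_derive x 1 (fun y : R => y^-1) (- (x ^- 2)).
  split; first by apply: derivableV.
  by rewrite deriveV// derive_id /GRing.scale/= mulr1.
 have dp : is_derive x 1 (fun y : R => p.[y^-1]) (p^`().[x^-1] * - (x ^- 2)).
  by apply: (@is_derive1_comp R (horner p) (fun y => y^-1)).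
 have de : is_derive x 1 (fun y : R => expR (- y^-1)) (expR (- x^-1) * (x ^- 2)).
  have dn : is_derive x 1 (fun y : R => - y^-1) (x ^- 2).
   by rewrite -[x ^- 2]opprK; apply: is_deriveN.
  by apply: (@is_derive1_comp R expR (fun y => - y^-1)).
 apply: (@der_ext R _ (fun y => p.[y^-1] * expR (- y^-1)) _ x _ x x0).
  move=> s; rewrite ltr_norml => /andP[s1 _]; rewrite /flat ifT//; lra.
 rewrite /flat x0; have := is_deriveM dp de; rewrite /GRing.scale/=.
 have -> : ('X^2 * (p - p^`())).[x^-1] * expR (- x^-1) =
  p.[x^-1] * (expR (- x^-1) * x ^- 2) + expR (- x^-1) * (p^`().[x^-1] * - x ^- 2).
  by rewrite hornerM hornerXn hornerD hornerN exprVn; ring.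
 by [].
- apply: (@der_ext R _ (cst 0) _ x _ (- x)); first by rewrite oppr_gt0.
  move=> s; rewrite ltr_norml => /andP[_ s1]; rewrite /flat ifF//.
  by apply/negP => s0; lra.
 by rewrite /flat ifF; [exact: is_derive_cst | apply/negP; rewrite ltNge (ltW x0)].
have [C [C0 HC]] := flat_small ('X * p).
have lim : h^-1 *: (flat p (h *: 1 + 0) - flat p 0) @[h --> 0^'] --> (0 : R).
 apply/cvgrPdist_le => e e0; near=> h.
 have h0 : h != 0 by near: h; exact: nbhs_dnbhs_neq.
 have h1 : `|h| < 1 by near: h; apply: dnbhs0_lt.
 have he : `|h| < e / (C + 1).
  by near: h; apply: dnbhs0_lt; rewrite divr_gt0// ltr_wpDl.
 rewrite sub0r normrN addr0 /flat ltxx subr0 [h *: 1]mulr1.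
 case: ifP => hp; last by rewrite scaler0 normr0 ltW.
 rewrite /GRing.scale/= mulrA -[h^-1 * _]/(h^-1 * p.[h^-1]).
 have -> : h^-1 * p.[h^-1] = ('X * p).[h^-1] by rewrite hornerM hornerX.
 apply: (le_trans (HC h hp _)).
  by apply: ltW; apply: le_lt_trans (ler_norm _) h1.
 move: he; rewrite ltr_pdivlMr ?ltr_wpDl// (gtr0_norm hp) => /ltW; apply: le_trans.
 by rewrite mulrC ler_wpM2l// ?lerDl// ltW.
have -> : flat ('X^2 * (p - p^`())) 0 = 0 by rewrite /flat ltxx.
split; first by apply/cvg_ex; exists 0.
exact: cvg_lim lim.
Unshelve. all: by end_near. Qed.

Lemma derive_compR n (h : R -> R) (g : 'rV[R]_n -> R) (y v : 'rV[R]_n) (h' : R) :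
 is_derive (g y) 1 h h' -> differentiable g y ->
 derivable (fun z => h (g z)) y v /\ 'D_v (fun z => h (g z)) y = h' * 'D_v g y.
Proof.
move=> [dh eh] dg; have dh' : differentiable h (g y) by exact/derivable1_diffP.
have dc : differentiable (h \o g) y by exact: differentiable_comp.
split; first exact: diff_derivable.
rewrite -[LHS]/('D_v (h \o g) y) deriveE// diff_comp//= [in RHS]deriveE//.
move: ('d g y v) => b; rewrite -{1}[b]mulr1 -[b * 1]/(b *: (1 : R)) linearZZ -deriveE// eh.
by rewrite mulrC.
Qed.

Lemma flat_comp_Ck k n (U : set 'rV[R]_n) (g : 'rV[R]_n -> R) (p : {poly R}) : open U ->
 smooth_on U g -> Ck k U (fun y => flat p (g y)).
Proof.
move=> oU sg; elim: k p => [|k IH] p.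
 move=> y Uy; apply: continuous_comp; first exact: smooth_cont sg Uy.
 exact: is_derive_cont (flat_derive p _).
have H y v (Uy : U y) := derive_compR v (flat_derive p (g y)) (smooth_diffR oU sg Uy).
split=> [y v Uy|v]; first by have [] := H y v Uy.
apply: (Ck_ext oU _ (Ck_mul oU (IH ('X^2 * (p - p^`()))) (smooth_D v sg k))).
by move=> y Uy; have [_ ->] := H y v Uy.
Qed.

(** A smooth replacement for the sup norm, comparable to its square by [sqdist_ge] and
    [sqdist_le]. *)
Definition sqdist n (z0 z : 'rV[R]_n) : R := \sum_j (z 0 j - z0 0 j) ^+ 2.

(** For r > 0 this is 1 where sqdist <= r^2/4 and 0 where sqdist >= r^2. Since r^2/4 < r^2, one of
    the two summands of the denominator is always positive. *)
Definition bump n (z0 : 'rV[R]_n) (r : R) (z : 'rV[R]_n) : R :=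
 flat 1 (r ^+ 2 - sqdist z0 z) /
 (flat 1 (r ^+ 2 - sqdist z0 z) + flat 1 (sqdist z0 z - r ^+ 2 / 4)).

Lemma flat1_ge0 (x : R) : 0 <= flat 1 x.
Proof. by rewrite /flat; case: ifP => // _; rewrite hornerE mul1r expR_ge0. Qed.

Lemma flat1_gt0 (x : R) : 0 < x -> 0 < flat 1 x.
Proof. by move=> x0; rewrite /flat x0 hornerE mul1r expR_gt0. Qed.

Lemma flat1_eq0 (x : R) : x <= 0 -> flat 1 x = 0.
Proof. by rewrite /flat => x0; rewrite ltNge x0. Qed.

Lemma sqdist_ge n (z0 z : 'rV[R]_n) : `|z - z0| ^+ 2 <= sqdist z0 z.
Proof.
have [->|N0] := eqVneq (`|z - z0|) 0.
 by rewrite expr0n/=; apply: sumr_ge0 => j _; rewrite sqr_ge0.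
have [[i j] ->] : exists ij : 'I_1 * 'I_n, `|z - z0| = `|(z - z0) ij.1 ij.2|.
 by apply: mx_norm_neq0.
rewrite /sqdist (bigD1 j)//= real_normK ?num_real// (ord1 i) !mxE lerDl.
by apply: sumr_ge0 => l _; rewrite sqr_ge0.
Qed.

Lemma sqdist_le n (z0 z : 'rV[R]_n) : sqdist z0 z <= n%:R * `|z - z0| ^+ 2.
Proof.
have : sqdist z0 z <= \sum_(j < n) `|z - z0| ^+ 2.
 apply: ler_sum => j _; rewrite -(real_normK (num_real _)) lerXn2r ?nnegrE//.
 by have := mx_entry_le (z - z0) 0 j; rewrite !mxE.
by rewrite sumr_const card_ord -[_ *+ n]mulr_natl.
Qed.

Lemma bump_smooth n (z0 : 'rV[R]_n) (r : R) : 0 < r -> smooth_on setT (bump z0 r).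
Proof.
move=> r0; have oT := @openT 'rV[R]_n.
have ss : smooth_on setT (sqdist z0).
 apply: smooth_sum => // j; rewrite /=.
 have sc : smooth_on setT (fun z : 'rV[R]_n => z 0 j - z0 0 j).
  by apply: smooth_add => //; [exact: smooth_coordR|exact: smooth_cst].
 exact: smooth_mulR.
have s1 : smooth_on setT (fun z => r ^+ 2 - sqdist z0 z).
 by apply: smooth_add => //; [exact: smooth_cst|exact: smooth_oppR].
have s2 : smooth_on setT (fun z => sqdist z0 z - r ^+ 2 / 4).
 by apply: smooth_add => //; exact: smooth_cst.
have f1 : smooth_on setT (fun z => flat 1 (r ^+ 2 - sqdist z0 z)) by move=> k; exact: flat_comp_Ck.
have f2 : smooth_on setT (fun z => flat 1 (sqdist z0 z - r ^+ 2 / 4)) by move=> k; exact: flat_comp_Ck.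
apply: smooth_mulR => //; apply: smooth_invR => //; last exact: smooth_add.
move=> y _; rewrite gt_eqF//.
have [h|h] := ltP (sqdist z0 y) (r ^+ 2).
 by rewrite ltr_pwDl ?flat1_ge0// flat1_gt0// subr_gt0.
rewrite ltr_wpDl ?flat1_ge0// flat1_gt0// subr_gt0.
apply: lt_le_trans h; rewrite ltr_pdivrMr// ltr_pMr ?exprn_gt0// ltr1n//.
Qed.

Lemma bump0 n (z0 : 'rV[R]_n) (r : R) (z : 'rV[R]_n) : 0 <= r -> r <= `|z - z0| -> bump z0 r z = 0.
Proof.
move=> r0 rz; rewrite /bump [flat 1 (r ^+ 2 - _)]flat1_eq0 ?mul0r// subr_le0.
by apply: le_trans (sqdist_ge _ _); rewrite lerXn2r ?nnegrE.
Qed.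

Lemma bump1 n (z0 : 'rV[R]_n) (r : R) : 0 < r -> exists2 d : R, 0 < d &
 forall z : 'rV[R]_n, `|z - z0| < d -> bump z0 r z = 1.
Proof.
(* n (r / (2 (n + 1)))^2 <= r^2/4, which absorbs the factor n between the Euclidean and the sup
   norm. *)
move=> r0; exists (r / (2 * n.+1%:R)); first by rewrite divr_gt0// mulr_gt0.
move=> z zd.
have s : sqdist z0 z <= r ^+ 2 / 4.
 apply: le_trans (sqdist_le _ _) _.
 have h : `|z - z0| ^+ 2 <= (r / (2 * n.+1%:R)) ^+ 2.
  by rewrite lerXn2r ?nnegrE ?divr_ge0 ?mulr_ge0 ?(ltW r0)// ltW.
 have n0 : 0 <= n%:R :> R by [].
 apply: (le_trans (ler_wpM2l n0 h)).
 have -> : (r / (2 * n.+1%:R)) ^+ 2 = r ^+ 2 / 4 / n.+1%:R ^+ 2.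
  have : n.+1%:R != 0 :> R by [].
  by move: (n.+1%:R) => N N0; field.
 rewrite mulrCA ler_piMr//; first by rewrite divr_ge0// exprn_ge0// ltW.
 by rewrite ler_pdivrMr ?exprn_gt0// mul1r -natrX ler_nat; lia.
rewrite /bump [flat 1 (_ - r ^+ 2 / 4)]flat1_eq0 ?addr0 ?subr_le0// divff// gt_eqF//.
apply: flat1_gt0; rewrite subr_gt0; apply: le_lt_trans s _.
by rewrite ltr_pdivrMr// ltr_pMr ?exprn_gt0// ltr1n.
Qed.

(** The bump has half the radius of a ball inside [Omega], so the product vanishes near every point
    outside of [Omega], where nothing is known about [f]. *)
Lemma cutoff n m l (f : 'rV[R]_n -> 'M[R]_(m, l)) (Omega : set 'rV[R]_n) (z0 : 'rV[R]_n) :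
 open Omega -> Omega z0 -> smooth_on Omega f ->
 exists (f' : 'rV[R]_n -> 'M[R]_(m, l)) (d r : R), [/\ smooth_on setT f', 0 < d, 0 < r,
  (forall z : 'rV[R]_n, `|z - z0| < d -> Omega z /\ f' z = f z) &
  (forall z : 'rV[R]_n, r <= `|z - z0| -> f' z = 0)].
Proof.
move=> oO Oz sf; have [e e0 He] := (open_rV _).1 oO _ Oz.
have r0 : 0 < e / 2 by rewrite divr_gt0.
have [d d0 Hd] := bump1 z0 r0.
have sb := bump_smooth z0 r0.
have oS : open [set z : 'rV[R]_n | e / 2 < `|z - z0|].
 apply/open_rV => z /= ez; exists (`|z - z0| - e / 2); first by rewrite subr_gt0.
 move=> z' /= z'z; have : `|z - z0| <= `|z' - z| + `|z' - z0|.
  by rewrite [`|z' - z|]distrC -[z - z0](subrKA z') ler_normD.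
 by lra.
exists (fun z => bump z0 (e / 2) z *: f z), (Num.min d e), (e / 2); split => //.
- apply: smooth_local => y _.
 have [ye|ye] := ltP (`|y - z0|) e.
  exists Omega; split => //; first exact: He.
  by apply: smooth_scale => //; apply: smooth_sub sb.
 exists [set z : 'rV[R]_n | e / 2 < `|z - z0|]; split.
 + exact: oS.
 + by apply: lt_le_trans ye; rewrite ltr_pdivrMr// ltr_pMr// ltr1n.
 + apply: (smooth_ext oS _ (smooth_cst oS 0)) => z /= ez.
  by rewrite bump0 ?scale0r// ltW.
- by rewrite lt_min d0.
- by move=> z; rewrite lt_min => /andP[zd ze]; rewrite Hd// scale1r; split => //; exact: He.
- by move=> z ez; rewrite bump0 ?scale0r// ltW.
Qed.

End Bump.

(** * Existence, uniqueness and confinement of flows *)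

Section FlowExist.
Variable R : realType.

Lemma lip_of_cutoff n m (f : 'rV[R]_n -> 'rV[R]_m) (z0 : 'rV[R]_n) (r : R) :
 smooth_on setT f -> (forall z : 'rV[R]_n, r <= `|z - z0| -> f z = 0) ->
 exists L : R, 0 <= L /\ forall z z' : 'rV[R]_n, `|f z' - f z| <= L * `|z' - z|.
Proof.
(* One unit beyond the support: if one point lies outside this ball and [f] is nonzero at the other,
   their distance is at least 1, and the sup bound [B] serves as a Lipschitz constant. *)
move=> sf f0; pose rho := `|z0| + `|r| + 1.
have [L [L0 HL]] := loc_lip rho sf.
have [B [B0 HB]] := bounded_on_ball rho (smoothT_cont sf).
have far (z : 'rV[R]_n) : rho < `|z| -> f z = 0.
 move=> h; apply: f0; have : `|z| <= `|z - z0| + `|z0| by rewrite -{1}(subrK z0 z) ler_normD.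
 by move: h; rewrite /rho; have := ler_norm r; lra.
have one (z z' : 'rV[R]_n) : rho < `|z'| -> `|f z| <= B * `|z' - z|.
 move=> h; have [hz|hz] := leP r (`|z - z0|); first by rewrite f0// normr0 mulr_ge0.
 have d1 : 1 <= `|z' - z|.
  have h1 : `|z'| <= `|z' - z| + `|z - z0| + `|z0|.
   have e1 : `|z'| <= `|z' - z| + `|z| by rewrite -{1}(subrK z z') ler_normD.
   have e2 : `|z| <= `|z - z0| + `|z0| by rewrite -{1}(subrK z0 z) ler_normD.
   by lra.
  by move: h h1; rewrite /rho; have := ler_norm r; lra.
 have [hz'|hz'] := leP `|z| rho; last by rewrite far// normr0 mulr_ge0.
 by apply: le_trans (HB z hz') _; rewrite ler_peMr.
exists (L + B); split; first by rewrite addr_ge0.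
move=> z z'; rewrite mulrDl.
have [h'|h'] := leP `|z'| rho; last first.
 by rewrite far// sub0r normrN; apply: le_trans (one z z' h') _; rewrite lerDr mulr_ge0.
have [h|h] := leP `|z| rho; first by apply: le_trans (HL z z' h h') _; rewrite lerDl mulr_ge0.
rewrite (far z)// subr0 distrC; apply: le_trans (one z' z h) _.
by rewrite lerDr mulr_ge0.
Qed.

Lemma flow_exists n (f : 'rV[R]_n -> 'rV[R]_n) (z0 : 'rV[R]_n) (r : R) :
 smooth_on setT f -> (forall z : 'rV[R]_n, r <= `|z - z0| -> f z = 0) ->
 exists x, flow_family f setT x.
Proof.
move=> sf f0; have [L [L0 HL]] := lip_of_cutoff sf f0.
have H (y : 'rV[R]_n) : exists c : R -> 'rV[R]_n, c 0 = y /\ forall t : R, is_derive t 1 c (f (c t)).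
 apply: (@picard R n (fun _ z => f z)).
  by move=> c cc t; apply: continuous_comp; [exact: cc | exact: smoothT_cont].
 by move=> T; exists L; split => // t x x' _; exact: HL.
have [x Hx] := choice H.
by exists (fun t y => x y t); split => //; exact: openT.
Qed.

(** Lebesgue number argument, carried out by induction along [0, T]. *)
Lemma curve_tube n (c : R -> 'rV[R]_n) (Omega : set 'rV[R]_n) (T : R) : 0 <= T ->
 (forall t : R, 0 <= t <= T -> {for t, continuous c}) ->
 open Omega -> (forall t : R, 0 <= t <= T -> Omega (c t)) ->
 exists2 e : R, 0 < e & forall (t : R) (z : 'rV[R]_n), 0 <= t <= T -> `|z - c t| < e -> Omega z.
Proof.
move=> T0 cc oO HO.
pose P (s : R) := exists2 e : R, 0 < e &
 forall (t : R) (z : 'rV[R]_n), 0 <= t <= s -> `|z - c t| < e -> Omega z.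
have loc (q : R) : 0 <= q <= T -> exists d e : R, [/\ 0 < d, 0 < e &
  forall (t : R) (z : 'rV[R]_n), `|t - q| < d -> `|z - c t| < e -> Omega z].
 move=> qT; have [e e0 He] := (open_rV _).1 oO _ (HO q qT).
 have e20 : 0 < e / 2 by rewrite divr_gt0.
 have /cont_R/(_ _ e20)[d d0 Hd] := cc q qT.
 exists d, (e / 2); split => // t z td ze; apply: He.
 have h1 := Hd t td.
 have : `|z - c q| <= `|z - c t| + `|c t - c q| by exact: ler_distD.
 by lra.
apply: (real_induction (P := P) T0).
 have [|d [e [d0 e0 H]]] := loc 0; first by rewrite lexx.
 exists e => // t z; rewrite -eq_le => /eqP <-; apply: H; by rewrite subrr normr0.
move=> q /loc[d [e [d0 e0 H]]]; exists d => // s s' sq qs [e' e'0 He'] qs' s'q s'T.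
exists (Num.min e e'); first by rewrite lt_min e0.
move=> t z /andP[t0 ts']; rewrite lt_min => /andP[ze ze'].
have [ts|st] := leP t s; first by apply: He' ze'; rewrite t0.
by apply: H ze; rewrite ltr_norml; apply/andP; split; lra.
Qed.

Lemma family_tube n (f : 'rV[R]_n -> 'rV[R]_n) O x (y0 : 'rV[R]_n) (W : set 'rV[R]_n) :
 flow_family f O x -> O y0 -> open W -> (forall t : R, 0 <= t <= 1 -> W (x t y0)) ->
 exists O', [/\ flow_family f O' x, O' y0 & forall y, O' y -> forall t : R, 0 <= t <= 1 -> W (x t y)].
Proof.
move=> fam Oy0 oW HW; have [sf oO Hx] := fam; have [_ dx] := Hx y0 Oy0.
have [|e e0 He] := curve_tube ler01 _ oW HW.
 by move=> t _; exact: is_derive_cont (dx t).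
have [d [K [d0 K0 Hd]]] := fam_cont fam Oy0 (@ler01 R).
exists [set y : 'rV[R]_n | `|y - y0| < Num.min d (e / K)]; split.
- split => //; last by move=> y /=; rewrite lt_min => /andP[/Hd[/Hx]].
 exact: open_nball.
- by rewrite /= subrr normr0 lt_min d0 divr_gt0.
- move=> y /=; rewrite lt_min => /andP[yd ye] t t01; apply: (He t) => //.
 have [_ /(_ t t01) /le_lt_trans] := Hd y yd; apply.
 by rewrite mulrC -ltr_pdivlMr.
Qed.

Lemma ode_unique n (f : 'rV[R]_n -> 'rV[R]_n) (c1 c2 : R -> 'rV[R]_n) (T : R) :
 smooth_on setT f ->
 (forall t : R, 0 <= t <= T -> is_derive t 1 c1 (f (c1 t))) ->
 (forall t : R, 0 <= t <= T -> is_derive t 1 c2 (f (c2 t))) ->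
 c1 0 = c2 0 -> forall t : R, 0 <= t <= T -> c1 t = c2 t.
Proof.
move=> sf d1 d2 c0 t tT; have T0 : 0 <= T by case/andP: tT; exact: le_trans.
have bd (c : R -> 'rV[R]_n) : (forall t : R, 0 <= t <= T -> is_derive t 1 c (f (c t))) ->
  exists B : R, forall t : R, 0 <= t <= T -> `|c t| <= B.
 move=> dc; have [|s _ Hs] := @EVT_max R (fun t => `|c t|) 0 T T0.
  apply/continuous_in_subspaceT => s /[!inE] /=; rewrite in_itv/= => sT.
  apply: continuous_comp; first exact: is_derive_cont (dc s sT).
  exact: norm_continuous.
 by exists `|c s| => u uT; apply: Hs; rewrite in_itv.
have [B1 H1] := bd _ d1; have [B2 H2] := bd _ d2.
have [L [L0 HL]] := loc_lip (`|B1| + `|B2|) sf.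
have [K [K0 HK]] := gronwall n T L0.
have := HK (fun t => c1 t - c2 t) (fun t => f (c1 t) - f (c2 t)) 0 T (lexx _) (lexx _) _ _ t tT.
rewrite c0 subrr normr0 addr0 mulr0 normr_le0 subr_eq0 => H; apply/eqP; apply: H.
 by move=> s sT; apply: is_deriveB; [exact: d1|exact: d2].
move=> s sT; rewrite addr0; apply: HL.
 by apply: le_trans (H2 s sT) _; apply: le_trans (ler_norm _) _; rewrite lerDr.
by apply: le_trans (H1 s sT) _; apply: le_trans (ler_norm _) _; rewrite lerDl.
Qed.

(** At a zero of the field the solution is constant, so solutions starting nearby stay up to time 1
    where the cut-off field coincides with [f]. It serves at the zero section of a spray and in the
    inverse function theorem. *)
Lemma near_equilibrium n (f : 'rV[R]_n -> 'rV[R]_n) (Omega : set 'rV[R]_n) (z0 : 'rV[R]_n) :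
 open Omega -> Omega z0 -> smooth_on Omega f -> f z0 = 0 ->
 exists f' O x W, [/\ flow_family f' O x, O z0, open W /\ W z0,
  (forall z, W z -> Omega z /\ f' z = f z) &
  forall y, O y -> forall t : R, 0 <= t <= 1 -> W (x t y)].
Proof.
move=> oO Oz sf fz.
have [f' [d [r [sf' d0 r0 ff f0]]]] := cutoff oO Oz sf.
have [x fam] := flow_exists sf' f0.
pose W := [set z : 'rV[R]_n | `|z - z0| < d].
have oW : open W by exact: open_nball.
have Wz : W z0 by rewrite /W /= subrr normr0.
have eqx (t : R) : 0 <= t <= 1 -> x t z0 = z0.
 have [_ _ /(_ z0 I)[x0 dx]] := fam.
 move=> t01; apply: (@ode_unique n f' (x^~ z0) (fun=> z0) 1 sf') => //.
 by move=> s _; rewrite (ff z0 Wz).2 fz; exact: is_derive_cst.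
have [|O' [fam' Oz' HO']] := family_tube fam I oW (y0 := z0).
 by move=> t /eqx ->.
by exists f', O', x, W.
Qed.

Lemma is_derive_jac n m (F : 'rV[R]_n -> 'rV[R]_m) (c : R -> 'rV[R]_n) (t : R) (v : 'rV[R]_n) :
 is_derive t 1 c v -> differentiable F (c t) ->
 is_derive t 1 (fun s => F (c s)) (v *m 'J F (c t)).
Proof.
move=> [dc ec] dF; have dc' : differentiable c t by exact/derivable1_diffP.
have dFc : differentiable (F \o c) t by exact: differentiable_comp.
split; first exact: diff_derivable.
rewrite -[LHS]/('D_1 (F \o c) t) deriveE// diff_comp//= -ec deriveE// -deriveEjacobian//.
by rewrite [in RHS]deriveE.
Qed.

Lemma der_line m n (v : 'M[R]_(m, n)) (t : R) : is_derive t 1 (fun s : R => s *: v) v.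
Proof.
apply/is_derive_rV => i j; have := @der_scal R (v i j) id t 1 _.
rewrite mulr1; have -> : (fun s : R => v i j * id s) = (fun s : R => (s *: v) i j).
 by apply/funext => s; rewrite mxE mulrC.
by apply.
Qed.

Lemma der0_const_mx m n (c : R -> 'M[R]_(m, n)) (a b : R) : a <= b ->
 (forall t : R, a <= t <= b -> is_derive t 1 c 0) -> c a = c b.
Proof.
move=> ab H; apply/matrixP => i j; apply: (@der0_const R (fun t => c t i j)) => // t tab.
by have /is_derive_rV/(_ i j) := H t tab; rewrite mxE.
Qed.

End FlowExist.

(** * The inverse function theorem *)

Section InverseFunction.
Variable R : realType.

(** Strict differentiability: one linear map works for all pairs of points near [z0], because each
    component of an increment is a derivative at a point of the segment. *)
Lemma smooth_strict n m (F : 'rV[R]_n -> 'rV[R]_m) (Omega : set 'rV[R]_n) (z0 : 'rV[R]_n) (e : R) :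
 open Omega -> Omega z0 -> smooth_on Omega F -> 0 < e ->
 exists2 d : R, 0 < d & forall z z' : 'rV[R]_n, `|z - z0| < d -> `|z' - z0| < d ->
  Omega z /\ `|F z' - F z - (z' - z) *m 'J F z0| <= e * `|z' - z|.
Proof.
move=> oO Oz sF e0; have [d1 d10 Hd1] := (open_rV _).1 oO _ Oz.
have sJ := smooth_jac oO sF.
have en0 : 0 < e / n.+1%:R by rewrite divr_gt0.
have /cont_rV/(_ _ en0)[d2 d20 Hd2] := smooth_cont sJ Oz.
exists (Num.min d1 d2); first by rewrite lt_min d10.
move=> z z'; rewrite !lt_min => /andP[zd1 zd2] /andP[z'd1 z'd2]; split; first exact: Hd1.
apply: mx_norm_le => [|i j]; first by rewrite mulr_ge0// ltW.
rewrite (ord1 i); set v := z' - z.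
have seg (c d : R) : 0 <= c <= 1 -> `|z - z0| < d -> `|z' - z0| < d -> `|z + c *: v - z0| < d.
 move=> /andP[c0 c1] h h'.
 have -> : z + c *: v - z0 = (1 - c) *: (z - z0) + c *: (z' - z0).
  by rewrite /v; apply/matrixP => a b; rewrite !mxE; ring.
 apply: le_lt_trans (ler_normD _ _) _; rewrite !normrZ (ger0_norm c0) ger0_norm ?subr_ge0//.
 have [->|cn0] := eqVneq c 0; first by rewrite subr0 mul1r mul0r addr0.
 have cp : 0 < c by rewrite lt_neqAle eq_sym cn0.
 have : c * `|z' - z0| < c * d by rewrite ltr_pM2l.
 have : (1 - c) * `|z - z0| <= (1 - c) * d by rewrite ler_wpM2l ?subr_ge0// ltW.
 by lra.
have sFj : smooth_on Omega (fun z => F z 0 j) by exact: smooth_entry.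
have [s s01|c [c01]] := @MVT_line R _ (fun z => F z 0 j) z v 1.
 by rewrite mulr1; apply: smooth_derivable sFj _; apply: Hd1; exact: seg.
rewrite scale1r mul1r mulr1 => E.
pose zc := z + c *: v.
have Ozc : Omega zc by apply: Hd1; exact: seg.
have EJ : (v *m 'J F zc) 0 j = 'D_v (fun z => F z 0 j) zc.
 have df := smooth_diff oO sF Ozc.
 rewrite -(deriveEjacobian v df) derive_mx ?mxE//; exact: diff_derivable.
have z'E : z' = z + v by rewrite /v addrC subrK.
rewrite [X in `|X|]mxE [X in `|X + _|]mxE [X in `|_ + X + _|]mxE [X in `|_ + X|]mxE z'E E -EJ.
have gen (M M' : 'M[R]_(n, m)) : (v *m M) 0 j - (v *m M') 0 j = (v *m (M - M')) 0 j.
 by rewrite mulmxBr [RHS]mxE [X in _ = _ + X]mxE.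
rewrite gen.
apply: le_trans (mx_entry_le _ _ _) _; apply: le_trans (mulmx_norm _ _) _.
rewrite mulrAC ler_wpM2r//.
have h : `|'J F zc - 'J F z0| <= e / n.+1%:R by apply/ltW/Hd2; exact: seg.
apply: (@le_trans _ _ (n%:R * (e / n.+1%:R))); first by rewrite ler_wpM2l.
rewrite mulrCA; apply: ler_piMr; first exact: ltW.
by rewrite ler_pdivrMr// mul1r ler_nat.
Qed.

Lemma open_preim n m (F : 'rV[R]_n -> 'rV[R]_m) (O : set 'rV[R]_n) (W : set 'rV[R]_m) :
 open O -> open W -> (forall z, O z -> {for z, continuous F}) -> open (O `&` F @^-1` W).
Proof.
move=> oO oW cF; apply/open_rV => z [Oz Wz].
have [d d0 Hd] := (open_rV _).1 oO _ Oz; have [e e0 He] := (open_rV _).1 oW _ Wz.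
have /cont_rV/(_ _ e0)[d' d'0 Hd'] := cF z Oz.
exists (Num.min d d'); first by rewrite lt_min d0.
by move=> z'; rewrite lt_min => /andP[/Hd ? /Hd' /He].
Qed.

Lemma open_unit n m (A : 'rV[R]_n -> 'M[R]_m) (O : set 'rV[R]_n) :
 open O -> smooth_on O A -> open [set z | O z /\ A z \in unitmx].
Proof.
move=> oO sA; have sd := smooth_det oO sA.
apply/open_rV => z [Oz uz]; have [d d0 Hd] := (open_rV _).1 oO _ Oz.
have e0 : 0 < `|\det (A z)| by rewrite normr_gt0 -unitfE -unitmxE.
have /cont_rV/(_ _ e0)[d' d'0 Hd'] := smooth_cont sd Oz.
exists (Num.min d d'); first by rewrite lt_min d0.
move=> z'; rewrite lt_min => /andP[/Hd ? /Hd' h]; split => //.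
rewrite unitmxE unitfE; apply/eqP => dz; move: h.
by rewrite dz sub0r normrN ltxx.
Qed.

(** The inverse comes from a flow: with w = y - F z0 held constant, the solution of z' = w (J F
    z)^-1 from z0 satisfies F(z(t)) = F z0 + t w, so z(1) is a preimage of y. Its smoothness in y is
    smooth dependence on initial values, and injectivity of [F] comes from strict
    differentiability. *)
Theorem inverse_function n (F : 'rV[R]_n -> 'rV[R]_n) (Omega : set 'rV[R]_n) (z0 : 'rV[R]_n) :
 open Omega -> Omega z0 -> smooth_on Omega F -> 'J F z0 \in unitmx ->
 exists (O O' : set 'rV[R]_n) (G : 'rV[R]_n -> 'rV[R]_n),
  [/\ [/\ open O, open O', O z0 & O `<=` Omega],
    (forall z, O z -> [/\ O' (F z), G (F z) = z & 'J F z \in unitmx]),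
    (forall y, O' y -> O (G y) /\ F (G y) = y) & smooth_on O' G].
Proof.
move=> oO Oz sF uJ.
(* [c] bounds the derivative from below: c |v| <= |v A|. An approximation error of c / 2 then leaves
   [F] injective. *)
pose A := 'J F z0; pose c := (n%:R * `|invmx A| + 1)^-1.
have c0 : 0 < c by rewrite invr_gt0 ltr_wpDl// mulr_ge0.
have lowA (v : 'rV[R]_n) : c * `|v| <= `|v *m A|.
 rewrite /c ler_pdivrMl ?ltr_wpDl ?mulr_ge0// mulrDl mul1r.
 have : `|v| <= n%:R * `|v *m A| * `|invmx A|.
  by rewrite -{1}[v](mulmxK uJ) mulmx_norm.
 by have := normr_ge0 (v *m A); rewrite mulrAC; lra.
have c20 : 0 < c / 2 by rewrite divr_gt0.
have [d1 d10 Hd1] := smooth_strict oO Oz sF c20.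
have sJ := smooth_jac oO sF.
have [d2 d20 Hd2] := (open_rV _).1 (open_unit oO sJ) z0 (conj Oz uJ).
pose B := [set z : 'rV[R]_n | `|z - z0| < Num.min d1 d2].
have oB : open B by exact: open_nball.
have Bz : B z0 by rewrite /B /= subrr normr0 lt_min d10.
have BO z : B z -> Omega z /\ 'J F z \in unitmx.
 by rewrite /B /= lt_min => /andP[_ /Hd2].
have inj z z' : B z -> B z' -> F z = F z' -> z = z'.
 rewrite /B /= !lt_min => /andP[h _] /andP[h' _] E.
 have [_] := Hd1 z z' h h'; rewrite -E subrr sub0r normrN => h1.
 have h2 := lowA (z' - z).
 have : `|z' - z| <= 0.
  rewrite leNgt; apply/negP => h3.
  by have := le_trans h2 h1; rewrite ler_pM2r//; lra.
 by rewrite normr_le0 subr_eq0 => /eqP.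
have sFB : smooth_on B F by apply: smooth_sub sF => z /BO[].
(* The pair (z, w) makes the parameter w part of the state; at w = 0 the field vanishes, so
   [near_equilibrium] applies. *)
pose g (u : 'rV[R]_(n + n)) : 'rV[R]_(n + n) := row_mx (rsubmx u *m invmx ('J F (lsubmx u))) 0.
have oB2 : open (lsubmx @^-1` B : set 'rV[R]_(n + n)) by exact: smooth_lsub.
have sg : smooth_on (lsubmx @^-1` B) g.
 apply: smooth_row_mx => //; last exact: smooth_cst.
 apply: smooth_mulmx => //; first by apply: smooth_rsubmx => //; exact: smooth_id.
 apply: (smooth_comp oB2 oB (f := fun u : 'rV[R]_(n + n) => lsubmx u) (g := fun z => invmx ('J F z))) => //.
  by apply: smooth_lsubmx => //; exact: smooth_id.
 apply: smooth_invmx; [exact: oB|by move=> z /BO[]|].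
 by apply: (smooth_sub _ sJ) => z /BO[].
pose u0 : 'rV[R]_(n + n) := row_mx z0 0.
have gu0 : g u0 = 0 by rewrite /g row_mxKr mul0mx row_mx0.
have Bu0 : (lsubmx @^-1` B) u0 by rewrite /= row_mxKl.
case: (near_equilibrium oB2 Bu0 sg gu0) => [f1 [Of [x [Wf [fam Ofu oWu fE HW]]]]].
have [sg1 oO1 Hx] := fam.
pose iota (y : 'rV[R]_n) : 'rV[R]_(n + n) := row_mx z0 (y - F z0).
have siota : smooth_on setT iota.
 apply: smooth_row_mx; [exact: openT|apply: smooth_cst; exact: openT|].
 by apply: smooth_add; [exact: openT|apply: smooth_id; exact: openT|apply: smooth_cst; exact: openT].
pose O' := iota @^-1` Of.
have oO' : open O'.
 have := @open_preim _ _ iota setT Of openT oO1; rewrite setTI; apply.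
 by move=> z _; exact: smoothT_cont siota z.
pose S y := lsubmx (x 1 (iota y)).
have HS y : O' y -> B (S y) /\ F (S y) = y.
 move=> Oy; have [x0 dx] := Hx _ Oy; have Wx := HW _ Oy.
 have B1 (t : R) : 0 <= t <= 1 -> B (lsubmx (x t (iota y))).
  by move=> /Wx /fE[].
 split; first by apply: B1; rewrite ler01 lexx.
 have dl (t : R) : is_derive t 1 (fun t => lsubmx (x t (iota y))) (lsubmx (f1 (x t (iota y)))).
  apply/is_derive_rV => i j; have /is_derive_rV/(_ i (lshift n j)) := dx t.
  rewrite mxE; congr (is_derive _ _ _ _); apply/funext => s; by rewrite mxE.
 have dr (t : R) : is_derive t 1 (fun t => rsubmx (x t (iota y))) (rsubmx (f1 (x t (iota y)))).
  apply/is_derive_rV => i j; have /is_derive_rV/(_ i (rshift n j)) := dx t.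
  rewrite mxE; congr (is_derive _ _ _ _); apply/funext => s; by rewrite mxE.
 have w_const (t : R) : 0 <= t <= 1 -> rsubmx (x t (iota y)) = y - F z0.
  move=> /andP[t0 t1].
  suff E : rsubmx (x 0 (iota y)) = rsubmx (x t (iota y)) by rewrite -E x0 row_mxKr.
  apply: (@der0_const_mx R 1 n (fun t => rsubmx (x t (iota y))) 0 t t0).
  move=> s /andP[s0 st]; have := dr s.
  rewrite (fE _ _).2 ?row_mxKr//; apply: Wx; rewrite s0; exact: le_trans st t1.
 pose h (t : R) := F (lsubmx (x t (iota y))) - t *: (y - F z0).
 have dh (t : R) : 0 <= t <= 1 -> is_derive t 1 h 0.
  move=> t01; have Bt := B1 t t01; have [Ot ut] := BO _ Bt.
  have d1' := is_derive_jac (dl t) (smooth_diff oO sF Ot).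
  have d2' : is_derive t 1 (fun t : R => t *: (y - F z0)) (y - F z0).
   exact: der_line.
  have := is_deriveB d1' d2'.
  rewrite (fE _ (Wx t t01)).2 row_mxKl mulmxKV// w_const// subrr.
  exact.
 have := der0_const_mx ler01 dh; rewrite /h scale0r subr0 scale1r x0 row_mxKl.
 by move=> E; rewrite -[LHS](subrK (y - F z0)) -/(S y) -E addrC subrK.
exists (B `&` F @^-1` O'), O', S; split.
- split => //; last by move=> z [/BO[]].
  by apply: open_preim => // z /(smooth_cont sFB).
 split => //; rewrite /O' /iota /= subrr; exact: Ofu.
- move=> z [Bz' Oz']; have [h1 h2] := HS _ Oz'.
 by split; [exact: Oz'|exact: inj|exact: (BO z Bz').2].
- by move=> y Oy; have [h1 h2] := HS y Oy; split => //; split => //=; rewrite /= h2.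
- apply: smooth_lsubmx => //.
 apply: (smooth_comp oO' oO1) => //; first by apply: smooth_sub siota.
 exact: fam_smooth fam (@ler01 R).
Unshelve. all: by end_near. Qed.

End InverseFunction.

(** * Flows near a curve *)

Section NearCurve.
Variable R : realType.

(** Vanishing near each point outside of [Omega], and not just at it, makes [phi] times a map smooth
    on [Omega] smooth everywhere. The last clause lets the resulting field be globally Lipschitz. *)
Definition cutoff_fun n (phi : 'rV[R]_n -> R) (Omega W : set 'rV[R]_n) : Prop :=
 [/\ smooth_on setT phi, open W, (forall z, W z -> Omega z /\ phi z = 1),
  (forall z, ~ Omega z -> exists2 d : R, 0 < d & forall z' : 'rV[R]_n, `|z' - z| < d -> phi z' = 0) &
  exists r : R, forall z : 'rV[R]_n, r <= `|z| -> phi z = 0].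

(** 1 - (1 - phi)(1 - psi) is 1 as soon as [phi] or [psi] is, and 0 where both are. *)
Lemma cutoff_union n (phi psi : 'rV[R]_n -> R) (Omega W W' : set 'rV[R]_n) :
 cutoff_fun phi Omega W -> cutoff_fun psi Omega W' ->
 cutoff_fun (fun z => 1 + (-1) * ((1 + (-1) * phi z) * (1 + (-1) * psi z))) Omega (W `|` W').
Proof.
move=> [s1 oW W1 O1 [r1 Hr1]] [s2 oW' W2 O2 [r2 Hr2]]; have oT := @openT 'rV[R]_n; split.
- apply: smooth_add => //; first exact: smooth_cst.
 apply: smooth_mulR => //; first exact: smooth_cst.
 by apply: smooth_mulR => //; apply: smooth_add; rewrite //; try exact: smooth_cst;
  apply: smooth_mulR => //; exact: smooth_cst.
- exact: openU.
- by move=> z [/W1|/W2] [? ->]; split => //; ring.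
- move=> z nO; have [d1 d10 H1] := O1 z nO; have [d2 d20 H2] := O2 z nO.
 exists (Num.min d1 d2); first by rewrite lt_min d10.
 by move=> z'; rewrite lt_min => /andP[/H1 -> /H2 ->]; ring.
- have h1 := ler_norm r1; have h2 := ler_norm r2; have h3 := normr_ge0 r1; have h4 := normr_ge0 r2.
 exists (`|r1| + `|r2|) => z zr; rewrite Hr1 ?Hr2; [ring|clear -zr h2 h3; lra|clear -zr h1 h4; lra].
Qed.

Lemma cutoff_fun_smooth n phi (Omega W : set 'rV[R]_n) m l (f : 'rV[R]_n -> 'M[R]_(m, l)) :
 cutoff_fun phi Omega W -> open Omega -> smooth_on Omega f ->
 smooth_on setT (fun z => phi z *: f z).
Proof.
move=> [sphi _ _ H _] oO sf; apply: smooth_local => y _.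
have [Oy|nOy] := pselect (Omega y).
 by exists Omega; split => //; apply: smooth_scale => //; apply: smooth_sub sphi.
have [d d0 Hd] := H y nOy.
have oB := @open_nball R n y d.
exists [set z : 'rV[R]_n | `|z - y| < d]; split => //=; first by rewrite subrr normr0.
apply: (smooth_ext oB _ (smooth_cst oB 0)) => z /= zd.
by rewrite Hd// scale0r.
Qed.

(** Bumps around points of the curve are merged by [cutoff_union]; induction along [0, T] takes the
    place of a finite subcover. *)
Lemma curve_cutoff n (c : R -> 'rV[R]_n) (Omega : set 'rV[R]_n) (T : R) : 0 <= T ->
 (forall t : R, 0 <= t <= T -> {for t, continuous c}) ->
 open Omega -> (forall t : R, 0 <= t <= T -> Omega (c t)) ->
 exists phi W, cutoff_fun phi Omega W /\ forall t : R, 0 <= t <= T -> W (c t).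
Proof.
move=> T0 cc oO HO.
have loc (q : R) : 0 <= q <= T -> exists phi W, cutoff_fun phi Omega W /\ W (c q).
 move=> qT; have [e e0 He] := (open_rV _).1 oO _ (HO q qT).
 have e20 : 0 < e / 2 by rewrite divr_gt0.
 have [d d0 Hd] := bump1 (c q) e20.
 pose W := [set z : 'rV[R]_n | `|z - c q| < Num.min d e].
 exists (bump (c q) (e / 2)), W; split; last by rewrite /W /= subrr normr0 lt_min d0.
 split.
 - exact: bump_smooth.
 - exact: open_nball.
 - by move=> z; rewrite /W /= lt_min => /andP[zd ze]; split; [exact: He|exact: Hd].
 - move=> z nO; have ze : e <= `|z - c q| by rewrite leNgt; apply/negP => /He.
  exists (e / 2) => // z' z'z; apply: bump0; first exact: ltW.
  by have := ler_distD z' z (c q); rewrite [`|z - z'|]distrC; lra.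
 - exists (`|c q| + e) => z zr; apply: bump0; first exact: ltW.
  have : `|z| <= `|z - c q| + `|c q| by rewrite -{1}(subrK (c q) z) ler_normD.
  by lra.
pose P (s : R) := exists phi W, cutoff_fun phi Omega W /\ forall t : R, 0 <= t <= s -> W (c t).
apply: (real_induction (P := P) T0).
 have [|phi [W [Hphi Wc]]] := loc 0; first by rewrite lexx.
 exists phi, W; split => // t /andP[t0 t1].
 by have -> : t = 0 by apply/eqP; rewrite eq_le t0 t1.
move=> q qT; have [phi [W [Hphi Wc]]] := loc q qT; have [_ oW _ _ _] := Hphi.
have [e e0 He] := (open_rV _).1 oW _ Wc.
have /cont_R/(_ _ e0)[d d0 Hd] := cc q qT.
exists d => // s s' sq qs [phi' [W' [Hphi' Wc']]] qs' s'q s'T.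
exists (fun z => 1 + (-1) * ((1 + (-1) * phi z) * (1 + (-1) * phi' z))), (W `|` W').
split; first exact: cutoff_union.
move=> t /andP[t0 ts']; have [ts|st] := leP t s; first by right; apply: Wc'; rewrite t0.
left; apply: He; apply: Hd; rewrite ltr_norml; apply/andP; split; lra.
Qed.

Lemma flow_near_curve n (f : 'rV[R]_n -> 'rV[R]_n) (c : R -> 'rV[R]_n) (Omega : set 'rV[R]_n) :
 open Omega -> smooth_on Omega f ->
 (forall t : R, 0 <= t <= 1 -> Omega (c t) /\ is_derive t 1 c (f (c t))) ->
 exists phi O x W, [/\ cutoff_fun phi Omega W, flow_family (fun z => phi z *: f z) O x, O (c 0) &
  forall y, O y -> forall t : R, 0 <= t <= 1 -> W (x t y)].
Proof.
move=> oO sf Hc.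
have [||phi [W [Hphi Wc]]] := @curve_cutoff n c Omega 1 ler01 _ oO.
- by move=> t /Hc[_]; exact: is_derive_cont.
- by move=> t /Hc[].
have [sphi oW W1 O1 [r Hr]] := Hphi.
pose f' z := phi z *: f z.
have sf' : smooth_on setT f' by exact: cutoff_fun_smooth Hphi oO sf.
have [|x fam] := @flow_exists R n f' 0 r sf'.
 by move=> z; rewrite subr0 => /Hr; rewrite /f' => ->; rewrite scale0r.
have eqx (t : R) : 0 <= t <= 1 -> x t (c 0) = c t.
 have [_ _ /(_ (c 0) I)[x0 dx]] := fam.
 apply: (@ode_unique R n f' (x^~ (c 0)) c 1 sf') => //.
 by move=> s s01; rewrite /f' (W1 _ (Wc s s01)).2 scale1r; exact: (Hc s s01).2.
have [|O' [fam' Oz' HO']] := family_tube fam I oW (y0 := c 0).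
 by move=> t t01; rewrite eqx//; exact: Wc.
by exists phi, O', x, W.
Qed.

Lemma der_shift (V : normedModType R) (f : R -> V) (t k : R) (d : V) :
 is_derive (t + k) 1 f d -> is_derive t 1 (fun s => f (s + k)) d.
Proof.
move=> [df ed].
have E : (fun h => h^-1 *: (f (h *: (1 : R) + t + k) - f (t + k))) =
  (fun h : R => h^-1 *: (f (h *: (1 : R) + (t + k)) - f (t + k))).
 by apply/funext => h; rewrite addrA.
by split; rewrite ?/derivable ?/derive /= E; [exact: df|exact: ed].
Qed.

(** One cut-off equal to 1 along both curves reduces the claim to a field defined everywhere. *)
Lemma ode_unique_open n (f : 'rV[R]_n -> 'rV[R]_n) (Omega : set 'rV[R]_n)
  (c1 c2 : R -> 'rV[R]_n) (T : R) : open Omega -> smooth_on Omega f ->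
 (forall t : R, 0 <= t <= T -> Omega (c1 t) /\ is_derive t 1 c1 (f (c1 t))) ->
 (forall t : R, 0 <= t <= T -> Omega (c2 t) /\ is_derive t 1 c2 (f (c2 t))) ->
 c1 0 = c2 0 -> forall t : R, 0 <= t <= T -> c1 t = c2 t.
Proof.
move=> oO sf H1 H2 c0 t tT; have T0 : 0 <= T by case/andP: tT; exact: le_trans.
have [||phi [W [Hphi Wc]]] := @curve_cutoff n c1 Omega T T0 _ oO.
- by move=> s /H1[_]; exact: is_derive_cont.
- by move=> s /H1[].
have [||psi [W' [Hpsi Wc']]] := @curve_cutoff n c2 Omega T T0 _ oO.
- by move=> s /H2[_]; exact: is_derive_cont.
- by move=> s /H2[].
pose chi z := 1 + (-1) * ((1 + (-1) * phi z) * (1 + (-1) * psi z)).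
have Hchi : cutoff_fun chi Omega (W `|` W') by exact: cutoff_union.
have [_ _ C1 _ _] := Hchi; have sf' := cutoff_fun_smooth Hchi oO sf.
apply: (ode_unique sf') c0 t tT => s sT /=.
 by rewrite (C1 _ (or_introl (Wc s sT))).2 scale1r; exact: (H1 s sT).2.
by rewrite (C1 _ (or_intror (Wc' s sT))).2 scale1r; exact: (H2 s sT).2.
Qed.

Lemma derive_near_ext n (V : normedModType R) (W : set 'rV[R]_n) (f g : 'rV[R]_n -> V) (y v : 'rV[R]_n) :
 open W -> W y -> (forall z, W z -> f z = g z) -> 'D_v f y = 'D_v g y.
Proof.
move=> oW Wy fg; apply: near_eq_derive.
by apply: filterS (open_nbhs_nbhs (conj oW Wy)) => z; exact: fg.
Qed.

Lemma jac_ext n m (W : set 'rV[R]_n) (F G : 'rV[R]_n -> 'rV[R]_m) (y : 'rV[R]_n) :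
 open W -> W y -> differentiable F y -> (forall z, W z -> F z = G z) -> 'J F y = 'J G y.
Proof.
move=> oW Wy dF fg; apply: near_jac => //.
by apply: filterS (open_nbhs_nbhs (conj oW Wy)) => z; exact: fg.
Qed.

Lemma deriveR_basis n (W : set 'rV[R]_n) (h : 'rV[R]_n -> R) (y v : 'rV[R]_n) :
 open W -> smooth_on W h -> W y -> 'D_v h y = \sum_j v 0 j * 'D_(E_ R j) h y.
Proof. by move=> oW sh Wy; rewrite derive_basis//; exact: smooth_diffR oW sh Wy. Qed.

Lemma is_derive_compR n (h : 'rV[R]_n -> R) (c : R -> 'rV[R]_n) (t : R) (v : 'rV[R]_n) :
 is_derive t 1 c v -> differentiable h (c t) -> is_derive t 1 (fun s => h (c s)) ('D_v h (c t)).
Proof.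
move=> [dc ec] dF; have dc' : differentiable c t by exact/derivable1_diffP.
have dFc : differentiable (h \o c) t by exact: differentiable_comp.
split; first exact: diff_derivable.
by rewrite -[LHS]/('D_1 (h \o c) t) deriveE// diff_comp//= -ec [in RHS]deriveE// deriveE.
Qed.

Lemma is_derive_sumR (I : Type) (r : seq I) (F : I -> R -> R) (t : R) (d : I -> R) :
 (forall i, is_derive t 1 (F i) (d i)) ->
 is_derive t 1 (fun s => \sum_(i <- r) F i s) (\sum_(i <- r) d i).
Proof.
move=> H; elim: r => [|i r IH].
 rewrite big_nil; have -> : (fun s => \sum_(i <- [::]) F i s) = cst 0 by apply/funext => s; rewrite big_nil.
 exact: is_derive_cst.
rewrite big_cons; have -> : (fun s => \sum_(j <- i :: r) F j s) = F i + (fun s => \sum_(j <- r) F j s).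
 by apply/funext => s; rewrite big_cons.
exact: is_deriveD.
Qed.

Lemma is_derive_mulR (F G : R -> R) (t a b : R) : is_derive t 1 F a -> is_derive t 1 G b ->
 is_derive t 1 (fun s => F s * G s) (a * G t + F t * b).
Proof.
move=> dF dG; have := is_deriveM dF dG; rewrite /GRing.scale/= addrC [G t * a]mulrC; exact.
Qed.

Lemma sum_sym n (v w : 'rV[R]_n) (a b : 'I_n -> R) (d : 'I_n -> 'I_n -> R) :
 (forall j, a j = \sum_i w 0 i * d i j) -> (forall j, b j = \sum_i v 0 i * d i j) ->
 (forall i j, d i j = d j i) -> \sum_j v 0 j * a j = \sum_j w 0 j * b j.
Proof.
move=> Ha Hb ds; under eq_bigr do rewrite Ha mulr_sumr.
under [RHS]eq_bigr do rewrite Hb mulr_sumr.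
rewrite exchange_big/=; apply: eq_bigr => i _; apply: eq_bigr => j _.
by rewrite ds mulrCA.
Qed.

Lemma second_sym n (h : 'rV[R]_n -> R) (W : set 'rV[R]_n) (x v w : 'rV[R]_n) :
 open W -> smooth_on W h -> W x ->
 \sum_j v 0 j * 'D_w ('D_(E_ R j) h) x = \sum_j w 0 j * 'D_v ('D_(E_ R j) h) x.
Proof.
move=> oW sh Wx.
have H (u : 'rV[R]_n) j : 'D_u ('D_(E_ R j) h) x = \sum_i u 0 i * 'D_(E_ R i) ('D_(E_ R j) h) x.
 exact: deriveR_basis oW (smooth_D _ sh) Wx.
exact: (sum_sym (H w) (H v) (fun i j => D_sym (E_ R j) (E_ R i) oW sh Wx)).
Qed.

(** Time derivative and variation commute: if Z is a variation of the solution x, the time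
    derivative of Z(h) is the variation of the derivative of h along [f]. The second derivatives of
    h occur on both sides and match by symmetry. *)
Lemma mixed_derivative n (f : 'rV[R]_n -> 'rV[R]_n) (h : 'rV[R]_n -> R) (W : set 'rV[R]_n)
  (x Z : R -> 'rV[R]_n) (t : R) : open W -> smooth_on W f -> smooth_on W h -> W (x t) ->
 is_derive t 1 x (f (x t)) -> is_derive t 1 Z (Z t *m 'J f (x t)) ->
 is_derive t 1 (fun s => \sum_j Z s 0 j * 'D_(E_ R j) h (x s))
  ('D_(Z t) (fun u => 'D_(f u) h u) (x t)).
Proof.
move=> oW sf sh Wx dx dZ.
have d1 j : is_derive t 1 (fun s => Z s 0 j * 'D_(E_ R j) h (x s))
  ((Z t *m 'J f (x t)) 0 j * 'D_(E_ R j) h (x t) + Z t 0 j * 'D_(f (x t)) ('D_(E_ R j) h) (x t)).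
 apply: is_derive_mulR; first by move/is_derive_rV: dZ; apply.
 apply: is_derive_compR => //; exact: (smooth_diffR oW (smooth_D _ sh) Wx).
have := is_derive_sumR (index_enum 'I_n) d1; congr (is_derive _ _ _ _).
have E : 'D_(Z t) (fun u => 'D_(f u) h u) (x t) =
  'D_(Z t) (fun u => \sum_j f u 0 j * 'D_(E_ R j) h u) (x t).
 by apply: (derive_near_ext _ oW Wx) => u Wu; exact: deriveR_basis oW sh Wu.
rewrite E.
have dj j : derivable (fun u => f u 0 j * 'D_(E_ R j) h u) (x t) (Z t).
 apply: derivableM; first exact: (smooth_derivable (smooth_entry oW 0 j sf) Wx).
 exact: (smooth_derivable (smooth_D _ sh) Wx).
have -> : 'D_(Z t) (fun u => \sum_j f u 0 j * 'D_(E_ R j) h u) (x t) =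
  \sum_j 'D_(Z t) (fun u => f u 0 j * 'D_(E_ R j) h u) (x t).
 have -> : (fun u => \sum_j f u 0 j * 'D_(E_ R j) h u) =
   \sum_j (fun u => f u 0 j * 'D_(E_ R j) h u) by apply/funext => u; rewrite fct_sumE.
 exact: derive_sum.
rewrite big_split/=.
have -> : \sum_j 'D_(Z t) (fun u => f u 0 j * 'D_(E_ R j) h u) (x t) =
  \sum_j (f (x t) 0 j * 'D_(Z t) ('D_(E_ R j) h) (x t)) +
  \sum_j ('D_(E_ R j) h (x t) * 'D_(Z t) (fun u => f u 0 j) (x t)).
 rewrite -big_split/=; apply: eq_bigr => j _; rewrite deriveM//.
  exact: (smooth_derivable (smooth_entry oW 0 j sf) Wx).
 exact: (smooth_derivable (smooth_D _ sh) Wx).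
rewrite [LHS]addrC; apply: f_equal2.
 exact: second_sym oW sh Wx.
apply: eq_bigr => j _; rewrite mulrC; congr (_ * _).
have df := smooth_diff oW sf Wx.
rewrite -(deriveEjacobian _ df) derive_mx ?mxE//; exact: diff_derivable.
Qed.

End NearCurve.

Section DerTools.
Variable R : realType.

Lemma is_derive_affine n (V : normedModType R) (F : 'rV[R]_n -> V) (y w : 'rV[R]_n) (d : V) :
 (forall h : R, F (h *: w + y) = F y + h *: d) -> is_derive y w F d.
Proof.
move=> HF.
have c : (fun h : R => h^-1 *: (F (h *: w + y) - F y)) @ 0^' --> d.
 apply: cvg_near_cst; near=> h; rewrite HF addrAC subrr add0r scalerA mulVf ?scale1r//.
 near: h; exact: nbhs_dnbhs_neq.
split; first by apply/cvg_ex; exists d.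
exact: cvg_lim c.
Unshelve. all: end_near. Qed.

Lemma derJ n m (W : set 'rV[R]_n) (F : 'rV[R]_n -> 'rV[R]_m) (y v : 'rV[R]_n) :
 open W -> smooth_on W F -> W y -> 'D_v F y = v *m 'J F y.
Proof. by move=> oW sF Wy; rewrite deriveEjacobian//; exact: smooth_diff oW sF Wy. Qed.

Lemma jac_entry n m (W : set 'rV[R]_n) (F : 'rV[R]_n -> 'rV[R]_m) (y : 'rV[R]_n) i j :
 open W -> smooth_on W F -> W y -> 'J F y i j = 'D_(E_ R i) (fun z => F z 0 j) y.
Proof.
move=> oW sF Wy; have <- : row i ('J F y) 0 j = 'J F y i j by rewrite mxE.
rewrite (jacE i (smooth_diff oW sF Wy)) derive_mx ?mxE//.
exact: smooth_derivable sF Wy.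
Qed.

Lemma derive_entry n m l (W : set 'rV[R]_n) (F : 'rV[R]_n -> 'M[R]_(m, l)) (y v : 'rV[R]_n) i j :
 smooth_on W F -> W y -> ('D_v F y) i j = 'D_v (fun z => F z i j) y.
Proof. by move=> sF Wy; rewrite derive_mx ?mxE//; exact: smooth_derivable sF Wy. Qed.

Lemma is_derive_mulmx m n p (F : R -> 'M[R]_(m, n)) (G : R -> 'M[R]_(n, p)) (t : R)
  (F' : 'M[R]_(m, n)) (G' : 'M[R]_(n, p)) : is_derive t 1 F F' -> is_derive t 1 G G' ->
 is_derive t 1 (fun s => F s *m G s) (F' *m G t + F t *m G').
Proof.
move=> /is_derive_rV dF /is_derive_rV dG; apply/is_derive_rV => i j.
have := is_derive_sumR (index_enum 'I_n) (fun k => is_derive_mulR (dF i k) (dG k j)).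
rewrite big_split !mxE.
by have -> : (fun s => (F s *m G s) i j) = (fun s => \sum_(k < n) F s i k * G s k j)
 by apply/funext => s; rewrite mxE.
Qed.

Lemma is_derive_tr m n (F : R -> 'M[R]_(m, n)) (t : R) (F' : 'M[R]_(m, n)) :
 is_derive t 1 F F' -> is_derive t 1 (fun s => (F s)^T) F'^T.
Proof.
move=> /is_derive_rV dF; apply/is_derive_rV => i j; rewrite mxE.
by have -> : (fun s => (F s)^T i j) = (fun s => F s j i) by apply/funext => s; rewrite mxE.
Qed.

Lemma is_derive_mulmxl m n p (F : 'M[R]_(m, n)) (G : R -> 'M[R]_(n, p)) (t : R) (G' : 'M[R]_(n, p)) :
 is_derive t 1 G G' -> is_derive t 1 (fun s => F *m G s) (F *m G').
Proof.
move=> dG; have := is_derive_mulmx (is_derive_cst F t 1) dG.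
by rewrite mul0mx add0r.
Qed.

(** The integral of [h] along solutions is adjoined as an extra coordinate of the flow, so that its
    smoothness in the initial value is inherited from [fam_smooth]. *)
Lemma quadrature_family n (f : 'rV[R]_n -> 'rV[R]_n) O x (h : 'rV[R]_n -> R) :
 flow_family f O x -> smooth_on setT h ->
 exists sg : R -> 'rV[R]_n -> R,
  (forall y, O y -> sg 0 y = 0 /\ forall t : R, is_derive t 1 (sg^~ y) (h (x t y))) /\
  flow_family (fun u : 'rV[R]_(n + 1) => row_mx (f (lsubmx u)) (h (lsubmx u))%:M)
   (lsubmx @^-1` O) (fun t u => row_mx (x t (lsubmx u)) (rsubmx u + (sg t (lsubmx u))%:M)).
Proof.
move=> fam sh; have [sf oO Hx] := fam.
have H (y : 'rV[R]_n) : exists sg : R -> R, O y -> sg 0 = 0 /\ forall t : R, is_derive t 1 sg (h (x t y)).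
 have [Oy|nO] := pselect (O y); last by exists (cst 0).
 have [_ dx] := Hx y Oy.
 have [|G HG] := @primitive_ex R (fun t => h (x t y)); last by exists G.
 move=> t; apply: continuous_comp; first exact: curve_continuous dx t.
 by apply: (smooth_cont sh).
have {H}[sg Hsg] := choice H.
exists (fun t y => sg y t); split; first by move=> y /Hsg.
have oT := @openT 'rV[R]_(n + 1); have oT' := @openT 'rV[R]_n.
have sl : smooth_on setT (fun u : 'rV[R]_(n + 1) => lsubmx u) by apply: smooth_lsubmx => //; exact: smooth_id.
split.
- apply: smooth_row_mx => //; first exact: (smooth_comp oT oT').
 apply/(smooth_mx _ oT) => i j; have := smooth_compR oT oT' (fun _ _ => I) sl sh.
 by apply: smooth_ext => // u _; rewrite mxE !ord1 eqxx mulr1n.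
- exact: smooth_lsub.
- move=> u Ou; have [x0 dx] := Hx _ Ou; have [s0 ds] := Hsg _ Ou; split.
  by rewrite x0 s0 raddf0 addr0 hsubmxK.
 move=> t; rewrite row_mxKl; apply: is_derive_row_mx => //.
 apply/is_derive_rV => i j; rewrite !ord1 mxE eqxx mulr1n.
 have := is_deriveD (is_derive_cst (rsubmx u 0 0) t 1) (ds t); rewrite add0r.
 suff -> : (fun s => (rsubmx u + (sg (lsubmx u) s)%:M : 'M[R]_1) 0 0) = cst (rsubmx u 0 0) + sg (lsubmx u) by [].
 by apply/funext => s; rewrite !mxE eqxx mulr1n.
Qed.

(** Differentiation under the integral: [tau] is the extra component of the linearised extended
    equation. *)
Lemma quadrature_derive n (f : 'rV[R]_n -> 'rV[R]_n) O x (h : 'rV[R]_n -> R) sg :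
 flow_family f O x -> smooth_on setT h ->
 (forall y, O y -> sg 0 y = 0 /\ forall t : R, is_derive t 1 (sg^~ y) (h (x t y))) ->
 flow_family (fun u : 'rV[R]_(n + 1) => row_mx (f (lsubmx u)) (h (lsubmx u))%:M)
   (lsubmx @^-1` O) (fun t u => row_mx (x t (lsubmx u)) (rsubmx u + (sg t (lsubmx u))%:M)) ->
 (forall t : R, 0 <= t -> smooth_on O (sg t)) /\
 forall y w, O y -> exists tau : R -> R, tau 0 = 0 /\ forall t : R, 0 <= t ->
  'D_w (sg t) y = tau t /\ is_derive t 1 tau ('D_('D_w (x t) y) h (x t y)).
Proof.
set fe := fun u => row_mx _ _; set xe := fun t u => row_mx _ _ => fam sh Hsg fame.
have [sf oO Hx] := fam; have [sfe oOe Hxe] := fame.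
have oT := @openT 'rV[R]_n.
pose i0 (y : 'rV[R]_n) : 'rV[R]_(n + 1) := row_mx y 0.
have si0 : smooth_on O i0 by apply: smooth_row_mx => //; [exact: smooth_id|exact: smooth_cst].
have Oi0 (y : 'rV[R]_n) : O y -> (lsubmx @^-1` O) (i0 y) by rewrite /= /i0 row_mxKl.
have sxe (t : R) : 0 <= t -> smooth_on O (fun y => xe t (i0 y)).
 by move=> t0; apply: (smooth_comp oO oOe Oi0 si0); exact: fam_smooth fame t0.
have sgE t y : sg t y = rsubmx (xe t (i0 y)) 0 0.
 by rewrite /xe /i0 !row_mxKl !row_mxKr !mxE add0r eqxx mulr1n.
have xE t y : x t y = lsubmx (xe t (i0 y)) by rewrite /xe /i0 !row_mxKl.
split=> [t t0|y w Oy].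
 apply: (smooth_ext oO (fun y _ => esym (sgE t y))).
 by apply: smooth_entry => //; apply: smooth_rsubmx => //; exact: sxe.
have [Ze [Z0 dZ]] := fam_variational (row_mx w 0) fame (Oi0 _ Oy).
have Dxe (t : R) : 0 <= t -> 'D_w (fun y => xe t (i0 y)) y = Ze t.
 move=> t0; have di0 : is_derive y w i0 (row_mx w 0).
  by apply: is_derive_affine => k; rewrite /i0 scale_row_mx add_row_mx scaler0 addr0 addrC.
 have dI := smooth_diff oO si0 Oy.
 have dX := smooth_diff oOe (fam_smooth fame t0) (Oi0 _ Oy).
 rewrite -[LHS]/('D_w (xe t \o i0) y) derive_comp//; case: di0 => _ ->.
 by have [_ ->] := fam_derive fame (Oi0 _ Oy) (conj Z0 dZ) t0.
exists (fun t => Ze t 0 (rshift n 0)); split; first by rewrite Z0 row_mxEr mxE.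
move=> t t0.
have ent j : Ze t 0 j = 'D_w (fun y => xe t (i0 y) 0 j) y.
 by rewrite -(derive_entry _ _ _ (sxe t t0) Oy) Dxe.
split.
 rewrite ent; have -> : sg t = (fun y => xe t (i0 y) 0 (rshift n 0)); last by [].
 by apply/funext => y'; rewrite sgE mxE.
have Dx : lsubmx (Ze t) = 'D_w (x t) y.
 apply/rowP => j; rewrite mxE ent (derive_entry _ _ _ (fam_smooth fam t0) Oy).
 by have -> : (fun y => xe t (i0 y) 0 (lshift 1 j)) = (fun y => x t y 0 j)
  by apply/funext => y'; rewrite [x t y']xE [RHS]mxE.
have := (is_derive_rV _ _ _).1 (dZ t) 0 (rshift n 0); set d := (X in is_derive _ _ _ X -> _).
suff -> : d = 'D_('D_w (x t) y) h (x t y) by [].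
rewrite /d -(derJ _ openT sfe I) (derive_entry _ _ _ sfe I).
have -> : (fun u : 'rV[R]_(n + 1) => fe u 0 (rshift n 0)) = h \o (fun u => lsubmx u).
 by apply/funext => u; rewrite /fe row_mxEr mxE eqxx mulr1n.
have sl : smooth_on setT (fun u : 'rV[R]_(n + 1) => lsubmx u).
 by apply: smooth_lsubmx; [exact: openT|apply: smooth_id; exact: openT].
rewrite derive_comp; last 2 first.
- exact: smooth_diff openT sl I.
- exact: smooth_diffR openT sh I.
have [_ ->] : is_derive (xe t (i0 y)) (Ze t) (fun u : 'rV[R]_(n + 1) => lsubmx u) (lsubmx (Ze t)).
 by apply: is_derive_affine => k; rewrite linearD linearZ addrC.
by rewrite -xE Dx.
Qed.

End DerTools.

(** * One-forms obtained by integration along families of paths *)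

Section Paths.
Variable R : realType.

Lemma near_curve n (x : R -> 'rV[R]_n) (W : set 'rV[R]_n) (t : R) (v : 'rV[R]_n) :
 open W -> W (x t) -> is_derive t 1 x v -> exists2 e : R, 0 < e & forall s : R, `|s - t| < e -> W (x s).
Proof.
move=> oW Wx dx; have [e e0 He] := (open_rV _).1 oW _ Wx.
have /cont_R/(_ _ e0)[d d0 Hd] := is_derive_cont dx.
by exists d => // s /Hd /He.
Qed.

Lemma open_preimS n m (U : set 'rV[R]_n) (V : set 'rV[R]_m) (F : 'rV[R]_n -> 'rV[R]_m) :
 open U -> open V -> smooth_on U F -> open (U `&` F @^-1` V).
Proof.
move=> oU oV sF; have := open_preim oU oV (fun z Uz => smooth_cont sF Uz).
by congr open; apply/seteqP; split => z [].
Qed.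

(** Matrix form of [mixed_derivative]. In its application K is the Jacobian of the flow in its
    parameters and [w] is the velocity of the projected curve. *)
Lemma mixed_jac N n l (f : 'rV[R]_n -> 'rV[R]_n) (q w : 'rV[R]_n -> 'rV[R]_l) (W : set 'rV[R]_n)
  (x : R -> 'rV[R]_n) (K : R -> 'M[R]_(N, n)) (t : R) : open W -> smooth_on W f ->
 smooth_on W q -> (forall u, W u -> w u = f u *m 'J q u) -> W (x t) ->
 is_derive t 1 x (f (x t)) -> is_derive t 1 K (K t *m 'J f (x t)) ->
 is_derive t 1 (fun s => K s *m 'J q (x s)) (K t *m 'J w (x t)).
Proof.
move=> oW sf sq Hw Wx dx dK; have [e e0 He] := near_curve oW Wx dx.
have sw : smooth_on W w.
 by apply: (smooth_ext oW (fun u Wu => esym (Hw u Wu))); apply: smooth_mulmx => //; exact: smooth_jac.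
apply/is_derive_rV => i j.
have sh : smooth_on W (fun u => q u 0 j) by exact: smooth_entry.
have dZ : is_derive t 1 (fun s => row i (K s)) (row i (K t) *m 'J f (x t)).
 rewrite -row_mul; apply/is_derive_rV => a b; rewrite mxE.
 have -> : (fun s => row i (K s) a b) = (fun s => K s i b) by apply/funext => s; rewrite mxE.
 by move/is_derive_rV: dK; apply.
have := mixed_derivative oW sf sh Wx dx dZ.
have -> : 'D_(row i (K t)) (fun u => 'D_(f u) (fun u0 => q u0 0 j) u) (x t) = (K t *m 'J w (x t)) i j.
 have <- : row i (K t *m 'J w (x t)) 0 j = (K t *m 'J w (x t)) i j by rewrite mxE.
 rewrite row_mul.
 rewrite -(derJ _ oW sw Wx) (derive_entry _ _ _ sw Wx).
 apply: (derive_near_ext _ oW Wx) => u Wu.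
 by rewrite Hw// -(derJ _ oW sq Wu) (derive_entry _ _ _ sq Wu).
apply: (der_ext e0) => s /He Ws; rewrite mxE; apply: eq_bigr => k _.
by rewrite mxE (jac_entry _ _ oW sq Ws).
Qed.

(** The matrix of the exterior derivative of the one-form [Th]. *)
Definition curl N (Th : 'rV[R]_N -> 'rV[R]_N) (z : 'rV[R]_N) : 'M[R]_N := 'J Th z - ('J Th z)^T.

Lemma derive_comp2 n m l (u : 'rV[R]_n -> 'rV[R]_m) (g : 'rV[R]_m -> 'rV[R]_l) (h : 'rV[R]_l -> R)
  (e z : 'rV[R]_n) :
 differentiable u z -> differentiable g (u z) -> differentiable h (g (u z)) ->
 'D_('D_('D_e u z) g (u z)) h (g (u z)) = 'D_e (fun z => h (g (u z))) z.
Proof.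
move=> du dg dh; have := derive_comp (f := g \o u) e (differentiable_comp du dg) dh.
by rewrite (derive_comp e du dg) => ->.
Qed.

Lemma trE m n (A : 'M[R]_(m, n)) i j : A^T i j = A j i. Proof. by rewrite mxE. Qed.

Lemma mulmx_trE m n p (A : 'M[R]_(m, n)) (B : 'M[R]_(p, n)) i j :
 (A *m B^T) i j = \sum_k A i k * B j k.
Proof. by rewrite mxE; apply: eq_bigr => k _; rewrite trE. Qed.

Lemma mulmx_trC m n p (A : 'M[R]_(m, n)) (B : 'M[R]_(p, n)) i j : (A *m B^T) i j = (B *m A^T) j i.
Proof. by rewrite !mulmx_trE; apply: eq_bigr => m' _; exact: mulrC. Qed.

Lemma curlE N (Th : 'rV[R]_N -> 'rV[R]_N) (z : 'rV[R]_N) i j :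
 curl Th z i j = 'J Th z i j - 'J Th z j i.
Proof. by rewrite /curl; set J := 'J Th z; rewrite !mxE. Qed.

(** For a flow with position [q] and covector part [a], [Th] is the one-form int_0^1 <a, dq> on the
    parameter space. [pf_int] and [pf_curl] express it and its exterior derivative by differential
    equations in t instead of integrals. [pf_tube] provides parameters whose whole paths stay in a
    given open set. *)
Record path_family N s n (f : 'rV[R]_s -> 'rV[R]_s) (a q : 'rV[R]_s -> 'rV[R]_n)
  (Om : set 'rV[R]_s) (iota : 'rV[R]_N -> 'rV[R]_s) (Z : set 'rV[R]_N)
  (X : R -> 'rV[R]_N -> 'rV[R]_s) (Th : 'rV[R]_N -> 'rV[R]_N) : Prop := PathFamily {
 pf_open : open Z;
 pf_flow : forall z, Z z -> X 0 z = iota z /\ forall t : R, 0 <= t <= 1 ->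
  Om (X t z) /\ is_derive t 1 (X^~ z) (f (X t z));
 pf_smooth : forall t : R, 0 <= t <= 1 -> smooth_on Z (X t);
 pf_tube : forall z0 (W : set 'rV[R]_s), Z z0 -> open W -> (forall t : R, 0 <= t <= 1 -> W (X t z0)) ->
  exists Z', [/\ open Z', Z' z0, Z' `<=` Z & forall z, Z' z -> forall t : R, 0 <= t <= 1 -> W (X t z)];
 pf_smooth1 : smooth_on Z Th;
 pf_var : forall z, Z z -> exists K : R -> 'M[R]_(N, s), forall t : R, 0 <= t <= 1 ->
  K t = 'J (X t) z /\ is_derive t 1 K (K t *m 'J f (X t z));
 pf_int : forall z, Z z -> exists g : R -> 'rV[R]_N, [/\ g 0 = 0, g 1 = Th z &
  forall t : R, 0 <= t <= 1 -> is_derive t 1 g (a (X t z) *m ('J (q \o X t) z)^T)];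
 pf_curl : forall z, Z z -> exists S : R -> 'M[R]_N, [/\ S 0 = 0, S 1 = curl Th z &
  forall t : R, 0 <= t <= 1 -> is_derive t 1 S
   ('J (a \o X t) z *m ('J (q \o X t) z)^T - 'J (q \o X t) z *m ('J (a \o X t) z)^T)] }.

(** Component j of the one-form is the quadrature of <a, dq(Z)> over the flow of the tangent field,
    started at [iota z] with tangent vector d_j iota. This makes it smooth, and its curl is found by
    differentiating the quadrature once more. *)
Theorem paths N s n (f : 'rV[R]_s -> 'rV[R]_s) (a q : 'rV[R]_s -> 'rV[R]_n) (Om : set 'rV[R]_s)
  (iota : 'rV[R]_N -> 'rV[R]_s) (Z0 : set 'rV[R]_N) (z0 : 'rV[R]_N) :
 open Om -> smooth_on Om f -> smooth_on Om a -> smooth_on Om q ->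
 open Z0 -> smooth_on Z0 iota -> Z0 z0 -> Om (iota z0) -> f (iota z0) = 0 ->
 exists Z X Th, path_family f a q Om iota Z X Th /\ Z z0 /\ Z `<=` Z0.
Proof.
move=> oO sf sa sq oZ0 si Zz Oz fz.
(* The quadrature asks for an integrand that is smooth everywhere, hence the cut-offs a' and q',
   equal to a and q near the stationary point. *)
have [a' [da [ra [sa' da0 _ aE _]]]] := cutoff oO Oz sa.
have [q' [dq [rq [sq' dq0 _ qE _]]]] := cutoff oO Oz sq.
pose Om' := [set u : 'rV[R]_s | `|u - iota z0| < Num.min da dq].
have Om'O u : Om' u -> [/\ Om u, a' u = a u & q' u = q u].
 by rewrite /Om' /= lt_min => /andP[/aE[? ?] /qE[? ?]].
have oO' : open Om' by exact: open_nball.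
have Oz' : Om' (iota z0) by rewrite /Om' /= subrr normr0 lt_min da0.
have sf' : smooth_on Om' f by apply: smooth_sub sf => u /Om'O[].
have [f' [VO [x [W [fam hOO [oW Wz] WE HW]]]]] := near_equilibrium oO' Oz' sf' fz.
have [sff oOO Hx] := fam.
pose Z := Z0 `&` iota @^-1` VO.
have oZ : open Z.
 exact: open_preimS oZ0 oOO si.
have ZZ0 : Z `<=` Z0 by move=> z [].
have siZ : smooth_on Z iota by exact: smooth_sub si.
have ZO z : Z z -> VO (iota z) by case.
pose X t z := x t (iota z).
have sX (t : R) : 0 <= t -> smooth_on Z (X t).
 by move=> t0; apply: (smooth_comp oZ oOO ZO siZ); exact: fam_smooth fam t0.
have XW z (t : R) : Z z -> 0 <= t <= 1 -> W (X t z) by move=> /ZO Oz1; exact: HW.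
have XOm z (t : R) : Z z -> 0 <= t <= 1 -> Om' (X t z) by move=> Hz /(XW _ _ Hz)/WE[].
have [Zt [Hvar famT]] := tangent_family fam.
have oT := @openT 'rV[R]_s; have oTT := @openT 'rV[R]_(s + s).
pose h (u : 'rV[R]_(s + s)) : R := (a' (lsubmx u) *m (rsubmx u *m 'J q' (lsubmx u))^T) 0 0.
have sl : smooth_on setT (fun u : 'rV[R]_(s + s) => lsubmx u) by apply: smooth_lsubmx => //; exact: smooth_id.
have sr : smooth_on setT (fun u : 'rV[R]_(s + s) => rsubmx u) by apply: smooth_rsubmx => //; exact: smooth_id.
have sh : smooth_on setT h.
 apply: smooth_entry => //; apply: smooth_mulmx => //; first exact: (smooth_comp oTT oT).
 apply: smooth_tr => //; apply: smooth_mulmx => //.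
 by apply: (smooth_comp oTT oT (fun _ _ => I) sl); exact: smooth_jac.
have [sg [Hsg fame]] := quadrature_family famT sh.
have [ssg Hder] := quadrature_derive famT sh Hsg fame.
have [_ oOT _] := famT.
pose u_ j z : 'rV[R]_(s + s) := row_mx (iota z) ('D_(E_ R j) iota z).
have su j : smooth_on Z (u_ j) by apply: smooth_row_mx => //; exact: smooth_D.
have Ou j z : Z z -> (lsubmx @^-1` VO) (u_ j z) by move=> /ZO; rewrite /= /u_ row_mxKl.
have DX (t : R) j z : 0 <= t -> Z z -> Zt t (iota z) ('D_(E_ R j) iota z) = 'D_(E_ R j) (X t) z.
 move=> t0 Hz; have [_ <-] := fam_derive fam (ZO _ Hz) (Hvar _ ('D_(E_ R j) iota z) (ZO _ Hz)) t0.
 have d1 := smooth_diff oZ siZ Hz.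
 have d2 := smooth_diff oOO (fam_smooth fam t0) (ZO _ Hz).
 exact: esym (derive_comp (E_ R j) d1 d2).
set XT := (fun t (u : 'rV[R]_(s + s)) => row_mx (x t (lsubmx u)) (Zt t (lsubmx u) (rsubmx u))) in famT Hsg fame Hder.
have XTu (t : R) j z : 0 <= t -> Z z -> XT t (u_ j z) = row_mx (X t z) ('D_(E_ R j) (X t) z).
 by move=> t0 Hz; rewrite /XT /u_ row_mxKl row_mxKr DX.
have DqX (t : R) z : 0 <= t <= 1 -> Z z -> 'J (q \o X t) z = 'J (X t) z *m 'J q' (X t z).
 move=> t01 Hz; have t0 : 0 <= t by case/andP: t01.
 have [Ob _ _] := Om'O _ (XOm _ _ Hz t01).
 have -> : 'J q' (X t z) = 'J q (X t z).
  by apply: (jac_ext oO' (XOm _ _ Hz t01) (smooth_diff oT sq' I)) => v /Om'O[].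
 rewrite jac_comp//; first exact: smooth_diff oZ (sX t t0) Hz.
 exact: smooth_diff oO sq Ob.
have sA (t : R) : 0 <= t <= 1 -> smooth_on Z (a \o X t).
 move=> t01; apply: (smooth_comp oZ oO _ (sX t _) sa); last by case/andP: t01.
 by move=> z Hz; have [] := Om'O _ (XOm _ _ Hz t01).
have sQ (t : R) : 0 <= t <= 1 -> smooth_on Z (q \o X t).
 move=> t01; apply: (smooth_comp oZ oO _ (sX t _) sq); last by case/andP: t01.
 by move=> z Hz; have [] := Om'O _ (XOm _ _ Hz t01).
have hXT (t : R) j z : 0 <= t <= 1 -> Z z ->
  h (XT t (u_ j z)) = (a (X t z) *m ('J (q \o X t) z)^T) 0 j.
 move=> t01 Hz; have t0 : 0 <= t by case/andP: t01.
 have [_ aE' _] := Om'O _ (XOm _ _ Hz t01).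
 rewrite XTu// /h row_mxKl row_mxKr (DqX _ _ t01 Hz) aE' (derJ _ oZ (sX t t0) Hz).
 rewrite -mulmxA {1}/E_ -rowE !mxE; apply: eq_bigr => k _.
 by rewrite !mxE.
pose Th z : 'rV[R]_N := \row_j sg 1 (u_ j z).
have sTh : smooth_on Z Th.
 apply/(smooth_mx _ oZ) => i j; apply: (@smooth_ext _ _ _ _ (fun z => sg 1 (u_ j z)) _ oZ) => [z _|].
  by rewrite mxE.
 by apply: (smooth_compR oZ oOT (Ou j) (su j)); exact: ssg.
exists Z, X, Th; split; last by split => //; split.
split => //.
- move=> z Hz; have [x0 dx] := Hx _ (ZO _ Hz); split => // t t01.
 have [? _ _] := Om'O _ (XOm _ _ Hz t01); split => //.
 by have [_ <-] := WE _ (XW _ _ Hz t01); exact: dx.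
- by move=> t /andP[t0 _]; exact: sX.
- move=> z1 W1 Hz1 oW1 HW1.
 have [VO' [fam' Oz1 HO']] := family_tube fam (ZO _ Hz1) oW1 HW1.
 exists (Z `&` iota @^-1` VO'); split => //.
 + by have [_ oO1 _] := fam'; exact: open_preimS oZ oO1 siZ.
 + by move=> z [Hz Oz2] t t01; exact: HO'.
- move=> z Hz.
 have H (j : 'I_N) := Hvar _ ('D_(E_ R j) iota z) (ZO _ Hz).
 exists (fun t => \matrix_(j, k) Zt t (iota z) ('D_(E_ R j) iota z) 0 k) => t t01.
 have t0 : 0 <= t by case/andP: t01.
 have eK : \matrix_(j, k) Zt t (iota z) ('D_(E_ R j) iota z) 0 k = 'J (X t) z.
  apply/matrixP => j k; rewrite mxE (DX _ _ _ t0 Hz) (derJ _ oZ (sX t t0) Hz).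
  by rewrite {1}/E_ -rowE mxE.
 split => //; apply/is_derive_rV => j k.
 have -> : (fun s0 => (\matrix_(j, k) Zt s0 (iota z) ('D_(E_ R j) iota z) 0 k) j k) =
  (fun s0 => Zt s0 (iota z) ('D_(E_ R j) iota z) 0 k) by apply/funext => s0; rewrite mxE.
 have := (is_derive_rV _ _ _).1 ((H j).2 t) 0 k; set d1 := (X in is_derive _ _ _ X -> _).
 suff -> : d1 = ((\matrix_(j, k) Zt t (iota z) ('D_(E_ R j) iota z) 0 k) *m 'J f (X t z)) j k by [].
 rewrite /d1; have -> : 'J f' (x t (iota z)) = 'J f (X t z).
  by apply: (jac_ext oW (XW _ _ Hz t01) (smooth_diff oT sff I)) => v /WE[].
 rewrite [LHS]mxE [RHS]mxE; apply: eq_bigr => l _; apply: f_equal2 => //.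
 by rewrite [RHS]mxE.
- move=> z Hz; exists (fun t => \row_j sg t (u_ j z)); split => //.
  by apply/rowP => j; rewrite !mxE (Hsg _ (Ou j _ Hz)).1.
 move=> t t01; apply/is_derive_rV => i j.
 have -> : (fun s0 => (\row_j0 sg s0 (u_ j0 z)) i j) = (fun s0 => sg s0 (u_ j z)).
  by apply/funext => s0; rewrite mxE.
 by rewrite ord1 -(hXT t j z t01 Hz); exact: (Hsg _ (Ou j _ Hz)).2.
- move=> z Hz.
 have H (ij : 'I_N * 'I_N) := Hder _ ('D_(E_ R ij.1) (u_ ij.2) z) (Ou ij.2 _ Hz).
 have [tau Htau] := choice H.
 exists (fun t => \matrix_(i, j) (tau (i, j) t - tau (j, i) t)); split.
 + by apply/matrixP => i j; rewrite !mxE !(Htau _).1 subrr.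
 + apply/matrixP => i j; rewrite mxE curlE.
  have E k l : tau (k, l) 1 = 'J Th z k l.
   rewrite (jac_entry _ _ oZ sTh Hz) -((Htau (k, l)).2 1 ler01).1 /=.
   have -> : (fun z => Th z 0 l) = sg 1 \o u_ l by apply/funext => z'; rewrite mxE.
   have e1 := smooth_diff oZ (su l) Hz.
   have e2 := smooth_diffR oOT (ssg 1 ler01) (Ou l _ Hz).
   exact: esym (derive_comp (E_ R k) e1 e2).
  by rewrite !E.
 + move=> t t01; have t0 : 0 <= t by case/andP: t01.
  apply/is_derive_rV => i j.
  have -> : (fun s0 => (\matrix_(i, j) (tau (i, j) s0 - tau (j, i) s0)) i j) = tau (i, j) - tau (j, i).
   by apply/funext => s0; rewrite mxE.
  have E k l : is_derive t 1 (tau (k, l)) ('D_(E_ R k) (fun z => (a (X t z) *m ('J (q \o X t) z)^T) 0 l) z).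
   have := ((Htau (k, l)).2 t t0).2 => /=; set d1 := (X in is_derive _ _ _ X -> _).
   suff -> : d1 = 'D_(E_ R k) (fun z => (a (X t z) *m ('J (q \o X t) z)^T) 0 l) z by [].
   rewrite /d1 -(derive_near_ext (f := fun z => h (XT t (u_ l z))) _ oZ Hz); last first.
    by move=> z' Hz'; exact: hXT.
   have dXT := smooth_diff oOT (fam_smooth famT t0) (Ou l _ Hz).
   have e1 := smooth_diff oZ (su l) Hz.
   have e2 := smooth_diffR oTT sh (I : setT (XT t (u_ l z))).
   have D := derive_comp2 (E_ R k) e1 dXT e2. exact D.
  have := is_deriveB (E i j) (E j i); set d1 := (X in is_derive _ _ _ X -> _).
  set d2 := (X in _ -> is_derive _ _ _ X); suff -> : d1 = d2 by [].
  (* Differentiating a_m d_l q_m produces (d_k a_m)(d_l q_m) and a term with d_k d_l q_m; the latter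
     is symmetric in k and l and drops out of the curl. *)
  have P k l : 'D_(E_ R k) (fun z => (a (X t z) *m ('J (q \o X t) z)^T) 0 l) z =
    ('J (a \o X t) z *m ('J (q \o X t) z)^T) k l +
    \sum_m a (X t z) 0 m * 'D_(E_ R k) ('D_(E_ R l) (fun z => q (X t z) 0 m)) z.
   have sAm m := smooth_entry oZ 0 m (sA t t01); have sQm m := smooth_entry oZ 0 m (sQ t t01).
   rewrite (derive_near_ext (g := fun z => \sum_m a (X t z) 0 m * 'D_(E_ R l) (fun z => q (X t z) 0 m) z) _ oZ Hz); last first.
    move=> z' Hz'; rewrite mxE; apply: eq_bigr => m _.
    by rewrite mxE (jac_entry _ _ oZ (sQ t t01) Hz').
   have -> : (fun z => \sum_m a (X t z) 0 m * 'D_(E_ R l) (fun z => q (X t z) 0 m) z) =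
    \sum_m (fun z => a (X t z) 0 m * 'D_(E_ R l) (fun z => q (X t z) 0 m) z).
    by apply/funext => z'; rewrite fct_sumE.
   rewrite derive_sum; last first.
    move=> m; apply: derivableM; first exact: smooth_derivable (sAm m) Hz.
    exact: smooth_derivable (smooth_D _ (sQm m)) Hz.
   rewrite mxE -big_split/=; apply: eq_bigr => m _; rewrite deriveM; last 2 first.
   - exact: smooth_derivable (sAm m) Hz.
   - exact: smooth_derivable (smooth_D _ (sQm m)) Hz.
   rewrite [LHS]addrC; apply: f_equal2; last by [].
   rewrite -[LHS]/(_ * _) [LHS]mulrC.
   have -> : ('J (q \o X t) z)^T m l = 'J (q \o X t) z l m by exact: trE.
   have e1 := jac_entry k m oZ (sA t t01) Hz; have e2 := jac_entry l m oZ (sQ t t01) Hz.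
   exact: (f_equal2 _ (esym e1) (esym e2)).
  rewrite /d1 /d2 (P i j) (P j i); have -> : ('J (a \o X t) z *m ('J (q \o X t) z)^T -
    'J (q \o X t) z *m ('J (a \o X t) z)^T) i j =
    ('J (a \o X t) z *m ('J (q \o X t) z)^T) i j - ('J (a \o X t) z *m ('J (q \o X t) z)^T) j i.
   rewrite mxE [X in _ + X]mxE; apply: f_equal2 => //; apply: f_equal.
   exact: mulmx_trC.
  rewrite opprD addrACA -[RHS]addr0; apply: f_equal2 => //.
  rewrite -sumrB big1// => m _.
  have -> := D_sym (E_ R j) (E_ R i) oZ (smooth_entry oZ 0 m (sQ t t01)) Hz.
  exact: subrr.
Qed.

End Paths.

(** * Variations of cotangent paths *)

Section Key.
Variable R : realType.

(** Extends coefficients given on [0, 1] continuously to all times, as the global existence theorem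
    for linear equations asks. *)
Definition clamp (t : R) : R := Num.max 0 (Num.min 1 t).

Lemma clamp01 (t : R) : 0 <= clamp t <= 1.
Proof. by rewrite /clamp le_max lexx ge_max ler01 ge_min lexx. Qed.

Lemma clampE (t : R) : 0 <= t <= 1 -> clamp t = t.
Proof. by move=> /andP[t0 t1]; rewrite /clamp (min_idPr t1) (max_idPr t0). Qed.

Lemma clamp_cont : continuous clamp.
Proof.
move=> t; apply: continuous_max; first exact: cst_continuous.
by apply: continuous_min; [exact: cst_continuous|exact: id].
Qed.

(** The inhomogeneous equation for b is the linear one for the pair (b, 1). *)
Lemma inhom_ode n (B : R -> 'M[R]_n) (c : R -> 'rV[R]_n) (b0 : 'rV[R]_n) :
 (forall t : R, 0 <= t <= 1 -> {for t, continuous B}) ->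
 (forall t : R, 0 <= t <= 1 -> {for t, continuous c}) ->
 exists b : R -> 'rV[R]_n, b 0 = b0 /\
  forall t : R, 0 <= t <= 1 -> is_derive t 1 b (b t *m B t + c t).
Proof.
move=> cB cc.
pose M (t : R) : 'M[R]_(n + 1) := block_mx (B (clamp t)) 0 (c (clamp t)) 0.
have cM : continuous M.
 move=> t; apply/continuous_mxP => i j.
 have cB' : {for t, continuous (B \o clamp)}.
  by apply: continuous_comp; [exact: clamp_cont|apply: cB; exact: clamp01].
 have cc' : {for t, continuous (c \o clamp)}.
  by apply: continuous_comp; [exact: clamp_cont|apply: cc; exact: clamp01].
 rewrite -(splitK i) -(splitK j).
 case: (fintype.split i) => i'; case: (fintype.split j) => j' /=.
 - have -> : (fun t => M t (lshift 1 i') (lshift 1 j')) = (fun t => (B \o clamp) t i' j').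
   by apply/funext => u; rewrite /M block_mxEul.
  by move/continuous_mxP: cB'; apply.
 - have -> : (fun t => M t (lshift 1 i') (rshift n j')) = cst 0.
   by apply/funext => u; rewrite /M block_mxEur mxE.
  exact: cst_continuous.
 - have -> : (fun t => M t (rshift n i') (lshift 1 j')) = (fun t => (c \o clamp) t i' j').
   by apply/funext => u; rewrite /M block_mxEdl.
  by move/continuous_mxP: cc'; apply.
 - have -> : (fun t => M t (rshift n i') (rshift n j')) = cst 0.
   by apply/funext => u; rewrite /M block_mxEdr mxE.
  exact: cst_continuous.
have [Z [Z0 dZ]] := linear_ode (row_mx b0 1%:M) cM.
have ZM (t : R) : Z t *m M t = row_mx (lsubmx (Z t) *m B (clamp t) + rsubmx (Z t) *m c (clamp t)) 0.
 by rewrite -{1}[Z t]hsubmxK /M mul_row_block !mulmx0 addr0.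
have dl (t : R) : is_derive t 1 (fun s => lsubmx (Z s)) (lsubmx (Z t) *m B (clamp t) + rsubmx (Z t) *m c (clamp t)).
 have := dZ t; rewrite ZM => /is_derive_rV H.
 apply/is_derive_rV => i j; have := H i (lshift 1 j); rewrite row_mxEl.
 by have -> : (fun s => lsubmx (Z s) i j) = (fun s => Z s i (lshift 1 j)) by apply/funext => s; rewrite mxE.
have dr (t : R) : is_derive t 1 (fun s => rsubmx (Z s)) 0.
 have := dZ t; rewrite ZM => /is_derive_rV H.
 apply/is_derive_rV => i j; have := H i (rshift n j); rewrite row_mxEr.
 by have -> : (fun s => rsubmx (Z s) i j) = (fun s => Z s i (rshift n j)) by apply/funext => s; rewrite mxE.
exists (fun t => lsubmx (Z t)); split; first by rewrite Z0 row_mxKl.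
move=> t t01; have /andP[t0 _] := t01.
have r1 : rsubmx (Z t) = 1%:M.
 by rewrite -(@der0_const_mx R _ _ (fun s => rsubmx (Z s)) 0 t t0) ?Z0 ?row_mxKr.
by have := dl t; rewrite r1 mul1mx (clampE t01).
Qed.

(** The matrix of v -> a (D_v Pi), that is, the derivative of a Pi in q with [a] held constant. A
    variation of q enters the linearised cotangent path equation through it. *)
Definition contr n (Pi : 'rV[R]_n -> 'M[R]_n) (a q : 'rV[R]_n) : 'M[R]_n :=
 \matrix_(l, k) (a *m 'D_(E_ R l) Pi q) 0 k.

(* The coordinate form of the Jacobi identity for an antisymmetric Pi. *)
Definition jacobi n (Om : set 'rV[R]_n) (Pi : 'rV[R]_n -> 'M[R]_n) : Prop :=
 forall q, Om q -> forall a : 'rV[R]_n,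
  Pi q *m contr Pi a q + (contr Pi a q)^T *m Pi q = 'D_(a *m Pi q) Pi q.

Lemma contr_mul n (Om : set 'rV[R]_n) (Pi : 'rV[R]_n -> 'M[R]_n) (a q v : 'rV[R]_n) :
 open Om -> smooth_on Om Pi -> Om q -> v *m contr Pi a q = a *m 'D_v Pi q.
Proof.
move=> oO sP Oq; apply/rowP => k.
rewrite (derive_basis _ (smooth_diff oO sP Oq)) mulmx_sumr summxE mxE.
by apply: eq_bigr => l _; rewrite -scalemxAr [RHS]mxE; apply: f_equal2; rewrite // mxE.
Qed.

Lemma linear_zero n (r : R -> 'rV[R]_n) (B : R -> 'M[R]_n) :
 (forall t : R, 0 <= t <= 1 -> {for t, continuous B}) ->
 (forall t : R, 0 <= t <= 1 -> is_derive t 1 r (r t *m B t)) ->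
 r 0 = 0 -> forall t : R, 0 <= t <= 1 -> r t = 0.
Proof.
move=> cB dr r0 t t01.
have cB' : continuous (B \o clamp).
 by move=> s; apply: continuous_comp; [exact: clamp_cont|apply: cB; exact: clamp01].
have [L [L0 HL]] : exists L : R, 0 < L /\ forall s : R, 0 <= s <= 1 -> `|B s| <= L.
 have cv : continuous (fun s => mxvec (B (clamp s))).
  move=> s; apply/continuous_mxP => i k; case/mxvec_indexP: k => k l.
  have -> : (fun s => mxvec (B (clamp s)) i (mxvec_index k l)) = (fun s => (B \o clamp) s k l).
   by apply/funext => u; rewrite ord1 mxvecE.
  by move/continuous_mxP: (cB' s); apply.
 have [C [C0 HC]] := bounded_on_seg 1 cv.
 exists (C + 1); split => [|s s01]; first by rewrite ltr_wpDl.
 apply: le_trans (_ : C <= _); last by rewrite lerDl.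
 apply: mx_norm_le => // i j; rewrite -(mxvecE (B s)).
 by apply: le_trans (mx_entry_le _ _ _) _; have /andP[s0 s1] := s01; have := HC s _; rewrite clampE//; apply; rewrite ger0_norm.
have [K [K0 HK]] := @gronwall R n (n%:R * L) 1 (mulr_ge0 (ler0n _ _) (ltW L0)).
have := HK r (fun t => r t *m B t) 0 1 (lexx 0) (lexx _) dr _ t t01.
rewrite r0 normr0 addr0 mulr0 normr_le0 => H; apply/eqP; apply: H.
move=> s s01; rewrite addr0; apply: le_trans (mulmx_norm _ _) _.
rewrite -mulrA -mulrA ler_wpM2l// mulrC ler_wpM2r//; exact: HL.
Qed.

Lemma contr_cont n (Om : set 'rV[R]_n) (Pi : 'rV[R]_n -> 'M[R]_n) (a q : R -> 'rV[R]_n) (t : R) :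
 open Om -> smooth_on Om Pi -> Om (q t) -> {for t, continuous a} -> {for t, continuous q} ->
 {for t, continuous (fun s => contr Pi (a s) (q s))}.
Proof.
move=> oO sP Oq ca cq; apply/continuous_mxP => l k.
have -> : (fun s => contr Pi (a s) (q s) l k) =
  (fun s => \sum_j a s 0 j * ('D_(E_ R l) Pi (q s)) j k).
 by apply/funext => s; rewrite mxE mxE.
apply: continuous_sumR => j; apply: continuousM.
 by move/continuous_mxP: ca; apply.
have c1 : {for q t, continuous ('D_(E_ R l) Pi)} by exact: smooth_cont (smooth_D _ sP) Oq.
have c2 : {for t, continuous ('D_(E_ R l) Pi \o q)} by exact: continuous_comp.
by move/continuous_mxP: c2; apply.
Qed.

Lemma mulmx_cont m n p (A : R -> 'M[R]_(m, n)) (B : R -> 'M[R]_(n, p)) (t : R) :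
 {for t, continuous A} -> {for t, continuous B} -> {for t, continuous (fun s => A s *m B s)}.
Proof.
move=> /continuous_mxP cA /continuous_mxP cB; apply/continuous_mxP => i j.
have -> : (fun s => (A s *m B s) i j) = (fun s => \sum_k A s i k * B s k j).
 by apply/funext => s; rewrite mxE.
by apply: continuous_sumR => k; apply: continuousM; [exact: cA|exact: cB].
Qed.

Lemma trmx_cont m n (A : R -> 'M[R]_(m, n)) (t : R) :
 {for t, continuous A} -> {for t, continuous (fun s => (A s)^T)}.
Proof.
move=> /continuous_mxP cA; apply/continuous_mxP => i j.
by have -> : (fun s => (A s)^T i j) = (fun s => A s j i) by apply/funext => s; rewrite mxE.
Qed.

Lemma opp_cont m n (A : R -> 'M[R]_(m, n)) (t : R) :
 {for t, continuous A} -> {for t, continuous (fun s => - A s)}.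
Proof. by move=> cA; apply: continuousN. Qed.

(* For a cotangent path (q, a) and variations U of q, a covector b with
   d U = b Pi at time 0 is transported by the linearised equation so that
   d U = b Pi persists; S integrates the symplectic pairing of the variations. *)
Lemma cotangent_path_key N n (Om : set 'rV[R]_n) (Pi : 'rV[R]_n -> 'M[R]_n)
  (q a : R -> 'rV[R]_n) (A U : R -> 'M[R]_(N, n)) (d : 'rV[R]_N) (b0 : 'rV[R]_n) :
 open Om -> smooth_on Om Pi -> (forall y, Om y -> (Pi y)^T = - Pi y) -> jacobi Om Pi ->
 (forall t : R, 0 <= t <= 1 -> Om (q t) /\ is_derive t 1 q (a t *m Pi (q t))) ->
 (forall t : R, 0 <= t <= 1 -> {for t, continuous a} /\ {for t, continuous A}) ->
 (forall t : R, 0 <= t <= 1 ->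
  is_derive t 1 U (A t *m Pi (q t) + U t *m contr Pi (a t) (q t))) ->
 d *m U 0 = b0 *m Pi (q 0) ->
 exists b1, d *m U 1 = b1 *m Pi (q 1) /\ forall S : R -> 'M[R]_N,
  (forall t : R, 0 <= t <= 1 -> is_derive t 1 S (A t *m (U t)^T - U t *m (A t)^T)) ->
  b1 *m (U 1)^T - b0 *m (U 0)^T = d *m (S 1 - S 0).
Proof.
move=> oO sP aP jP Hq Hc dU E0.
pose B t := contr Pi (a t) (q t).
have cq (t : R) : 0 <= t <= 1 -> {for t, continuous q} by move=> /Hq[_]; exact: is_derive_cont.
have cB (t : R) : 0 <= t <= 1 -> {for t, continuous B}.
 by move=> t01; apply: (contr_cont oO sP (Hq t t01).1 (Hc t t01).1 (cq t t01)).
(* The equation b' = - b B^T + d A is chosen so that, by the Jacobi identity, d U - b Pi solves a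
   homogeneous linear equation and stays 0. *)
have [||b [b00 db]] := @inhom_ode n (fun t => - (B t)^T) (fun t => d *m A t) b0.
- by move=> t t01; apply: opp_cont; apply: trmx_cont; exact: cB.
- by move=> t t01; apply: mulmx_cont; [exact: cst_continuous|exact: (Hc t t01).2].
have dPi (t : R) : 0 <= t <= 1 -> is_derive t 1 (fun s => Pi (q s)) ('D_(a t *m Pi (q t)) Pi (q t)).
 move=> t01; have [Ot dq] := Hq t t01.
 apply/is_derive_rV => i j; rewrite (derive_entry _ _ _ sP Ot).
 exact: (is_derive_compR (h := fun u => Pi u i j) dq (smooth_diffR oO (smooth_entry oO i j sP) Ot)).
pose r t := d *m U t - b t *m Pi (q t).
have dr (t : R) : 0 <= t <= 1 -> is_derive t 1 r (r t *m B t).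
 move=> t01; have [Ot dq] := Hq t t01.
 have d1 := is_derive_mulmxl d (dU t t01).
 have d2 := is_derive_mulmx (db t t01) (dPi t t01).
 have := is_deriveB d1 d2; set e := (X in is_derive _ _ _ X -> _); suff -> : e = r t *m B t by [].
 rewrite /e -(jP _ Ot) -/(B t) /r mulmxBl !mulmxDr !mulmxDl mulmxN mulNmx !mulmxA.
 by rewrite opprD opprD opprK [X in _ + X]addrC; apply/matrixP => i j; rewrite !mxE; ring.
have rz (t : R) : 0 <= t <= 1 -> d *m U t = b t *m Pi (q t).
 move=> t01; apply/eqP; rewrite -subr_eq0; apply/eqP.
 apply: (linear_zero cB dr _ t01); rewrite /r b00 E0; exact: subrr.
have h1 : 0 <= (1 : R) <= 1 by rewrite ler01 lexx.
exists (b 1); split; first exact: rz.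
move=> S dS.
(* Since d U = b Pi persists, the derivative of b U^T is d (A U^T - U A^T), which is the derivative
   of d S. *)
pose w t := b t *m (U t)^T - d *m S t.
have dw (t : R) : 0 <= t <= 1 -> is_derive t 1 w 0.
 move=> t01; have [Ot dq] := Hq t t01.
 have d1 := is_derive_mulmx (db t t01) (is_derive_tr (dU t t01)).
 have d2 := is_derive_mulmxl d (dS t t01).
 have := is_deriveB d1 d2; set e := (X in is_derive _ _ _ X -> _); suff -> : e = 0 by [].
 have tE : (A t *m Pi (q t) + U t *m contr Pi (a t) (q t))^T = (B t)^T *m (U t)^T - Pi (q t) *m (A t)^T.
  by rewrite raddfD/= !trmx_mul (aP _ Ot) mulNmx addrC.
 rewrite /e tE mulmxDl mulmxN mulNmx !mulmxBr !mulmxA -(rz t t01).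
 by apply/matrixP => i j; rewrite !mxE; ring.
have E := der0_const_mx ler01 dw.
have -> : b 1 *m (U 1)^T = w 1 + d *m S 1 by rewrite /w subrK.
rewrite -E /w b00 mulmxBr; by apply/matrixP => i j; rewrite !mxE; ring.
Qed.

End Key.

(** * Gauge transformations and Moser's flow *)

Section GaugeJacobi.
Variable R : realType.

Lemma derive_mulmx N m n p (W : set 'rV[R]_N) (F : 'rV[R]_N -> 'M[R]_(m, n)) (G : 'rV[R]_N -> 'M[R]_(n, p))
  (z v : 'rV[R]_N) : open W -> smooth_on W F -> smooth_on W G -> W z ->
 'D_v (fun y => F y *m G y) z = 'D_v F z *m G z + F z *m 'D_v G z.
Proof.
move=> oW sF sG Wz; apply/matrixP => i j.
rewrite (derive_entry _ _ _ (smooth_mulmx oW sF sG) Wz) mxE [X in X + _]mxE [X in _ + X]mxE -big_split/=.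
have dF k := smooth_derivable (v := v) (smooth_entry oW i k sF) Wz.
have dG k := smooth_derivable (v := v) (smooth_entry oW k j sG) Wz.
have -> : (fun y => (F y *m G y) i j) = \sum_k (fun y => F y i k * G y k j).
 by apply/funext => y; rewrite fct_sumE mxE.
rewrite derive_sum => [|k]; last exact: derivableM (dF k) (dG k).
apply: eq_bigr => k _; rewrite (deriveM (dF k) (dG k)) (derive_entry _ _ _ sF Wz) (derive_entry _ _ _ sG Wz).
by rewrite addrC; apply: f_equal2; rewrite // -[LHS]/(_ * _) mulrC.
Qed.

Lemma derive_tr N m n (W : set 'rV[R]_N) (F : 'rV[R]_N -> 'M[R]_(m, n)) (z v : 'rV[R]_N) :
 open W -> smooth_on W F -> W z -> 'D_v (fun y => (F y)^T) z = ('D_v F z)^T.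
Proof.
move=> oW sF Wz; apply/matrixP => i j; rewrite trE.
rewrite (derive_entry _ _ _ (smooth_tr oW sF) Wz) (derive_entry _ _ _ sF Wz).
by congr ('D_v _ z); apply/funext => y; rewrite trE.
Qed.

Lemma derive_lin N (V : normedModType R) (F : 'rV[R]_N -> V) (z v w : 'rV[R]_N) (k : R) :
 differentiable F z -> 'D_(k *: v + w) F z = k *: 'D_v F z + 'D_w F z.
Proof. by move=> dF; rewrite !deriveE// linearP. Qed.

Lemma smooth_curl N (W : set 'rV[R]_N) (eta : 'rV[R]_N -> 'rV[R]_N) :
 open W -> smooth_on W eta -> smooth_on W (curl eta).
Proof.
by move=> oW se; apply: smooth_sub_mx => //; [|apply: smooth_tr => //]; exact: smooth_jac.
Qed.

Lemma curl_antisym N (eta : 'rV[R]_N -> 'rV[R]_N) (z : 'rV[R]_N) : (curl eta z)^T = - curl eta z.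
Proof. by rewrite /curl raddfB/= trmxK opprB. Qed.

(** This is d (d eta) = 0 contracted with [v]: after expansion the second derivatives of eta cancel
    in pairs. *)
Lemma curl_closed N (W : set 'rV[R]_N) (eta : 'rV[R]_N -> 'rV[R]_N) (z v : 'rV[R]_N) :
 open W -> smooth_on W eta -> W z ->
 contr (curl eta) v z - (contr (curl eta) v z)^T = 'D_v (curl eta) z.
Proof.
move=> oW se Wz; have sc := smooth_curl oW se.
have DB l i j : ('D_(E_ R l) (curl eta) z) i j =
  'D_(E_ R l) ('D_(E_ R i) (fun y => eta y 0 j)) z - 'D_(E_ R l) ('D_(E_ R j) (fun y => eta y 0 i)) z.
 rewrite (derive_entry _ _ _ sc Wz).
 rewrite (derive_near_ext (g := 'D_(E_ R i) (fun y => eta y 0 j) - 'D_(E_ R j) (fun y => eta y 0 i)) _ oW Wz).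
  have h a b := smooth_derivable (v := E_ R l) (smooth_D (E_ R a) (smooth_entry oW 0 b se)) Wz.
  by rewrite deriveB//; exact: h.
 by move=> y Wy; rewrite curlE (jac_entry i j oW se Wy) (jac_entry j i oW se Wy).
have sy a b c : 'D_(E_ R a) ('D_(E_ R b) (fun y => eta y 0 c)) z = 'D_(E_ R b) ('D_(E_ R a) (fun y => eta y 0 c)) z.
 exact: D_sym (E_ R b) (E_ R a) oW (smooth_entry oW 0 c se) Wz.
apply/matrixP => l j.
have -> : (contr (curl eta) v z - (contr (curl eta) v z)^T) l j =
  \sum_i v 0 i * (('D_(E_ R l) (curl eta) z) i j - ('D_(E_ R j) (curl eta) z) i l).
 rewrite mxE [X in _ + X]mxE trE [X in X - _]mxE [X in _ - X]mxE [X in X - _]mxE [X in _ - X]mxE -sumrB.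
 by apply: eq_bigr => i _; rewrite mulrBr.
rewrite (derive_basis v (smooth_diff oW sc Wz)) summxE; apply: eq_bigr => i _.
have aux (a b c x1 x2 x3 y1 y2 y3 : R) : a = y1 - x3 -> b = y2 - y3 -> c = x1 - x2 ->
  x1 = y1 -> x2 = y2 -> x3 = y3 -> a - b = c by move=> -> -> -> -> -> ->; ring.
have E1 := aux _ _ _ _ _ _ _ _ _ (DB l i j) (DB j i l) (DB i l j) (sy i l j) (sy i j l) (sy l j i).
have -> : (v 0 i *: 'D_(E_ R i) (curl eta) z) l j = v 0 i * ('D_(E_ R i) (curl eta) z) l j by rewrite mxE.
by rewrite E1.
Qed.

Lemma derive_cstDZ N (V : normedModType R) (F : 'rV[R]_N -> V) (c : V) (k : R) (z v : 'rV[R]_N) :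
 derivable F z v -> 'D_v (fun y => c + k *: F y) z = k *: 'D_v F z.
Proof.
move=> dF; have dZ := is_deriveZ k (DeriveDef dF (erefl _)).
by have [_ ->] := is_deriveD (is_derive_cst c z v) dZ; rewrite add0r.
Qed.

Lemma gauge_alg1 N (DQ DB B q A g : 'M[R]_N) (t : R) : g = q *m A ->
 A^T = 1%:M - t *: (g *m B) ->
 (DQ - g *m (t *: (DB *m q + B *m DQ))) *m A = A^T *m DQ *m A - t *: (g *m DB *m g).
Proof.
move=> gE ->; rewrite {4}gE -scalemxAr mulmxDr scalerDr !mulmxBl mul1mx mulmxDl -!scalemxAl !mulmxA.
by apply/matrixP => i j; rewrite !mxE; ring.
Qed.

Lemma gauge_alg2 N (c C q A g : 'M[R]_N) (t : R) : g = q *m A -> A^T *m q = g -> g^T = - g ->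
 g *m (c *m A - t *: (C *m g)) + (c *m A - t *: (C *m g))^T *m g =
 A^T *m (q *m c + c^T *m q) *m A - t *: (g *m (C - C^T) *m g).
Proof.
move=> gE gE' gT.
have -> : (c *m A - t *: (C *m g))^T = A^T *m c^T - t *: (- g *m C^T).
 by rewrite [LHS]linearB/= [X in _ - X]linearZ/= !trmx_mul gT.
rewrite mulmxBr mulmxBl -scalemxAr -scalemxAl.
have -> : g *m (c *m A) = A^T *m (q *m c) *m A by rewrite -{1}gE' !mulmxA.
have -> : A^T *m c^T *m g = A^T *m (c^T *m q) *m A by rewrite {1}gE !mulmxA.
rewrite !mulmxBr !mulmxDr !mulmxDl !mulNmx !mulmxA.
by apply/matrixP => i j; rewrite !mxE; ring.
Qed.

Section Gauge.
Variables (N : nat) (W : set 'rV[R]_N) (Q : 'rV[R]_N -> 'M[R]_N) (eta : 'rV[R]_N -> 'rV[R]_N) (t : R).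
Hypotheses (oW : open W) (sQ : smooth_on W Q) (se : smooth_on W eta).
Hypothesis aQ : forall z, W z -> (Q z)^T = - Q z.
Hypothesis jQ : jacobi W Q.

(** [gauge] is the bivector whose graph arises from that of Q by adding s d eta: the covector c over
    the vector c Q is replaced by c + s (c Q) (curl eta). The graph is again that of a bivector
    where [gauge_den] is invertible. *)
Definition gauge_den (s : R) (z : 'rV[R]_N) : 'M[R]_N := 1%:M + s *: (curl eta z *m Q z).
Definition gauge (s : R) (z : 'rV[R]_N) : 'M[R]_N := Q z *m invmx (gauge_den s z).

Hypothesis uW : forall z, W z -> gauge_den t z \in unitmx.

Let sB := smooth_curl oW se.

Lemma gauge_inv z : W z -> invmx (gauge_den t z) = 1%:M - t *: (curl eta z *m gauge t z).
Proof.
move=> Wz; have := mulmxV (uW Wz); rewrite {1}/gauge_den mulmxDl mul1mx -scalemxAl -mulmxA.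
by move=> <-; rewrite addrK.
Qed.

Lemma gauge_tr z : W z -> (invmx (gauge_den t z))^T *m Q z = gauge t z.
Proof.
move=> Wz; set A := invmx _.
have aB := curl_antisym eta z; set B := curl eta z in aB *.
have E : (gauge_den t z)^T *m Q z = Q z *m gauge_den t z.
 rewrite /gauge_den -/B raddfD/= trmx1 linearZ/= trmx_mul aB (aQ Wz) mulmxDl mulmxDr mul1mx mulmx1.
 by rewrite -?scalemxAl -?scalemxAr mulNmx mulmxN opprK mulmxA.
have u := uW Wz; rewrite /A trmx_inv.
have u' : (gauge_den t z)^T \in unitmx by rewrite unitmx_tr.
by apply: (can_inj (mulKmx u')); rewrite mulKVmx// /gauge mulmxA E mulmxK.
Qed.

Lemma gauge_antisym z : W z -> (gauge t z)^T = - gauge t z.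
Proof. by move=> Wz; rewrite -{1}(gauge_tr Wz) trmx_mul trmxK (aQ Wz) mulNmx. Qed.

Lemma smooth_gauge_den : smooth_on W (gauge_den t).
Proof.
apply: smooth_add => //; first exact: smooth_cst.
by apply: smooth_scale => //; [exact: smooth_cst|exact: smooth_mulmx].
Qed.

Lemma smooth_gauge : smooth_on W (gauge t).
Proof. by apply: smooth_mulmx => //; apply: smooth_invmx => //; exact: smooth_gauge_den. Qed.

(** Obtained by differentiating the product of [gauge] and [gauge_den], which is Q. *)
Lemma derive_gauge z v : W z -> 'D_v (gauge t) z =
 (invmx (gauge_den t z))^T *m 'D_v Q z *m invmx (gauge_den t z)
 - t *: (gauge t z *m 'D_v (curl eta) z *m gauge t z).
Proof.
move=> Wz; set A := invmx _; have u := uW Wz.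
have E : 'D_v Q z = 'D_v (gauge t) z *m gauge_den t z + gauge t z *m 'D_v (gauge_den t) z.
 rewrite -(derive_mulmx _ oW smooth_gauge smooth_gauge_den Wz).
 by apply: (derive_near_ext _ oW Wz) => y Wy; rewrite /gauge mulmxKV//; exact: uW.
have D1 : 'D_v (gauge_den t) z = t *: ('D_v (curl eta) z *m Q z + curl eta z *m 'D_v Q z).
 rewrite -(derive_mulmx _ oW sB sQ Wz).
 exact: derive_cstDZ (smooth_derivable (v := v) (smooth_mulmx oW sB sQ) Wz).
have AT : A^T = 1%:M - t *: (gauge t z *m curl eta z).
 rewrite /A (gauge_inv Wz) raddfB/= trmx1 linearZ/= trmx_mul (gauge_antisym Wz) curl_antisym.
 by rewrite mulmxN mulNmx opprK.
have -> : 'D_v (gauge t) z = ('D_v Q z - gauge t z *m 'D_v (gauge_den t) z) *m A.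
 by rewrite E addrK mulmxK.
by rewrite D1; exact: (gauge_alg1 _ _ (erefl (gauge t z)) AT).
Qed.

Lemma contr_gauge z a : W z -> contr (gauge t) a z =
 contr Q (a *m (invmx (gauge_den t z))^T) z *m invmx (gauge_den t z)
 - t *: (contr (curl eta) (a *m gauge t z) z *m gauge t z).
Proof.
move=> Wz; apply/row_matrixP => l; rewrite rowE.
have sg := smooth_gauge.
rewrite (contr_mul _ _ oW sg Wz) (derive_gauge _ Wz) mulmxBr raddfB/= !linearZ/= !row_mul.
rewrite (rowE l (contr Q _ z)) (rowE l (contr (curl eta) _ z)).
by rewrite (contr_mul _ _ oW sQ Wz) (contr_mul _ _ oW sB Wz) !mulmxA.
Qed.

(** Closed forms preserve the Jacobi identity: by the derivative formulas the identity for [gauge]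
    is a conjugate of that for Q, corrected by a term that [curl_closed] accounts for. *)
Lemma gauge_jacobi : jacobi W (gauge t).
Proof.
move=> z Wz a; set A := invmx (gauge_den t z).
pose c := contr Q (a *m A^T) z; pose C := contr (curl eta) (a *m gauge t z) z.
rewrite (contr_gauge _ Wz) -/A -/c -/C (derive_gauge _ Wz) -/A.
have e1 := jQ Wz (a *m A^T); rewrite -mulmxA (gauge_tr Wz) -/c in e1.
have e2 := curl_closed (a *m gauge t z) oW se Wz; rewrite -/C in e2.
rewrite -e1 -e2; exact: (gauge_alg2 _ _ _ (erefl (gauge t z)) (gauge_tr Wz) (gauge_antisym Wz)).
Qed.

(** Moser's equation. Combined with d/dt gauge = - gauge (curl eta) gauge, it says that the
    time-dependent field V carries the family of bivectors along. *)
Lemma gauge_lie z : W z ->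
 let V := fun y => - (eta y *m gauge t y) in
 ('J V z)^T *m gauge t z + gauge t z *m 'J V z =
  'D_(V z) (gauge t) z - gauge t z *m curl eta z *m gauge t z.
Proof.
move=> Wz V; have sg := smooth_gauge.
have sV : smooth_on W V by apply: smooth_opp => //; exact: smooth_mulmx.
have JV : 'J V z = - ('J eta z *m gauge t z) - contr (gauge t) (eta z) z.
 apply/row_matrixP => l; rewrite (jacE l (smooth_diff oW sV Wz)).
 have dd := smooth_derivable (v := E_ R l) (smooth_mulmx oW se sg) Wz.
 rewrite deriveN// (derive_mulmx _ oW se sg Wz) raddfB/= raddfN/= row_mul.
 rewrite (jacE l (smooth_diff oW se Wz)) (rowE l (contr _ _ _)).
 by rewrite (contr_mul _ _ oW sg Wz) opprD.
have DV : 'D_(V z) (gauge t) z = - 'D_(eta z *m gauge t z) (gauge t) z.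
 have dg := smooth_diff oW sg Wz.
 by rewrite !deriveE// linearN.
rewrite JV DV -(gauge_jacobi Wz (eta z)) /curl; move: (gauge_antisym Wz).
move: (contr _ _ _) (gauge t z) ('J eta z) => c g J gT.
rewrite raddfB/= raddfN/= !trmx_mul gT.
rewrite !mulmxBr !mulmxBl !mulmxN !mulNmx !mulmxA !opprB !opprK.
by apply/matrixP => i j; rewrite !mxE; ring.
Qed.

End Gauge.
End GaugeJacobi.

(** * Moser's flow *)

Section Moser.
Variable R : realType.

Lemma pullback_alg N n (J X Dw : 'M[R]_(N, n)) (G Q cQ DQ : 'M[R]_N) (c : 'M[R]_n) :
 J *m X^T = 1%:M -> G^T = G -> Q^T = - Q -> J *m c = G *m Q *m J + cQ *m J + Dw ->
 J^T *m Q *m J *m c + c^T *m (J^T *m Q *m J) = Dw^T *m Q *m J + J^T *m DQ *m J + J^T *m Q *m Dw ->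
 Q *m cQ + cQ^T *m Q = DQ.
Proof.
move=> JX GT QT Jc E.
have cJ : c^T *m J^T = - (J^T *m Q *m G) + J^T *m cQ^T + Dw^T.
 by rewrite -trmx_mul Jc !raddfD/= !trmx_mul GT QT mulNmx mulmxN mulmxA.
have E2 : J^T *m (Q *m cQ + cQ^T *m Q) *m J = J^T *m DQ *m J.
 move: E; rewrite -[_ *m J *m c]mulmxA Jc !mulmxA cJ => /(congr1 (fun A => A - (Dw^T *m Q *m J + J^T *m Q *m Dw))).
 have -> : Dw^T *m Q *m J + J^T *m DQ *m J + J^T *m Q *m Dw - (Dw^T *m Q *m J + J^T *m Q *m Dw) = J^T *m DQ *m J.
  by apply/matrixP => i j; rewrite !mxE; ring.
 move=> <-; rewrite !mulmxDr !mulmxDl !mulNmx !mulmxA.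
 by apply/matrixP => i j; rewrite !mxE; ring.
have XJ : X *m J^T = 1%:M by rewrite -[X]trmxK -trmx_mul JX trmx1.
have := congr1 (fun A => X *m A *m X^T) E2.
by rewrite /= !mulmxA XJ !mul1mx -!(mulmxA _ J X^T) JX !mulmx1.
Qed.

(** [F] is an immersion carrying Q to Pi. Its second derivatives enter through the symmetric matrix
    G, which cancels in the Jacobi expression; injectivity of the Jacobian then removes the
    conjugation. *)
Lemma jacobi_pullback N n (W : set 'rV[R]_N) (Om : set 'rV[R]_n) (F : 'rV[R]_N -> 'rV[R]_n)
  (Q : 'rV[R]_N -> 'M[R]_N) (Pi : 'rV[R]_n -> 'M[R]_n) :
 open W -> open Om -> smooth_on W F -> smooth_on W Q -> smooth_on Om Pi -> (forall z, W z -> Om (F z)) ->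
 (forall z, W z -> (Q z)^T = - Q z) -> jacobi Om Pi ->
 (forall z, W z -> ('J F z)^T *m Q z *m 'J F z = Pi (F z)) ->
 (forall z, W z -> row_free ('J F z)) -> jacobi W Q.
Proof.
move=> oW oO sF sQ sP FW aQ jP HQ rf z Wz a.
have /row_freeP[X JX] := rf _ Wz.
have sJ := smooth_jac oW sF; have dF := smooth_diff oW sF Wz.
pose at_ := a *m X^T; pose w := a *m Q z.
have atJ : at_ *m ('J F z)^T = a by rewrite -mulmxA -trmx_mul JX trmx1 mulmx1.
pose DJ (v : 'rV[R]_N) := 'D_v (fun y => 'J F y) z.
have DJE v j p : DJ v j p = 'D_v ('D_(E_ R j) (fun y => F y 0 p)) z.
 rewrite /DJ (derive_entry v j p sJ Wz).
 by apply: (derive_near_ext _ oW Wz) => y Wy; exact: jac_entry j p oW sF Wy.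
have DJs j k p : DJ (E_ R j) k p = DJ (E_ R k) j p.
 have e1 := DJE (E_ R j) k p; have e2 := DJE (E_ R k) j p.
 exact: etrans e1 (etrans (D_sym (E_ R k) (E_ R j) oW (smooth_entry oW 0 p sF) Wz) (esym e2)).
pose G : 'M[R]_N := \matrix_(j, k) (at_ *m (DJ (E_ R j))^T) 0 k.
have GT : G^T = G.
 apply/matrixP => j k; rewrite trE [LHS]mxE [RHS]mxE [LHS]mulmx_trE [RHS]mulmx_trE.
 by apply: eq_bigr => p _; exact: f_equal2 erefl (DJs k j p).
have DPi v : 'D_(v *m 'J F z) Pi (F z) =
  (DJ v)^T *m Q z *m 'J F z + ('J F z)^T *m 'D_v Q z *m 'J F z + ('J F z)^T *m Q z *m DJ v.
 rewrite -(derJ _ oW sF Wz) -(derive_comp _ dF (smooth_diff oO sP (FW _ Wz))).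
 rewrite (derive_near_ext (g := fun y => ('J F y)^T *m Q y *m 'J F y) _ oW Wz); last first.
  by move=> y Wy; rewrite (HQ _ Wy).
 have sJT := smooth_tr oW sJ; have sJQ := smooth_mulmx oW sJT sQ.
 rewrite (derive_mulmx _ oW sJQ sJ Wz) (derive_mulmx _ oW sJT sQ Wz) (derive_tr _ oW sJ Wz).
 by rewrite mulmxDl.
have wJ : at_ *m Pi (F z) = w *m 'J F z by rewrite -(HQ _ Wz) !mulmxA atJ.
have E := jP _ (FW _ Wz) at_; rewrite wJ DPi -(HQ _ Wz) in E.
apply: (@pullback_alg N n ('J F z) X^T (DJ w) G (Q z) (contr Q a z) ('D_w Q z) _ _ GT (aQ _ Wz) _ E).
 by rewrite trmxK.
apply/row_matrixP => j; rewrite !rowE !mulmxDr !mulmxA.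
rewrite (contr_mul at_ _ oO sP (FW _ Wz)) DPi !mulmxDr !mulmxA atJ -/w.
rewrite (contr_mul a (delta_mx 0 j) oW sQ Wz).
have -> : delta_mx 0 j *m G = at_ *m (DJ (delta_mx 0 j))^T.
 by rewrite -rowE; apply/rowP => k; rewrite mxE [LHS]mxE.
have e3 : w *m DJ (delta_mx 0 j) = delta_mx 0 j *m DJ w :> 'rV_n.
 rewrite -rowE; apply/rowP => p; rewrite [RHS]mxE {2}/DJ.
 rewrite (derive_basis w (smooth_diff oW sJ Wz)) summxE [LHS]mxE.
 by apply: eq_bigr => k _; rewrite [RHS]mxE; exact: f_equal2 erefl (DJs j k p).
exact: (congr1 (fun r => _ + r) e3).
Qed.

Lemma is_derive_comp_mx N m n (W : set 'rV[R]_N) (F : 'rV[R]_N -> 'M[R]_(m, n)) (c : R -> 'rV[R]_N)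
  (t : R) (v : 'rV[R]_N) : open W -> smooth_on W F -> W (c t) -> is_derive t 1 c v ->
 is_derive t 1 (fun s => F (c s)) ('D_v F (c t)).
Proof.
move=> oW sF Wc dc; apply/is_derive_rV => i j; rewrite (derive_entry _ _ _ sF Wc).
exact: (is_derive_compR (h := fun u => F u i j) dc (smooth_diffR oW (smooth_entry oW i j sF) Wc)).
Qed.

Lemma matrix_ode n (B : R -> 'M[R]_n) : (forall t : R, 0 <= t <= 1 -> {for t, continuous B}) ->
 exists T : R -> 'M[R]_n, T 0 = 1%:M /\ forall t : R, 0 <= t <= 1 -> is_derive t 1 T (T t *m B t).
Proof.
move=> cB.
have H (i : 'I_n) := inhom_ode (delta_mx 0 i) cB (fun t _ => @cst_continuous _ _ (0 : 'rV[R]_n) t).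
have {H}[b Hb] := choice H.
exists (fun t => \matrix_(i, j) b i t 0 j); split.
 by apply/matrixP => i j; rewrite mxE (Hb i).1 !mxE eqxx eq_sym.
move=> t t01; apply/is_derive_rV => i j.
have := (is_derive_rV _ _ _).1 ((Hb i).2 t t01) 0 j; rewrite addr0.
have -> : (fun s => (\matrix_(i, j) b i s 0 j) i j) = (fun s => b i s 0 j) by apply/funext => s; rewrite mxE.
suff -> : (b i t *m B t) 0 j = (\matrix_(i, j) b i t 0 j *m B t) i j by [].
by rewrite !mxE; apply: eq_bigr => k _; rewrite mxE.
Qed.

Lemma fam_jac N n (f : 'rV[R]_n -> 'rV[R]_n) VO x (W : set 'rV[R]_N) (iota : 'rV[R]_N -> 'rV[R]_n)
  (z : 'rV[R]_N) : flow_family f VO x -> open W -> smooth_on W iota -> (forall z, W z -> VO (iota z)) ->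
 W z -> exists K : R -> 'M[R]_(N, n), forall t : R, 0 <= t ->
  K t = 'J (fun z => x t (iota z)) z /\ is_derive t 1 K (K t *m 'J f (x t (iota z))).
Proof.
move=> fam oW si HW Wz; have [_ oVO _] := fam.
have H (j : 'I_N) := fam_variational ('D_(E_ R j) iota z) fam (HW _ Wz).
have {H}[Zt Hvar] := choice H.
have sX (t : R) : 0 <= t -> smooth_on W (fun z => x t (iota z)).
 by move=> t0; apply: (smooth_comp oW oVO HW si); exact: fam_smooth fam t0.
have DX (t : R) j : 0 <= t -> Zt j t = 'D_(E_ R j) (fun z => x t (iota z)) z.
 move=> t0; have [_ <-] := fam_derive fam (HW _ Wz) (Hvar j) t0.
 have d1 := smooth_diff oW si Wz.
 have d2 := smooth_diff oVO (fam_smooth fam t0) (HW _ Wz).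
 exact: esym (derive_comp (E_ R j) d1 d2).
exists (fun t => \matrix_(j, k) Zt j t 0 k) => t t0; split.
 apply/row_matrixP => j; rewrite (jacE j (smooth_diff oW (sX t t0) Wz)) -DX//.
 by apply/rowP => k; rewrite !mxE.
apply/is_derive_rV => j k; have := (is_derive_rV _ _ _).1 ((Hvar j).2 t) 0 k.
have -> : (fun s => (\matrix_(j, k) Zt j s 0 k) j k) = (fun s => Zt j s 0 k) by apply/funext => s; rewrite mxE.
suff -> : (Zt j t *m 'J f (x t (iota z))) 0 k = (\matrix_(j, k) Zt j t 0 k *m 'J f (x t (iota z))) j k by [].
by rewrite [LHS]mxE [RHS]mxE; apply: eq_bigr => l _; apply: f_equal2 => //; rewrite [RHS]mxE.
Qed.

Section Flow.
Variables (N : nat) (Z : set 'rV[R]_N) (Q : 'rV[R]_N -> 'M[R]_N) (eta : 'rV[R]_N -> 'rV[R]_N).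

Definition moser_field (t : R) (z : 'rV[R]_N) : 'rV[R]_N := - (eta z *m gauge Q eta t z).

(** Invertibility of the denominator along the curve is part of the notion, since the field is
    meaningful only there. *)
Definition moser_curve (c : R -> 'rV[R]_N) : Prop := forall t : R, 0 <= t <= 1 ->
 [/\ Z (c t), gauge_den Q eta t (c t) \in unitmx & is_derive t 1 c (moser_field t (c t))].

Hypotheses (oZ : open Z) (sQ : smooth_on Z Q) (se : smooth_on Z eta).

(** Time becomes the first coordinate of u = (t, z), which makes Moser's field autonomous on the
    open set [Om] where the gauge transform exists. *)
Let tt (u : 'rV[R]_(1 + N)) : R := lsubmx u 0 0.
Let zz (u : 'rV[R]_(1 + N)) : 'rV[R]_N := rsubmx u.
Let den u := gauge_den Q eta (tt u) (zz u).
Let Qh u := gauge Q eta (tt u) (zz u).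
Let Om := [set u | (setT `&` zz @^-1` Z) u /\ den u \in unitmx].
Let f (u : 'rV[R]_(1 + N)) : 'rV[R]_(1 + N) := row_mx 1%:M (moser_field (tt u) (zz u)).

Let oT := @openT 'rV[R]_(1 + N).
Let szz : smooth_on setT zz.
Proof. by apply: smooth_rsubmx => //; exact: smooth_id. Qed.
Let stt : smooth_on setT tt.
Proof. by apply: smooth_entry => //; apply: smooth_lsubmx => //; exact: smooth_id. Qed.
Let oZZ : open (setT `&` zz @^-1` Z).
Proof. exact: open_preimS oT oZ szz. Qed.
Let sZ (m n : nat) (F : 'rV[R]_N -> 'M[R]_(m, n)) : smooth_on Z F ->
 smooth_on (setT `&` zz @^-1` Z) (fun u => F (zz u)).
Proof.
move=> sF; apply: (smooth_comp oZZ oZ _ _ sF); first by move=> u [].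
by apply: smooth_sub szz.
Qed.
Let sden : smooth_on (setT `&` zz @^-1` Z) den.
Proof.
apply: smooth_add => //; first exact: smooth_cst.
apply: smooth_scale => //; first by apply: smooth_sub stt.
by apply: smooth_mulmx => //; apply: sZ => //; exact: smooth_curl.
Qed.
Let oOm : open Om. Proof. exact: open_unit. Qed.
Let OmZ u : Om u -> (setT `&` zz @^-1` Z) u. Proof. by case. Qed.
Let sQh : smooth_on Om Qh.
Proof.
apply: smooth_mulmx => //; first by apply: smooth_sub (sZ sQ).
by apply: smooth_invmx => // [u [_]//|]; apply: smooth_sub sden.
Qed.
Let sf : smooth_on Om f.
Proof.
apply: smooth_row_mx => //; first exact: smooth_cst.
by apply: smooth_opp => //; apply: smooth_mulmx => //; apply: smooth_sub (sZ se).
Qed.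

Let tt_row (t : R) z : tt (row_mx t%:M z) = t.
Proof. by rewrite /tt row_mxKl mxE eqxx mulr1n. Qed.
Let zz_row (t : 'M[R]_1) z : zz (row_mx t z) = z.
Proof. by rewrite /zz row_mxKr. Qed.
Let row_tz u : u = row_mx (tt u)%:M (zz u).
Proof.
rewrite -[LHS]hsubmxK; congr row_mx; apply/matrixP => i j.
by rewrite !ord1 [RHS]mxE eqxx mulr1n.
Qed.

Let der_id (t : R) : is_derive t 1 (fun s : R => s%:M : 'M[R]_1) 1%:M.
Proof.
apply/is_derive_rV => i j; rewrite !ord1 mxE eqxx mulr1n.
have -> : (fun s : R => (s%:M : 'M[R]_1) 0 0) = id by apply/funext => s; rewrite mxE eqxx mulr1n.
exact: is_derive_id.
Qed.

Let lift_curve c (t : R) : moser_curve c -> 0 <= t <= 1 -> Om (row_mx t%:M (c t)) /\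
 is_derive t 1 (fun s : R => row_mx s%:M (c s)) (f (row_mx t%:M (c t))).
Proof.
move=> mc t01; have [Zc u dc] := mc t t01; split.
 by rewrite /Om /= /den tt_row zz_row.
rewrite /f tt_row zz_row; exact: is_derive_row_mx.
Qed.

Lemma moser_unique c1 c2 : moser_curve c1 -> moser_curve c2 -> c1 0 = c2 0 ->
 forall t : R, 0 <= t <= 1 -> c1 t = c2 t.
Proof.
move=> m1 m2 c12 t t01.
have := ode_unique_open oOm sf (fun t => @lift_curve c1 t m1) (fun t => @lift_curve c2 t m2).
by rewrite c12 => /(_ erefl t t01) /eq_row_mx[].
Qed.

Lemma moser_curve_cst z : Z z -> eta z = 0 -> curl eta z = 0 -> moser_curve (fun=> z).
Proof.
move=> Zz e0 B0 t t01; split => //.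
 by rewrite /gauge_den B0 mul0mx scaler0 addr0 unitmx1.
rewrite /moser_field e0 mul0mx oppr0; exact: is_derive_cst.
Qed.

Hypothesis aQ : forall z, Z z -> (Q z)^T = - Q z.
Hypothesis jQ : jacobi Z Q.

Let fixed_time u : Om u -> exists W, [/\ open W, W (zz u), (forall z, W z -> Z z),
 (forall z, W z -> gauge_den Q eta (tt u) z \in unitmx) & forall z, W z -> Om (row_mx (tt u)%:M z)].
Proof.
move=> Ou; pose W := [set z | Z z /\ gauge_den Q eta (tt u) z \in unitmx].
exists W; split => //.
- apply: open_unit => //; exact: smooth_gauge_den.
- by case: Ou => [[_ ?] ?].
- by move=> z [].
- by move=> z [].
- by move=> z [Zz uz]; rewrite /Om /= /den tt_row zz_row.
Qed.

(** The derivative along f = (1, V) splits into the spatial part and the time derivative of the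
    gauge transform; the latter is found by differentiating gauge times denominator = Q in t. *)
Let DQh u : Om u -> 'D_(f u) Qh u =
 'D_(moser_field (tt u) (zz u)) (gauge Q eta (tt u)) (zz u) - Qh u *m curl eta (zz u) *m Qh u.
Proof.
move=> Ou; have dQh := smooth_diff oOm sQh Ou.
have [Wt [oW Wz WZ Wu WO]] := fixed_time Ou.
have -> : f u = 1 *: row_mx 1%:M 0 + row_mx 0 (moser_field (tt u) (zz u)).
 by rewrite scale1r add_row_mx addr0 add0r.
rewrite (derive_lin (row_mx 1%:M 0) _ 1 dQh) scale1r [LHS]addrC; apply: f_equal2.
 have E : gauge Q eta (tt u) = Qh \o (fun z => row_mx (tt u)%:M z).
  by apply/funext => z; rewrite /= /Qh tt_row zz_row.
 have [] : is_derive (zz u) (moser_field (tt u) (zz u)) (fun z : 'rV[R]_N => row_mx (tt u)%:M z : 'rV[R]_(1 + N))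
   (row_mx 0 (moser_field (tt u) (zz u))).
  by apply: is_derive_affine => h; rewrite scale_row_mx add_row_mx scaler0 addr0 addrC.
 move=> _ dr; rewrite E derive_comp ?dr -?row_tz//.
 have sr : smooth_on Wt (fun z : 'rV[R]_N => row_mx (tt u)%:M z : 'rV[R]_(1 + N)).
  by apply: smooth_row_mx => //; [exact: smooth_cst|exact: smooth_id].
 exact: smooth_diff oW sr Wz.
set v : 'rV[R]_(1 + N) := row_mx 1%:M 0.
have affs h : zz (h *: v + u) = zz u /\ tt (h *: v + u) = tt u + h.
 rewrite /zz /tt /v scale_row_mx {1 3}(row_tz u) add_row_mx row_mxKr row_mxKl scaler0 add0r; split => //.
 rewrite -/(tt u); move: (tt u) => r; by rewrite !mxE eqxx !mulr1n mulr1 addrC.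
have D1 : 'D_v den u = curl eta (zz u) *m Q (zz u).
 have [] // : is_derive u v den (curl eta (zz u) *m Q (zz u)).
 apply: is_derive_affine => h; have [e1 e2] := affs h.
 by rewrite /den /gauge_den e1 e2 scalerDl addrA.
have D2 : 'D_v (fun u => Q (zz u)) u = 0.
 have [] // : is_derive u v (fun u => Q (zz u)) 0.
 by apply: is_derive_affine => h; have [-> _] := affs h; rewrite scaler0 addr0.
have sd : smooth_on Om den by apply: smooth_sub sden.
have := derive_mulmx v oOm sQh sd Ou.
rewrite (derive_near_ext (g := fun u => Q (zz u)) _ oOm Ou); last first.
 by move=> y [_ uy]; rewrite /Qh /gauge mulmxKV.
rewrite D2 D1 => /eqP; rewrite eq_sym addr_eq0 => /eqP /(congr1 (fun A => A *m invmx (den u))).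
case: (Ou) => _ uu; rewrite /= mulmxK// mulNmx => ->.
by rewrite {3}/Qh /gauge !mulmxA.
Qed.

Let JV u : Om u -> drsubmx ('J f u) = 'J (moser_field (tt u)) (zz u).
Proof.
move=> Ou; have [Wt [oW Wz WZ Wu WO]] := fixed_time Ou.
have sV : smooth_on Wt (moser_field (tt u)).
 apply: smooth_opp => //; apply: smooth_mulmx => //; first by apply: smooth_sub se.
 by apply: smooth_gauge => //; [apply: smooth_sub sQ|apply: smooth_sub se].
have sr : smooth_on Wt (fun z : 'rV[R]_N => row_mx (tt u)%:M z : 'rV[R]_(1 + N)).
 by apply: smooth_row_mx => //; [exact: smooth_cst|exact: smooth_id].
have dr := smooth_diff oW sr Wz.
have df := smooth_diff oOm sf Ou; rewrite (row_tz u) in df.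
have srow : 'J (fun z : 'rV[R]_N => row_mx (tt u)%:M z : 'rV[R]_(1 + N)) (zz u) = row_mx 0 1%:M.
 apply/row_matrixP => j; rewrite (jacE j dr).
 have [_ ->] : is_derive (zz u) (E_ R j) (fun z : 'rV[R]_N => row_mx (tt u)%:M z : 'rV[R]_(1 + N)) (row_mx 0 (E_ R j)).
  by apply: is_derive_affine => h; rewrite scale_row_mx add_row_mx scaler0 addr0 addrC.
 by rewrite row_row_mx row0 rowE mulmx1.
have E1 := jac_comp dr df; rewrite srow -row_tz -[X in _ *m X]submxK mul_row_block !mul0mx !mul1mx !add0r in E1.
have : rsubmx ('J (f \o (fun z : 'rV[R]_N => row_mx (tt u)%:M z : 'rV[R]_(1 + N))) (zz u)) = drsubmx ('J f u).
 by rewrite E1 row_mxKr.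
move=> <-; have sfr : smooth_on Wt (f \o (fun z : 'rV[R]_N => row_mx (tt u)%:M z : 'rV[R]_(1 + N))).
 exact: (smooth_comp oW oOm WO sr sf).
apply/row_matrixP => j; rewrite (jacE j (smooth_diff oW sV Wz)).
apply/rowP => k; rewrite mxE [LHS]mxE (jac_entry j (rshift 1 k) oW sfr Wz) (derive_entry _ _ _ sV Wz).
by apply: (derive_near_ext _ oW Wz) => y Wy; rewrite /= row_mxEr tt_row zz_row.
Qed.

(** Where eta and d eta vanish the field is zero at all times, so nearby curves exist up to time 1.
    The last clause confines curves near every other such point as well; it is what allows germs of
    [mu] to be compared between charts. *)
Theorem moser z0 : Z z0 -> eta z0 = 0 -> curl eta z0 = 0 ->
 exists (Z0 : set 'rV[R]_N) (mu : 'rV[R]_N -> 'rV[R]_N),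
  [/\ [/\ open Z0, Z0 z0, Z0 `<=` Z & smooth_on Z0 mu],
    (forall z, Z0 z -> 'J mu z \in unitmx /\
      ('J mu z)^T *m Q z *m 'J mu z = gauge Q eta 1 (mu z)),
    (forall z, Z0 z -> exists c, [/\ moser_curve c, c 0 = z & c 1 = mu z]) &
    (forall z1 (W : set 'rV[R]_N), Z0 z1 -> eta z1 = 0 -> curl eta z1 = 0 -> open W -> W z1 ->
      exists W', [/\ open W', W' z1, W' `<=` Z0 & forall z, W' z ->
       exists c, [/\ moser_curve c, c 0 = z, c 1 = mu z & forall t : R, 0 <= t <= 1 -> W (c t)]])].
Proof.
move=> Zz0 e0 B0.
pose c0 (t : R) : 'rV[R]_(1 + N) := row_mx t%:M z0.
have [phi [VO [x [W [Hphi fam Vc0 HW]]]]] :=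
 flow_near_curve oOm sf (fun t => lift_curve (t := t) (moser_curve_cst Zz0 e0 B0)).
have [sphi oWW W1 _ _] := Hphi; have [sff oVO Hx] := fam.
pose io (z : 'rV[R]_N) : 'rV[R]_(1 + N) := row_mx 0%:M z.
have sio (U : set 'rV[R]_N) : open U -> smooth_on U io.
 by move=> oU; apply: smooth_row_mx => //; [exact: smooth_cst|exact: smooth_id].
pose Z0 := Z `&` io @^-1` VO.
have oZ0 : open Z0 by exact: open_preimS oZ oVO (sio _ oZ).
have ZV z : Z0 z -> VO (io z) by case.
have si0 := sio _ oZ0.
pose u z (t : R) := x t (io z).
have u0 z : Z0 z -> u z 0 = io z by move=> /ZV/Hx[].
have du z (t : R) : Z0 z -> 0 <= t <= 1 -> is_derive t 1 (u z) (f (u z t)).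
 move=> /ZV Vz t01; have := (Hx _ Vz).2 t.
 by rewrite (W1 _ (HW _ Vz t t01)).2 scale1r.
have Wu z (t : R) : Z0 z -> 0 <= t <= 1 -> W (u z t) by move=> /ZV Vz; exact: HW.
have Ou z (t : R) : Z0 z -> 0 <= t <= 1 -> Om (u z t) by move=> Hz t01; have [] := W1 _ (Wu _ _ Hz t01).
have zio z : zz (io z) = z by exact: zz_row.
have tu z (t : R) : Z0 z -> 0 <= t <= 1 -> tt (u z t) = t.
 move=> Hz /andP[t0 t1].
 have D (s : R) : 0 <= s <= t -> is_derive s 1 (fun s => tt (u z s) - s) 0.
  move=> /andP[s0 st]; have s01 : 0 <= s <= 1 by rewrite s0 (le_trans st).
  have := (is_derive_rV _ _ _).1 (du z s Hz s01) 0 (lshift N 0).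
  rewrite row_mxEl mxE eqxx mulr1n => d1.
  have -> : (fun s => tt (u z s) - s) = (fun s => u z s 0 (lshift N 0)) - id.
   by apply/funext => r; rewrite /tt mxE.
  by have := is_deriveB d1 (is_derive_id s 1); rewrite subrr.
 have := der0_const t0 D; rewrite u0// /io tt_row subrr => /esym/eqP.
 by rewrite subr_eq0 => /eqP.
have mcu z : Z0 z -> moser_curve (fun t => zz (u z t)).
 move=> Hz t t01; have [[_ Zc] uc] := Ou z t Hz t01.
 rewrite /den (tu z t Hz t01) in uc; split => //.
 have H := (is_derive_rV _ _ _).1 (du z t Hz t01); apply/is_derive_rV => i j.
 have := H i (rshift 1 j); rewrite row_mxEr (tu z t Hz t01).
 by have -> : (fun s => zz (u z s) i j) = (fun s => u z s i (rshift 1 j)) by apply/funext => s; rewrite /zz mxE.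
pose mu z := zz (u z 1).
have h01 : 0 <= (1 : R) <= 1 by rewrite ler01 lexx.
have sx (t : R) : 0 <= t -> smooth_on Z0 (fun z => u z t).
 by move=> t0; apply: (smooth_comp oZ0 oVO ZV si0); exact: fam_smooth fam t0.
have smu : smooth_on Z0 mu.
 by apply: (smooth_comp oZ0 oT _ (sx 1 ler01) szz).
exists Z0, mu; split.
- by split => // z [].
- move=> z Hz.
 have [K HK] := fam_jac fam oZ0 si0 ZV Hz.
 have dK (t : R) : 0 <= t <= 1 -> is_derive t 1 K (K t *m 'J f (u z t)).
  move=> t01; have t0 : 0 <= t by case/andP: t01.
  have := (HK t t0).2; rewrite -/(u z t).
  have -> : 'J (fun z1 => phi z1 *: f z1) (u z t) = 'J f (u z t); last by [].
  apply: (jac_ext oWW (Wu _ _ Hz t01) (smooth_diff oT sff I)) => v /W1[_ ->].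
  by rewrite scale1r.
 pose M t := rsubmx (K t).
 have K0 (t : R) : 0 <= t <= 1 -> K t = row_mx 0 (M t).
  move=> t01; have t0 : 0 <= t by case/andP: t01.
  rewrite -[LHS]hsubmxK; congr row_mx; apply/matrixP => i j.
  rewrite (HK t t0).1 mxE [RHS]mxE (jac_entry i (lshift N j) oZ0 (sx t t0) Hz).
  rewrite (derive_near_ext (g := cst t) _ oZ0 Hz) ?derive_cst// => y Hy.
  by rewrite -[RHS](tu y t Hy t01) /tt mxE; congr (u _ _ _ (lshift _ _)); rewrite !ord1.
 pose DV t := drsubmx ('J f (u z t)).
 have dM (t : R) : 0 <= t <= 1 -> is_derive t 1 M (M t *m DV t).
  move=> t01; have := (is_derive_rV _ _ _).1 (dK t t01).
  rewrite {1}(K0 t t01) -[X in _ *m X]submxK mul_row_block !mul0mx !add0r => H.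
  apply/is_derive_rV => i j; have := H i (rshift 1 j); rewrite row_mxEr.
  by have -> : (fun s => M s i j) = (fun s => K s i (rshift 1 j)) by apply/funext => s; rewrite /M mxE.
 have cDV (t : R) : 0 <= t <= 1 -> {for t, continuous DV}.
  move=> t01; have cu := is_derive_cont (du z t Hz t01).
  have cJ : {for u z t, continuous (fun v => 'J f v)}.
   exact: smooth_cont (smooth_jac oOm sf) (Ou _ _ Hz t01).
  have cJu : {for t, continuous ((fun v => 'J f v) \o u z)} by exact: continuous_comp.
  apply/continuous_mxP => i j.
  have -> : (fun s => DV s i j) = (fun s => ((fun v => 'J f v) \o u z) s (rshift 1 i) (rshift 1 j)).
   by apply/funext => s; rewrite /DV !mxE.
  by move/continuous_mxP: cJu; apply.
 (* T is the transposed inverse of the Jacobian M of the flow, produced by its own linear equation;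
    this also shows that M is invertible. *)
 have [|T [T0 dT]] := @matrix_ode N (fun t => - (DV t)^T).
  by move=> t t01; apply: opp_cont; apply: trmx_cont; exact: cDV.
 have M0 : M 0 = 1%:M.
  have h00 : 0 <= (0 : R) <= 1 by rewrite lexx ler01.
  apply/matrixP => i j; rewrite /M (HK 0 (lexx 0)).1 mxE (jac_entry i (rshift 1 j) oZ0 (sx 0 (lexx 0)) Hz).
  rewrite (derive_near_ext (g := fun y : 'rV[R]_N => y 0 j) _ oZ0 Hz) => [|y Hy].
   have [_ ->] : is_derive z (E_ R i) (fun y : 'rV[R]_N => y 0 j) ((E_ R i) 0 j).
    by apply: is_derive_affine => h; rewrite !mxE addrC.
   by rewrite !mxE eqxx eq_sym.
  by rewrite [u y 0]u0// /io row_mxEr.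
 have MT (t : R) : 0 <= t <= 1 -> M t *m (T t)^T = 1%:M.
  move=> /andP[t0 t1].
  have D (s : R) : 0 <= s <= t -> is_derive s 1 (fun s => M s *m (T s)^T) 0.
   move=> /andP[s0 st]; have s01 : 0 <= s <= 1 by rewrite s0 (le_trans st).
   have := is_derive_mulmx (dM s s01) (is_derive_tr (dT s s01)).
   by rewrite trmx_mul raddfN/= trmxK mulNmx mulmxN mulmxA subrr.
  by have := der0_const_mx t0 D; rewrite M0 T0 trmx1 mulmx1 => <-.
 (* E measures the failure of the flow to carry Q to the gauge transform at time t. It solves a
    homogeneous linear equation, so that T E T^T is constant, and E starts at 0. *)
 pose E t := (M t)^T *m Q z *m M t - Qh (u z t).
 have dE (t : R) : 0 <= t <= 1 -> is_derive t 1 E ((DV t)^T *m E t + E t *m DV t).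
  move=> t01; have Ot := Ou z t Hz t01.
  have d1 := is_derive_mulmx (is_derive_mulmx (is_derive_tr (dM t t01)) (is_derive_cst (Q z) t 1)) (dM t t01).
  have d2 := is_derive_comp_mx oOm sQh Ot (du z t Hz t01).
  have := is_deriveB d1 d2; rewrite (DQh Ot).
  have [Wt [oW Wz WZ Wt' WO]] := fixed_time Ot.
  have sQ' : smooth_on Wt Q by apply: smooth_sub sQ.
  have se' : smooth_on Wt eta by apply: smooth_sub se.
  have L := gauge_lie oW sQ' se' (fun y Wy => aQ (WZ y Wy)) (fun y Wy => jQ (WZ y Wy)) Wt' Wz.
  rewrite -/(moser_field (tt (u z t)) (zz (u z t))) in L.
  have L2 : (DV t)^T *m Qh (u z t) + Qh (u z t) *m DV t =
   'D_(moser_field (tt (u z t)) (zz (u z t))) (gauge Q eta (tt (u z t))) (zz (u z t)) -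
   Qh (u z t) *m curl eta (zz (u z t)) *m Qh (u z t).
   by rewrite /DV (JV Ot); exact: L.
  rewrite -L2; set e := (X in is_derive _ _ _ X -> _).
  suff -> : e = (DV t)^T *m E t + E t *m DV t by [].
  rewrite /e /E trmx_mul mulmx0 addr0 mulmxBr mulmxBl !mulmxA.
  by apply/matrixP => i j; rewrite !mxE; ring.
 pose G t := T t *m E t *m (T t)^T.
 have dG (t : R) : 0 <= t <= 1 -> is_derive t 1 G 0.
  move=> t01; have := is_derive_mulmx (is_derive_mulmx (dT t t01) (dE t t01)) (is_derive_tr (dT t t01)).
  have -> : (T t *m - (DV t)^T)^T = - (DV t *m (T t)^T) by rewrite trmx_mul linearN/= trmxK mulNmx.
  set e := (X in is_derive _ _ _ X -> _); suff -> : e = 0 by [].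
  rewrite /e !mulmxDl !mulmxDr !mulNmx !mulmxN !mulmxDl !mulNmx !mulmxA.
  by apply/matrixP => i j; rewrite !mxE; ring.
 have := der0_const_mx ler01 dG.
 have -> : G 0 = 0.
  have h00 : 0 <= (0 : R) <= 1 by rewrite lexx ler01.
  rewrite /G /E M0 trmx1 mul1mx mulmx1 u0// /Qh /io tt_row zz_row /gauge /gauge_den scale0r addr0 invmx1 mulmx1.
  by rewrite subrr mulmx0 mul0mx.
 move=> /esym G1.
 have Jmu : 'J mu z = M 1.
  apply/matrixP => i j; rewrite (jac_entry i j oZ0 smu Hz) /M mxE (HK 1 ler01).1.
  rewrite (jac_entry i (rshift 1 j) oZ0 (sx 1 ler01) Hz).
  by congr ('D_(E_ R i) _ z); apply/funext => y; rewrite /mu /zz mxE.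
 have MT1 := MT 1 h01; have uM : M 1 \in unitmx by case/mulmx1_unit: MT1.
 rewrite Jmu; split => //.
 have TM : T 1 *m (M 1)^T = 1%:M by rewrite -[T 1]trmxK -trmx_mul MT1 trmx1.
 have TM' : (T 1)^T *m M 1 = 1%:M by apply: mulmx1C.
 have TM2 : (M 1)^T *m T 1 = 1%:M by apply: mulmx1C.
 have : E 1 = 0.
  have := congr1 (fun A => (M 1)^T *m A *m M 1) G1.
  by rewrite /G /= mulmx0 mul0mx !mulmxA TM2 mul1mx -mulmxA TM' mulmx1.
 move=> /eqP; rewrite subr_eq0 => /eqP ->.
 by rewrite /Qh (tu z 1 Hz h01).
- move=> z Hz; exists (fun t => zz (u z t)); split => //; first exact: mcu.
 by rewrite u0.
- move=> z1 U Hz1 e1 B1 oU Uz1.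
 have cst1 (t : R) : 0 <= t <= 1 -> zz (u z1 t) = z1.
  move=> t01; apply: (moser_unique (mcu z1 Hz1) (moser_curve_cst (proj1 Hz1) e1 B1)) => //.
  by rewrite u0.
 have oU' : open (setT `&` zz @^-1` U) by exact: open_preimS oT oU szz.
 have HU (t : R) : 0 <= t <= 1 -> (setT `&` zz @^-1` U) (x t (io z1)).
  by move=> t01; split => //=; rewrite -/(u z1 t) cst1.
 have [VO' [fam' V1 HV]] := family_tube fam (ZV _ Hz1) oU' HU.
 exists (Z0 `&` io @^-1` VO'); split => //.
 + by have [_ oV' _] := fam'; exact: open_preimS oZ0 oV' si0.
 + move=> z [Hz Vz]; exists (fun t => zz (u z t)); split => //; first exact: mcu.
   by rewrite u0.
  by move=> t t01; have [] := HV _ Vz t t01.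
Qed.

End Flow.
End Moser.

(** * Spray coordinates *)

Section LocalExp.
Variable R : realType.

Lemma path_family_sub N s n f a q (Om : set 'rV[R]_s) (iota : 'rV[R]_N -> 'rV[R]_s) Z Z' X Th :
 open Z' -> Z' `<=` Z -> @path_family R N s n f a q Om iota Z X Th ->
 path_family f a q Om iota Z' X Th.
Proof.
move=> oZ' ZZ [? pflow psm ptube psm1 pvar pint pcurl]; split => //.
- by move=> z /ZZ; exact: pflow.
- by move=> t t01; apply: smooth_sub (psm t t01).
- move=> z0 W Hz oW HW; have [Z1 [oZ1 Z1z Z1Z HZ1]] := ptube z0 W (ZZ _ Hz) oW HW.
 exists (Z1 `&` Z'); split => //; first exact: openI.
 by move=> z [/HZ1].
- exact: smooth_sub psm1.
- by move=> z /ZZ; exact: pvar.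
- by move=> z /ZZ; exact: pint.
- by move=> z /ZZ; exact: pcurl.
Qed.

Lemma lsub_affine m r (z v : 'rV[R]_(m + r)) : is_derive z v (fun u : 'rV[R]_(m + r) => lsubmx u) (lsubmx v).
Proof. by apply: is_derive_affine => k; rewrite linearD linearZ addrC. Qed.

Lemma rsub_affine m r (z v : 'rV[R]_(m + r)) : is_derive z v (fun u : 'rV[R]_(m + r) => rsubmx u) (rsubmx v).
Proof. by apply: is_derive_affine => k; rewrite linearD linearZ addrC. Qed.

Lemma smooth_lsubT m r (U : set 'rV[R]_(m + r)) : open U -> smooth_on U (fun u : 'rV[R]_(m + r) => lsubmx u).
Proof. by move=> oU; apply: smooth_lsubmx => //; exact: smooth_id. Qed.

Lemma smooth_rsubT m r (U : set 'rV[R]_(m + r)) : open U -> smooth_on U (fun u : 'rV[R]_(m + r) => rsubmx u).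
Proof. by move=> oU; apply: smooth_rsubmx => //; exact: smooth_id. Qed.

Lemma jac_lsub m r (z : 'rV[R]_(m + r)) : 'J (fun u : 'rV[R]_(m + r) => lsubmx u) z = col_mx 1%:M 0.
Proof.
apply/row_matrixP => i; rewrite (jacE i (smooth_diff openT (smooth_lsubT openT) (I : setT z))).
have [_ ->] := lsub_affine z (E_ R i).
by rewrite rowE -[delta_mx 0 i]hsubmxK mul_row_col mulmx1 mulmx0 addr0.
Qed.

Lemma jac_rsub m r (z : 'rV[R]_(m + r)) : 'J (fun u : 'rV[R]_(m + r) => rsubmx u) z = col_mx 0 1%:M.
Proof.
apply/row_matrixP => i; rewrite (jacE i (smooth_diff openT (smooth_rsubT openT) (I : setT z))).
have [_ ->] := rsub_affine z (E_ R i).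
by rewrite rowE -[delta_mx 0 i]hsubmxK mul_row_col mulmx1 mulmx0 add0r.
Qed.

Lemma jac_row_mx N m n (W : set 'rV[R]_N) (F : 'rV[R]_N -> 'rV[R]_m) (G : 'rV[R]_N -> 'rV[R]_n) (z : 'rV[R]_N) :
 open W -> smooth_on W F -> smooth_on W G -> W z ->
 'J (fun u => row_mx (F u) (G u)) z = row_mx ('J F z) ('J G z).
Proof.
move=> oW sF sG Wz; have sH := smooth_row_mx oW sF sG.
apply/matrixP => i j; rewrite (jac_entry i j oW sH Wz); rewrite -(splitK j); case: (fintype.split j) => k /=.
 rewrite row_mxEl (jac_entry i k oW sF Wz).
 by congr ('D_(E_ R i) _ z); apply/funext => y; rewrite row_mxEl.
rewrite row_mxEr (jac_entry i k oW sG Wz).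
by congr ('D_(E_ R i) _ z); apply/funext => y; rewrite row_mxEr.
Qed.

Lemma jac_compS N m n (W : set 'rV[R]_N) (V : set 'rV[R]_m) (F : 'rV[R]_N -> 'rV[R]_m) (G : 'rV[R]_m -> 'rV[R]_n)
  (z : 'rV[R]_N) : open W -> open V -> smooth_on W F -> smooth_on V G -> W z -> V (F z) ->
 'J (fun u => G (F u)) z = 'J F z *m 'J G (F z).
Proof.
move=> oW oV sF sG Wz Vz.
exact: jac_comp (smooth_diff oW sF Wz) (smooth_diff oV sG Vz).
Qed.

(* Coordinate data of a coregular submanifold X with its saturation P in M:
   jj and kk represent P -> M and X -> P, lam is a left inverse of jj, gg is the
   fibre component of the spray, and the rows of ee frame the annihilator of W. *)
Record exp_data m r D n := ExpData {
 Om : set 'rV[R]_n; Pi : 'rV[R]_n -> 'M[R]_n;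
 OP : set 'rV[R]_D; jj : 'rV[R]_D -> 'rV[R]_n; lam : 'rV[R]_n -> 'rV[R]_D;
 gg : 'rV[R]_(n + n) -> 'rV[R]_n;
 OX : set 'rV[R]_m; kk : 'rV[R]_m -> 'rV[R]_D; ee : 'rV[R]_m -> 'M[R]_(r, n) }.

Record exp_ok m r D n (E : exp_data m r D n) : Prop := ExpOk {
 ok_oOm : open (Om E); ok_oOP : open (OP E); ok_oOX : open (OX E);
 ok_Pi : smooth_on (Om E) (Pi E); ok_j : smooth_on (OP E) (jj E); ok_lam : smooth_on (Om E) (lam E);
 ok_g : smooth_on (lsubmx @^-1` Om E) (gg E); ok_k : smooth_on (OX E) (kk E); ok_e : smooth_on (OX E) (ee E);
 ok_OX : forall x, OX E x -> OP E (kk E x);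
 ok_OP : forall p, OP E p -> Om E (jj E p);
 ok_anti : forall q, Om E q -> (Pi E q)^T = - Pi E q;
 ok_jac : jacobi (Om E) (Pi E);
 ok_lamj : forall p, OP E p -> lam E (jj E p) = p;
 ok_Pij : forall p, OP E p -> (Pi E (jj E p) <= 'J (jj E) p)%MS;
 ok_g0 : forall q, Om E q -> gg E (row_mx q 0) = 0 /\ 'J (gg E) (row_mx q 0) = 0 }.

Lemma mulmxD2 a b c d e (K : 'M[R]_(a, b)) (A : 'M[R]_(b, c)) (P : 'M[R]_(c, d)) (B : 'M[R]_(b, e)) (C : 'M[R]_(e, d)) :
 K *m (A *m P + B *m C) = K *m A *m P + K *m B *m C.
Proof. by rewrite mulmxDr !mulmxA. Qed.

Section Sys.
Variables (m r D n : nat) (E : exp_data m r D n).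

(** A state u = (p, a) is a point of P in coordinates with a covector of M at jj p. As sharp is
    tangent to P, the spray restricts to such states; [lam] converts its base velocity into
    coordinates of P. *)
Definition ed_a (u : 'rV[R]_(D + n)) : 'rV[R]_n := rsubmx u.
Definition ed_q (u : 'rV[R]_(D + n)) : 'rV[R]_n := jj E (lsubmx u).
Definition ed_f (u : 'rV[R]_(D + n)) : 'rV[R]_(D + n) :=
 row_mx (ed_a u *m Pi E (ed_q u) *m 'J (lam E) (ed_q u)) (gg E (row_mx (ed_q u) (ed_a u))).
Definition ed_dom : set 'rV[R]_(D + n) := lsubmx @^-1` OP E.
Definition ed_iota (z : 'rV[R]_(m + r)) : 'rV[R]_(D + n) :=
 row_mx (kk E (lsubmx z)) (rsubmx z *m ee E (lsubmx z)).
Definition ed_i (x : 'rV[R]_m) : 'rV[R]_n := jj E (kk E x).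

(** The bivector of P in coordinates, computed through a left inverse of the embedding; by [QP_uniq]
    the choice of [lam] does not matter. *)
Definition ed_QP (p : 'rV[R]_D) : 'M[R]_D :=
 ('J (lam E) (jj E p))^T *m Pi E (jj E p) *m 'J (lam E) (jj E p).

Hypothesis ok : exp_ok E.
Let oOm := ok_oOm ok. Let oOP := ok_oOP ok. Let oOX := ok_oOX ok.
Let sPi := ok_Pi ok. Let sj := ok_j ok. Let slam := ok_lam ok. Let sg := ok_g ok.

Let odom : open ed_dom. Proof. exact: smooth_lsub. Qed.
Let sl := @smooth_lsubT D n ed_dom odom.
Let sr := @smooth_rsubT D n ed_dom odom.
Let sq : smooth_on ed_dom ed_q. Proof. exact: (smooth_comp odom oOP (fun _ h => h) sl sj). Qed.
Let qOm u : ed_dom u -> Om E (ed_q u). Proof. exact: (ok_OP ok). Qed.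
Let sw : smooth_on ed_dom (fun u => ed_a u *m Pi E (ed_q u)).
Proof. by apply: smooth_mulmx => //; exact: (smooth_comp odom oOm qOm sq sPi). Qed.
Let slamq : smooth_on ed_dom (fun u => 'J (lam E) (ed_q u)).
Proof. by apply: (smooth_comp odom oOm qOm sq); exact: smooth_jac. Qed.
Let sqa : smooth_on ed_dom (fun u => row_mx (ed_q u) (ed_a u)).
Proof. exact: smooth_row_mx. Qed.
Let qaO u : ed_dom u -> (lsubmx @^-1` Om E) (row_mx (ed_q u) (ed_a u)).
Proof. by move=> du; rewrite /= row_mxKl; exact: qOm. Qed.
Let sf : smooth_on ed_dom ed_f.
Proof.
apply: smooth_row_mx => //; first exact: smooth_mulmx.
by apply: (smooth_comp odom _ qaO sqa sg); exact: smooth_lsub.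
Qed.

Lemma ed_smooth : [/\ open ed_dom, smooth_on ed_dom ed_f, smooth_on ed_dom ed_a & smooth_on ed_dom ed_q].
Proof. by split. Qed.

Lemma lam_jac p : OP E p -> 'J (jj E) p *m 'J (lam E) (jj E p) = 1%:M.
Proof.
move=> Op; rewrite -(jac_compS oOP oOm sj slam Op (ok_OP ok Op)) -(jac_id p).
apply: esym; apply: (jac_ext oOP Op) => [|y Oy]; last by rewrite (ok_lamj ok Oy).
exact: smooth_diff oOP (smooth_id oOP) Op.
Qed.

(** The range of Pi at a point of P is tangent to P, and there the derivatives of [lam] and [jj] are
    inverse to each other. *)
Lemma Pi_lam_j p : OP E p -> Pi E (jj E p) *m 'J (lam E) (jj E p) *m 'J (jj E) p = Pi E (jj E p).
Proof.
move=> Op; have /submxP[Y ->] := ok_Pij ok Op.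
by rewrite -!mulmxA (mulmxA ('J (jj E) p)) (lam_jac Op) mul1mx.
Qed.

Lemma QP_pull p : OP E p -> ('J (jj E) p)^T *m ed_QP p *m 'J (jj E) p = Pi E (jj E p).
Proof.
move=> Op; have h := Pi_lam_j Op; have a := ok_anti ok (ok_OP ok Op).
rewrite /ed_QP; move: h a; move: (Pi E _) ('J (lam E) _) ('J (jj E) p) => P L J h a.
rewrite -!mulmxA (mulmxA P) h; apply: (can_inj trmxK).
by rewrite !trmx_mul !trmxK a mulNmx !mulNmx h.
Qed.

Lemma QP_uniq p (Q' : 'M[R]_D) : OP E p -> ('J (jj E) p)^T *m Q' *m 'J (jj E) p = Pi E (jj E p) -> Q' = ed_QP p.
Proof.
move=> Op h; rewrite /ed_QP -h; have l := lam_jac Op.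
move: l; move: ('J (lam E) _) ('J (jj E) p) => L J l.
have l' : L^T *m J^T = 1%:M by rewrite -trmx_mul l trmx1.
by rewrite !mulmxA l' mul1mx -mulmxA l mulmx1.
Qed.

Lemma smooth_QP : smooth_on (OP E) ed_QP.
Proof.
have sL : smooth_on (OP E) (fun p => 'J (lam E) (jj E p)).
 by apply: (smooth_comp oOP oOm (ok_OP ok) sj); exact: smooth_jac.
apply: smooth_mulmx => //; apply: smooth_mulmx => //; first exact: smooth_tr.
exact: (smooth_comp oOP oOm (ok_OP ok) sj sPi).
Qed.

Lemma QP_antisym p : OP E p -> (ed_QP p)^T = - ed_QP p.
Proof.
move=> Op; have a := ok_anti ok (ok_OP ok Op); rewrite /ed_QP; move: a.
move: (Pi E _) ('J (lam E) _) => P L a.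
by rewrite !trmx_mul trmxK a mulNmx mulmxN mulmxA.
Qed.

Lemma jac_q u : ed_dom u -> 'J ed_q u = col_mx ('J (jj E) (lsubmx u)) 0.
Proof.
move=> du; rewrite (jac_compS odom oOP sl sj du du) jac_lsub mul_col_mx mul1mx mul0mx.
by [].
Qed.

Lemma f_jac_q u : ed_dom u -> ed_a u *m Pi E (ed_q u) = ed_f u *m 'J ed_q u.
Proof.
move=> du; rewrite (jac_q du) mul_row_col mulmx0 addr0.
by rewrite -!mulmxA (mulmxA (Pi E _)) [X in _ = _ *m X](Pi_lam_j du).
Qed.

Lemma ed_const x : OX E x -> ed_f (row_mx (kk E x) 0) = 0.
Proof.
move=> Ox; rewrite /ed_f /ed_a row_mxKr !mul0mx.
have dk : ed_dom (row_mx (kk E x) 0) by rewrite /ed_dom /= row_mxKl; exact: (ok_OX ok).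
by have [-> _] := ok_g0 ok (qOm dk); rewrite row_mx0.
Qed.

Section Sol.
Variables (Z : set 'rV[R]_(m + r)) (X : R -> 'rV[R]_(m + r) -> 'rV[R]_(D + n))
 (Th : 'rV[R]_(m + r) -> 'rV[R]_(m + r)).
Hypothesis pf : path_family ed_f ed_a ed_q ed_dom ed_iota Z X Th.
Hypothesis ZOX : forall z, Z z -> OX E (lsubmx z).

Let oZ := pf_open pf.
Let h00 : 0 <= (0 : R) <= 1. Proof. by rewrite lexx ler01. Qed.
Let h11 : 0 <= (1 : R) <= 1. Proof. by rewrite lexx ler01. Qed.
Definition es_F (z : 'rV[R]_(m + r)) : 'rV[R]_D := lsubmx (X 1 z).

Lemma es_OP z : Z z -> OP E (es_F z).
Proof. by move=> Hz; have [_ /(_ 1 h11)[]] := pf_flow pf Hz. Qed.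

Lemma smooth_F : smooth_on Z es_F.
Proof. by apply: smooth_lsubmx => //; exact: (pf_smooth pf h11). Qed.

(** Zero covectors are stationary because the spray vanishes on the zero section; so the parameter
    (x, 0) stands for the point x of X. *)
Lemma es_zero z : Z z -> rsubmx z = 0 -> forall t : R, 0 <= t <= 1 -> X t z = row_mx (kk E (lsubmx z)) 0.
Proof.
move=> Hz z0 t t01; have Ox := ZOX Hz; have [X0 HX] := pf_flow pf Hz.
apply: (ode_unique_open (c1 := X^~ z) (c2 := fun=> row_mx (kk E (lsubmx z)) 0) odom sf HX _ _ t01).
 move=> s s01; rewrite (ed_const Ox); split; first by rewrite /ed_dom /= row_mxKl; exact: (ok_OX ok).
 exact: is_derive_cst.
by rewrite X0 /ed_iota z0 mul0mx.
Qed.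

Lemma es_F_zero z : Z z -> rsubmx z = 0 -> es_F z = kk E (lsubmx z).
Proof. by move=> Hz z0; rewrite /es_F (es_zero Hz z0 h11) row_mxKl. Qed.

Lemma jac_qX0 z : Z z -> 'J (ed_q \o X 0) z = col_mx ('J ed_i (lsubmx z)) 0.
Proof.
move=> Hz; have Ox := ZOX Hz.
have si : smooth_on (OX E) ed_i by exact: (smooth_comp oOX oOP (ok_OX ok) (ok_k ok) sj).
have oW : open (Z `&` (lsubmx @^-1` OX E)) by apply: openI => //; exact: smooth_lsub.
rewrite -(mul0mx _ ('J ed_i (lsubmx z))) -[X in col_mx X _]mul1mx -mul_col_mx -(jac_lsub z).
rewrite -(jac_compS openT oOX (smooth_lsubT openT) si I Ox).
apply: esym; apply: (jac_ext oZ Hz) => [|y Hy].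
 apply: differentiable_comp; first exact: smooth_diff openT (smooth_lsubT openT) I.
 exact: smooth_diff oOX si Ox.
by have [/= -> _] := pf_flow pf Hy; rewrite /ed_q /ed_iota row_mxKl.
Qed.

Lemma jac_qX1 z : Z z -> 'J (ed_q \o X 1) z = 'J es_F z *m 'J (jj E) (es_F z).
Proof. by move=> Hz; exact: jac_compS oZ oOP smooth_F sj Hz (es_OP Hz). Qed.

(** The linearised cotangent path equation, from the commutation of time derivative and
    variation. *)
Lemma es_variation z : Z z -> exists (A U : R -> 'M[R]_(m + r, n)),
 forall t : R, 0 <= t <= 1 -> [/\ A t = 'J (ed_a \o X t) z, U t = 'J (ed_q \o X t) z,
  {for t, continuous A} &
  is_derive t 1 U (A t *m Pi E (ed_q (X t z)) + U t *m contr (Pi E) (ed_a (X t z)) (ed_q (X t z)))].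
Proof.
move=> Hz; have [K HK] := pf_var pf Hz; have [X0 HX] := pf_flow pf Hz.
exists (fun t => K t *m 'J ed_a (X t z)), (fun t => K t *m 'J ed_q (X t z)) => t t01.
have [dXt dX] := HX t t01; have [Kt dK] := HK t t01.
have sX := pf_smooth pf t01; have jE F := fun sF => esym (jac_compS oZ odom sX sF Hz dXt) : _ = 'J (F \o X t) z.
split.
- by rewrite Kt; exact: (jE _ ed_a sr).
- by rewrite Kt; exact: (jE _ ed_q sq).
- have -> : (fun t => K t *m 'J ed_a (X t z)) = (fun t => K t *m col_mx 0 1%:M).
  by apply/funext => s; rewrite /ed_a jac_rsub.
 by apply: mulmx_cont; [exact: is_derive_cont dK|exact: cst_continuous].
- have := mixed_jac odom sf sq f_jac_q dXt dX dK.
 have eJ : K t *m 'J (fun u => ed_a u *m Pi E (ed_q u)) (X t z) =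
   K t *m 'J ed_a (X t z) *m Pi E (ed_q (X t z)) +
   K t *m 'J ed_q (X t z) *m contr (Pi E) (ed_a (X t z)) (ed_q (X t z)); last first.
  by move=> h; rewrite -eJ; exact: h.
 have eW : 'J (fun u => ed_a u *m Pi E (ed_q u)) (X t z) = 'J ed_a (X t z) *m Pi E (ed_q (X t z)) +
   'J ed_q (X t z) *m contr (Pi E) (ed_a (X t z)) (ed_q (X t z)); last first.
  exact: etrans (congr1 (mulmx (K t)) eW) (mulmxD2 _ _ _ _ _).
 have sPq := smooth_comp odom oOm qOm sq sPi.
 apply/row_matrixP => i; rewrite (jacE i (smooth_diff odom sw dXt)).
 rewrite (derive_mulmx _ odom sr sPq dXt) raddfD/= !row_mul.
 rewrite -(jacE i (smooth_diff odom sr dXt)); apply: f_equal2 => //.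
 rewrite (contr_mul _ _ oOm sPi (qOm dXt)) (jacE i (smooth_diff odom sq dXt)).
 apply: (congr1 (mulmx (ed_a (X t z)))).
 exact: (derive_comp (E_ R i) (smooth_diff odom sq dXt) (smooth_diff oOm sPi (qOm dXt))).
Qed.

(** [cotangent_path_key] along the spray: a covector [b0] realising an element of i^! L at time 0 is
    transported to [b1] over the final variation, and the two induced covectors on the parameter
    space differ by d Theta. *)
Lemma es_key z (d : 'rV[R]_(m + r)) (b0 : 'rV[R]_n) : Z z -> lsubmx d *m 'J ed_i (lsubmx z) = b0 *m Pi E (ed_i (lsubmx z)) ->
 exists b1, d *m 'J (ed_q \o X 1) z = b1 *m Pi E (jj E (es_F z)) /\
  b1 *m ('J (ed_q \o X 1) z)^T - row_mx (b0 *m ('J ed_i (lsubmx z))^T) 0 = d *m curl Th z.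
Proof.
move=> Hz Hb; have [A [U HAU]] := es_variation Hz; have [X0 HX] := pf_flow pf Hz.
have dq (t : R) : 0 <= t <= 1 -> Om E (ed_q (X t z)) /\ is_derive t 1 (fun s => ed_q (X s z)) (ed_a (X t z) *m Pi E (ed_q (X t z))).
 move=> t01; have [du dX] := HX t t01; split; first exact: qOm.
 rewrite (f_jac_q du); exact: is_derive_jac dX (smooth_diff odom sq du).
have ca (t : R) : 0 <= t <= 1 -> {for t, continuous (fun s => ed_a (X s z))} /\ {for t, continuous A}.
 move=> t01; have [_ _ cA _] := HAU t t01; have [du dX] := HX t t01.
 exact: conj (is_derive_cont (is_derive_jac dX (smooth_diff odom sr du))) cA.
have U0 : U 0 = col_mx ('J ed_i (lsubmx z)) 0.
 by have [_ -> _ _] := HAU 0 h00; exact: jac_qX0.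
have q0 : ed_q (X 0 z) = ed_i (lsubmx z) by rewrite X0 /ed_q /ed_iota row_mxKl.
have [||b1 [E1 HS]] := cotangent_path_key oOm sPi (ok_anti ok) (ok_jac ok) dq ca (U := U) (d := d) (b0 := b0).
- by move=> t t01; have [] := HAU t t01.
- by rewrite U0 q0 -[d]hsubmxK mul_row_col mulmx0 addr0.
exists b1; have [_ U1 _ _] := HAU 1 h11; rewrite -U1; split; first exact: E1.
have [S [S0 S1 dS]] := pf_curl pf Hz.
have {}HS : b1 *m (U 1)^T - b0 *m (U 0)^T = d *m (S 1 - S 0).
 by apply: HS => t t01; have [-> -> _ _] := HAU t t01; exact: dS.
by rewrite S0 S1 subr0 U0 tr_col_mx mul_mx_row trmx0 mulmx0 in HS.
Qed.

(** The reversed path with covector -a is again a cotangent path. Both directions together show that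
    the graph of the bivector equals the gauge transform, rather than one containing the other. *)
Lemma es_key_rev z (d : 'rV[R]_(m + r)) (b1 : 'rV[R]_n) : Z z -> d *m 'J (ed_q \o X 1) z = b1 *m Pi E (jj E (es_F z)) ->
 exists b0, lsubmx d *m 'J ed_i (lsubmx z) = b0 *m Pi E (ed_i (lsubmx z)) /\
  b1 *m ('J (ed_q \o X 1) z)^T - row_mx (b0 *m ('J ed_i (lsubmx z))^T) 0 = d *m curl Th z.
Proof.
move=> Hz Hb; have [A [U HAU]] := es_variation Hz; have [X0 HX] := pf_flow pf Hz.
have rev01 (t : R) : 0 <= t <= 1 -> 0 <= 1 - t <= 1 by move=> /andP[? ?]; apply/andP; split; lra.
have drev (V : normedModType R) (g : R -> V) (t : R) (w : V) : is_derive (1 - t) 1 g w ->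
  is_derive t 1 (fun s => g (1 - s)) (- w).
 move=> dg; have d1 : is_derive t 1 (fun s : R => 1 - s) (-1).
  by have := is_deriveB (is_derive_cst (1 : R) t 1) (is_derive_id t 1); rewrite sub0r.
 have [dd e] := d1; have [ddg eg] := dg.
 have df1 : differentiable (fun s : R => 1 - s) t by exact/derivable1_diffP.
 have df2 : differentiable g (1 - t) by exact/derivable1_diffP.
 have df : differentiable (g \o (fun s : R => 1 - s)) t by exact: differentiable_comp.
 split; first exact: diff_derivable.
 rewrite -[LHS]/('D_1 (g \o (fun s : R => 1 - s)) t) deriveE// diff_comp//=.
 have -> : 'd (fun s : R => 1 - s) t 1 = -1 by rewrite -deriveE.
 by rewrite linearN -deriveE// eg.
have dq (t : R) : 0 <= t <= 1 -> Om E (ed_q (X (1 - t) z)) /\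
  is_derive t 1 (fun s => ed_q (X (1 - s) z)) (- ed_a (X (1 - t) z) *m Pi E (ed_q (X (1 - t) z))).
 move=> t01; have [du dX] := HX _ (rev01 t t01); split; first exact: qOm.
 rewrite mulNmx (f_jac_q du); apply: (drev _ (fun s => ed_q (X s z))).
 exact: is_derive_jac dX (smooth_diff odom sq du).
have crev m' n' (g : R -> 'M[R]_(m', n')) (t : R) : {for 1 - t, continuous g} -> {for t, continuous (fun s : R => - g (1 - s))}.
 move=> cg; apply: opp_cont; apply: (@continuous_comp _ _ _ (fun s : R => 1 - s) g t _ cg).
 apply: continuousB; [exact: cst_continuous|exact: id].
have ca (t : R) : 0 <= t <= 1 -> {for t, continuous (fun s : R => - ed_a (X (1 - s) z))} /\ {for t, continuous (fun s : R => - A (1 - s))}.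
 move=> t01; have [_ _ cA _] := HAU _ (rev01 t t01).
 have [du dX] := HX _ (rev01 t t01); split; last exact: crev.
 apply: (crev _ _ (fun s => ed_a (X s z))).
 exact: is_derive_cont (is_derive_jac dX (smooth_diff odom sr du)).
have U0 : U 0 = col_mx ('J ed_i (lsubmx z)) 0.
 by have [_ -> _ _] := HAU 0 h00; exact: jac_qX0.
have q0 : ed_q (X 0 z) = ed_i (lsubmx z) by rewrite X0 /ed_q /ed_iota row_mxKl.
have [_ U1 _ _] := HAU 1 h11.
have contrN a q : contr (Pi E) (- a) q = - contr (Pi E) a q.
 by apply/matrixP => i j; rewrite mxE mulNmx !mxE.
have [||b0 [E1 HS]] := cotangent_path_key (U := fun s => U (1 - s)) oOm sPi (ok_anti ok) (ok_jac ok) dq ca (d := d) (b0 := b1).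
- move=> t t01; have [_ _ _ dU] := HAU _ (rev01 t t01).
 by have := drev _ _ _ _ dU; rewrite opprD mulNmx contrN mulmxN.
- by rewrite subr0 U1.
rewrite /= subrr q0 U0 in E1 HS; exists b0; split.
 by rewrite -E1 -[d in RHS]hsubmxK mul_row_col mulmx0 addr0.
have [S [S0 S1 dS]] := pf_curl pf Hz.
have dS1 (t : R) : 0 <= t <= 1 -> is_derive t 1 (fun s => S (1 - s))
  (- A (1 - t) *m (U (1 - t))^T - U (1 - t) *m (- A (1 - t))^T).
 move=> t01; have [At Ut _ _] := HAU _ (rev01 t t01).
 have := drev _ _ _ _ (dS _ (rev01 t t01)); rewrite -At -Ut opprB.
 by rewrite raddfN/= mulNmx mulmxN opprK addrC.
have {}HS := HS _ dS1; rewrite /= subrr subr0 S0 S1 in HS.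
rewrite tr_col_mx mul_mx_row trmx0 mulmx0 U1 sub0r mulmxN in HS.
by rewrite -[LHS]opprK opprB HS opprK.
Qed.

Lemma es_Th_zero z : Z z -> rsubmx z = 0 -> Th z = 0.
Proof.
move=> Hz z0; have [g [g0 g1 dg]] := pf_int pf Hz; rewrite -g1 -g0; apply: esym.
apply: (der0_const_mx ler01) => t t01; have := dg t t01.
by rewrite (es_zero Hz z0 t01) {1}/ed_a row_mxKr mul0mx.
Qed.

(** On the zero section the fibre part of the spray and its first derivative vanish, so the covector
    variation [Ka] is constant and the position variation is U0 + t Ka P. Integration expresses d
    Theta by the pairing of the frame with TX and by pi on the frame. *)
Lemma es_zero_var z : Z z -> rsubmx z = 0 ->
 let Ka := col_mx 0 (ee E (lsubmx z)) in
 let U0 := col_mx ('J ed_i (lsubmx z)) 0 in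
 let P := Pi E (ed_i (lsubmx z)) in
 'J (ed_q \o X 1) z = U0 + Ka *m P /\
 curl Th z = Ka *m U0^T - U0 *m Ka^T - Ka *m P *m Ka^T.
Proof.
move=> Hz z0 Ka U0 P; have Ox := ZOX Hz.
have [K HK] := pf_var pf Hz; have [X0 HX] := pf_flow pf Hz.
set p0 := row_mx (kk E (lsubmx z)) 0 : 'rV[R]_(D + n).
have Xp (t : R) : 0 <= t <= 1 -> X t z = p0 by exact: es_zero.
have dp : ed_dom p0 by rewrite -(Xp 0 h00); have [] := HX 0 h00.
have qp : ed_q p0 = ed_i (lsubmx z) by rewrite /ed_q /p0 row_mxKl.
have ap : ed_a p0 = 0 by rewrite /ed_a row_mxKr.
have Jfr : rsubmx ('J ed_f p0) = 0.
 have oG := smooth_lsub (m := n) oOm.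
 have dG : (lsubmx @^-1` Om E) (row_mx (ed_q p0) (ed_a p0)) by exact: qaO.
 rewrite /ed_f (jac_row_mx odom (smooth_mulmx odom sw slamq) (smooth_comp odom oG qaO sqa sg) dp) row_mxKr.
 rewrite (jac_compS odom oG sqa sg dp dG) ap.
 by have [_ ->] := ok_g0 ok (qOm dp); rewrite mulmx0.
have aK (t : R) : 0 <= t <= 1 -> 'J (ed_a \o X t) z = rsubmx (K t).
 move=> t01; have [du _] := HX t t01; have [-> _] := HK t t01.
 rewrite -[LHS]/('J (fun u => ed_a (X t u)) z) (jac_compS oZ odom (pf_smooth pf t01) sr Hz du) jac_rsub.
 by rewrite -[X in X *m _]hsubmxK mul_row_col mulmx0 mulmx1 add0r.
have dKr (t : R) : 0 <= t <= 1 -> is_derive t 1 (fun s => rsubmx (K s)) 0.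
 move=> t01; have [_ dK] := HK t t01; rewrite (Xp t t01) in dK.
 have H := (is_derive_rV _ _ _).1 dK; apply/is_derive_rV => i j.
 have := H i (rshift D j).
 have -> : (fun s => rsubmx (K s) i j) = (fun s => K s i (rshift D j)) by apply/funext => s; rewrite mxE.
 suff -> : (K t *m 'J ed_f p0) i (rshift D j) = (0 : 'M[R]_(m + r, n)) i j by [].
 have -> : (0 : 'M[R]_(m + r, n)) i j = (rsubmx (K t *m 'J ed_f p0)) i j; last by rewrite [RHS]mxE.
 by rewrite -[X in rsubmx (_ *m X)]hsubmxK mul_mx_row row_mxKr Jfr mulmx0.
have Kr (t : R) : 0 <= t <= 1 -> rsubmx (K t) = Ka.
 move=> /andP[t0 t1].
 have D0 (s : R) : 0 <= s <= t -> is_derive s 1 (fun s => rsubmx (K s)) 0.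
  by move=> /andP[s0 st]; apply: dKr; rewrite s0 (le_trans st).
 rewrite -(der0_const_mx t0 D0) -(aK 0 h00).
 pose G (u : 'rV[R]_(m + r)) := rsubmx u *m ee E (lsubmx u).
 have oW := smooth_lsub (m := r) oOX.
 have s1 := smooth_comp oW oOX (fun _ h => h) (smooth_lsubT oW) (ok_e ok).
 have s2 := smooth_rsubT oW.
 have sG : smooth_on (lsubmx @^-1` OX E) G by exact: smooth_mulmx.
 rewrite (jac_ext (F := ed_a \o X 0) (G := G) oZ Hz); last 2 first.
 - apply: smooth_diff oZ _ Hz; apply: (smooth_comp oZ odom _ (pf_smooth pf h00) sr).
  by move=> y Hy; have [_ /(_ 0 h00)[]] := pf_flow pf Hy.
 - by move=> y Hy; have [/= -> _] := pf_flow pf Hy; rewrite /ed_a /ed_iota row_mxKr.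
 apply/row_matrixP => i; rewrite (jacE i (smooth_diff oW sG Ox)).
 rewrite (derive_mulmx _ oW s2 s1 Ox) z0 mul0mx addr0.
 have [_ ->] := rsub_affine z (E_ R i).
 by rewrite rowE -[X in _ = X *m _]hsubmxK mul_row_col mulmx0 add0r.
have [A [U HAU]] := es_variation Hz.
have At (t : R) : 0 <= t <= 1 -> A t = Ka.
 by move=> t01; have [-> _ _ _] := HAU t t01; rewrite aK// Kr.
have contr0 q : contr (Pi E) 0 q = 0 by apply/matrixP => i j; rewrite mxE mul0mx !mxE.
have dU (t : R) : 0 <= t <= 1 -> is_derive t 1 U (Ka *m P).
 move=> t01; have [_ _ _] := HAU t t01.
 by rewrite (At t t01) (Xp t t01) qp ap contr0 mulmx0 addr0.
have U00 : U 0 = U0 by have [_ -> _ _] := HAU 0 h00; exact: jac_qX0.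
have Ut (t : R) : 0 <= t <= 1 -> U t = U0 + t *: (Ka *m P).
 move=> /andP[t0 t1].
 have D1 (s : R) : 0 <= s <= t -> is_derive s 1 (fun s => U s - s *: (Ka *m P)) 0.
  move=> /andP[s0 st]; have s01 : 0 <= s <= 1 by rewrite s0 (le_trans st).
  by have := is_deriveB (dU s s01) (der_line (Ka *m P) s); rewrite subrr.
 have := der0_const_mx t0 D1; rewrite scale0r subr0 U00 => ->.
 by rewrite subrK.
have [_ U1 _ _] := HAU 1 h11; split; first by rewrite -U1 (Ut 1 h11) scale1r.
have [S [S0 S1 dS]] := pf_curl pf Hz.
have PT : P^T = - P by apply: (ok_anti ok); rewrite -qp; exact: qOm.
have dS' (t : R) : 0 <= t <= 1 -> is_derive t 1 S (Ka *m U0^T - U0 *m Ka^T - (2 * t) *: (Ka *m P *m Ka^T)).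
 move=> t01; have := dS t t01; have [<- <- _ _] := HAU t t01.
 rewrite (At t t01) (Ut t t01).
 suff -> : Ka *m (U0 + t *: (Ka *m P))^T - (U0 + t *: (Ka *m P)) *m Ka^T =
  Ka *m U0^T - U0 *m Ka^T - (2 * t) *: (Ka *m P *m Ka^T) by [].
 have -> : (U0 + t *: (Ka *m P))^T = U0^T - t *: (P *m Ka^T).
  by rewrite linearD linearZ/= trmx_mul PT mulNmx scalerN.
 rewrite mulmxBr mulmxDl -scalemxAl -scalemxAr !mulmxA.
 by apply/matrixP => i j; rewrite !mxE; ring.
pose C := Ka *m U0^T - U0 *m Ka^T; pose B := Ka *m P *m Ka^T.
have dW (t : R) : 0 <= t <= 1 -> is_derive t 1 (fun s => S s - s *: C + (s * s) *: B) 0.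
 move=> t01; have d1 := is_deriveB (dS' t t01) (der_line C t).
 have d2 : is_derive t 1 (fun s : R => (s * s) *: B) ((2 * t) *: B).
  apply/is_derive_rV => i j.
  have := is_derive_mulR (is_derive_mulR (is_derive_id t 1) (is_derive_id t 1)) (is_derive_cst (B i j) t 1).
  have -> : (1 * t + t * 1) * cst (B i j) t + t * t * 0 = ((2 * t) *: B) i j by rewrite [RHS]mxE; move: (B i j) => b; rewrite /cst/=; ring.
  by have -> : (fun s : R => ((s * s) *: B) i j) = (fun s => id s * id s * cst (B i j) s)
   by apply/funext => s; rewrite mxE.
 have := is_deriveD d1 d2; rewrite -/C -/B.
 by have -> : C - (2 * t) *: B - C + (2 * t) *: B = 0 by rewrite addrAC subrK subrr.
have := der0_const_mx ler01 dW.
rewrite S0 scale0r mulr0 scale0r subr0 addr0 mulr1 !scale1r S1 => /eqP.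
by rewrite eq_sym -addrA addr_eq0 opprD opprK => /eqP.
Qed.

End Sol.
End Sys.
End LocalExp.

(** * Local Poisson diffeomorphisms *)

Section LocalIso.
Variable R : realType.

(** An injective Jacobian gives N <= D; the assumed opposite inequality, in the application a bound
    on dim P, makes the map a local diffeomorphism. *)
Lemma inverse_function_dim N D (F : 'rV[R]_N -> 'rV[R]_D) (Om : set 'rV[R]_N) (z0 : 'rV[R]_N) :
 (D <= N)%N -> open Om -> Om z0 -> smooth_on Om F -> row_free ('J F z0) ->
 exists (U : set 'rV[R]_N) (V : set 'rV[R]_D) (G : 'rV[R]_D -> 'rV[R]_N),
  [/\ [/\ open U, open V, U z0 & U `<=` Om],
    (forall z, U z -> V (F z) /\ G (F z) = z),
    (forall y, V y -> U (G y) /\ F (G y) = y) & smooth_on V G].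
Proof.
move=> DN oO Oz sF rf.
have E : N = D.
 apply/eqP; rewrite eqn_leq DN andbT; move: rf; rewrite /row_free => /eqP <-.
 exact: rank_leq_col.
subst D; rewrite row_free_unit in rf.
have [U [V [G [[oU oV Uz UO] H1 H2 sG]]]] := inverse_function oO Oz sF rf.
by exists U, V, G; split => // z /H1[].
Qed.

Lemma inv_jac N D (F : 'rV[R]_N -> 'rV[R]_D) (G : 'rV[R]_D -> 'rV[R]_N) U V (z : 'rV[R]_N) :
 open U -> open V -> smooth_on U F -> smooth_on V G -> (forall z, U z -> V (F z) /\ G (F z) = z) ->
 U z -> 'J F z *m 'J G (F z) = 1%:M.
Proof.
move=> oU oV sF sG H Uz; have [Vz _] := H z Uz.
rewrite -(jac_compS oU oV sF sG Uz Vz) -(jac_id z); apply: esym.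
apply: (jac_ext oU Uz) => [|y /H[_ ->]//].
exact: smooth_diff oU (smooth_id oU) Uz.
Qed.

(** [G] inverts the time-one map, so the parameter space X x R^r provides coordinates on an open
    part of P. *)
Record exp_solution m r D n (E : exp_data R m r D n) Z X Th G OF : Prop := ExpSolution {
 es_ok : exp_ok E;
 es_pf : path_family (ed_f E) (@ed_a R D n) (ed_q E) (ed_dom E) (ed_iota E) Z X Th;
 es_dom : forall z, Z z -> OX E (lsubmx z);
 es_oF : open OF;
 es_FG : forall z, Z z -> OF (es_F X z) /\ G (es_F X z) = z;
 es_GF : forall p, OF p -> Z (G p) /\ es_F X (G p) = p;
 es_sG : smooth_on OF G }.

Lemma exp_solution_sub m r D n (E : exp_data R m r D n) Z Z' X Th G OF : open Z' -> Z' `<=` Z ->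
 exp_solution E Z X Th G OF -> exp_solution E Z' X Th G (OF `&` G @^-1` Z').
Proof.
move=> oZ' ZZ [ok pf dm oF FG GF sG]; split => //.
- exact: path_family_sub pf.
- by move=> z /ZZ; exact: dm.
- exact: open_preimS.
- by move=> z Hz; have [? e] := FG z (ZZ _ Hz); rewrite /= e.
- by move=> p [/GF[_ ?] ?].
- by apply: smooth_sub sG => p [].
Qed.

Theorem exp_exists m r D n (E : exp_data R m r D n) (x0 : 'rV[R]_m) :
 exp_ok E -> (D <= m + r)%N -> OX E x0 ->
 row_free (col_mx ('J (ed_i E) x0) (ee E x0 *m Pi E (ed_i E x0))) ->
 exists Z X Th G OF, exp_solution E Z X Th G OF /\ Z (row_mx x0 0).
Proof.
move=> ok DN Ox rf; pose z0 : 'rV[R]_(m + r) := row_mx x0 0.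
have [odom sf sa sq] := ed_smooth ok.
have oOX := ok_oOX ok.
pose Z0 : set 'rV[R]_(m + r) := lsubmx @^-1` OX E.
have oZ0 : open Z0 by exact: smooth_lsub.
have si : smooth_on Z0 (ed_iota E).
 apply: smooth_row_mx => //.
  exact: (smooth_comp oZ0 oOX (fun _ h => h) (smooth_lsubT oZ0) (ok_k ok)).
 apply: smooth_mulmx => //; first exact: smooth_rsubT.
 exact: (smooth_comp oZ0 oOX (fun _ h => h) (smooth_lsubT oZ0) (ok_e ok)).
have Zz0 : Z0 z0 by rewrite /Z0 /= row_mxKl.
have i0 : ed_iota E z0 = row_mx (kk E x0) 0 by rewrite /ed_iota row_mxKl row_mxKr mul0mx.
have [||Z [X [Th [pf [Zz ZZ0]]]]] := paths odom sf sa sq oZ0 si Zz0.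
- by rewrite i0 /ed_dom /= row_mxKl; exact: ok_OX ok _ Ox.
- by rewrite i0; exact: ed_const ok _ Ox.
have sF := smooth_F pf.
(* Followed by the embedding of P, the Jacobian becomes the matrix of TX and of the sharps of the
   frame, which is injective by hypothesis. *)
have rF : row_free ('J (es_F X) z0).
 have [h _] := es_zero_var ok pf ZZ0 Zz (row_mxKr _ _).
 move: h; rewrite row_mxKl (jac_qX1 ok pf Zz) mul_col_mx mul0mx add_col_mx addr0 add0r => h.
 move: rf; rewrite -h /row_free => /eqP e; rewrite eqn_leq rank_leq_row -{1}e.
 exact: mxrankM_maxl.
have [U [V [G [[oU oV Uz UZ] FG GF sG]]]] := inverse_function_dim DN (pf_open pf) Zz sF rF.
exists U, X, Th, G, V; split => //; split => //.
- exact: path_family_sub pf.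
- by move=> z /UZ /ZZ0.
Qed.

Lemma jac_sub N n (W : set 'rV[R]_N) (F G : 'rV[R]_N -> 'rV[R]_n) (z : 'rV[R]_N) :
 open W -> smooth_on W F -> smooth_on W G -> W z -> 'J (fun y => F y - G y) z = 'J F z - 'J G z.
Proof.
move=> oW sF sG Wz; apply/row_matrixP => i.
rewrite (jacE i (smooth_diff oW (smooth_sub_mx oW sF sG) Wz)).
have e1 := jacE i (smooth_diff oW sF Wz); have e2 := jacE i (smooth_diff oW sG Wz).
have -> : row i ('J F z - 'J G z) = row i ('J F z) - row i ('J G z) by rewrite linearB.
have dF := smooth_derivable (v := E_ R i) sF Wz; have dG := smooth_derivable (v := E_ R i) sG Wz.
exact: etrans (deriveB dF dG) (f_equal2 (fun a b => a - b) (esym e1) (esym e2)).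
Qed.

Section Sol.
Variables (m r D n : nat) (E : exp_data R m r D n) (Z : set 'rV[R]_(m + r))
 (X : R -> 'rV[R]_(m + r) -> 'rV[R]_(D + n)) (Th : 'rV[R]_(m + r) -> 'rV[R]_(m + r))
 (G : 'rV[R]_D -> 'rV[R]_(m + r)) (OF : set 'rV[R]_D).
Hypothesis S : exp_solution E Z X Th G OF.

Let ok := es_ok S. Let pf := es_pf S. Let oZ := pf_open pf.
Let sF := smooth_F pf. Let oF := es_oF S.
Let F := es_F X.

Definition es_Q (z : 'rV[R]_(m + r)) : 'M[R]_(m + r) :=
 ('J G (F z))^T *m ed_QP E (F z) *m 'J G (F z).

Lemma es_oZ : open Z. Proof. exact: oZ. Qed.
Lemma es_smF : smooth_on Z F. Proof. exact: sF. Qed.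

Lemma es_JFG z : Z z -> 'J F z *m 'J G (F z) = 1%:M.
Proof. by move=> Hz; apply: (inv_jac oZ oF sF (es_sG S) (es_FG S) Hz). Qed.

Lemma es_JGF z : Z z -> 'J G (F z) *m 'J F z = 1%:M.
Proof.
move=> Hz; have [Fz e] := es_FG S Hz.
have := inv_jac oF oZ (es_sG S) sF (es_GF S) Fz; by rewrite e.
Qed.

Lemma es_sQ : smooth_on Z es_Q.
Proof.
have FOF z : Z z -> OF (F z) by move=> /(es_FG S)[].
have sJ : smooth_on Z (fun z => 'J G (F z)).
 by apply: (smooth_comp oZ oF FOF sF); apply: smooth_jac => //; exact: es_sG S.
apply: smooth_mulmx => //; apply: smooth_mulmx => //; first exact: smooth_tr.
by apply: (smooth_comp oZ (ok_oOP ok) _ sF (smooth_QP ok)) => z Hz; exact: (es_OP pf Hz).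
Qed.

Lemma es_Q_antisym z : Z z -> (es_Q z)^T = - es_Q z.
Proof.
move=> Hz; have := QP_antisym ok (es_OP pf Hz : OP E (F z)); rewrite /es_Q.
move: (ed_QP E (F z)) ('J G (F z)) => P L a; rewrite !trmx_mul trmxK a.
by rewrite mulNmx mulmxN mulmxA.
Qed.

Lemma es_Q_F z : Z z -> ('J F z)^T *m es_Q z *m 'J F z = ed_QP E (F z).
Proof.
move=> Hz; rewrite /es_Q -!mulmxA (es_JGF Hz) mulmx1 !mulmxA -trmx_mul (es_JGF Hz) trmx1.
by rewrite mul1mx.
Qed.

Let J z := 'J (ed_q E \o X 1) z.

Lemma es_Q_J z : Z z -> (J z)^T *m es_Q z *m J z = Pi E (jj E (F z)).
Proof.
move=> Hz; rewrite /J (jac_qX1 ok pf Hz) trmx_mul -(QP_pull ok (es_OP pf Hz)) -(es_Q_F Hz).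
by rewrite !mulmxA.
Qed.

Lemma es_J_inv z : Z z -> J z *m ('J (lam E) (jj E (F z)) *m 'J G (F z)) = 1%:M.
Proof.
move=> Hz; rewrite /J (jac_qX1 ok pf Hz) -mulmxA (mulmxA ('J (jj E) _)).
by rewrite (lam_jac ok (es_OP pf Hz)) mul1mx; exact: es_JFG.
Qed.

Lemma es_Q_jacobi : jacobi Z es_Q.
Proof.
have h11 : 0 <= (1 : R) <= 1 by rewrite ler01 lexx.
have sFt : smooth_on Z (ed_q E \o X 1).
 have [odom _ _ sq] := ed_smooth ok.
 apply: (smooth_comp oZ odom _ (pf_smooth pf h11) sq) => z Hz.
 by have [_ /(_ 1 h11)[]] := pf_flow pf Hz.
apply: (jacobi_pullback oZ (ok_oOm ok) sFt es_sQ (ok_Pi ok)) => [z Hz|z Hz||z Hz|z Hz].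
- exact: (ok_OP ok) (es_OP pf Hz).
- exact: es_Q_antisym.
- exact: (ok_jac ok).
- exact: es_Q_J.
- by apply/row_freeP; eexists; exact: es_J_inv Hz.
Qed.

(** In these coordinates the Poisson structure of P is the pullback of i^! L under the projection to
    X, gauge transformed by d Theta: a covector on X is extended by 0 along the fibres and d (curl
    Th) is added. *)
Lemma es_graph z (c d : 'rV[R]_(m + r)) : Z z -> c *m es_Q z = d <->
 exists b0 : 'rV[R]_n, lsubmx d *m 'J (ed_i E) (lsubmx z) = b0 *m Pi E (ed_i E (lsubmx z)) /\
  c = row_mx (b0 *m ('J (ed_i E) (lsubmx z))^T) 0 + d *m curl Th z.
Proof.
move=> Hz; have JX := es_J_inv Hz; set Y := _ *m 'J G _ in JX.
have YJ : Y^T *m (J z)^T = 1%:M by rewrite -trmx_mul JX trmx1.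
split=> [cd|[b0 [e1 ->]]].
 pose b1 := c *m Y^T.
 have cE : c = b1 *m (J z)^T by rewrite -mulmxA YJ mulmx1.
 have [b0 [e1 e2]] : exists b0, lsubmx d *m 'J (ed_i E) (lsubmx z) = b0 *m Pi E (ed_i E (lsubmx z)) /\
  b1 *m (J z)^T - row_mx (b0 *m ('J (ed_i E) (lsubmx z))^T) 0 = d *m curl Th z.
  apply: (es_key_rev ok pf (es_dom S) Hz).
  by rewrite -/(J z) -cd cE -(es_Q_J Hz) !mulmxA.
 by exists b0; split => //; rewrite -e2 -cE addrC subrK.
have [b1 [e2 e3]] := es_key ok pf (es_dom S) Hz e1.
rewrite -e3 -/(J z) addrC subrK.
have gen (j : 'M[R]_(m + r, n)) q y : d *m j = b1 *m (j^T *m q *m j) -> j *m y = 1%:M -> b1 *m j^T *m q = d.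
 by move=> e jy; have := congr1 (fun A => A *m y) e; rewrite /= !mulmxA -!(mulmxA _ j) jy !mulmx1 => ->.
by apply: gen JX; rewrite (es_Q_J Hz); exact: e2.
Qed.

End Sol.

(** What equality of the quadruples provides in coordinates: the same i^! L, the same pairing of the
    frames with TX, the same form on the frames. *)
Definition compat m r D1 D2 n1 n2 (E1 : exp_data R m r D1 n1) (E2 : exp_data R m r D2 n2) : Prop :=
 forall x, OX E1 x -> OX E2 x ->
 [/\ (forall v c : 'rV[R]_m,
    (exists b, v *m 'J (ed_i E1) x = b *m Pi E1 (ed_i E1 x) /\ c = b *m ('J (ed_i E1) x)^T) <->
    (exists b, v *m 'J (ed_i E2) x = b *m Pi E2 (ed_i E2 x) /\ c = b *m ('J (ed_i E2) x)^T)),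
   ee E1 x *m ('J (ed_i E1) x)^T = ee E2 x *m ('J (ed_i E2) x)^T &
   ee E1 x *m Pi E1 (ed_i E1 x) *m (ee E1 x)^T = ee E2 x *m Pi E2 (ed_i E2 x) *m (ee E2 x)^T].

Section Two.
Variables (m r D1 D2 n1 n2 : nat) (E1 : exp_data R m r D1 n1) (E2 : exp_data R m r D2 n2).
Variables (Z : set 'rV[R]_(m + r)) (X1 : R -> 'rV[R]_(m + r) -> 'rV[R]_(D1 + n1))
 (X2 : R -> 'rV[R]_(m + r) -> 'rV[R]_(D2 + n2))
 (Th1 Th2 : 'rV[R]_(m + r) -> 'rV[R]_(m + r))
 (G1 : 'rV[R]_D1 -> 'rV[R]_(m + r)) (G2 : 'rV[R]_D2 -> 'rV[R]_(m + r)) (OF1 : set 'rV[R]_D1) (OF2 : set 'rV[R]_D2).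
Hypotheses (S1 : exp_solution E1 Z X1 Th1 G1 OF1) (S2 : exp_solution E2 Z X2 Th2 G2 OF2).
Hypothesis co : compat E1 E2.

Let eta z := Th2 z - Th1 z.
Let Q1 := es_Q E1 X1 G1.
Let Q2 := es_Q E2 X2 G2.
Let oZ := es_oZ S1.

Lemma two_smooth_eta : smooth_on Z eta.
Proof. by apply: smooth_sub_mx => //; [exact: pf_smooth1 (es_pf S2)|exact: pf_smooth1 (es_pf S1)]. Qed.

Lemma two_curl z : Z z -> curl eta z = curl Th2 z - curl Th1 z.
Proof.
move=> Hz; have s1 := pf_smooth1 (es_pf S1); have s2 := pf_smooth1 (es_pf S2).
have -> : curl eta z = ('J Th2 z - 'J Th1 z) - ('J Th2 z - 'J Th1 z)^T.
 rewrite /curl; have -> // : 'J eta z = 'J Th2 z - 'J Th1 z.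
 exact: jac_sub oZ s2 s1 Hz.
rewrite /curl; move: ('J Th1 z) ('J Th2 z) => A B.
by apply/matrixP => i j; rewrite !mxE; ring.
Qed.

Lemma two_eta_zero z : Z z -> rsubmx z = 0 -> eta z = 0.
Proof.
move=> Hz z0; rewrite /eta (es_Th_zero (es_ok S1) (es_pf S1) (es_dom S1) Hz z0).
by rewrite (es_Th_zero (es_ok S2) (es_pf S2) (es_dom S2) Hz z0) subrr.
Qed.

Lemma two_curl_zero z : Z z -> rsubmx z = 0 -> curl eta z = 0.
Proof.
move=> Hz z0; have [_ e3 e4] := co (es_dom S1 Hz) (es_dom S2 Hz).
have [_ c1] := es_zero_var (es_ok S1) (es_pf S1) (es_dom S1) Hz z0.
have [_ c2] := es_zero_var (es_ok S2) (es_pf S2) (es_dom S2) Hz z0.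
rewrite (two_curl Hz) c1 c2; apply/eqP; rewrite subr_eq0; apply/eqP.
have B n D (E : exp_data R m r D n) : col_mx 0 (ee E (lsubmx z)) *m (col_mx ('J (ed_i E) (lsubmx z)) 0)^T =
 block_mx 0 0 (ee E (lsubmx z) *m ('J (ed_i E) (lsubmx z))^T) 0 :> 'M[R]_(m + r).
 by rewrite tr_col_mx mul_col_row !mul0mx trmx0 !mulmx0.
have C n D (E : exp_data R m r D n) : col_mx 0 (ee E (lsubmx z)) *m Pi E (ed_i E (lsubmx z)) *m (col_mx 0 (ee E (lsubmx z)))^T =
 block_mx 0 0 0 (ee E (lsubmx z) *m Pi E (ed_i E (lsubmx z)) *m (ee E (lsubmx z))^T) :> 'M[R]_(m + r).
 by rewrite tr_col_mx mul_col_mx mul0mx mul_col_row !mul0mx trmx0 !mulmx0.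
have T n D (E : exp_data R m r D n) : col_mx ('J (ed_i E) (lsubmx z)) 0 *m (col_mx 0 (ee E (lsubmx z)))^T =
 (col_mx 0 (ee E (lsubmx z)) *m (col_mx ('J (ed_i E) (lsubmx z)) 0)^T)^T :> 'M[R]_(m + r).
 by rewrite trmx_mul trmxK.
by rewrite !T !B !C e3 e4.
Qed.

Let lem m' (P Q T : 'M[R]_m') : (forall c : 'rV[R]_m', (c + c *m P *m T) *m Q = c *m P) ->
 (1%:M + P *m T) *m Q = P.
Proof.
move=> H; apply/row_matrixP => i; rewrite rowE mulmxA mulmxDr mulmx1 mulmxA H.
by rewrite -rowE.
Qed.

Let add_curl (c r0 d : 'rV[R]_(m + r)) (A B C : 'M[R]_(m + r)) :
 c = r0 + d *m A -> B = C - A -> c + d *m B = r0 + d *m C.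
Proof. by move=> -> ->; rewrite mulmxBr -addrA (addrC (d *m A)) subrK. Qed.

Let conj_comp (a b c d : nat) (g : 'M[R]_(a, b)) (k : 'M[R]_(b, c)) (f : 'M[R]_(c, d)) (P : 'M[R]_a) (Q : 'M[R]_c) :
 k^T *m (g^T *m P *m g) *m k = Q -> (g *m k *m f)^T *m P *m (g *m k *m f) = f^T *m Q *m f.
Proof. by move=> <-; rewrite !trmx_mul !mulmxA. Qed.

Let anti_swap (k : nat) (P Q K : 'M[R]_k) : P^T = - P -> Q^T = - Q -> K *m Q = P -> P = Q *m K^T.
Proof. by move=> aP aQ e; apply: oppr_inj; rewrite -aP -e trmx_mul aQ mulNmx. Qed.

(** Both graphs are gauge transforms of one Dirac structure, so they differ by B = d eta. Exchanging
    the roles gives (1 + Q1 B)(1 - Q2 B) = 1, which makes the denominator invertible without any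
    smallness. *)
Lemma two_gauge z : Z z -> gauge_den Q1 eta 1 z \in unitmx /\ gauge Q1 eta 1 z = Q2 z.
Proof.
move=> Hz; have [dir _ _] := co (es_dom S1 Hz) (es_dom S2 Hz).
have cB := two_curl Hz; set B := curl eta z in cB.
have E12 : (1%:M + Q1 z *m B) *m Q2 z = Q1 z.
 apply: lem => c; pose d := c *m Q1 z.
 have /(es_graph S1 c d Hz)[b0 [h1 h2]] : c *m Q1 z = d by [].
 have [b0' [h3 h4]] := (dir _ _).1 (ex_intro _ b0 (conj h1 erefl)).
 apply/(es_graph S2 _ _ Hz); exists b0'; split; first exact: h3.
 by rewrite -h4; exact: (add_curl h2 cB).
have E21 : (1%:M + Q2 z *m (- B)) *m Q1 z = Q2 z.
 apply: lem => c; pose d := c *m Q2 z.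
 have /(es_graph S2 c d Hz)[b0 [h1 h2]] : c *m Q2 z = d by [].
 have [b0' [h3 h4]] := (dir _ _).2 (ex_intro _ b0 (conj h1 erefl)).
 apply/(es_graph S1 _ _ Hz); exists b0'; split; first exact: h3.
 have cB' : - B = curl Th1 z - curl Th2 z := etrans (congr1 (fun A => - A) cB) (opprB _ _).
 by rewrite -h4; exact: (add_curl h2 cB').
have aQ1 := es_Q_antisym S1 Hz; have aQ2 := es_Q_antisym S2 Hz.
have aB : B^T = - B by exact: curl_antisym.
have uu : (1%:M + Q1 z *m B) *m (1%:M - Q2 z *m B) = 1%:M.
 by rewrite mulmxBr mulmx1 mulmxA E12 addrK.
have gT : gauge_den Q1 eta 1 z = (1%:M + Q1 z *m B)^T.
 rewrite /gauge_den scale1r -/B raddfD/= trmx1 trmx_mul aB [(Q1 z)^T]aQ1 mulNmx mulmxN opprK.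
 by [].
have ud : gauge_den Q1 eta 1 z \in unitmx.
 by rewrite gT unitmx_tr; case/mulmx1_unit: uu.
split => //; rewrite /gauge; apply: (can_inj (mulmxK ud)); rewrite mulmxKV//.
by rewrite gT; exact: anti_swap aQ1 aQ2 E12.
Qed.

(** [psi] reads a point of P1 in the parameter space, applies Moser's map and maps to P2. At time 1
    the gauge transform of Q1 is Q2, so [psi] is Poisson. The clauses on Moser curves are kept for
    the comparison of charts. *)
Theorem local_iso z0 : Z z0 -> rsubmx z0 = 0 ->
 exists (Z0 : set 'rV[R]_(m + r)) (mu : 'rV[R]_(m + r) -> 'rV[R]_(m + r))
     (O1 : set 'rV[R]_D1) (O2 : set 'rV[R]_D2) (psi' : 'rV[R]_D2 -> 'rV[R]_D1),
  let psi p := es_F X2 (mu (G1 p)) in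
  [/\ [/\ open Z0, Z0 z0, Z0 `<=` Z,
    (forall z, Z0 z -> exists c, [/\ moser_curve Z Q1 eta c, c 0 = z & c 1 = mu z]) &
    (forall z1 (W : set 'rV[R]_(m + r)), Z0 z1 -> rsubmx z1 = 0 -> open W -> W z1 ->
      exists W', [/\ open W', W' z1, W' `<=` Z0 & forall z, W' z ->
       exists c, [/\ moser_curve Z Q1 eta c, c 0 = z, c 1 = mu z & forall t : R, 0 <= t <= 1 -> W (c t)]])],
    [/\ open O1, open O2, O1 (es_F X1 z0) & forall p, O1 p -> OF1 p /\ Z0 (G1 p)],
    [/\ (forall p, O1 p -> O2 (psi p) /\ psi' (psi p) = p),
      (forall q, O2 q -> O1 (psi' q) /\ psi (psi' q) = q),
      smooth_on O1 psi & smooth_on O2 psi'],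
    (forall p, O1 p -> ('J psi p)^T *m ed_QP E1 p *m 'J psi p = ed_QP E2 (psi p)) &
    (forall z, Z0 z -> rsubmx z = 0 -> mu z = z /\ psi (es_F X1 z) = es_F X2 z)].
Proof.
move=> Hz0 z00.
have sQ := es_sQ S1; have se := two_smooth_eta.
have [Z0 [mu [[oZ0 Zz0 Z0Z smu] Hmu Hc Ht]]] :=
 moser oZ sQ se (es_Q_antisym S1) (es_Q_jacobi S1) Hz0 (two_eta_zero Hz0 z00) (two_curl_zero Hz0 z00).
have h01 : 0 <= (0 : R) <= 1 by rewrite lexx ler01.
have h11 : 0 <= (1 : R) <= 1 by rewrite lexx ler01.
have muZ z : Z0 z -> Z (mu z) by move=> /Hc[c [mc _ <-]]; have [] := mc 1 h11.
have mu0 z : Z0 z -> rsubmx z = 0 -> mu z = z.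
 move=> Hz zz; have [c [mc c0 c1]] := Hc z Hz.
 have mcst := @moser_curve_cst R _ Z Q1 eta z (Z0Z _ Hz) (two_eta_zero (Z0Z _ Hz) zz) (two_curl_zero (Z0Z _ Hz) zz).
 by rewrite -c1 (moser_unique oZ sQ se mc mcst c0 h11).
have [uJ _] := Hmu _ Zz0.
have [U [V [Gm [[oU oV Uz UZ] FGm GFm sGm]]]] := inverse_function oZ0 Zz0 smu uJ.
have sF1 := es_smF S1; have sF2 := es_smF S2.
have oF1 := es_oF S1; have oF2 := es_oF S2.
have sG1 := es_sG S1; have sG2 := es_sG S2.
pose O1 := OF1 `&` G1 @^-1` U; pose O2 := OF2 `&` G2 @^-1` (Z `&` V).
have VZ y : V y -> Z y by move=> /GFm[Uy <-]; apply: muZ; exact: UZ.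
have o1 : open O1 by exact: open_preimS.
have o2 : open O2 by apply: open_preimS => //; exact: openI.
pose psi p := es_F X2 (mu (G1 p)); pose psi' q := es_F X1 (Gm (G2 q)).
have sGmu p : O1 p -> Z0 (G1 p) by move=> [_ /UZ].
have spsi1 : smooth_on O1 (fun p => mu (G1 p)).
 by apply: (smooth_comp o1 oZ0 sGmu _ smu); apply: smooth_sub sG1 => p [].
have mZ p : O1 p -> Z (mu (G1 p)) by move=> /sGmu; exact: muZ.
have spsi : smooth_on O1 psi by apply: (smooth_comp o1 oZ mZ spsi1 sF2).
exists Z0, mu, O1, O2, psi'; split.
- split => // z1 W Hz1 zz oW Wz1.
 apply: Ht => //; [exact: two_eta_zero (Z0Z _ Hz1) zz|exact: two_curl_zero (Z0Z _ Hz1) zz].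
- split => //; first by have [? e] := es_FG S1 Hz0; split => //=; rewrite e.
 by move=> p Op; have [? _] := Op; split => //; exact: sGmu.
- split => //.
 + move=> p [Fp Up]; have [Vm em] : V (mu (G1 p)) /\ Gm (mu (G1 p)) = G1 p by have [] := FGm _ Up.
  have Zm := VZ _ Vm; have [Fm e2] := es_FG S2 Zm.
  split; first by split => //=; rewrite /psi e2.
  by rewrite /psi' /psi e2 em; exact: (es_GF S1 Fp).2.
 + move=> q [Fq [Zq Vq]]; have [Um em] := GFm _ Vq; have Zm := Z0Z _ (UZ _ Um).
  have [Fm e1] := es_FG S1 Zm.
  split; first by split => //=; rewrite /psi' e1.
  by rewrite /psi' e1 em; exact: (es_GF S2 Fq).2.
 + have s1 : smooth_on O2 (fun q => Gm (G2 q)).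
   apply: (smooth_comp o2 oV _ _ sGm); first by move=> q [_ []].
   by apply: smooth_sub sG2 => q [].
  apply: (smooth_comp o2 oZ _ s1 sF1) => q [Fq [Zq Vq]].
  by have [/UZ/Z0Z] := GFm _ Vq.
- move=> p Op; have [Fp Up] := Op; have Zp := sGmu _ Op; have Zm := mZ _ Op.
 have [_ P] := Hmu _ Zp; have [_ g2] := two_gauge Zm; rewrite g2 in P.
 have eG := (es_GF S1 Fp).2; have ZG := (es_GF S1 Fp).1.
 have Jp : 'J (fun p => es_F X2 (mu (G1 p))) p = 'J G1 p *m 'J mu (G1 p) *m 'J (es_F X2) (mu (G1 p)).
  rewrite (jac_compS (F := fun p => mu (G1 p)) o1 oZ spsi1 sF2 Op Zm).
  by rewrite (jac_compS oF1 oZ0 sG1 smu Fp Zp).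
 have Q1E : es_Q E1 X1 G1 (G1 p) = ('J G1 p)^T *m ed_QP E1 p *m 'J G1 p by rewrite /es_Q eG.
 rewrite Q1E in P; rewrite Jp -(es_Q_F S2 Zm); exact: conj_comp P.
- move=> z Hz zz; have e := mu0 z Hz zz; split => //.
 by have [_ e2] := es_FG S1 (Z0Z _ Hz); rewrite e2 e.
Qed.

End Two.
End LocalIso.

(** * Dependence on charts and frames *)

Section Naturality.
Variable R : realType.

(** The change of bundle coordinates on the cotangent bundle induced by [kM]: covectors transform by
    the transposed inverse Jacobian. *)
Definition cot_lift n (kM : 'rV[R]_n -> 'rV[R]_n) (u : 'rV[R]_(n + n)) : 'rV[R]_(n + n) :=
 row_mx (kM (lsubmx u)) (rsubmx u *m (invmx ('J kM (lsubmx u)))^T).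

(** Two coordinate descriptions of the same geometry: [tX], [kP], [kM] change charts on X, P, M, and
    [g] changes the frame. [tr_g] says that the two local fields represent one spray. *)
Record transition m r D n (E E' : exp_data R m r D n) (tX : 'rV[R]_m -> 'rV[R]_m) (g : 'rV[R]_m -> 'M[R]_r)
  (kP : 'rV[R]_D -> 'rV[R]_D) (kM : 'rV[R]_n -> 'rV[R]_n)
  (UX : set 'rV[R]_m) (UP : set 'rV[R]_D) (UM : set 'rV[R]_n) : Prop := Transition {
 tr_open : [/\ open UX, open UP & open UM];
 tr_X : forall x, UX x -> [/\ OX E x, OX E' (tX x), UP (kk E x) & kk E' (tX x) = kP (kk E x)];
 tr_P : forall p, UP p -> [/\ OP E p, OP E' (kP p), UM (jj E p) & jj E' (kP p) = kM (jj E p)];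
 tr_M : forall q, UM q -> [/\ Om E q, Om E' (kM q), 'J kM q \in unitmx &
  Pi E' (kM q) = ('J kM q)^T *m Pi E q *m 'J kM q];
 tr_smooth : [/\ smooth_on UX tX, smooth_on UP kP, smooth_on UM kM & smooth_on UX g];
 tr_e : forall x, UX x -> ee E x = g x *m ee E' (tX x) *m ('J kM (ed_i E x))^T;
 tr_g : forall u, UM (lsubmx u) ->
  row_mx (rsubmx (cot_lift kM u) *m Pi E' (kM (lsubmx u))) (gg E' (cot_lift kM u)) =
  row_mx (rsubmx u *m Pi E (lsubmx u)) (gg E u) *m 'J (cot_lift kM) u }.

Definition tau_map m r (tX : 'rV[R]_m -> 'rV[R]_m) (g : 'rV[R]_m -> 'M[R]_r) (z : 'rV[R]_(m + r)) : 'rV[R]_(m + r) :=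
 row_mx (tX (lsubmx z)) (rsubmx z *m g (lsubmx z)).

Section One.
Variables (m r D n : nat) (E E' : exp_data R m r D n) (tX : 'rV[R]_m -> 'rV[R]_m) (g : 'rV[R]_m -> 'M[R]_r)
  (kP : 'rV[R]_D -> 'rV[R]_D) (kM : 'rV[R]_n -> 'rV[R]_n)
  (UX : set 'rV[R]_m) (UP : set 'rV[R]_D) (UM : set 'rV[R]_n).
Hypothesis T : transition E E' tX g kP kM UX UP UM.
Hypotheses (ok : exp_ok E) (ok' : exp_ok E').

Let oUX : open UX. Proof. by case: (tr_open T). Qed.
Let oUP : open UP. Proof. by case: (tr_open T). Qed.
Let oUM : open UM. Proof. by case: (tr_open T). Qed.
Let skP : smooth_on UP kP. Proof. by case: (tr_smooth T). Qed.
Let skM : smooth_on UM kM. Proof. by case: (tr_smooth T). Qed.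
Let stX : smooth_on UX tX. Proof. by case: (tr_smooth T). Qed.
Let sg : smooth_on UX g. Proof. by case: (tr_smooth T). Qed.
Let sj : smooth_on UP (jj E). Proof. by apply: smooth_sub (ok_j ok) => p /(tr_P T)[]. Qed.

Definition liftP (u : 'rV[R]_(D + n)) : 'rV[R]_(D + n) :=
 row_mx (kP (lsubmx u)) (rsubmx u *m (invmx ('J kM (jj E (lsubmx u))))^T).

Let Dm : set 'rV[R]_(D + n) := lsubmx @^-1` UP.
Let oDm : open Dm. Proof. exact: smooth_lsub. Qed.
Let iota (u : 'rV[R]_(D + n)) : 'rV[R]_(n + n) := row_mx (jj E (lsubmx u)) (rsubmx u).
Let siota : smooth_on Dm iota.
Proof.
apply: smooth_row_mx => //; last exact: smooth_rsubT.
exact: (smooth_comp oDm oUP (fun _ h => h) (smooth_lsubT oDm) sj).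
Qed.
Let DmM u : Dm u -> UM (jj E (lsubmx u)). Proof. by move=> /(tr_P T)[]. Qed.
Let sinv : smooth_on UM (fun q => (invmx ('J kM q))^T).
Proof.
apply: smooth_tr => //; apply: smooth_invmx => // [q /(tr_M T)[]//|]; exact: smooth_jac.
Qed.
Let DM : set 'rV[R]_(n + n) := lsubmx @^-1` UM.
Let oDM : open DM. Proof. exact: smooth_lsub. Qed.
Let scot : smooth_on DM (cot_lift kM).
Proof.
have sl := smooth_lsubT oDM; apply: smooth_row_mx => //.
 exact: (smooth_comp oDM oUM (fun _ h => h) sl skM).
apply: smooth_mulmx => //; first exact: smooth_rsubT.
exact: (smooth_comp oDM oUM (fun _ h => h) sl sinv).
Qed.
Let iotaDM u : Dm u -> DM (iota u). Proof. by move=> du; rewrite /DM /= /iota row_mxKl; exact: DmM. Qed.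

Let smlift : smooth_on Dm liftP.
Proof.
have sl := smooth_lsubT oDm; apply: smooth_row_mx => //.
 exact: (smooth_comp oDm oUP (fun _ h => h) sl skP).
apply: smooth_mulmx => //; first exact: smooth_rsubT.
apply: (smooth_comp oDm oUM DmM _ sinv).
exact: (smooth_comp oDm oUP (fun _ h => h) sl sj).
Qed.

Let rlift u : rsubmx (liftP u) = rsubmx (cot_lift kM (iota u)).
Proof. by rewrite /liftP /cot_lift /iota !row_mxKr row_mxKl. Qed.

Lemma trans_j p : UP p -> 'J kP p *m 'J (jj E') (kP p) = 'J (jj E) p *m 'J kM (jj E p).
Proof.
move=> Up; have [Op Op' Uj _] := tr_P T Up.
rewrite -(jac_compS oUP (ok_oOP ok') skP (ok_j ok') Up Op') -(jac_compS oUP oUM sj skM Up Uj).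
apply: (jac_ext oUP Up) => [|y /(tr_P T)[]//].
apply: differentiable_comp (smooth_diff oUP skP Up) _.
exact: smooth_diff (ok_oOP ok') (ok_j ok') Op'.
Qed.

Lemma trans_QP p : UP p -> ed_QP E' (kP p) = ('J kP p)^T *m ed_QP E p *m 'J kP p.
Proof.
move=> Up; have [Op Op' Uj jE] := tr_P T Up; have [_ _ _ PE] := tr_M T Uj.
apply: esym; apply: (QP_uniq ok' Op'); rewrite jE PE -(QP_pull ok Op).
have := trans_j Up; move: ('J kP p) ('J (jj E') _) ('J (jj E) p) ('J kM _) (ed_QP E p) => a b c d q e.
by rewrite !mulmxA -trmx_mul e -!mulmxA e trmx_mul !mulmxA.
Qed.

Let fst_alg (a : 'rV[R]_n) (P P' c : 'M[R]_n) (k : 'M[R]_D) (y : 'M[R]_(n, D)) (j j' : 'M[R]_(D, n))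
  (l l' : 'M[R]_(n, D)) : c \in unitmx -> P = y *m j -> P' = c^T *m P *m c -> k *m j' = j *m c ->
 j *m l = 1%:M -> j' *m l' = 1%:M ->
 a *m (invmx c)^T *m P' *m l' = a *m P *m l *m k.
Proof.
move=> uc -> -> kj jl jl'; rewrite trmx_inv !mulmxA mulmxKV ?unitmx_tr//.
by rewrite -!mulmxA (mulmxA j c) -kj -!mulmxA jl' mulmx1 (mulmxA j l) jl mul1mx.
Qed.

(** The lifted change of charts intertwines the two fields on states, so uniqueness of solutions
    yields [trans_X]. *)
Lemma trans_f u : Dm u -> ed_f E' (liftP u) = ed_f E u *m 'J liftP u.
Proof.
move=> du; have [Op Op' Uj jE] := tr_P T du; have [OM OM' uc PE] := tr_M T Uj.
have tg := tr_g T (iotaDM du).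
have qa' : row_mx (ed_q E' (liftP u)) (ed_a (liftP u)) = cot_lift kM (iota u).
 by rewrite /ed_q /ed_a /liftP row_mxKl row_mxKr jE /cot_lift /iota row_mxKl row_mxKr.
rewrite -[RHS]hsubmxK; congr row_mx.
 have -> : lsubmx (ed_f E u *m 'J liftP u) = lsubmx (ed_f E u) *m 'J kP (lsubmx u).
  rewrite -(derJ _ oDm smlift du).
  have sl := smooth_lsubT oDm; have skl := smooth_comp oDm oUP (fun _ h => h) sl skP.
  have -> : lsubmx ('D_(ed_f E u) liftP u) = 'D_(ed_f E u) (fun u => kP (lsubmx u)) u.
   apply/rowP => i; rewrite mxE (derive_entry _ _ _ smlift du) (derive_entry _ _ _ skl du).
   have -> // : (fun z => liftP z 0 (lshift n i)) = (fun z => kP (lsubmx z) 0 i).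
   by apply/funext => y; rewrite /liftP row_mxEl.
  rewrite (derJ _ oDm skl du) (jac_compS oDm oUP sl skP du du) jac_lsub mulmxA.
  by rewrite -[X in X *m _ *m _]hsubmxK mul_row_col mulmx1 mulmx0 addr0.
 rewrite /ed_f row_mxKl /ed_a /ed_q /liftP row_mxKl row_mxKr jE.
 have /submxP[y Py] := ok_Pij ok Op.
 apply: (fst_alg _ uc Py PE (trans_j du) (lam_jac ok Op)) => //.
 by have := lam_jac ok' Op'; rewrite jE.
rewrite qa'.
have -> : gg E' (cot_lift kM (iota u)) = rsubmx (row_mx (ed_a u *m Pi E (ed_q E u)) (gg E (iota u)) *m 'J (cot_lift kM) (iota u)).
 have i1 : rsubmx (iota u) = ed_a u by rewrite /iota row_mxKr.
 have i2 : lsubmx (iota u) = ed_q E u by rewrite /iota row_mxKl.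
 have e2 := congr1 (fun v => rsubmx v) tg; rewrite /= row_mxKr i1 i2 in e2; exact: e2.
have -> : row_mx (ed_a u *m Pi E (ed_q E u)) (gg E (iota u)) = ed_f E u *m 'J iota u.
 have sl := smooth_lsubT oDm; have sjl := smooth_comp oDm oUP (fun _ h => h) sl sj.
 rewrite /iota (jac_row_mx oDm sjl (smooth_rsubT oDm) du) mul_mx_row; congr row_mx.
  exact: (f_jac_q ok (u := u) Op).
 by rewrite jac_rsub -[X in X *m _]hsubmxK mul_row_col mulmx1 mulmx0 add0r /ed_f row_mxKr.
rewrite -mulmxA -(jac_compS oDm oDM siota scot du (iotaDM du)).
have scomp := smooth_comp oDm oDM iotaDM siota scot.
rewrite -(derJ _ oDm scomp du) -(derJ _ oDm smlift du).
apply/rowP => i; rewrite !mxE (derive_entry _ _ _ scomp du) (derive_entry _ _ _ smlift du).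
congr ('D_(_) _ u); apply/funext => y.
by have := congr1 (fun v : 'rV[R]_n => v 0 i) (rlift y); rewrite !mxE.
Qed.

Section Sol.
Variables (Z Z' : set 'rV[R]_(m + r)) (X X' : R -> 'rV[R]_(m + r) -> 'rV[R]_(D + n))
 (Th Th' : 'rV[R]_(m + r) -> 'rV[R]_(m + r)) (G G' : 'rV[R]_D -> 'rV[R]_(m + r)) (OF OF' : set 'rV[R]_D).
Hypotheses (S : exp_solution E Z X Th G OF) (S' : exp_solution E' Z' X' Th' G' OF').
Let tau := tau_map tX g.
Let pf := es_pf S. Let pf' := es_pf S'.

Let UZ : set 'rV[R]_(m + r) := lsubmx @^-1` UX.
Let oUZ : open UZ. Proof. exact: smooth_lsub. Qed.

Lemma smooth_tau : smooth_on UZ tau.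
Proof.
have sl := smooth_lsubT oUZ; apply: smooth_row_mx => //.
 exact: (smooth_comp oUZ oUX (fun _ h => h) sl stX).
apply: smooth_mulmx => //; first exact: smooth_rsubT.
exact: (smooth_comp oUZ oUX (fun _ h => h) sl sg).
Qed.

Definition trans_dom (z : 'rV[R]_(m + r)) : Prop :=
 [/\ Z z, Z' (tau z), UX (lsubmx z) & forall t : R, 0 <= t <= 1 -> UP (lsubmx (X t z))].

Lemma trans_iota z : UX (lsubmx z) -> ed_iota E' (tau z) = liftP (ed_iota E z).
Proof.
move=> Ux; have [Ox Ox' Uk kE] := tr_X T Ux; have [_ _ Uj _] := tr_P T Uk; have [_ _ uc _] := tr_M T Uj.
rewrite /ed_iota /tau /tau_map /liftP !row_mxKl !row_mxKr kE; congr row_mx.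
rewrite (tr_e T Ux) /ed_i trmx_inv !mulmxA mulmxK ?unitmx_tr//.
Qed.

Lemma trans_X z : trans_dom z -> forall t : R, 0 <= t <= 1 -> X' t (tau z) = liftP (X t z).
Proof.
move=> [Hz Hz' Ux HU]; have [odom' sf' _ _] := ed_smooth ok'.
have [X0 HX] := pf_flow pf Hz; have [X0' HX'] := pf_flow pf' Hz'.
apply: (ode_unique_open odom' sf' HX') => [t t01|]; last by rewrite X0 X0'; exact: trans_iota.
have Ut := HU t t01; have [_ Op' _ _] := tr_P T Ut; split; first by rewrite /ed_dom /= /liftP row_mxKl.
rewrite (trans_f Ut); have [_ dX] := HX t t01.
exact: is_derive_jac dX (smooth_diff oDm smlift Ut).
Qed.

Lemma trans_F z : trans_dom z -> es_F X' (tau z) = kP (es_F X z).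
Proof.
move=> dz; have h11 : 0 <= (1 : R) <= 1 by rewrite ler01 lexx.
by rewrite /es_F (trans_X dz h11) /liftP row_mxKl.
Qed.

(** Paths from the zero section are constant and hence stay in the common chart domain; the tube
    property extends this to nearby parameters. *)
Lemma trans_dom_near z : Z z -> Z' (tau z) -> UX (lsubmx z) -> rsubmx z = 0 ->
 exists W, [/\ open W, W z & forall y, W y -> trans_dom y].
Proof.
move=> Hz Hz' Ux z0.
have HU (t : R) : 0 <= t <= 1 -> Dm (X t z).
 move=> t01; rewrite (es_zero ok pf (es_dom S) Hz z0 t01) /Dm /= row_mxKl.
 by have [] := tr_X T Ux.
have [W1 [oW1 W1z W1Z HW1]] := pf_tube pf Hz oDm HU.
exists (W1 `&` (UZ `&` tau @^-1` Z')); split.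
- apply: openI => //; exact: open_preimS oUZ (pf_open pf') smooth_tau.
- by split => //; split.
- by move=> y [Wy [Uy Zy]]; split => //; [exact: W1Z|move=> t t01; exact: HW1].
Qed.

Section Dom.
Variable W : set 'rV[R]_(m + r).
Hypotheses (oW : open W) (HW : forall y, W y -> trans_dom y).
Let WZ y : W y -> Z y. Proof. by move=> /HW[]. Qed.
Let WZ' y : W y -> Z' (tau y). Proof. by move=> /HW[]. Qed.
Let stau : smooth_on W tau. Proof. by apply: smooth_sub smooth_tau => y /HW[]. Qed.
Let F := es_F X. Let F' := es_F X'.

Lemma trans_Jtau z : W z -> 'J tau z *m 'J F' (tau z) = 'J F z *m 'J kP (F z).
Proof.
move=> Wz; have [Hz Hz' _ HU] := HW Wz.
have h11 : 0 <= (1 : R) <= 1 by rewrite ler01 lexx.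
have sF : smooth_on W F by apply: smooth_sub (es_smF S).
have UF y : W y -> UP (F y) by move=> /HW[_ _ _ /(_ 1 h11)].
rewrite -(jac_compS oW (es_oZ S') stau (es_smF S') Wz Hz') -(jac_compS oW oUP sF skP Wz (UF _ Wz)).
apply: (jac_ext oW Wz) => [|y /HW dy]; last exact: trans_F.
apply: differentiable_comp (smooth_diff oW stau Wz) _.
exact: smooth_diff (es_oZ S') (es_smF S') Hz'.
Qed.

Let inv_swap (N D' : nat) (t : 'M[R]_N) (f f' : 'M[R]_(N, D')) (k : 'M[R]_D') (h h' : 'M[R]_(D', N)) :
 t *m f' = f *m k -> h *m f = 1%:M -> f' *m h' = 1%:M -> k *m h' = h *m t.
Proof.
move=> e e1 e2; rewrite -[k]mul1mx -e1 -(mulmxA h) -e -!mulmxA e2 mulmx1.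
by [].
Qed.

Let conj_swap (N D' : nat) (t : 'M[R]_N) (k q : 'M[R]_D') (h h' : 'M[R]_(D', N)) :
 k *m h' = h *m t -> h'^T *m (k^T *m q *m k) *m h' = t^T *m (h^T *m q *m h) *m t.
Proof. by move=> e; rewrite !mulmxA -!trmx_mul -!(mulmxA _ k) e !mulmxA. Qed.

Lemma trans_Q z : W z -> es_Q E' X' G' (tau z) = ('J tau z)^T *m es_Q E X G z *m 'J tau z.
Proof.
move=> Wz; have [Hz Hz' _ HU] := HW Wz.
have h11 : 0 <= (1 : R) <= 1 by rewrite ler01 lexx.
have UF : UP (F z) by exact: HU.
have e := trans_Jtau Wz; have e1 := es_JGF S Hz; have e2 := es_JFG S' Hz'.
rewrite /es_Q (trans_F (HW Wz)) -/F (trans_QP UF).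
have {}e2 : 'J F' (tau z) *m 'J G' (kP (F z)) = 1%:M by rewrite -(trans_F (HW Wz)).
have k : 'J kP (F z) *m 'J G' (kP (F z)) = 'J G (F z) *m 'J tau z.
 exact: inv_swap e e1 e2.
exact: conj_swap k.
Qed.

(** Theta is intrinsic because <a, dq> is unchanged by a lifted change of coordinates. *)
Lemma trans_Th z : W z -> Th z = Th' (tau z) *m ('J tau z)^T.
Proof.
move=> Wz; have [Hz Hz' _ HU] := HW Wz.
have [h [h0 h1 dh]] := pf_int pf Hz; have [h' [h0' h1' dh']] := pf_int pf' Hz'.
have [_ _ _ sq'] := ed_smooth ok'; have [odom _ _ sq] := ed_smooth ok; have [odom' _ _ _] := ed_smooth ok'.
have dk (t : R) : 0 <= t <= 1 -> is_derive t 1 (fun s => h s - h' s *m ('J tau z)^T) 0.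
 move=> t01; have Ut := HU t t01; have [Op _ Uj jE] := tr_P T Ut; have [_ _ uc _] := tr_M T Uj.
 have d2 := is_derive_mulmx (dh' t t01) (is_derive_cst ('J tau z)^T t 1).
 have := is_deriveB (dh t t01) d2; rewrite mulmx0 addr0.
 set e := (X in is_derive _ _ _ X -> _); suff -> : e = 0 by [].
 have XW y : W y -> ed_dom E' (X' t (tau y)) by move=> /WZ' Hy; have [_ /(_ t t01)[]] := pf_flow pf' Hy.
 have XW0 y : W y -> ed_dom E (X t y) by move=> /WZ Hy; have [_ /(_ t t01)[]] := pf_flow pf Hy.
 have sX' := pf_smooth pf' t01; have sX : smooth_on W (X t) by apply: smooth_sub (pf_smooth pf t01).
 have sqX' : smooth_on Z' (ed_q E' \o X' t).
  apply: (smooth_comp (es_oZ S') odom' _ sX' sq') => y Hy; by have [_ /(_ t t01)[]] := pf_flow pf' Hy.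
 have sqX : smooth_on W (ed_q E \o X t) by exact: (smooth_comp oW odom XW0 sX sq).
 have UqX y : W y -> UM ((ed_q E \o X t) y).
  by move=> /HW[_ _ _ /(_ t t01)/(tr_P T)[]].
 have J1 : 'J tau z *m 'J (ed_q E' \o X' t) (tau z) = 'J (ed_q E \o X t) z *m 'J kM (ed_q E (X t z)).
  rewrite -(jac_compS oW (es_oZ S') stau sqX' Wz Hz') -(jac_compS oW oUM sqX skM Wz (UqX _ Wz)).
  apply: (jac_ext oW Wz) => [|y Wy].
   apply: differentiable_comp (smooth_diff oW stau Wz) _.
   exact: smooth_diff (es_oZ S') sqX' Hz'.
  rewrite /= (trans_X (HW Wy) t01) /ed_q /liftP row_mxKl.
  by have [_ _ _ /(_ t t01)/(tr_P T)[]] := HW Wy.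
 rewrite /e -mulmxA -trmx_mul J1 trmx_mul mulmxA (trans_X (HW Wz) t01) /ed_a /liftP row_mxKr.
 by rewrite trmx_inv mulmxKV ?unitmx_tr// subrr.
have := der0_const_mx ler01 dk; rewrite h0 h0' mul0mx subrr h1 h1' => /esym/eqP.
by rewrite subr_eq0 => /eqP.
Qed.

End Dom.
End Sol.
End One.

(** The exterior derivative commutes with pullback: the second derivatives of [tau] form a symmetric
    matrix and cancel. *)
Lemma curl_pullback N (W V : set 'rV[R]_N) (tau eta eta' : 'rV[R]_N -> 'rV[R]_N) (z : 'rV[R]_N) :
 open W -> open V -> smooth_on W tau -> smooth_on W eta -> smooth_on V eta' ->
 (forall y, W y -> V (tau y) /\ eta y = eta' (tau y) *m ('J tau y)^T) -> W z ->
 curl eta z = 'J tau z *m curl eta' (tau z) *m ('J tau z)^T.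
Proof.
move=> oW oV st se se' H Wz; have sJ := smooth_jac oW st; have sJT := smooth_tr oW sJ.
have tV y (Wy : W y) := (H y Wy).1.
have sc : smooth_on W (fun y => eta' (tau y)) := smooth_comp oW oV tV st se'.
pose S : 'M[R]_N := \matrix_(i, j) (eta' (tau z) *m ('D_(E_ R i) (fun y => 'J tau y) z)^T) 0 j.
have DJE i j k : ('D_(E_ R i) (fun y => 'J tau y) z) j k = 'D_(E_ R i) ('D_(E_ R j) (fun y => tau y 0 k)) z.
 rewrite (derive_entry _ _ _ sJ Wz).
 by apply: (derive_near_ext _ oW Wz) => y Wy; exact: jac_entry j k oW st Wy.
have ST : S^T = S.
 apply/matrixP => i j; rewrite trE [LHS]mxE [RHS]mxE [LHS]mulmx_trE [RHS]mulmx_trE.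
 apply: eq_bigr => k _; have e1 := DJE j i k; have e2 := DJE i j k.
 apply: (f_equal2 _ erefl).
 exact: etrans e1 (etrans (D_sym (E_ R i) (E_ R j) oW (smooth_entry oW 0 k st) Wz) (esym e2)).
have JE : 'J eta z = 'J tau z *m 'J eta' (tau z) *m ('J tau z)^T + S.
 apply/row_matrixP => i.
 rewrite (jacE i (smooth_diff oW se Wz)).
 rewrite (derive_near_ext (g := fun y => eta' (tau y) *m ('J tau y)^T) _ oW Wz); last first.
  by move=> y /H[].
 rewrite (derive_mulmx _ oW sc sJT Wz) (derive_tr _ oW sJ Wz).
 rewrite (derJ _ oW sc Wz) (jac_compS oW oV st se' Wz (tV _ Wz)) linearD/=.
 apply: f_equal2; first by rewrite {1}/E_ -rowE !row_mul.
 by apply/rowP => j; rewrite [RHS]mxE [RHS]mxE.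
rewrite /curl JE; clearbody S; clear -ST; move: ('J tau z) ('J eta' _) ST => a b sT.
rewrite [(_ + S)^T]linearD/= sT !trmx_mul trmxK mulmxBr mulmxBl !mulmxA.
by apply/matrixP => i j; rewrite !mxE; ring.
Qed.

Section TwoNat.
Variables (m r D1 D2 n1 n2 : nat).
Variables (E1 E1' : exp_data R m r D1 n1) (E2 E2' : exp_data R m r D2 n2).
Variables (tX : 'rV[R]_m -> 'rV[R]_m) (g : 'rV[R]_m -> 'M[R]_r) (UX1 UX2 : set 'rV[R]_m)
 (kP1 : 'rV[R]_D1 -> 'rV[R]_D1) (kM1 : 'rV[R]_n1 -> 'rV[R]_n1) (UP1 : set 'rV[R]_D1) (UM1 : set 'rV[R]_n1)
 (kP2 : 'rV[R]_D2 -> 'rV[R]_D2) (kM2 : 'rV[R]_n2 -> 'rV[R]_n2) (UP2 : set 'rV[R]_D2) (UM2 : set 'rV[R]_n2).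
Hypotheses (T1 : transition E1 E1' tX g kP1 kM1 UX1 UP1 UM1) (T2 : transition E2 E2' tX g kP2 kM2 UX2 UP2 UM2).
Variables (Z Z' : set 'rV[R]_(m + r)).
Variables (X1 X1' : R -> 'rV[R]_(m + r) -> 'rV[R]_(D1 + n1)) (X2 X2' : R -> 'rV[R]_(m + r) -> 'rV[R]_(D2 + n2))
 (Th1 Th1' Th2 Th2' : 'rV[R]_(m + r) -> 'rV[R]_(m + r))
 (G1 G1' : 'rV[R]_D1 -> 'rV[R]_(m + r)) (G2 G2' : 'rV[R]_D2 -> 'rV[R]_(m + r))
 (OF1 OF1' : set 'rV[R]_D1) (OF2 OF2' : set 'rV[R]_D2).
Hypotheses (S1 : exp_solution E1 Z X1 Th1 G1 OF1) (S1' : exp_solution E1' Z' X1' Th1' G1' OF1').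
Hypotheses (S2 : exp_solution E2 Z X2 Th2 G2 OF2) (S2' : exp_solution E2' Z' X2' Th2' G2' OF2').
Let tau := tau_map tX g.
Let eta z := Th2 z - Th1 z. Let eta' z := Th2' z - Th1' z.
Let Q := es_Q E1 X1 G1. Let Q' := es_Q E1' X1' G1'.

Let gauge_alg (s : R) (t b' q : 'M[R]_(m + r)) : t \in unitmx ->
 1%:M + s *: (t *m b' *m t^T *m q) \in unitmx ->
 1%:M + s *: (b' *m (t^T *m q *m t)) \in unitmx /\
 t^T *m q *m t *m invmx (1%:M + s *: (b' *m (t^T *m q *m t))) =
 t^T *m (q *m invmx (1%:M + s *: (t *m b' *m t^T *m q))) *m t.
Proof.
move=> ut u; set a := 1%:M + _; set c := 1%:M + _ in u *.
have e : t *m a = c *m t.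
 by rewrite /a /c mulmxDr mulmxDl mulmx1 mul1mx -scalemxAr -scalemxAl !mulmxA.
have ua : a \in unitmx.
 by have := unitmx_mul t a; rewrite ut /= => <-; rewrite e unitmx_mul u ut.
split => //; rewrite -!mulmxA; congr (_ *m (_ *m _)).
by apply: (can_inj (mulKmx u)); rewrite mulKVmx// mulmxA -e mulmxK.
Qed.

Let field_alg (e : 'rV[R]_(m + r)) (t k : 'M[R]_(m + r)) :
 - (e *m (t^T *m k *m t)) = - (e *m t^T *m k) *m t.
Proof. by rewrite mulNmx !mulmxA. Qed.

(** [tau] matches the bivectors, eta and d eta of the two pieces, hence maps Moser curves to Moser
    curves, and uniqueness of these gives mu' o tau = tau o mu near the point. Only curves confined
    to the domain of [tau] can be compared, which is what the tube clause provides. *)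
Theorem local_iso_natural (Z0 Z0' : set 'rV[R]_(m + r)) (mu mu' : 'rV[R]_(m + r) -> 'rV[R]_(m + r)) (z : 'rV[R]_(m + r)) :
 Z0 z -> rsubmx z = 0 -> UX1 (lsubmx z) -> UX2 (lsubmx z) -> Z0' (tau z) -> 'J tau z \in unitmx ->
 Z0 `<=` Z -> open Z0' -> Z0' `<=` Z' ->
 (forall z, Z0' z -> exists c, [/\ moser_curve Z' Q' eta' c, c 0 = z & c 1 = mu' z]) ->
 (forall z1 (W : set 'rV[R]_(m + r)), Z0 z1 -> rsubmx z1 = 0 -> open W -> W z1 ->
   exists W', [/\ open W', W' z1, W' `<=` Z0 & forall z, W' z ->
    exists c, [/\ moser_curve Z Q eta c, c 0 = z, c 1 = mu z & forall t : R, 0 <= t <= 1 -> W (c t)]]) ->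
 exists V, [/\ open V, V (es_F X1 z), V `<=` OF1 & forall p, V p -> [/\ OF1' (kP1 p), UP1 p &
  es_F X2' (mu' (G1' (kP1 p))) = kP2 (es_F X2 (mu (G1 p)))]].
Proof.
move=> Hz0 zz U1 U2 Hz0' uJ Z0Z oZ0' Z0Z' Hc' Ht.
have h01 : 0 <= (0 : R) <= 1 by rewrite lexx ler01.
have h11 : 0 <= (1 : R) <= 1 by rewrite ler01 lexx.
have Hz := Z0Z _ Hz0; have Hz' := Z0Z' _ Hz0'.
have [W1 [oW1 W1z HW1]] := trans_dom_near T1 (es_ok S1) S1 S1' Hz Hz' U1 zz.
have [W2 [oW2 W2z HW2]] := trans_dom_near T2 (es_ok S2) S2 S2' Hz Hz' U2 zz.
have st1 : smooth_on W1 tau by apply: smooth_sub (smooth_tau T1) => y /HW1[].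
pose W3 := W1 `&` W2.
have oW3 : open W3 by exact: openI.
have st3 : smooth_on W3 tau by apply: smooth_sub st1 => y [].
pose W := [set y | (W3 `&` tau @^-1` Z0') y /\ 'J tau y \in unitmx].
have oW4 : open (W3 `&` tau @^-1` Z0') by exact: open_preimS.
have oW : open W.
 by apply: open_unit => //; apply: smooth_jac => //; apply: smooth_sub st3 => y [].
have Wz : W z by split => //; split.
have HD1 y : W y -> trans_dom tX g UX1 UP1 Z Z' X1 y by move=> [[[/HW1]]].
have HD2 y : W y -> trans_dom tX g UX2 UP2 Z Z' X2 y by move=> [[[_ /HW2]]].
have WZ y : W y -> Z y by move=> /HD1[].
have WZ' y : W y -> Z' (tau y) by move=> /HD1[].
have st : smooth_on W tau by apply: smooth_sub st3 => y [[]].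
have eE y : W y -> eta y = eta' (tau y) *m ('J tau y)^T.
 move=> Wy; rewrite /eta /eta' mulmxBl.
 have e2 := trans_Th T2 (es_ok S2) (es_ok S2') S2 S2' oW HD2 Wy.
 have e1 := trans_Th T1 (es_ok S1) (es_ok S1') S1 S1' oW HD1 Wy.
 exact: (f_equal2 (fun a b => a - b) e2 e1).
have QE y : W y -> Q' (tau y) = ('J tau y)^T *m Q y *m 'J tau y.
 exact: (trans_Q T1 (es_ok S1) (es_ok S1') S1 S1' oW HD1).
have se : smooth_on W eta.
 apply: smooth_sub (two_smooth_eta S1 S2); exact: WZ.
have se' := two_smooth_eta S1' S2'.
have BE y : W y -> curl eta y = 'J tau y *m curl eta' (tau y) *m ('J tau y)^T.
 apply: (curl_pullback oW (es_oZ S1') st se se') => w Ww; split; [exact: WZ'|exact: eE].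
have mcT c : moser_curve Z Q eta c -> (forall t : R, 0 <= t <= 1 -> W (c t)) -> moser_curve Z' Q' eta' (fun t => tau (c t)).
 move=> mc Wc t t01; have [Zc uc dc] := mc t t01; have Wt := Wc t t01.
 have [_ ut] := Wt.
 have GA : gauge_den Q' eta' t (tau (c t)) \in unitmx /\
   gauge Q' eta' t (tau (c t)) = ('J tau (c t))^T *m gauge Q eta t (c t) *m 'J tau (c t).
  move: uc; rewrite /gauge /gauge_den (QE _ Wt) (BE _ Wt) => uc.
  exact: gauge_alg ut uc.
 have [uc' ge] := GA; split; [exact: WZ' _ Wt|exact: uc'|].
 have := is_derive_jac dc (smooth_diff oW st Wt).
 have eV : moser_field Q' eta' t (tau (c t)) = moser_field Q eta t (c t) *m 'J tau (c t); last first.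
  by move=> h; rewrite eV; exact: h.
 have h1 := congr1 (fun A => - (eta' (tau (c t)) *m A)) ge.
 have h2 := congr1 (fun e => - (e *m gauge Q eta t (c t)) *m 'J tau (c t)) (eE _ Wt).
 exact: etrans h1 (etrans (field_alg _ _ _) (esym h2)).
have [W' [oW' W'z W'Z HW']] := Ht z W Hz0 zz oW Wz.
have muE y : W' y -> W y -> W (mu y) /\ mu' (tau y) = tau (mu y).
 move=> W'y Wy; have [c [mc c0 c1 Wc]] := HW' y W'y.
 have [[_ Zt'] _] := Wy; have [c' [mc' c0' c1']] := Hc' _ Zt'.
 split; first by rewrite -c1; exact: Wc.
 rewrite -c1' -c1; apply: (moser_unique (es_oZ S1') (es_sQ S1') se' mc' (mcT c mc Wc)) => //.
 by rewrite c0' c0.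
pose V0 := W' `&` W.
have oV0 : open V0 by exact: openI.
exists (OF1 `&` G1 @^-1` V0); split.
- exact: open_preimS (es_oF S1) oV0 (es_sG S1).
- have [Fz ez] := es_FG S1 Hz.
 have e : V0 (G1 (es_F X1 z)) by rewrite ez; exact: conj W'z Wz.
 exact: conj Fz e.
- by move=> p [].
- move=> p [Fp [W'y Wy]]; set y := G1 p in W'y Wy.
 have [Zy pE] := es_GF S1 Fp; rewrite -/y in Zy pE.
 have FT := trans_F T1 (es_ok S1) (es_ok S1') S1 S1' (HD1 _ Wy).
 have [Fy' ey'] := es_FG S1' (WZ' _ Wy).
 rewrite FT pE in Fy' ey'; split => //.
  by have [_ _ _ /(_ 1 h11)] := HD1 _ Wy; rewrite -/(es_F X1 y) pE.
 have [Wm mE] := muE y W'y Wy; rewrite ey' mE.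
 have FT2 := trans_F T2 (es_ok S2) (es_ok S2') S2 S2' (HD2 _ Wm).
 exact: FT2.
Qed.

End TwoNat.
End Naturality.

(** * Charts *)

Section Atlas.
Variable R : realType.
Implicit Types M N X : charted R.

(** The part of [is_manifold] that concerns charts only. The cotangent bundle inherits it, and
    separation is carried along on its own as [separated]. *)
Record atlas M : Prop := Atlas {
 at_mem : forall p : M, cdom (chart_at p) p;
 at_inj : forall p x : M, cdom (chart_at p) x -> cof (chart_at p) (cto (chart_at p) x) = x;
 at_open : forall p : M, open (cimg (chart_at p));
 at_compat : forall p q : M,
  let D := cto (chart_at p) @` (cdom (chart_at p) `&` cdom (chart_at q)) in
  open D /\ smooth_on D (cto (chart_at q) \o cof (chart_at p)) }.

Lemma atlasP M : is_manifold M -> atlas M.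
Proof. by case. Qed.

Definition to M (p x : M) : 'rV[R]_(mdim M) := cto (chart_at p) x.
Definition fr M (p : M) (y : 'rV[R]_(mdim M)) : M := cof (chart_at p) y.
Definition dm M (p : M) : set M := cdom (chart_at p).
Definition im M (p : M) : set 'rV[R]_(mdim M) := cimg (chart_at p).
Definition ov M (p q : M) : set 'rV[R]_(mdim M) := to p @` (dm p `&` dm q).
Definition cc M (p q x : M) : 'M[R]_(mdim M) := cchange (chart_at p) (chart_at q) x.

Section One.
Variable M : charted R.
Hypothesis aM : atlas M.

Lemma dm_mem (p : M) : dm p p. Proof. exact: (at_mem aM). Qed.

Lemma fr_to (p x : M) : dm p x -> fr p (to p x) = x. Proof. exact: (at_inj aM). Qed.

Lemma im_to (p x : M) : dm p x -> im p (to p x). Proof. by move=> dx; exists x. Qed.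

Lemma to_fr (p : M) y : im p y -> dm p (fr p y) /\ to p (fr p y) = y.
Proof. by move=> [x dx <-]; rewrite -/(to p x) (fr_to dx). Qed.

Lemma ovP (p q : M) y : ov p q y <-> im p y /\ dm q (fr p y).
Proof.
split=> [[x [dx qx] <-]|[iy qy]]; first by rewrite (fr_to dx); split => //; exact: im_to.
by have [dy ey] := to_fr iy; exists (fr p y).
Qed.

Lemma open_im (p : M) : open (im p). Proof. exact: (at_open aM). Qed.
Arguments open_im p : clear implicits.

Lemma open_ov (p q : M) : open (ov p q). Proof. by have [] := at_compat aM p q. Qed.
Arguments open_ov p q : clear implicits.

Definition tr (p q : M) (y : 'rV[R]_(mdim M)) : 'rV[R]_(mdim M) := to q (fr p y).

Lemma smooth_tr_chart (p q : M) : smooth_on (ov p q) (tr p q).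
Proof. by have [] := at_compat aM p q. Qed.
Arguments smooth_tr_chart p q : clear implicits.

Lemma ccE (p q x : M) : cc p q x = 'J (tr p q) (to p x). Proof. by []. Qed.

Lemma ov_to (p q x : M) : dm p x -> dm q x -> ov p q (to p x).
Proof. by move=> dp dq; exists x. Qed.

Lemma cc_id (p x : M) : dm p x -> cc p p x = 1%:M.
Proof.
move=> dx; rewrite ccE -(jac_id (to p x)); apply: esym.
apply: (jac_ext (open_im p) (im_to dx)); first exact: smooth_diff openT (smooth_id openT) I.
by move=> y /to_fr[_]; rewrite /tr => ->.
Qed.

Lemma cc_comp (p q s x : M) : dm p x -> dm q x -> dm s x -> cc p q x *m cc q s x = cc p s x.
Proof.
move=> dp dq ds; rewrite !ccE.
have -> : 'J (tr q s) (to q x) = 'J (tr q s) (tr p q (to p x)) by rewrite /tr (fr_to dp).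
have opq := ov_to dp dq; have oqs : ov q s (tr p q (to p x)) by rewrite /tr (fr_to dp); exact: ov_to.
rewrite -(jac_compS (open_ov p q) (open_ov q s) (smooth_tr_chart p q) (smooth_tr_chart q s) opq oqs).
have ops := ov_to dp ds.
apply: (jac_ext (openI (open_ov p q) (open_ov p s)) (conj opq ops)).
 apply: differentiable_comp; first exact: smooth_diff (open_ov p q) (smooth_tr_chart p q) opq.
 exact: smooth_diff (open_ov q s) (smooth_tr_chart q s) oqs.
by move=> y [/ovP[iy qy] _]; rewrite /tr (fr_to qy).
Qed.

Lemma cc_inv (p q x : M) : dm p x -> dm q x -> cc p q x *m cc q p x = 1%:M.
Proof. by move=> dp dq; rewrite cc_comp// cc_id. Qed.

Lemma cc_unit (p q x : M) : dm p x -> dm q x -> cc p q x \in unitmx.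
Proof. by move=> dp dq; have [u _] := mulmx1_unit (cc_inv dp dq); exact: u. Qed.

Lemma cc_invE (p q x : M) : dm p x -> dm q x -> cc q p x = invmx (cc p q x).
Proof.
move=> dp dq; apply: (can_inj (mulKmx (cc_unit dp dq))).
by rewrite cc_inv// mulmxV// cc_unit.
Qed.

Lemma mopenP (U : set M) : mopen U <-> forall p x : M, dm p x -> U x ->
 exists2 e : R, 0 < e & forall y : 'rV[R]_(mdim M), `|y - to p x| < e -> im p y /\ U (fr p y).
Proof.
split=> [oU p x dx Ux|H p].
 have [e e0 He] := (open_rV _).1 (oU p) _ (ex_intro2 _ _ x (conj dx Ux) erefl).
 by exists e => // y /He[x' [dx' Ux'] <-]; rewrite -/(to p x') (fr_to dx'); split => //; exact: im_to.
apply/open_rV => _ [x [dx Ux] <-]; have [e e0 He] := H p x dx Ux.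
by exists e => // y /He[/to_fr[dy ey] Uy]; exists (fr p y).
Qed.

Lemma mopenT : mopen [set: M].
Proof.
apply/mopenP => p x dx _; have [e e0 He] := (open_rV _).1 (open_im p) _ (im_to dx).
by exists e => // y /He.
Qed.

Lemma mopenI (U V : set M) : mopen U -> mopen V -> mopen (U `&` V).
Proof.
move=> /mopenP oU /mopenP oV; apply/mopenP => p x dx [Ux Vx].
have [e e0 He] := oU p x dx Ux; have [d d0 Hd] := oV p x dx Vx.
exists (Num.min e d); first by rewrite lt_min e0.
by move=> y; rewrite lt_min => /andP[/He[? ?] /Hd[? ?]].
Qed.

Lemma mopen_local (U : set M) : (forall x, U x -> exists V, [/\ mopen V, V x & V `<=` U]) -> mopen U.
Proof.
move=> H; apply/mopenP => p x dx Ux; have [V [/mopenP oV Vx VU]] := H x Ux.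
by have [e e0 He] := oV p x dx Vx; exists e => // y /He[? /VU].
Qed.

Lemma mopen_chart (p : M) (W : set 'rV[R]_(mdim M)) : open W -> mopen [set x | dm p x /\ W (to p x)].
Proof.
move=> oW; apply/mopenP => q x dq [dp Wx].
have oq := ov_to dq dp.
have oV : open (ov q p `&` tr q p @^-1` W) by exact: open_preimS (open_ov q p) oW (smooth_tr_chart q p).
have Vx : (ov q p `&` tr q p @^-1` W) (to q x) by split => //=; rewrite /tr (fr_to dq).
have [e e0 He] := (open_rV _).1 oV _ Vx.
by exists e => // y /He[/ovP[iy dy] Wy].
Qed.
Arguments mopen_chart p W oW : clear implicits.

Lemma mopen_dm (p : M) : mopen (dm p).
Proof.
have := mopen_chart p setT (@openT 'rV[R]_(mdim M)); congr mopen.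
by apply/seteqP; split => x // [].
Qed.

Lemma mopen_bigcup (I : Type) (U : I -> set M) : (forall i, mopen (U i)) -> mopen [set x | exists i, U i x].
Proof.
by move=> oU; apply: mopen_local => x [i Ui]; exists (U i); split => // y Uy; exists i.
Qed.

Lemma mopen_imE (p : M) (U : set M) y : (to p @` (dm p `&` U)) y <-> im p y /\ U (fr p y).
Proof.
split=> [[x [dx Ux] <-]|[iy Uy]]; first by rewrite (fr_to dx); split => //; exact: im_to.
by have [dy ey] := to_fr iy; exists (fr p y).
Qed.

End One.
Arguments open_im {M} aM p.
Arguments open_ov {M} aM p q.
Arguments smooth_tr_chart {M} aM p q.
Arguments mopen_chart {M} aM p W oW.
Arguments mopen_dm {M} aM p.
Arguments mopenT {M} aM.

Section Maps.
Variables (M N : charted R).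
Hypotheses (aM : atlas M) (aN : atlas N).
Implicit Types (U : set M) (f : M -> N).

Definition rep f (p : M) (q : N) (y : 'rV[R]_(mdim M)) : 'rV[R]_(mdim N) := to q (f (fr p y)).
Definition rep_dom U f (p : M) (q : N) : set 'rV[R]_(mdim M) := to p @` (dm p `&` U `&` f @^-1` dm q).

Lemma rep_domP U f p q y : rep_dom U f p q y <-> [/\ im p y, U (fr p y) & dm q (f (fr p y))].
Proof.
split=> [[x [[dx Ux] qx] <-]|[iy Uy qy]].
 by rewrite (fr_to aM dx); split => //; exact: im_to.
by have [dy ey] := to_fr aM iy; exists (fr p y).
Qed.

Lemma rep_smooth U f p q : smooth_map_on U f -> open (rep_dom U f p q) /\ smooth_on (rep_dom U f p q) (rep f p q).
Proof. exact. Qed.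

Lemma smooth_map_preim U f (O : set N) : smooth_map_on U f -> mopen U -> mopen O -> mopen (U `&` f @^-1` O).
Proof.
move=> sf oU oO; apply/(mopenP aM) => p x dx [Ux Ox]; have qx := dm_mem aN (f x).
have [oD sD] := rep_smooth p (f x) sf.
have Dx : rep_dom U f p (f x) (to p x) by exists x.
pose W := to (f x) @` (dm (f x) `&` O).
have oV := open_preimS oD (oO (f x) : open W) sD.
have Vx : (rep_dom U f p (f x) `&` rep f p (f x) @^-1` W) (to p x).
 by split => //; exists (f x) => //; rewrite /rep (fr_to aM dx).
have [e e0 He] := (open_rV _).1 oV _ Vx.
exists e => // y /He[/rep_domP[iy Uy qy] /(mopen_imE aN)[_ Oy]]; split => //; split => //=.
by move: Oy; rewrite /rep (fr_to aN qy).
Qed.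

Lemma smooth_map_cont f (O : set N) : smooth_map f -> mopen O -> mopen (f @^-1` O).
Proof.
move=> sf oO; have := smooth_map_preim sf (mopenT aM) oO; congr mopen.
by apply/seteqP; split => x // [].
Qed.

(** Passes between Jacobians in arbitrary charts and [tmap], which refers to the preferred charts at
    x and f x. *)
Lemma rep_jac U f p q x : smooth_map_on U f -> U x -> dm p x -> dm q (f x) ->
 'J (rep f p q) (to p x) = cc p x x *m tmap f x *m cc (f x) q (f x).
Proof.
move=> sf Ux dp dq; have xx := dm_mem aM x; have fx := dm_mem aN (f x).
have [oD sD] := rep_smooth x (f x) sf.
have Dx : rep_dom U f x (f x) (to x x) by exists x.
have o1 := open_ov aM p x; have o2 := open_ov aN (f x) q.
have s1 := smooth_tr_chart aM p x; have s2 := smooth_tr_chart aN (f x) q.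
pose W := [set y | (ov p x `&` tr p x @^-1` rep_dom U f x (f x)) y].
have oW : open W by exact: open_preimS o1 oD s1.
have t1 : tr p x (to p x) = to x x by rewrite /tr (fr_to aM dp).
have Wx : W (to p x) by split; [exact: ov_to|rewrite /= t1].
have sW : smooth_on W (tr p x) by apply: smooth_sub s1 => y [].
have sc : smooth_on W (fun y => rep f x (f x) (tr p x y)) by apply: (smooth_comp oW oD _ sW sD) => y [].
have r1 : rep f x (f x) (to x x) = to (f x) (f x) by rewrite /rep (fr_to aM xx).
have o3 : ov (f x) q (rep f x (f x) (tr p x (to p x))) by rewrite t1 r1; exact: ov_to.
have e1 : 'J (fun y => tr (f x) q (rep f x (f x) (tr p x y))) (to p x) =
  'J (tr p x) (to p x) *m 'J (rep f x (f x)) (to x x) *m 'J (tr (f x) q) (to (f x) (f x)).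
 rewrite (jac_compS oW o2 sc s2 Wx o3) (jac_compS oW oD sW sD Wx); last by rewrite t1.
 by rewrite t1 r1.
rewrite -[RHS]/('J (tr p x) (to p x) *m 'J (rep f x (f x)) (to x x) *m 'J (tr (f x) q) (to (f x) (f x))) -e1.
apply: esym; apply: (jac_ext (W := W `&` (fun y => rep f x (f x) (tr p x y)) @^-1` ov (f x) q)).
- exact: open_preimS.
- by split.
- apply: differentiable_comp; first exact: smooth_diff oW sc Wx.
 exact: smooth_diff o2 s2 o3.
move=> y [[/(ovP aM)[iy xy] /= /rep_domP[i2 U2 q2]] /= /(ovP aN)[i3 d3]].
rewrite /tr /rep in i2 U2 q2 i3 d3 *; rewrite (fr_to aM xy) in q2 d3 i3 *.
by rewrite (fr_to aN q2).
Qed.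

End Maps.

End Atlas.
Arguments open_im {R M} aM p.
Arguments open_ov {R M} aM p q.
Arguments smooth_tr_chart {R M} aM p q.
Arguments mopen_chart {R M} aM p W oW.
Arguments mopen_dm {R M} aM p.
Arguments mopenT {R M} aM.

(** * The Jacobi identity in a chart *)

Section Global.
Variable R : realType.
Variable M : charted R.
Hypothesis hM : is_manifold M.
Let aM := atlasP hM.

Section Separate.
Import finmap.

(** A closed coordinate ball is compact, so the Hausdorff property separates it from any point
    outside: finitely many of the separating open sets are intersected. *)
Lemma ball_sep (p x : M) (c : 'rV[R]_(mdim M)) (r : R) :
 (forall y : 'rV[R]_(mdim M), `|y - c| <= r -> im p y) -> ~ (dm p x /\ `|to p x - c| <= r) ->
 exists V, [/\ mopen V, V x & forall z, V z -> dm p z -> r < `|to p z - c|].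
Proof.
move=> rim nx; pose K := [set y : 'rV[R]_(mdim M) | `|y - c| <= r].
have cK : compact K.
 apply: bounded_closed_compact.
  exists (`|r| + `|c|); split => //= t rt y /= yr.
  apply: le_trans (ltW rt); have : `|y| <= `|y - c| + `|c| by rewrite -{1}(subrK c y) ler_normD.
  by have := ler_norm r; move: yr; rewrite /K /=; clear; lra.
 rewrite -[K]setCK; apply: open_closedC; apply/open_rV => y /= /negP; rewrite -ltNge => ry.
 exists (`|y - c| - r); first by rewrite subr_gt0.
 move=> z zy; rewrite /K /=; apply/negP; rewrite -ltNge.
 have h := ler_distD z y c; have e := distrC y z; rewrite e in h; move: zy h; clear; lra.
have H (y : 'rV[R]_(mdim M)) : exists UV : set M * set M, K y ->
  [/\ mopen UV.1, mopen UV.2, UV.1 (fr p y), UV.2 x & UV.1 `&` UV.2 = set0].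
 have [Ky|nK] := pselect (K y); last by exists (set0, set0).
 have [|U [V h]] := hausdorff_mfd hM (p := fr p y) (q := x); last by exists (U, V).
 by move=> e; apply: nx; have [d et] := to_fr aM (rim y Ky); rewrite -e et.
have {H}[UV HUV] := choice H.
move: cK; rewrite compact_cover => /(_ _ K (fun y => to p @` (dm p `&` (UV y).1))) [].
- by move=> y /HUV[+ _ _ _ _]; exact.
- by move=> y Ky; exists y => //; apply/(mopen_imE aM); split; [exact: rim|have [] := HUV y Ky].
move=> D' DK cov; exists [set z | forall y, y \in D' -> (UV y).2 z]; split.
- have : {subset (enum_fset D') <= K} by move=> y /DK.
 have -> : [set z | forall y, y \in D' -> (UV y).2 z] = [set z | forall y, y \in enum_fset D' -> (UV y).2 z] by [].
 elim: (enum_fset D') => [|y s IH] sub.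
  by have := mopenT aM; congr mopen; apply/seteqP; split.
 have -> : [set z | forall y', y' \in y :: s -> (UV y').2 z] =
   (UV y).2 `&` [set z | forall y', y' \in s -> (UV y').2 z].
  apply/seteqP; split=> z /=.
   by move=> h; split=> [|y' ys]; apply: h; rewrite inE ?eqxx ?ys ?orbT.
  by move=> [h1 h2] y'; rewrite inE => /predU1P[->|/h2].
 apply: (mopenI aM); last by apply: IH => y' ys; apply: sub; rewrite inE ys orbT.
 have Ky : K y by apply: set_mem; exact: (sub y (mem_head _ _)).
 by have [] := HUV y Ky.
- move=> y yD; have Ky : K y by apply: set_mem; exact: DK.
 by have [] := HUV y Ky.
move=> z Vz dz; rewrite ltNge; apply/negP => zr.
have [y /= yD /(mopen_imE aM)[_]] := cov (to p z) zr.
rewrite (fr_to aM dz) => Uz; have Ky : K y by apply: set_mem; exact: DK.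
have [_ _ _ _ /seteqP[e _]] := HUV y Ky.
by apply: (e z); split => //; exact: Vz.
Qed.

End Separate.

Definition gext (p : M) (h : 'rV[R]_(mdim M) -> R) (x : M) : R :=
 if pselect (dm p x) then h (to p x) else 0.

Lemma gextE (p x : M) h : dm p x -> gext p h x = h (to p x).
Proof. by rewrite /gext; case: pselect. Qed.

(** At points outside the chart the extension vanishes on a whole neighbourhood, because the ball
    carrying [h] is closed in M by [ball_sep]. *)
Lemma gext_smooth (p : M) (c : 'rV[R]_(mdim M)) (r : R) (h : 'rV[R]_(mdim M) -> R) :
 (forall y : 'rV[R]_(mdim M), `|y - c| <= r -> im p y) ->
 smooth_on setT h -> (forall y : 'rV[R]_(mdim M), r <= `|y - c| -> h y = 0) -> smooth_fun (gext p h).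
Proof.
move=> rim sh h0 q; apply: smooth_local => y iy; have [dy ey] := to_fr aM iy.
have oT := @openT 'rV[R]_(mdim M).
have [dp|ndp] := pselect (dm p (fr q y)).
 exists (ov q p); split; [exact: open_ov|exact/(ovP aM)|].
 have := smooth_compR (open_ov aM q p) oT (fun _ _ => I) (smooth_tr_chart aM q p) sh.
 apply: smooth_ext; first exact: open_ov.
 by move=> z /(ovP aM)[iz dz]; rewrite /= gextE.
have [|V [oV Vx HV]] := ball_sep (x := fr q y) rim; first by case.
exists (to q @` (dm q `&` V)); split; [exact: (oV q)|exact/(mopen_imE aM)|].
apply: (smooth_ext (oV q) _ (smooth_cst (oV q) 0)) => z /(mopen_imE aM)[iz Vz] /=.
rewrite /gext; case: pselect => //= dz; rewrite h0//; apply: ltW; exact: HV Vz dz.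
Qed.

Lemma dfun_chart (f : M -> R) (p x : M) (W : set 'rV[R]_(mdim M)) (F : 'rV[R]_(mdim M) -> R) :
 dm p x -> open W -> W (to p x) -> smooth_on W F -> (forall y, W y -> f (fr p y) = F y) ->
 dfun f x = (\row_l 'D_(E_ R l) F (to p x)) *m (cc x p x)^T.
Proof.
move=> dp oW Wx sF fF; have xx := dm_mem aM x.
have so := smooth_tr_chart aM x p; have oo := open_ov aM x p; have xo := ov_to (p := x) xx dp.
have tx : tr x p (to x x) = to p x by rewrite /tr (fr_to aM xx).
have oV := open_preimS oo oW so.
have Vx : (ov x p `&` tr x p @^-1` W) (to x x) by split => //=; rewrite tx.
have dF := smooth_diffR oW sF Wx.
apply/rowP => j; rewrite mxE mulmx_trE.
have -> : 'D_(delta_mx 0 j) (f \o cof (chart_at x)) (cto (chart_at x) x) =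
  'D_(E_ R j) (F \o tr x p) (to x x).
 apply: (derive_near_ext _ oV Vx) => y [/(ovP aM)[iy dy] Wy] /=.
 by rewrite -fF// /tr (fr_to aM dy).
rewrite derive_comp; last 2 first.
- exact: smooth_diff oo so xo.
- by rewrite tx.
rewrite tx (deriveR_basis _ oW sF Wx); apply: eq_bigr => l _.
rewrite mulrC; apply: f_equal2; first by rewrite mxE.
rewrite ccE (jac_entry j l oo so xo) (derive_entry _ _ _ so xo).
by [].
Qed.

Definition pihat (pi : bivec M) (p : M) (y : 'rV[R]_(mdim M)) : 'M[R]_(mdim M) :=
 let q := fr p y in (cc q p q)^T *m pi q *m cc q p q.

Lemma pihat_smooth (pi : bivec M) (p : M) : is_poisson pi -> smooth_on (im p) (pihat pi p).
Proof. by move=> [_ + _]; exact. Qed.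

Lemma pihat_antisym (pi : bivec M) (p : M) y : is_poisson pi -> (pihat pi p y)^T = - pihat pi p y.
Proof.
move=> [a _ _]; rewrite /pihat; move: (cc _ _ _) => J; have aq := a (fr p y).
by rewrite !trmx_mul trmxK aq mulNmx mulmxN mulmxA.
Qed.

(** The cyclic identity is contracted with [a]; antisymmetry turns two of its three sums into the
    products on the left. *)
Lemma jacobi_tensor n (P : 'rV[R]_n -> 'M[R]_n) (Om : set 'rV[R]_n) (q : 'rV[R]_n) : open Om -> smooth_on Om P -> Om q ->
 (forall y, Om y -> (P y)^T = - P y) ->
 (forall i j k, \sum_l P q i l * 'D_(E_ R l) (fun y => P y j k) q +
   \sum_l P q j l * 'D_(E_ R l) (fun y => P y k i) q +
   \sum_l P q k l * 'D_(E_ R l) (fun y => P y i j) q = 0) ->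
 forall a : 'rV[R]_n, P q *m contr P a q + (contr P a q)^T *m P q = 'D_(a *m P q) P q.
Proof.
move=> oO sP Oq aP H a.
have dN l i j : 'D_(E_ R l) (fun y => P y i j) q = - 'D_(E_ R l) (fun y => P y j i) q.
 have d := smooth_derivable (v := E_ R l) (smooth_entry oO j i sP) Oq.
 have e := deriveN d; apply: etrans _ e; apply: (derive_near_ext _ oO Oq) => y Oy.
 by have := congr1 (fun A : 'M[R]_n => A j i) (aP y Oy); rewrite /= trE => ->; rewrite mxE.
have PN i j : P q i j = - P q j i.
 by have := congr1 (fun A : 'M[R]_n => A j i) (aP q Oq); rewrite /= trE => ->; rewrite mxE.
pose T i j k := \sum_l P q i l * 'D_(E_ R l) (fun y => P y j k) q.
apply/matrixP => j k.
have -> : ('D_(a *m P q) P q) j k = \sum_i a 0 i * T i j k.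
 rewrite (derive_entry _ _ _ sP Oq) (deriveR_basis _ oO (smooth_entry oO j k sP) Oq).
 under eq_bigr do rewrite mxE mulr_suml.
 rewrite exchange_big/=; apply: eq_bigr => i _; rewrite mulr_sumr; apply: eq_bigr => l _.
 by rewrite mulrA.
have c1 l k' : contr P a q l k' = \sum_i a 0 i * 'D_(E_ R l) (fun y => P y i k') q.
 rewrite mxE mxE; apply: eq_bigr => i _; apply: f_equal2 => //.
 by rewrite (derive_entry _ _ _ sP Oq).
have s1 : (P q *m contr P a q) j k = \sum_i a 0 i * - T j k i.
 rewrite mxE; under eq_bigr do rewrite c1 mulr_sumr.
 rewrite exchange_big/=; apply: eq_bigr => i _; rewrite -sumrN mulr_sumr; apply: eq_bigr => l _.
 by rewrite (dN l k i); move: ('D_(E_ R l) (fun y => P y i k) q) (P q j l) (a 0 i) => u v w; ring.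
have s2 : ((contr P a q)^T *m P q) j k = \sum_i a 0 i * - T k i j.
 rewrite mxE; under eq_bigr do rewrite trE c1 mulr_suml.
 rewrite exchange_big/=; apply: eq_bigr => i _; rewrite -sumrN mulr_sumr; apply: eq_bigr => l _.
 by rewrite (PN l k); move: ('D_(E_ R l) (fun y => P y i j) q) (P q k l) (a 0 i) => u v w; ring.
rewrite mxE s1 s2 -big_split/=; apply: eq_bigr => i _; rewrite -mulrDr; congr (_ * _).
have := H i j k; rewrite -/(T i j k) -/(T j k i) -/(T k i j) => /eqP.
by rewrite -addrA addr_eq0 opprD => /eqP <-.
Qed.

(** [is_poisson] states the identity for globally defined functions, so the coordinate functions are
    cut off by a bump and extended by 0. Near the given point they are still the coordinates, and
    their brackets are the entries of [pihat]. *)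
Lemma jacobi_chart (pi : bivec M) (p : M) : is_poisson pi -> jacobi (im p) (pihat pi p).
Proof.
move=> hpi y0 iy0; have sP := pihat_smooth p hpi; have oO := open_im aM p.
apply: (jacobi_tensor oO sP iy0 (fun y _ => pihat_antisym p y hpi)) => i j k.
have [e e0 He] := (open_rV _).1 oO _ iy0; have r0 : 0 < e / 2 by rewrite divr_gt0.
have rim (y : 'rV[R]_(mdim M)) : `|y - y0| <= e / 2 -> im p y by move=> h; apply: He; lra.
have [d d0 Hd] := bump1 y0 r0.
have oT := @openT 'rV[R]_(mdim M).
pose h (l : 'I_(mdim M)) (y : 'rV[R]_(mdim M)) := bump y0 (e / 2) y * y 0 l.
have sh l : smooth_on setT (h l).
 by apply: smooth_mulR => //; [exact: bump_smooth|exact: smooth_coordR].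
have h0 l (y : 'rV[R]_(mdim M)) : e / 2 <= `|y - y0| -> h l y = 0.
 by move=> yr; rewrite /h bump0 ?mul0r// ltW.
have sf l := gext_smooth rim (sh l) (h0 l).
pose f l := gext p (h l).
pose W := [set y : 'rV[R]_(mdim M) | `|y - y0| < Num.min d e].
have oW : open W by exact: open_nball.
have Wim y : W y -> im p y by rewrite /W /= lt_min => /andP[_ /He].
have fW l y : W y -> f l (fr p y) = y 0 l.
 move=> Wy; have [dy ey] := to_fr aM (Wim _ Wy); rewrite /f gextE// ey /h.
 by move: Wy; rewrite /W /= lt_min => /andP[/Hd -> _]; rewrite mul1r.
have W0 : W y0 by rewrite /W /= subrr normr0 lt_min d0.
have df l y : W y -> dfun (f l) (fr p y) = delta_mx 0 l *m (cc (fr p y) p (fr p y))^T.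
 move=> Wy; have [dy ey] := to_fr aM (Wim _ Wy).
 have sc : smooth_on W (fun y : 'rV[R]_(mdim M) => y 0 l) by exact: smooth_coordR.
 rewrite (dfun_chart dy oW _ sc (fun y => @fW l y)) ey//; congr (_ *m _).
 apply/rowP => l'; rewrite mxE.
 have [_ ->] : is_derive y (E_ R l') (fun y : 'rV[R]_(mdim M) => y 0 l) ((E_ R l') 0 l).
  by apply: is_derive_affine => t; rewrite !mxE addrC.
 by rewrite !mxE eqxx eq_sym.
have br l l' y : W y -> bracket pi (f l) (f l') (fr p y) = pihat pi p y l l'.
 move=> Wy; rewrite /bracket /bform !df//.
 have -> : pihat pi p y l l' = ((delta_mx 0 l : 'rV[R]_(mdim M)) *m pihat pi p y *m (delta_mx 0 l' : 'rV[R]_(mdim M))^T) 0 0.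
  by rewrite trmx_delta -rowE -colE !mxE.
 by rewrite /pihat trmx_mul trmxK !mulmxA.
have dbr l l' : dfun (bracket pi (f l) (f l')) (fr p y0) =
  (\row_s 'D_(E_ R s) (fun y => pihat pi p y l l') y0) *m (cc (fr p y0) p (fr p y0))^T.
 have [dy ey] := to_fr aM iy0.
 have sc : smooth_on W (fun y => pihat pi p y l l') by apply: smooth_sub (smooth_entry oO l l' sP).
 by rewrite (dfun_chart dy oW _ sc (fun y => @br l l' y)) ey.
have bb l l' l'' : bracket pi (f l) (bracket pi (f l') (f l'')) (fr p y0) =
  \sum_s pihat pi p y0 l s * 'D_(E_ R s) (fun y => pihat pi p y l' l'') y0.
 rewrite {1}/bracket /bform dbr (df _ _ W0).
 rewrite trmx_mul trmxK !mulmxA -[_ *m cc _ _ _ *m _^T]mulmxA.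
 have -> : (delta_mx 0 l : 'rV[R]_(mdim M)) *m (cc (fr p y0) p (fr p y0))^T *m pi (fr p y0) *m
   (cc (fr p y0) p (fr p y0) *m (\row_s 'D_(E_ R s) (fun y => pihat pi p y l' l'') y0)^T) =
   row l (pihat pi p y0) *m (\row_s 'D_(E_ R s) (fun y => pihat pi p y l' l'') y0)^T.
  by rewrite rowE /pihat !mulmxA.
 rewrite mulmx_trE; apply: eq_bigr => s _.
 by apply: f_equal2; rewrite mxE.
have [_ _ /(_ (f i) (f j) (f k) (sf i) (sf j) (sf k) (fr p y0))] := hpi.
by rewrite !bb.
Qed.

End Global.

(** * Cotangent bundles and Poisson sprays *)

Section CotLift.
Variable R : realType.

Lemma smooth_cot_lift n (kM : 'rV[R]_n -> 'rV[R]_n) (U : set 'rV[R]_n) : open U -> smooth_on U kM ->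
 (forall q, U q -> 'J kM q \in unitmx) ->
 smooth_on (lsubmx @^-1` U : set 'rV[R]_(n + n)) (cot_lift kM).
Proof.
move=> oU sk uk; have oD : open (lsubmx @^-1` U : set 'rV[R]_(n + n)) by exact: smooth_lsub.
have sl := smooth_lsubT oD; apply: smooth_row_mx => //.
 exact: (smooth_comp oD oU (fun _ h => h) sl sk).
apply: smooth_mulmx => //; first exact: smooth_rsubT.
have sG : smooth_on U (fun q => (invmx ('J kM q))^T).
 apply: smooth_tr => //; apply: smooth_invmx => //; exact: smooth_jac.
exact: (smooth_comp oD oU (fun _ h => h) sl sG).
Qed.

(** Fibrewise multiplication m_t in bundle coordinates. *)
Definition fscale n (t : R) (u : 'rV[R]_(n + n)) : 'rV[R]_(n + n) := row_mx (lsubmx u) (t *: rsubmx u).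

Lemma fscale_lin n (t : R) (u : 'rV[R]_(n + n)) : fscale t u = u *m block_mx 1%:M 0 0 t%:M + 0.
Proof.
by rewrite addr0 /fscale -[u in RHS]hsubmxK mul_row_block !mulmx0 addr0 add0r mulmx1 mul_mx_scalar.
Qed.

Lemma jac_fscale n (t : R) (u : 'rV[R]_(n + n)) :
 'J (@fscale n t) u = block_mx 1%:M 0 0 t%:M /\ differentiable (@fscale n t) u.
Proof.
have -> : @fscale n t = fun u => u *m block_mx 1%:M 0 0 t%:M + 0 by apply/funext => v; exact: fscale_lin.
by have [d e] := jac_lin (block_mx (1%:M : 'M[R]_n) 0 0 (t%:M : 'M[R]_n)) 0 u.
Qed.

(* Differentiating [g (q, t a) = t^2 g (q, a)] at [a = 0]. *)
Lemma quadratic_fibre n m (U : set 'rV[R]_n) (g : 'rV[R]_(n + n) -> 'rV[R]_m) (q : 'rV[R]_n) : open U -> U q ->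
 smooth_on (lsubmx @^-1` U : set 'rV[R]_(n + n)) g ->
 (forall u : 'rV[R]_(n + n), U (lsubmx u) -> g (fscale 2 u) = 4 *: g u) ->
 g (row_mx q 0) = 0 /\ 'J g (row_mx q 0) = 0.
Proof.
move=> oU Uq sg hg; have oD : open (lsubmx @^-1` U : set 'rV[R]_(n + n)) by exact: smooth_lsub.
have Du : (lsubmx @^-1` U) (row_mx q 0 : 'rV[R]_(n + n)) by rewrite /= row_mxKl.
have fu : fscale 2 (row_mx q 0) = row_mx q 0 :> 'rV[R]_(n + n).
 by rewrite /fscale row_mxKl row_mxKr scaler0.
split.
 have := hg _ Du; rewrite fu => e; apply/rowP => j; rewrite mxE.
 by have := congr1 (fun v : 'rV[R]_m => v 0 j) e; rewrite mxE; lra.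
have [jf df] := jac_fscale 2 (row_mx q 0 : 'rV[R]_(n + n)).
have dg := smooth_diff oD sg Du.
have e1 : 'J (g \o @fscale n 2) (row_mx q 0) = block_mx 1%:M 0 0 2%:M *m 'J g (row_mx q 0).
 by rewrite -jf -[in 'J g _]fu; apply: jac_comp; rewrite ?fu.
have e2 : 'J (g \o @fscale n 2) (row_mx q 0) = 4 *: 'J g (row_mx q 0).
 have [d4 j4] := jac_lin (4%:M : 'M[R]_m) 0 (g (row_mx q 0)).
 rewrite -mul_mx_scalar -[X in _ *m X]j4 -(jac_comp dg d4).
 apply: esym; apply: (jac_ext oD Du); first exact: differentiable_comp.
 by move=> y Dy /=; rewrite (hg y Dy) addr0 mul_mx_scalar.
move: e1; rewrite e2; move: ('J g _) => G; rewrite -[G]vsubmxK scale_col_mx mul_block_col !mul0mx addr0 add0r mul1mx mul_scalar_mx.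
move=> /eq_col_mx[a b]; have -> : usubmx G = 0.
 by apply/matrixP => i j; rewrite [RHS]mxE; have := congr1 (fun v : 'M[R]_(n, m) => v i j) a; rewrite /= [LHS]mxE; move: (usubmx G i j) => x; lra.
suff -> : dsubmx G = 0 by rewrite col_mx0.
by apply/matrixP => i j; rewrite [RHS]mxE; have := congr1 (fun v : 'M[R]_(n, m) => v i j) b; rewrite /= [LHS]mxE [RHS]mxE; move: (dsubmx G i j) => x; lra.
Qed.

Lemma scale_alg N (t : R) (x : 'rV[R]_N) (C C0 S C' B : 'M[R]_N) : C0 *m C = 1%:M -> B = C *m S *m C' ->
 (t *: x) *m S *m C' = (t *: (x *m C0)) *m B.
Proof. by move=> h ->; rewrite -!scalemxAl !mulmxA -(mulmxA x C0 C) h mulmx1. Qed.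

End CotLift.

Section Cotangent.
Variable R : realType.
Variable M : charted R.
Hypothesis aM : atlas M.
Notation n := (mdim M).
Notation T := (cotangent M).

Lemma cot_to (c b : T) : to c b = row_mx (to c.1 b.1) (b.2 *m (cc c.1 b.1 b.1)^T) :> 'rV[R]_(n + n).
Proof. by []. Qed.

Lemma cot_fr (c : T) (u : 'rV[R]_(n + n)) : fr (M := T) c u = (fr c.1 (lsubmx u), rsubmx u *m (cc (fr c.1 (lsubmx u)) c.1 (fr c.1 (lsubmx u)))^T).
Proof. by []. Qed.

Lemma cot_frto (c b : T) : dm c.1 b.1 -> fr (M := T) c (to c b) = b.
Proof.
move=> dc; rewrite cot_fr cot_to row_mxKl row_mxKr (fr_to aM dc) -mulmxA -trmx_mul (cc_inv aM)//; last exact: dm_mem.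
by rewrite trmx1 mulmx1; case: b dc.
Qed.

Lemma cot_tofr (c : T) (u : 'rV[R]_(n + n)) : im c.1 (lsubmx u) -> to c (fr (M := T) c u) = u.
Proof.
move=> iu; have [d e] := to_fr aM iu.
rewrite cot_to cot_fr /= e -mulmxA -trmx_mul (cc_inv aM)//; last exact: dm_mem.
by rewrite trmx1 mulmx1 hsubmxK.
Qed.

Lemma cot_im (c : T) (u : 'rV[R]_(n + n)) : im (M := T) c u <-> im c.1 (lsubmx u).
Proof.
split=> [[b dc <-]|iu]; first by rewrite -[cto _ b]/(to c b) cot_to row_mxKl; exact: im_to.
by exists (fr (M := T) c u); [exact: (to_fr aM iu).1|exact: cot_tofr].
Qed.

Lemma cot_tr (c c' : T) (u : 'rV[R]_(n + n)) : ov c.1 c'.1 (lsubmx u) ->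
 tr (M := T) c c' u = cot_lift (tr c.1 c'.1) u.
Proof.
move=> /(ovP aM)[iu du]; have [d e] := to_fr aM iu.
have qq := dm_mem aM (fr c.1 (lsubmx u)).
rewrite /tr cot_to cot_fr /= /cot_lift; apply: f_equal2 => //.
rewrite -mulmxA -trmx_mul (cc_comp aM) // (cc_invE aM d du) ccE e; exact: erefl.
Qed.

Lemma cot_ov (c c' : T) (u : 'rV[R]_(n + n)) : ov (M := T) c c' u <-> ov c.1 c'.1 (lsubmx u).
Proof.
split=> [[b [d d'] <-]|/(ovP aM)[iu du]].
 by rewrite -/(to c b) cot_to row_mxKl; exact: ov_to.
exists (fr (M := T) c u); last exact: cot_tofr.
by split => //; exact: (to_fr aM iu).1.
Qed.

Lemma unit_tr (p q : M) y : ov p q y -> 'J (tr p q) y \in unitmx.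
Proof.
move=> /(ovP aM)[iy dy]; have [d e] := to_fr aM iy.
by have := cc_unit aM d dy; rewrite ccE e.
Qed.

Lemma atlas_cotangent : atlas T.
Proof.
have H (c c' : T) : open (ov (M := T) c c') /\ smooth_on (ov (M := T) c c') (tr (M := T) c c').
 have -> : ov (M := T) c c' = lsubmx @^-1` ov c.1 c'.1 :> set 'rV[R]_(n + n).
  by apply/seteqP; split => u /cot_ov.
 have oo := open_ov aM c.1 c'.1; have oD : open (lsubmx @^-1` ov c.1 c'.1 : set 'rV[R]_(n + n)) by exact: smooth_lsub.
 split => //.
 apply: (smooth_ext oD (f := cot_lift (tr c.1 c'.1))); first by move=> u /= /(@cot_tr c c' u) ->.
 by apply: smooth_cot_lift => //; [exact: smooth_tr_chart|exact: unit_tr].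
split.
- by move=> c; exact: dm_mem aM c.1.
- by move=> c b; exact: cot_frto.
- move=> c; have -> : cimg (chart_at c) = lsubmx @^-1` im c.1 :> set 'rV[R]_(n + n).
  by apply/seteqP; split => u /cot_im.
 by apply: smooth_lsub; exact: open_im.
- exact: H.
Qed.

Let aT := atlas_cotangent.

Lemma smooth_proj : smooth_map (@cotangent_proj R M).
Proof.
move=> c q; have e : rep_dom setT (@cotangent_proj R M) c q = lsubmx @^-1` ov c.1 q :> set 'rV[R]_(n + n).
 apply/seteqP; split => u; first by move=> /(rep_domP aT)[/cot_im ? _ ?]; exact/(ovP aM).
 by move=> /(ovP aM)[? ?]; apply/(rep_domP aT); split => //; exact/cot_im.
rewrite -[X in let D := X in _]/(rep_dom setT (@cotangent_proj R M) c q) e.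
have oo := open_ov aM c.1 q; have oD : open (lsubmx @^-1` ov c.1 q : set 'rV[R]_(n + n)) by exact: smooth_lsub.
split => //.
exact: (smooth_comp oD oo (fun _ h => h) (smooth_lsubT oD) (smooth_tr_chart aM c.1 q)).
Qed.

Lemma tmap_proj (b : T) : tmap (@cotangent_proj R M) b = col_mx 1%:M 0.
Proof.
have oD : open (lsubmx @^-1` im b.1 : set 'rV[R]_(n + n)) by apply: smooth_lsub; exact: open_im.
rewrite -(jac_lsub (to b b : 'rV[R]_(n + n))); apply: esym.
apply: (jac_ext oD); first by rewrite /= cot_to row_mxKl; apply: im_to; exact: dm_mem.
 exact: smooth_diff openT (smooth_lsubT openT) I.
by move=> u /= iu; exact: esym (to_fr aM iu).2.
Qed.

Lemma rep_scale (t : R) (c c' : T) (u : 'rV[R]_(n + n)) :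
 rep (@cotangent_scale R M t) c c' u = fscale t (tr (M := T) c c' u).
Proof.
rewrite /rep /tr /fscale !cot_to !row_mxKl !row_mxKr /=.
by rewrite -scalemxAl.
Qed.

Lemma smooth_cotangent_scale (t : R) : smooth_map (@cotangent_scale R M t).
Proof.
move=> c c'; have e : rep_dom setT (@cotangent_scale R M t) c c' = ov (M := T) c c'.
 apply/seteqP; split => u; first by move=> /(rep_domP aT)[? _ ?]; exact/(ovP aT).
 by move=> /(ovP aT)[? ?]; apply/(rep_domP aT).
rewrite -[X in let D := X in _]/(rep_dom setT (@cotangent_scale R M t) c c') e.
have oo := open_ov aT c c'; split => //.
apply: (smooth_ext oo (f := fun u => fscale t (tr (M := T) c c' u))).
 by move=> u _; exact: esym (rep_scale t c c' u).
have s := smooth_tr_chart aT c c'.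
apply: smooth_row_mx => //; first exact: smooth_lsubmx.
have sc : smooth_on (ov (M := T) c c') (fun=> t) by exact: smooth_cst.
by apply: (smooth_scale oo sc); exact: smooth_rsubmx.
Qed.

Section Vector.
Variable N : charted R.
Hypothesis aN : atlas N.
Variable v : N -> 'rV[R]_(mdim N).
Hypothesis sv : smooth_vector_field v.

Definition vhat (c : N) (y : 'rV[R]_(mdim N)) : 'rV[R]_(mdim N) := v (fr c y) *m cc (fr c y) c (fr c y).

Lemma smooth_vhat c : smooth_on (im c) (vhat c).
Proof.
have := sv c c; congr smooth_on; apply/seteqP; split => y.
 by move=> [x [[d _] _] <-]; exact: im_to.
by move=> [x d <-]; exists x.
Qed.

Lemma vhat_tr (c c' : N) y : ov c c' y -> vhat c' (tr c c' y) = vhat c y *m 'J (tr c c') y.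
Proof.
move=> /(ovP aN)[iy dy]; have [d e] := to_fr aN iy; have qq := dm_mem aN (fr c y).
rewrite /vhat /tr (fr_to aN dy) -mulmxA; congr (_ *m _).
by have := cc_comp aN qq d dy; rewrite (ccE c c') e => <-.
Qed.

End Vector.

Section Spray.
Variables (pi : bivec M) (chi : T -> 'rV[R]_(mdim T)).
Hypothesis spr : poisson_spray pi chi.

Definition ghat (c : T) (u : 'rV[R]_(n + n)) : 'rV[R]_n := rsubmx (vhat (N := T) chi c u : 'rV[R]_(n + n)).

(** The projection of a spray to the base is sharp, so only its fibre component [ghat] is free. *)
Lemma vhat_split (c : T) (u : 'rV[R]_(n + n)) : im c.1 (lsubmx u) ->
 vhat (N := T) chi c u = row_mx (rsubmx u *m pihat pi c.1 (lsubmx u)) (ghat c u) :> 'rV[R]_(n + n).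
Proof.
move=> iu; rewrite -[LHS]hsubmxK; congr row_mx.
have [d e] := to_fr aM iu; pose b := fr (M := T) c u; have bb := dm_mem aM b.1.
have e1 : b.1 = fr c.1 (lsubmx u) by [].
have Ju (w : 'rV[R]_(n + n)) : lsubmx w = w *m col_mx 1%:M 0.
 by rewrite -[w in RHS]hsubmxK mul_row_col mulmx1 mulmx0 addr0.
have jc : cc (M := T) b c b *m col_mx 1%:M 0 = col_mx 1%:M 0 *m cc b.1 c.1 b.1.
 have d1 := ov_to (M := T) (p := b) (q := c) bb (d : dm c b).
 have oo := open_ov aT b c; have so := smooth_tr_chart aT b c.
 have lb : lsubmx (to b b : 'rV[R]_(n + n)) = to b.1 b.1 by rewrite cot_to row_mxKl.
 have -> : cc (M := T) b c b *m col_mx 1%:M 0 = 'J (fun w : 'rV[R]_(n + n) => lsubmx (tr (M := T) b c w : 'rV[R]_(n + n))) (to b b).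
  by rewrite (jac_compS oo openT so (smooth_lsubT openT) d1 I) jac_lsub ccE.
 have o1 := open_ov aM b.1 c.1; have oD : open (lsubmx @^-1` ov b.1 c.1 : set 'rV[R]_(n + n)) by exact: smooth_lsub.
 have s1 := smooth_tr_chart aM b.1 c.1; have d2 : ov b.1 c.1 (lsubmx (to b b : 'rV[R]_(n + n))) by rewrite lb; exact: ov_to.
 have -> : col_mx 1%:M 0 *m cc b.1 c.1 b.1 = 'J (fun w : 'rV[R]_(n + n) => tr b.1 c.1 (lsubmx w)) (to b b).
  by rewrite (jac_compS oD o1 (smooth_lsubT oD) s1 d2 d2) jac_lsub lb.
 apply: esym; apply: (jac_ext oD d2).
  apply: differentiable_comp; first exact: smooth_diff oD (smooth_lsubT oD) d2.
  exact: smooth_diff o1 s1 d2.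
 by move=> w Dw; rewrite cot_tr// /cot_lift row_mxKl.
rewrite Ju /vhat -mulmxA jc mulmxA -(tmap_proj b) (spray_proj spr b) /sharp.
rewrite {1}/b cot_fr /= /pihat -e1 -!mulmxA; exact: erefl.
Qed.

Lemma smooth_ghat (c : T) : smooth_on (lsubmx @^-1` im c.1 : set 'rV[R]_(n + n)) (ghat c).
Proof.
have -> : (lsubmx @^-1` im c.1 : set 'rV[R]_(n + n)) = im (M := T) c by apply/seteqP; split => u /cot_im.
apply: smooth_rsubmx; first exact: open_im aT c.
exact: smooth_vhat (spray_smooth spr) c.
Qed.

(** Homogeneity at t = 2: one factor 2 comes from t chi, the other from the differential of m_t in
    the fibre direction. *)
Lemma ghat_scale (c : T) (u : 'rV[R]_(n + n)) : im c.1 (lsubmx u) -> ghat c (fscale 2 u) = 4 *: ghat c u.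
Proof.
move=> iu; pose b := fr (M := T) c u; have [d e] := to_fr aM iu.
have bb := dm_mem aM b.1.
have fb : fr (M := T) c (fscale 2 u) = cotangent_scale 2 b.
 by rewrite !cot_fr /fscale row_mxKl row_mxKr /cotangent_scale /b cot_fr /= -scalemxAl.
have h2 : (0 : R) < 2 by [].
have e1 : vhat (N := T) chi c (fscale 2 u) = (2 *: vhat (N := T) chi c u) *m block_mx 1%:M 0 0 2%:M.
 rewrite /vhat fb (spray_homog spr b h2) -/b.
 have d1 : dm (M := T) c b by exact: d.
 have := rep_jac aT aT (smooth_cotangent_scale 2) (I : setT b) d1 (d1 : dm (M := T) c (cotangent_scale 2 b)).
 have tb : to c b = u by exact: cot_tofr.
 have -> : 'J (rep (@cotangent_scale R M 2) c c) (to c b) = block_mx 1%:M 0 0 2%:M :> 'M[R]_(n + n).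
  have [j4 d4] := jac_fscale 2 (to c b : 'rV[R]_(n + n)); rewrite -j4; apply: esym.
  apply: (jac_ext (open_im aT c)) => //; first exact: im_to.
  move=> w iw; have [dw ew] := to_fr aT iw.
  by rewrite rep_scale /tr ew.
 exact: scale_alg (cc_inv aT bb d1).
rewrite /ghat e1 -[vhat _ _ _ in LHS]hsubmxK scale_row_mx mul_row_block !mulmx0 addr0 add0r row_mxKr mul_mx_scalar scalerA.
by congr (_ *: _); ring.
Qed.

Lemma ghat_zero (c : T) (q : 'rV[R]_n) : im c.1 q -> ghat c (row_mx q 0) = 0 /\ 'J (ghat c) (row_mx q 0) = 0.
Proof.
move=> iq; apply: (quadratic_fibre (open_im aM c.1) iq (smooth_ghat c)) => u; exact: ghat_scale.
Qed.

End Spray.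

End Cotangent.

Definition separated (R : realType) (N : charted R) : Prop := forall p q : N, p <> q ->
 exists U V : set N, [/\ mopen U, mopen V, U p, V q & U `&` V = set0].

Section Separation.
Variable R : realType.

Lemma separate_chart (N : charted R) (aN : atlas N) (c p q : N) : dm c p -> dm c q -> p <> q ->
 exists U V : set N, [/\ mopen U, mopen V, U p, V q & U `&` V = set0].
Proof.
move=> dp dq npq; pose e := `|to c p - to c q| / 2.
have e0 : 0 < e.
 rewrite /e divr_gt0// normr_gt0 subr_eq0; apply/eqP => h; apply: npq.
 by rewrite -(fr_to aN dp) h fr_to.
pose B (z : 'rV[R]_(mdim N)) := [set y : 'rV[R]_(mdim N) | `|y - z| < e].
have oB z : open (B z) by exact: open_nball.
exists [set x | dm c x /\ B (to c p) (to c x)], [set x | dm c x /\ B (to c q) (to c x)]; split.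
- exact: mopen_chart.
- exact: mopen_chart.
- by split => //; rewrite /B /= subrr normr0.
- by split => //; rewrite /B /= subrr normr0.
apply/seteqP; split => x //= [[_ h1] [_ h2]].
have h3 := ler_distD (to c x) (to c p) (to c q); have h4 := distrC (to c p) (to c x).
by move: h1 h2 h3; rewrite h4 /B /= /e; clear; lra.
Qed.

(** Covectors at different points are separated through the base, covectors at one point inside a
    bundle chart. *)
Lemma separated_cotangent (M : charted R) (aM : atlas M) : separated M -> separated (cotangent M).
Proof.
move=> hM p q npq; have aT := atlas_cotangent aM.
have [e|ne] := pselect (p.1 = q.1).
 by apply: (separate_chart aT (c := p) (dm_mem aT p) _ npq); rewrite /dm /= -e; exact: dm_mem.
have [U [V [oU oV Up Vq UV]]] := hM _ _ ne; have sp := smooth_proj aM.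
exists (@cotangent_proj R M @^-1` U), (@cotangent_proj R M @^-1` V); split => //.
- exact: smooth_map_cont aT aM _ _ sp oU.
- exact: smooth_map_cont aT aM _ _ sp oV.
by apply/seteqP; split => x // h; have /seteqP[+ _] := UV; move=> /(_ x.1 h).
Qed.

End Separation.

(** * Integral curves on manifolds *)

Section Curves.
Variable R : realType.
Variable N : charted R.
Hypotheses (aN : atlas N) (hN : separated N).
Variable v : N -> 'rV[R]_(mdim N).
Hypothesis sv : smooth_vector_field v.
Local Notation n := (mdim N).

Lemma ic_chart (g : R -> N) (c : N) (t : R) : integral_curve v g -> 0 <= t <= 1 -> dm c (g t) ->
 (exists2 d : R, 0 < d & forall s : R, `|s - t| < d -> dm c (g s)) /\
 is_derive t 1 (fun s => to c (g s)) (vhat v c (to c (g t))).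
Proof.
move=> [e [e0 Hg]] t01 dc; have [|nr dg] := Hg t; first by case/andP: t01 => ? ?; apply/andP; split; lra.
have gg := dm_mem aN (g t).
have oo := open_ov aN (g t) c; have so := smooth_tr_chart aN (g t) c.
have ot := ov_to gg dc.
have [d1 d10 H1] := near_curve oo ot dg.
have /nbhs_ballP[d2 d20 H2] := nr.
have near : forall s : R, `|s - t| < Num.min d1 d2 -> dm (g t) (g s) /\ dm c (g s).
 move=> s; rewrite lt_min => /andP[s1 s2].
 have dgs : dm (g t) (g s) by apply: H2; rewrite /ball /= distrC.
 split=> //; have /(ovP aN)[_] := H1 s s1.
 by rewrite -[cto _ _]/(to (g t) (g s)) fr_to.
have d0 : 0 < Num.min d1 d2 by rewrite lt_min d10.
split; first by exists (Num.min d1 d2) => // s /near[].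
have := is_derive_jac dg (smooth_diff oo so ot).
rewrite /vhat (fr_to aN dc) => h; apply: (der_ext d0 _ h) => s /near[ds _].
by rewrite /tr -[cto _ _]/(to (g t) (g s)) (fr_to aN ds).
Qed.

Lemma short_flow (c : N) y0 : im c y0 -> exists (e : R) (W : set 'rV[R]_n) (x : R -> 'rV[R]_n -> 'rV[R]_n),
 [/\ 0 < e, open W, W y0 & forall t : R, 0 <= t <= e -> smooth_on W (x t) /\ forall y, W y ->
   [/\ x 0 y = y, im c (x t y) & is_derive t 1 (x^~ y) (vhat v c (x t y))]].
Proof.
move=> iy; have sV := smooth_vhat sv c; have oI := open_im aN c.
have [f [d [r [sf d0 r0 ff f0]]]] := cutoff oI iy sV.
have [x fam] := flow_exists sf f0; have [_ oT Hx] := fam.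
have [x0 dx] := Hx y0 I.
have [k [K [k0 K0 HK]]] := fam_cont fam (I : setT y0) (@ler01 R).
have d20 : 0 < d / 2 by rewrite divr_gt0.
have /cont_R/(_ _ d20)[e e0 He] := is_derive_cont (dx 0).
pose W := [set y : 'rV[R]_n | `|y - y0| < Num.min k (d / 2 / K)].
have near t y : 0 <= t <= Num.min (e / 2) 1 -> W y -> `|x t y - y0| < d.
 rewrite le_min => /andP[t0 /andP[te t1]]; rewrite /W /= lt_min => /andP[yk yK].
 have t01 : 0 <= t <= 1 by rewrite t0 t1.
 have [_ /(_ t t01) h1] := HK y yk.
 have h2 : `|x t y0 - y0| < d / 2.
  by rewrite -{2}x0; apply: He; rewrite subr0 ger0_norm//; lra.
 have h3 : K * `|y - y0| < d / 2 by rewrite mulrC -ltr_pdivlMr.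
 have h4 := ler_distD (x t y0) (x t y) y0; move: h1 h2 h3 h4; clear; lra.
exists (Num.min (e / 2) 1), W, x; split.
- by rewrite lt_min divr_gt0//= ltr01.
- exact: open_nball.
- by rewrite /W /= subrr normr0 lt_min k0 !divr_gt0.
move=> t te; split.
 apply: smooth_sub (fam_smooth fam _); first by [].
 by case/andP: te.
move=> y Wy; have [xy dxy] := Hx y I; have [imx fx] := ff _ (near t y te Wy).
by split => //; rewrite -fx; exact: dxy.
Qed.

(** An integral curve on the manifold cannot deviate from the local flow in the chart: the times of
    agreement form an open set by local uniqueness, and a closed one because the manifold is
    separated. *)
Lemma follow_flow (c : N) (e : R) (W : set 'rV[R]_n) (x : R -> 'rV[R]_n -> 'rV[R]_n) (h : R -> N) (s s' : R) :
 (forall t : R, 0 <= t <= e -> forall y, W y ->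
   [/\ x 0 y = y, im c (x t y) & is_derive t 1 (x^~ y) (vhat v c (x t y))]) ->
 integral_curve v h -> 0 <= s -> s <= s' -> s' <= 1 -> s' - s <= e -> dm c (h s) -> W (to c (h s)) ->
 dm c (h s') /\ to c (h s') = x (s' - s) (to c (h s)).
Proof.
move=> Hx ih s0 ss s1 se dc Wh; set y := to c (h s).
have T0 : 0 <= s' - s by rewrite subr_ge0.
have Hy t (te : 0 <= t <= s' - s) : [/\ x 0 y = y, im c (x t y) & is_derive t 1 (x^~ y) (vhat v c (x t y))].
 by apply: Hx => //; case/andP: te => -> ?; apply: le_trans se.
have h01 t : 0 <= t <= s' - s -> 0 <= s + t <= 1 by move=> /andP[? ?]; apply/andP; split; lra.
suff : h (s + (s' - s)) = fr c (x (s' - s) y).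
 have -> : s + (s' - s) = s' by ring.
 have [|_ ix _] := Hy (s' - s); first by rewrite T0 lexx.
 by have [d e1] := to_fr aN ix; move=> ->.
apply: (real_induction (P := fun t => h (s + t) = fr c (x t y)) T0).
 have [|-> _ _] := Hy 0; first by rewrite lexx.
 by rewrite addr0 /y (fr_to aN dc).
move=> q qT; have [xy0 ix dx] := Hy q qT; have [dxq exq] := to_fr aN ix.
have [oI sV] := (open_im aN c, smooth_vhat sv c).
have [E|ne] := pselect (h (s + q) = fr c (x q y)).
 have dq : dm c (h (s + q)) by rewrite E.
 have [[d d0 Hd] _] := ic_chart ih (h01 q qT) dq.
 exists d => // t t' /andP[t0 tq] qt Pt qt' t'd t'T.
 have in01 u : 0 <= u <= t' - t -> 0 <= u + t <= s' - s by move=> /andP[? ?]; apply/andP; split; lra.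
 have dmu u : 0 <= u <= t' - t -> dm c (h (s + (u + t))).
  by move=> /andP[? ?]; apply: Hd; rewrite ltr_norml; apply/andP; split; lra.
 have T1 : 0 <= t' - t <= t' - t by rewrite lexx andbT; lra.
 have := @ode_unique_open _ _ (vhat v c) (im c) (fun u => to c (h (s + (u + t)))) (fun u => x (u + t) y) (t' - t) oI sV.
 move=> /(_ _ _ _ (t' - t) T1); rewrite subrK => uniq.
 have dt' := dmu _ T1; rewrite subrK in dt'.
 have eh : h (s + t') = fr c (to c (h (s + t'))) by rewrite fr_to.
 apply: etrans eh _; apply: (congr1 (fr c)); apply: uniq.
 - move=> u u01; have du := dmu u u01; split; first exact: im_to.
  have [_ dd] := ic_chart ih (h01 _ (in01 u u01)) du.
  have dd' : is_derive (u + (s + t)) 1 (fun u => to c (h u)) (vhat v c (to c (h (s + (u + t))))).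
   by have -> : u + (s + t) = s + (u + t) by ring.
  have := der_shift dd'; congr (is_derive _ _ _ _); apply/funext => w; congr (to c (h _)); ring.
 - move=> u u01; have [_ iu du] := Hy _ (in01 u u01); split; [exact: iu|exact: der_shift du].
 rewrite add0r; have [|_ iu _] := Hy t; first by apply/andP; split => //; lra.
 by rewrite Pt; have [_ ->] := to_fr aN iu.
have [U [V [oU oV Uh Vx UV]]] := hN ne.
have hq := dm_mem aN (h (s + q)); have [_ dh] := ic_chart ih (h01 q qT) hq.
have WU : (to (h (s + q)) @` (dm (h (s + q)) `&` U)) (to (h (s + q)) (h (s + q))) by exists (h (s + q)).
have [d1 d10 H1] := near_curve (oU (h (s + q))) WU dh.
have [[d3 d30 H3] _] := ic_chart ih (h01 q qT) hq.
have WV : (to c @` (dm c `&` V)) (x q y) by apply/(mopen_imE aN).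
have [d2 d20 H2] := near_curve (oV c) WV dx.
exists (Num.min d1 (Num.min d2 d3)); first by rewrite !lt_min d10 d20.
move=> t t' /andP[t0 tq] qt Pt; exfalso.
have td : `|t - q| < Num.min d1 (Num.min d2 d3) by rewrite ltr_norml; apply/andP; split; lra.
have td' : `|s + t - (s + q)| < Num.min d1 (Num.min d2 d3) by rewrite (_ : s + t - (s + q) = t - q)//; ring.
move: td td'; rewrite !lt_min => /andP[_ /andP[t2 _]] /andP[t1 /andP[_ t3]].
have /(mopen_imE aN)[_ Ut] := H1 _ t1; have /(mopen_imE aN)[_ Vt] := H2 _ t2.
have e1 := fr_to aN (H3 _ t3); have /seteqP[+ _] := UV; apply; split; last exact: Vt.
by move: Ut; rewrite e1 Pt.
Qed.

(** Short flows in charts are composed along the given curve by induction on time. The result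
    replaces the partially defined time-one flow: every integral curve that starts near [g 0] ends
    where one smooth map says. *)
Theorem endpoint_map (g : R -> N) : integral_curve v g ->
 exists (VO : set 'rV[R]_n) (F : 'rV[R]_n -> 'rV[R]_n),
  [/\ open VO, VO (to (g 0) (g 0)), smooth_on VO F & forall h, integral_curve v h ->
    dm (g 0) (h 0) -> VO (to (g 0) (h 0)) -> dm (g 1) (h 1) /\ to (g 1) (h 1) = F (to (g 0) (h 0))].
Proof.
move=> ig.
apply: (real_induction (P := fun t => exists (VO : set 'rV[R]_n) (F : 'rV[R]_n -> 'rV[R]_n),
  [/\ open VO, VO (to (g 0) (g 0)), smooth_on VO F & forall h, integral_curve v h ->
    dm (g 0) (h 0) -> VO (to (g 0) (h 0)) -> dm (g t) (h t) /\ to (g t) (h t) = F (to (g 0) (h 0))]) ler01).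
 exists setT, (fun y => y); split; [exact: openT|exact: I|exact: smooth_id openT|].
 by move=> h _ d _; exact: conj d erefl.
move=> q q01; pose c := g q; have gq : dm c (g q) := dm_mem aN (g q).
have [e [W [x [e0 oW Wy Hx]]]] := short_flow (im_to gq).
have Hf t (te : 0 <= t <= e) := (Hx t te).2.
have [[d1 d10 H1] dg] := ic_chart ig q01 gq.
have [d2 d20 H2] := near_curve oW Wy dg.
exists (Num.min (e / 2) (Num.min d1 d2)); first by rewrite !lt_min divr_gt0// d10.
move=> s s' /andP[s0 sq] qs [VO [F [oVO VOg sF HF]]] qs' s'q s'1.
have in01 : 0 <= s' - s <= e by move: qs s'q; rewrite !(ltrBlDr, ltrBlDl); have := ge_min (e / 2) (e / 2) (Num.min d1 d2); rewrite lexx /= => h1 h2 h3; apply/andP; split; lra.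
have sd : `|s - q| < Num.min (e / 2) (Num.min d1 d2) by rewrite ltr_norml; apply/andP; split; lra.
move: sd; rewrite !lt_min => /andP[_ /andP[sd1 sd2]].
have ss : s <= s' by lra.
have Hstep h (ih : integral_curve v h) := follow_flow Hf ih s0 ss s'1 (andP in01).2.
have [sx _] := Hx _ in01.
have [gs eF] := HF g ig (dm_mem aN (g 0)) VOg.
have cs : dm c (g s) := H1 _ sd1; have Ws : W (to c (g s)) := H2 _ sd2.
have [cs' ex] := Hstep g ig cs Ws.
pose A1 := VO `&` F @^-1` ov (g s) c.
have oA1 : open A1 by exact: open_preimS oVO (open_ov aN _ _) sF.
pose F1 y := tr (g s) c (F y).
have sF1 : smooth_on A1 F1.
 apply: (smooth_comp oA1 (open_ov aN (g s) c) _ _ (smooth_tr_chart aN (g s) c)); first by move=> y [].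
 by apply: smooth_sub sF => y [].
pose A2 := A1 `&` F1 @^-1` W; have oA2 : open A2 by exact: open_preimS.
pose F2 y := x (s' - s) (F1 y).
have sF2 : smooth_on A2 F2.
 apply: (smooth_comp oA2 oW _ _ sx); first by move=> y [].
 by apply: smooth_sub sF1 => y [].
pose A3 := A2 `&` F2 @^-1` ov c (g s'); have oA3 : open A3 by apply: open_preimS => //; exact: open_ov.
have key h : integral_curve v h -> dm (g s) (h s) -> to (g s) (h s) = F (to (g 0) (h 0)) ->
  dm c (h s) -> F1 (to (g 0) (h 0)) = to c (h s) by move=> ih ds e1 dc; rewrite /F1 -e1 /tr fr_to.
exists A3, (fun y => tr c (g s') (F2 y)); split => //.
- have k := key g ig (dm_mem aN _) eF cs; split; last by rewrite /= /F2 k -ex; apply: ov_to => //; exact: dm_mem.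
 by split; [split => //=; rewrite -eF; apply: ov_to => //; exact: dm_mem|rewrite /= k].
- apply: (smooth_comp oA3 (open_ov aN c (g s')) _ _ (smooth_tr_chart aN c (g s'))); first by move=> y [].
 by apply: smooth_sub sF2 => y [].
move=> h ih d0 [[[VOh /(ovP aN)[_ oh]] Wh] /(ovP aN)[_ o2]].
have [ds e1] := HF h ih d0 VOh.
have dc : dm c (h s) by move: oh; rewrite -e1 fr_to.
have k := key h ih ds e1 dc; have [dc' e2] := Hstep h ih dc (eq_ind _ W Wh _ k).
have eF2 : F2 (to (g 0) (h 0)) = to c (h s') by rewrite /F2 k.
by move: o2; rewrite eF2 /tr (fr_to aN dc').
Qed.

End Curves.

(** An alias carrying the norm and completeness together, as Baire's theorem requires. *)
Definition rVc (R : realType) n := 'rV[R]_n.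
HB.instance Definition _ (R : realType) n := NormedModule.on (rVc R n).
HB.instance Definition _ (R : realType) n := Complete.on (rVc R n).

(** * The dimension of the saturation *)

Section Dim.
Variable R : realType.

Definition lip_image N D (E : set 'rV[R]_D) : Prop :=
 exists (c0 : 'rV[R]_N) (rho L : R) (f : 'rV[R]_N -> 'rV[R]_D), [/\ 0 < rho, 0 <= L,
  forall u u' : 'rV[R]_N, `|u - c0| <= rho -> `|u' - c0| <= rho -> `|f u - f u'| <= L * `|u - u'| &
  forall y, E y -> exists2 u : 'rV[R]_N, `|u - c0| <= rho & f u = y].

Lemma nat_dist (a b : nat) : `|a%:R - b%:R| < 1 :> R -> a = b.
Proof.
rewrite ltr_norml => /andP[h1 h2]; case: (ltngtP a b) => [||//]; rewrite -(ler_nat R) -natr1 => h3; exfalso;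
 by move: h1 h2 h3; move: (a%:R : R) (b%:R : R) => x y; clear; lra.
Qed.

(* A grid of mesh 1/k has k^D points; their preimages occupy different cells of a grid
   of k^N cells, up to a constant factor. *)
Lemma lip_pigeonhole N D (E : set 'rV[R]_D) (c : 'rV[R]_D) (dl : R) : lip_image N E -> 0 < dl ->
 (forall y : 'rV[R]_D, `|y - c| < dl -> forall t : R, 0 < t -> exists2 z, E z & `|z - y| < t) -> (D <= N)%N.
Proof.
move=> [c0 [rho [L [f [rho0 L0 Hf HE]]]]] dl0 He; rewrite leqNgt; apply/negP => ND.
(* C exceeds 8 L rho / dl: cells of side 2 rho / (C K) then have images of diameter below half of
   the spacing dl / (2 K) of the target grid. *)
pose C := (Num.truncn (8 * L * rho / dl)).+1.
have x0 : 0 <= 8 * L * rho / dl by rewrite divr_ge0 ?(ltW dl0)// !mulr_ge0// ltW.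
have CL : 8 * L * rho < dl * C%:R.
 have /andP[_] := Num.Theory.truncn_itv x0; rewrite -/C ltr_pdivrMr//.
 by rewrite [C%:R * _]mulrC.
(* K > (C + 1)^N contradicts the count K^(N + 1) <= K^D <= (C K + 1)^N <= ((C + 1) K)^N. *)
pose k := (C.+1 ^ N)%N; pose K := k.+1; pose M := (C * K)%N.
have K0 : (0 : R) < K%:R by rewrite ltr0n.
have M0 : (0 : R) < M%:R by rewrite ltr0n muln_gt0.
pose tau := dl / (8 * K%:R); have tau0 : 0 < tau by rewrite divr_gt0// mulr_gt0.
pose Y (phi : {ffun 'I_D -> 'I_K}) : 'rV[R]_D := c + (dl / (2 * K%:R)) *: \row_i (phi i)%:R.
have dK : 0 < dl / (2 * K%:R) by rewrite divr_gt0// mulr_gt0.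
have Yc phi : `|Y phi - c| < dl.
 have -> : Y phi - c = (dl / (2 * K%:R)) *: \row_i (phi i)%:R by rewrite /Y addrC addKr.
 rewrite normrZ gtr0_norm//.
 have h : `|\row_i (phi i)%:R : 'rV[R]_D| <= K%:R.
  apply: mx_norm_le => [|i j]; first exact: ltW.
  by rewrite mxE normr_nat ler_nat ltnW.
 apply: (@le_lt_trans _ _ (dl / (2 * K%:R) * K%:R)); first by rewrite ler_wpM2l// ltW.
 have -> : dl / (2 * K%:R) * K%:R = dl / 2 by field; rewrite ?gt_eqF.
 by rewrite ltr_pdivrMr// mulr_natr; lra.
have Ysep phi phi' : `|Y phi - Y phi'| < dl / (2 * K%:R) -> phi = phi'.
 have -> : Y phi - Y phi' = (dl / (2 * K%:R)) *: \row_i ((phi i)%:R - (phi' i)%:R).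
  by apply/rowP => i; rewrite !mxE; ring.
 rewrite normrZ gtr0_norm// -ltr_pdivlMl// mulVf ?gt_eqF// => h.
 apply/ffunP => i; apply: val_inj => /=.
 have := le_lt_trans (mx_entry_le _ 0 i) h; rewrite mxE.
 exact: nat_dist.
have Hu phi : exists u : 'rV[R]_N, `|u - c0| <= rho /\ `|f u - Y phi| < tau.
 by have [z /HE[u uc <-] zt] := He _ (Yc phi) tau tau0; exists u.
have [U HU] := choice Hu.
pose T (u : 'rV[R]_N) (j : 'I_N) : R := (u 0 j - c0 0 j + rho) / (2 * rho) * M%:R.
have T0 u j : `|u - c0| <= rho -> 0 <= T u j <= M%:R.
 move=> uc; have := le_trans (mx_entry_le (u - c0) 0 j) uc; rewrite !mxE ler_norml => /andP[h1 h2].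
 have r2 : 0 < 2 * rho by rewrite mulr_gt0.
 rewrite /T; apply/andP; split.
  by rewrite mulr_ge0 ?(ltW M0)// divr_ge0 ?(ltW r2)//; lra.
 by rewrite ler_piMl ?(ltW M0)// ler_pdivrMr// mul1r; lra.
pose I0 phi : {ffun 'I_N -> 'I_M.+1} := [ffun j => inord (Num.truncn (T (U phi) j))].
have I0_inj : injective I0.
 move=> phi phi' e; have [uc ut] := HU phi; have [uc' ut'] := HU phi'.
 have ud : `|U phi - U phi'| <= 2 * rho / M%:R.
  apply: mx_norm_le => [|i j]; first by rewrite divr_ge0 ?(ltW M0)// mulr_ge0// ltW.
  rewrite (ord1 i) !mxE; have := congr1 (fun g : {ffun 'I_N -> 'I_M.+1} => nat_of_ord (g j)) e.
  have /andP[t0 tM] := T0 _ j uc; have /andP[t0' tM'] := T0 _ j uc'.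
  have /andP[a1 a2] := Num.Theory.truncn_itv t0; have /andP[b1 b2] := Num.Theory.truncn_itv t0'.
  have am : (Num.truncn (T (U phi) j) < M.+1)%N by rewrite ltnS -(ler_nat R) (le_trans a1).
  have bm : (Num.truncn (T (U phi') j) < M.+1)%N by rewrite ltnS -(ler_nat R) (le_trans b1).
  rewrite /I0 !ffunE !inordK// => ee; rewrite ee in a1 a2.
  have td : `|T (U phi) j - T (U phi') j| <= 1.
   move: a1 a2 b1 b2; rewrite -!natr1; move: (T _ j) (T _ j) (_%:R) => p q w.
   by rewrite ler_norml; clear => *; apply/andP; split; lra.
  have -> : U phi 0 j - U phi' 0 j = (T (U phi) j - T (U phi') j) * (2 * rho / M%:R).
   by rewrite /T; field; rewrite ?gt_eqF.
  rewrite normrM [ `|2 * rho / M%:R| ]ger0_norm; last by rewrite divr_ge0 ?(ltW M0)// mulr_ge0// ltW.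
  by rewrite ler_piMl// divr_ge0 ?(ltW M0)// mulr_ge0// ltW.
 apply: Ysep; have fd := Hf _ _ uc uc'.
 have fd2 : `|f (U phi) - f (U phi')| < dl / (4 * K%:R).
  apply: le_lt_trans fd _; apply: (@le_lt_trans _ _ (L * (2 * rho / M%:R))); first by rewrite ler_wpM2l.
  have -> : L * (2 * rho / M%:R) = 8 * L * rho / C%:R / (4 * K%:R).
   by rewrite /M natrM; field; rewrite ?gt_eqF//= ltr0n.
  by rewrite ltr_pM2r ?invr_gt0 ?mulr_gt0// ltr_pdivrMr// ltr0n.
 have t1 := ler_distD (f (U phi)) (Y phi) (Y phi').
 have t2 := ler_distD (f (U phi')) (f (U phi)) (Y phi').
 have t3 := distrC (Y phi) (f (U phi)).
 have te : tau + tau + dl / (4 * K%:R) = dl / (2 * K%:R) by rewrite /tau; field; rewrite ?gt_eqF.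
 rewrite -te; move: t1 t2 fd2 ut ut'; rewrite t3; clear; lra.
have := leq_card _ I0_inj; rewrite !card_ffun !card_ord => h1.
have MC : (M.+1 <= C.+1 * K)%N by rewrite mulSn -/M -add1n leq_add2r.
have pw a b l : (a <= b -> a ^ l <= b ^ l)%N by case: l => [|l] ab; rewrite ?expn0// leq_exp2r.
have h2 : (M.+1 ^ N <= (C.+1 * K) ^ N)%N by exact: pw.
have h3 : (K ^ N.+1 <= K ^ D)%N by rewrite leq_pexp2l.
have := leq_trans h3 (leq_trans h1 h2); rewrite expnS expnMn leq_pmul2r ?expn_gt0//.
by rewrite /K /k ltnn.
Qed.

(** If D > N, the pigeonhole bound shows that no set of the cover is dense in a ball. The
    complements of the closures are then open and dense, and Baire's theorem yields an uncovered
    point of the ball. *)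
Theorem countable_lip_cover N D (E : nat -> set 'rV[R]_D) (y0 : 'rV[R]_D) (r0 : R) : 0 < r0 ->
 (forall n, lip_image N (E n)) ->
 (forall y : 'rV[R]_D, `|y - y0| < r0 -> exists n, E n y) -> (D <= N)%N.
Proof.
move=> r00 HE cov; rewrite leqNgt; apply/negP => ND.
pose F (n : nat) : set (rVc R D) := ~` closure (E n).
have dF : dense (\bigcap_n F n).
 apply: Baire => n; split; first exact/closed_openC/closed_closure.
 move=> VO [c Oc] oVO; apply/set0P/negP => /eqP VF.
 have [e e0 He] := (open_rV _).1 (oVO : open (VO : set 'rV[R]_D)) c Oc.
 suff : (D <= N)%N by rewrite leqNgt ND.
 apply: (lip_pigeonhole (HE n) e0 (c := c)) => y yc t t0.
 have cl : closure (E n) y.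
  by apply: contrapT => ncl; have /seteqP[+ _] := VF; move=> /(_ y); apply; split; [exact: He|].
 have nb : nbhs (y : 'rV[R]_D) [set z : 'rV[R]_D | `|z - y| < t] by apply/nbhs_rV; exists t.
 by have [z [Ez zy]] := cl _ nb; exists z.
have [|y [yr yF]] := dF [set y : 'rV[R]_D | `|y - y0| < r0] _ (@open_nball R D y0 r0).
 by exists y0; rewrite /= subrr normr0.
have [n En] := cov y yr; have := yF n I; apply; exact: subset_closure.
Qed.

End Dim.

(** * Retractions, frames and countable bases *)

Section Local.
Variable R : realType.

(** The map (y, w) -> F y + w c, with [c] a basis of a complement of the range of the derivative, is
    a local diffeomorphism; [lam] is the first component of its inverse. *)
Lemma immersion_retract D n (F : 'rV[R]_D -> 'rV[R]_n) (W : set 'rV[R]_D) (y0 : 'rV[R]_D) :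
 open W -> W y0 -> smooth_on W F -> row_free ('J F y0) ->
 exists (OP : set 'rV[R]_D) (VO : set 'rV[R]_n) (lam : 'rV[R]_n -> 'rV[R]_D),
  [/\ [/\ open OP, open VO, OP y0 & OP `<=` W], smooth_on VO lam &
    forall y, OP y -> VO (F y) /\ lam (F y) = y].
Proof.
move=> oW Wy sF rf; pose A := 'J F y0; pose k := \rank (A^C)%MS; pose c : 'M[R]_(k, n) := row_base (A^C)%MS.
have rA : \rank A = D by apply/eqP.
have Dn : (D <= n)%N by rewrite -rA rank_leq_col.
have rfc : row_free (col_mx A c).
 rewrite /row_free -addsmxE (adds_eqmx (eqmx_refl A) (eq_row_base _)).
 have := addsmx_compl_full A; rewrite /row_full => /eqP ->.
 by rewrite /k mxrank_compl rA subnKC.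
have nDk : (n <= D + k)%N by rewrite /k mxrank_compl rA subnKC.
pose W' : set 'rV[R]_(D + k) := lsubmx @^-1` W; have oW' : open W' by exact: smooth_lsub.
pose z0 : 'rV[R]_(D + k) := row_mx y0 0; have Wz : W' z0 by rewrite /W' /= row_mxKl.
pose V (u : 'rV[R]_(D + k)) := row_mx (F (lsubmx u)) (rsubmx u).
pose L (v : 'rV[R]_(n + k)) := v *m col_mx 1%:M c + 0.
have sFl : smooth_on W' (fun u => F (lsubmx u)) by exact: (smooth_comp oW' oW (fun _ h => h) (smooth_lsubT oW') sF).
have sV : smooth_on W' V by apply: smooth_row_mx => //; exact: smooth_rsubT.
have sL : smooth_on setT L.
 apply: smooth_add; [exact: openT| |by apply: smooth_cst; exact: openT].
 by apply: smooth_mulmx; [exact: openT|exact: smooth_id openT|by apply: smooth_cst; exact: openT].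
have sLV : smooth_on W' (fun u => L (V u)) by exact: (smooth_comp oW' openT (fun _ _ => I) sV sL).
have jLV : 'J (fun u => L (V u)) z0 = col_mx A c.
 rewrite (jac_compS oW' openT sV sL Wz I) (jac_lin _ _ _).2 (jac_row_mx oW' sFl (smooth_rsubT oW') Wz).
 rewrite (jac_compS oW' oW (smooth_lsubT oW') sF Wz Wz) jac_lsub jac_rsub row_mxKl -/A.
 by rewrite mul_row_col mulmx1 !mul_col_mx !mul1mx !mul0mx add_col_mx addr0 add0r.
have [|U [VO [G [[oU oV Uz UW] H1 H2 sG]]]] := inverse_function_dim nDk oW' Wz sLV; first by rewrite jLV.
have sI : smooth_on setT (fun y : 'rV[R]_D => row_mx y 0 : 'rV[R]_(D + k)).
 by apply: smooth_row_mx; [exact: openT|exact: smooth_id openT|by apply: smooth_cst; exact: openT].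
exists (setT `&` (fun y : 'rV[R]_D => row_mx y 0 : 'rV[R]_(D + k)) @^-1` U), VO, (fun q => lsubmx (G q)); split.
- split=> //; first exact: open_preimS openT oU sI.
 by move=> y [_ /UW]; rewrite /W' /= row_mxKl.
- by apply: smooth_lsubmx.
move=> y [_ /H1[]]; have -> : L (V (row_mx y 0)) = F y.
 by rewrite /L /V row_mxKl row_mxKr addr0 mul_row_col mulmx1 mul0mx addr0.
by move=> ? ->; rewrite row_mxKl.
Qed.

Lemma kernel_frame rho n (s : 'M[R]_(rho, n)) : row_free s ->
 exists A : 'M[R]_(n - rho, n), row_free A /\ A *m s^T = 0.
Proof.
move=> rf; have rs : \rank s = rho by apply/eqP.
have : (n - rho)%N = \rank (kermx s^T) by rewrite mxrank_ker mxrank_tr rs.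
move: (n - rho)%N => r ->; exists (row_base (kermx s^T)); split; first exact: row_base_free.
by apply/sub_kermxP; rewrite eq_row_base.
Qed.

(** A frame [A] of the annihilator at [y0] is projected to the annihilator of s(y) along the rows of
    K^T, where K is a right inverse of s(y0). A right inverse of [A] shows that independence
    persists nearby. *)
Lemma smooth_annihilator m rho n (s : 'rV[R]_m -> 'M[R]_(rho, n)) (VO : set 'rV[R]_m) (y0 : 'rV[R]_m) :
 open VO -> VO y0 -> smooth_on VO s -> row_free (s y0) ->
 exists (VO' : set 'rV[R]_m) (e : 'rV[R]_m -> 'M[R]_(n - rho, n)),
  [/\ open VO', VO' y0, VO' `<=` VO, smooth_on VO' e &
    forall y, VO' y -> row_free (e y) /\ e y *m (s y)^T = 0].
Proof.
move=> oO Oy ss rf; have [A [rA As]] := kernel_frame rf.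
have /row_freeP[K sK] := rf; have /row_freeP[B AB] := rA.
pose e y := A - A *m (s y)^T *m (invmx (s y *m K))^T *m K^T.
pose V1 := [set y | VO y /\ s y *m K \in unitmx].
have sK' : smooth_on VO (fun y => s y *m K) by apply: smooth_mulmx => //; exact: smooth_cst.
have o1 : open V1 by exact: open_unit.
have s1 : smooth_on V1 s by apply: smooth_sub ss => y [].
have se : smooth_on V1 e.
 apply: smooth_sub_mx => //; first exact: smooth_cst.
 apply: smooth_mulmx => //; last exact: smooth_cst.
 apply: smooth_mulmx => //; first by apply: smooth_mulmx => //; [exact: smooth_cst|exact: smooth_tr].
 apply: smooth_tr => //; apply: smooth_invmx => //; first by move=> y [].
 by apply: smooth_sub sK' => y [].
have seB : smooth_on V1 (fun y => e y *m B) by apply: smooth_mulmx => //; exact: smooth_cst.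
exists [set y | V1 y /\ e y *m B \in unitmx], e; split.
- exact: open_unit.
- split; first by split => //; rewrite sK unitmx1.
 by rewrite /e As !mul0mx subr0 AB unitmx1.
- by move=> y [[]].
- by apply: smooth_sub se => y [].
move=> y [[_ u1] u2]; split.
 by apply/row_freeP; exists (B *m invmx (e y *m B)); rewrite mulmxA mulmxV.
rewrite /e mulmxBl -!mulmxA -[K^T *m _]trmx_mul -(trmx_mul (s y *m K)) mulmxV// trmx1 mulmx1.
by rewrite subrr.
Qed.

Lemma frame_complete k r n m (e : 'M[R]_(r, n)) (A : 'M[R]_(m, n)) (b : 'M[R]_(k, n)) :
 row_free e -> e *m A^T = 0 -> (\rank A + r = n)%N -> b *m A^T = 0 -> exists y, b = y *m e.
Proof.
move=> rf eA rA bA; have ek : (e <= kermx A^T)%MS by apply/sub_kermxP.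
have rk : \rank e = \rank (kermx A^T) by rewrite mxrank_ker mxrank_tr (eqP rf); lia.
have ee : (kermx A^T <= e)%MS by have := mxrank_leqif_sup ek => /leqifP; rewrite rk; case: ifP => // _; rewrite ltnn.
by have /submxP[y ->] : (b <= e)%MS; [apply: submx_trans ee; apply/sub_kermxP|exists y].
Qed.

(** Rational centres and radii 1 / (l + 1), enumerated through [pickle]. Codes that decode to
    nothing get radius 0, which the first clause of the conclusion excludes. *)
Lemma rational_balls N : exists B : nat -> 'rV[R]_N * R, forall (y : 'rV[R]_N) (e : R), 0 < e ->
 exists n, [/\ 0 < (B n).2, `|y - (B n).1| < (B n).2 & forall z : 'rV[R]_N, `|z - (B n).1| <= (B n).2 -> `|z - y| < e].
Proof.
exists (fun n => if (unpickle n : option ('rV[rat]_N * nat)) is Some p then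
  (map_mx ratr p.1, p.2.+1%:R^-1) else (0, 0)) => y e e0.
pose l := Num.truncn (2 / e); have /andP[_ le] : l%:R <= 2 / e < l.+1%:R.
 by apply: Num.Theory.truncn_itv; rewrite divr_ge0// ltW.
pose d : R := l.+1%:R^-1; have d0 : 0 < d by rewrite invr_gt0 ltr0n.
have de : 2 * d < e by move: le; rewrite ltr_pdivrMr// -ltr_pdivrMl ?ltr0n// mulrC.
have Hq (j : 'I_N) : exists q : rat, `|y 0 j - ratr q| < d / 2.
 have [|q] := @rat_in_itvoo _ (y 0 j - d / 2) (y 0 j + d / 2); first by move: d0; clear; lra.
 by rewrite in_itv /= => /andP[h1 h2]; exists q; rewrite ltr_norml; move: h1 h2; clear => h1 h2; apply/andP; split; lra.
have [q Hq'] := choice Hq.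
exists (pickle (\row_j q j : 'rV[rat]_N, l)); rewrite pickleK /= -/d.
have yq : `|y - map_mx ratr (\row_j q j)| < d.
 apply: (@le_lt_trans _ _ (d / 2)); last by move: d0; clear; lra.
 apply: mx_norm_le => [|i j]; first by move: d0; clear; lra.
 by rewrite (ord1 i) !mxE; apply: ltW.
split=> // z zq; have h := ler_distD (map_mx ratr (\row_j q j)) z y.
have hs := distrC (map_mx ratr (\row_j q j)) y; rewrite hs in h.
by move: zq yq h de; clear; lra.
Qed.

(** Rational balls in the charts of a countable family of points. The union over all points with
    code p.1, of which there is at most one, avoids inverting the enumeration. *)
Lemma countable_basis (M : charted R) : is_manifold M -> exists B : nat -> set M, (forall n, mopen (B n)) /\
 forall (VO : set M) (p : M), mopen VO -> VO p -> exists n, B n p /\ B n `<=` VO.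
Proof.
move=> hM; have aM := atlasP hM; have [A [/countable_injP[f finj] cA]] := second_countable_mfd hM.
have [B HB] := rational_balls (mdim M).
pose S (a : M) (l : nat) : set M := [set x | dm a x /\ `|to a x - (B l).1| < (B l).2].
have oS a l : mopen (S a l).
 apply: (mopen_chart aM a [set y : 'rV[R]_(mdim M) | `|y - (B l).1| < (B l).2]).
 exact: open_nball.
exists (fun n => if (unpickle n : option (nat * nat)) is Some p then
 [set x | exists a : {a : M | A a /\ f a = p.1}, S (sval a) p.2 x] else set0); split.
 move=> n; case: unpickle => [p|]; first by apply: (mopen_bigcup aM) => a; exact: oS.
 by apply: (mopen_local aM) => x.
move=> VO p oVO Vp; have : [set: M] p by []; rewrite -cA => -[a Aa dp].
have /(mopenP aM)/(_ a p dp Vp)[e e0 He] := oVO.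
have [l [l0 lp Hl]] := HB (to a p) e e0.
exists (pickle (f a, l)); rewrite pickleK /=; split; first by exists (exist _ a (conj Aa erefl)).
move=> x [[a' [Aa' fa]] /= [dx xl]].
have aa : a' = a by apply: finj => //; rewrite inE.
subst a'; have [_] := He _ (Hl _ (ltW xl)); by rewrite fr_to.
Qed.

Section Frame.
Variables (X M : charted R) (i : X -> M).
Hypotheses (aX : atlas X) (aM : atlas M) (si : smooth_map i).

Lemma local_frame (E : X -> 'M[R]_(mdim M)) : subbundle i E -> exists rho, (forall x, \rank (E x) = rho) /\
 forall x0, exists (VO : set 'rV[R]_(mdim X)) (e : 'rV[R]_(mdim X) -> 'M[R]_(mdim M - rho, mdim M)),
  [/\ [/\ open VO, VO (to x0 x0) & VO `<=` im x0],
    (forall y, VO y -> dm (i x0) (i (fr x0 y))), smooth_on VO e &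
    forall y, VO y -> let x := fr x0 y in
     row_free (e y) /\ e y *m (E x *m cc (i x) (i x0) (i x))^T = 0].
Proof.
move=> [rho [rE HE]]; exists rho; split => // x0; have [U [oU Ux0 [s [ss sE]]]] := HE x0.
have xx := dm_mem aX x0; have ii := dm_mem aM (i x0).
pose V0 := to x0 @` (dm x0 `&` U `&` i @^-1` dm (i x0)).
have V0P y : V0 y <-> [/\ im x0 y, U (fr x0 y) & dm (i x0) (i (fr x0 y))] by exact: (rep_domP aX).
have oV0 : open V0.
 have : mopen (U `&` i @^-1` dm (i x0)).
  exact: mopenI aX _ _ oU (smooth_map_cont aX aM si (mopen_dm aM (i x0))).
 move=> /(_ x0).
 congr open; apply/seteqP; split => y; first by move=> /(mopen_imE aX)[? [? ?]]; apply/V0P.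
 by move=> /V0P[? ? ?]; apply/(mopen_imE aX).
have V0x : V0 (to x0 x0) by exists x0.
pose sh y := s (fr x0 y) *m cc (i (fr x0 y)) (i x0) (i (fr x0 y)).
have ssh : smooth_on V0 sh := ss x0 (i x0).
have rfs : row_free (sh (to x0 x0)).
 by rewrite /sh (fr_to aX xx) (cc_id aM ii) mulmx1 /row_free (sE x0 Ux0) rE.
have [VO [e [oVO VOx VV se He]]] := smooth_annihilator oV0 V0x ssh rfs.
exists VO, e; split => //.
- by split => // y /VV/V0P[].
- by move=> y /VV/V0P[].
move=> y Vy x; have [rf es] := He y Vy; split => //.
have /V0P[_ Ux _] := VV y Vy.
have /submxP[Y ->] : (E x <= s x)%MS by rewrite (sE x Ux).
by rewrite -mulmxA trmx_mul mulmxA es mul0mx.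
Qed.

Lemma ann_subP m1 m2 n (A : 'M[R]_(m1, n)) (b : 'M[R]_(m2, n)) : (b <= ann A)%MS <-> b *m A^T = 0.
Proof. by split=> /sub_kermxP. Qed.

End Frame.

Section Retract.
Variables (P M : charted R) (j : P -> M).
Hypotheses (aP : atlas P) (aM : atlas M) (ej : is_embedding j).

(** The last clause comes from the embedding being a homeomorphism onto its image: points of P with
    image near j p lie near p, and not on another sheet of P. *)
Lemma embedding_retract (p0 p : P) (q0 : M) : dm p0 p -> dm q0 (j p) ->
 exists (OP : set 'rV[R]_(mdim P)) (VO : set 'rV[R]_(mdim M)) (lam : 'rV[R]_(mdim M) -> 'rV[R]_(mdim P)),
  [/\ [/\ open OP, open VO, OP (to p0 p) & VO (to q0 (j p))],
    OP `<=` rep_dom setT j p0 q0 /\ VO `<=` im q0, smooth_on VO lam,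
    (forall y, OP y -> VO (rep j p0 q0 y) /\ lam (rep j p0 q0 y) = y) &
    forall p', dm q0 (j p') -> VO (to q0 (j p')) -> dm p0 p' /\ OP (to p0 p')].
Proof.
move=> dp dq; have [sj injj immj topj] := ej.
have [oD sD] := rep_smooth p0 q0 sj; have Dp : rep_dom setT j p0 q0 (to p0 p) by exists p.
have rf : row_free ('J (rep j p0 q0) (to p0 p)).
 have u1 := cc_unit aP dp (dm_mem aP p); have u2 := cc_unit aM (dm_mem aM (j p)) dq.
 rewrite (rep_jac aP aM sj I dp dq) /row_free mxrankMfree; last by rewrite row_free_unit.
 by rewrite eqmxMfull; [exact: immj|rewrite row_full_unit].
have [OP [VO [lam [[oOP oVO OPy OPD] sl H]]]] := immersion_retract oD Dp sD rf.
have [VM [oVM eVM]] := topj _ (mopen_chart aP p0 OP oOP).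
have HVM p' : VM (j p') <-> dm p0 p' /\ OP (to p0 p').
 by have /seteqP[h1 h2] := eVM; split=> [/(h2 p')|/(h1 p')].
exists OP, (VO `&` to q0 @` (dm q0 `&` VM)), lam; split.
- split=> //; first exact: openI oVO (oVM q0).
 split; last by exists (j p) => //; split => //; apply/HVM.
 by have [+ _] := H _ OPy; rewrite /rep (fr_to aP dp).
- by split=> // y [_ /(mopen_imE aM)[]].
- by apply: smooth_sub sl => y [].
- move=> y Oy; have [Vy e] := H y Oy; split => //; split => //.
 have /(rep_domP aP)[iy _ qy] := OPD y Oy; have [dy ey] := to_fr aP iy.
 by exists (j (fr p0 y)) => //; split => //; apply/HVM; rewrite ey.
by move=> p' dq' [_ /(mopen_imE aM)[_]]; rewrite (fr_to aM dq') => /HVM.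
Qed.

End Retract.
End Local.

(** * The dimension bound for the saturation *)

Section Dimension.
Variable R : realType.

Lemma smooth_lipschitz N D (F : 'rV[R]_N -> 'rV[R]_D) (W : set 'rV[R]_N) (z0 : 'rV[R]_N) : open W -> W z0 ->
 smooth_on W F -> exists d L : R, [/\ 0 < d, 0 <= L & forall z z' : 'rV[R]_N, `|z - z0| < d -> `|z' - z0| < d ->
  W z /\ `|F z - F z'| <= L * `|z - z'|].
Proof.
move=> oW Wz sF; have [d d0 Hd] := smooth_strict oW Wz sF ltr01.
exists d, (1 + N%:R * `|'J F z0|); split => //.
move=> z z' zd zd'; have [Wz' h] := Hd z' z zd' zd; have [Wz2 _] := Hd z z' zd zd'; split => //.
rewrite -[F z - F z'](subrK ((z - z') *m 'J F z0)); apply: le_trans (ler_normD _ _) _.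
rewrite mulrDl mul1r lerD//; first by rewrite mul1r in h.
apply: le_trans (mulmx_norm _ _) _; rewrite -!mulrA ler_wpM2l// mulrC lexx.
by [].
Qed.

Lemma ann_change k n m (A : 'M[R]_(m, n)) (xi : 'M[R]_(k, n)) (S T : 'M[R]_n) : S *m T = 1%:M -> xi *m A^T = 0 ->
 xi *m T^T *m (A *m S)^T = 0.
Proof.
by move=> ST h; rewrite trmx_mul !mulmxA -(mulmxA xi) -trmx_mul ST trmx1 mulmx1.
Qed.

Lemma tr_of (N : charted R) (aN : atlas N) (c c' b : N) y : dm c b -> to c b = y -> tr c c' y = to c' b.
Proof. by move=> d <-; rewrite /tr fr_to. Qed.

Lemma lip_image0 N D : @lip_image R N D set0.
Proof. by exists 0, 1, 0, (fun=> 0); split => // u u' _ _; rewrite subrr normr0 mul0r. Qed.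

Variables (X M P : charted R) (pi : bivec M) (i : X -> M) (j : P -> M) (piP : bivec P).
Hypotheses (hX : is_manifold X) (hM : is_manifold M) (ei : is_embedding i).
Hypothesis sat : local_poisson_saturation pi i j piP.

Let aX := atlasP hX.
Let aM := atlasP hM.
Let aT := atlas_cotangent aM.
Let sM : separated M. Proof. exact: hausdorff_mfd hM. Qed.
Let sT := separated_cotangent aM sM.
Let si := emb_smooth ei.

(** A coordinate ball of P consists of endpoints of spray curves started at covectors annihilating
    [C], a family with dim X + rank TX^perp parameters. Countably many pieces cover it, and on each
    the endpoint is a Lipschitz function of the parameters. *)
Theorem saturation_dim (x0 : X) : (mdim P <= mdim X + \rank (Tperp pi i x0))%N.
Proof.
have [chi [Sigma [C [spr _ [sC dC fC] rj [hP [ej _ _] ij]]]]] := sat.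
have aP := atlasP hP; have sv := spray_smooth spr.
have [rho [rC HC]] := local_frame aX aM si sC.
have rT : (\rank (Tperp pi i x0) = mdim M - rho)%N.
 by have /mxdirectP/= := dC x0; rewrite (fC x0) mxrank1 (rC x0); move: (\rank (Tperp pi i x0)) => t ->; rewrite addnK.
rewrite rT; set n := mdim M; set r := (n - rho)%N; set m := mdim X.
have [p0 _ jp0] : (range j) (i x0) by apply: ij; exists x0.
have [VO HVO] := choice HC; have {HVO}[e He] := choice HVO.
have [B [oB HB]] := countable_basis hX; have [Q HQ] := rational_balls R (m + r).
pose OXs (x : X) := [set x' | dm x x' /\ VO x (to x x')].
have oOXs x : mopen (OXs x) by apply: mopen_chart => //; have [[]] := He x.
have [xs Hxs] : exists xs : nat -> X, forall n, (exists x, B n `<=` OXs x) -> B n `<=` OXs (xs n).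
 have h l : exists x, (exists x, B l `<=` OXs x) -> B l `<=` OXs x.
  by have [[x hx]|nx] := pselect (exists x, B l `<=` OXs x); [exists x|exists x0 => /nx].
 by have [xs hxs] := choice h; exists xs => l; exact: hxs.
have [r0 r00 Hr0] := (open_rV _).1 (open_im aP p0) _ (im_to (dm_mem aP p0)).
(* The points of a ball of P reached from covectors with base point near [xs a]
   and coordinates in the b-th rational ball. *)
pose E (a b : nat) : set 'rV[R]_(mdim P) := [set y | `|y - to p0 p0| < r0 /\
 exists (x : X) (eta : 'rV[R]_r) (g : R -> cotangent M), [/\ OXs (xs a) x,
  `|row_mx (to (xs a) x) eta - (Q b).1| < (Q b).2, integral_curve chi g,
  (g 0).1 = i x /\ (g 0).2 *m (cc (i (xs a)) (i x) (i x))^T = eta *m e (xs a) (to (xs a) x) &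
  (g 1).1 = j (fr p0 y)]].
(* Pieces that are not Lipschitz images are discarded; every point of the ball is then shown to lie
   in a piece that is kept. *)
pose E' (c : nat) := if (unpickle c : option (nat * nat)) is Some ab then
 (if `[< lip_image (m + r) (E ab.1 ab.2) >] then E ab.1 ab.2 else set0) else set0.
apply: (@countable_lip_cover _ (m + r) (mdim P) E' (to p0 p0) r0 r00).
 move=> c; rewrite /E'; case: (unpickle c) => [ab|]; last exact: lip_image0.
 by case: asboolP => // _; exact: lip_image0.
move=> y yr; suff [a [b [Eab lab]]] : exists a b, E a b y /\ lip_image (m + r) (E a b).
 by exists (pickle (a, b)); rewrite /E' pickleK /=; case: asboolP.
have iy := Hr0 y yr; pose p := fr p0 y; have [dp ep] := to_fr aP iy.
have : (range j) (j p) by exists p.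
rewrite rj => -[x [xi [xiC _ [g [ig g0 g1]]]]].
have OXx : OXs x x by split; [exact: dm_mem|have [[_ h _] _ _ _] := He x].
have [a [Bx BO]] := HB _ x (oOXs x) OXx.
have Ox : OXs (xs a) x by apply: Hxs Bx; exists x.
have [dx Vx] := Ox; have [[oV _ Vim] Vi se Ve] := He (xs a).
have dix : dm (i (xs a)) (i x) by have := Vi _ Vx; rewrite (fr_to aX dx).
have ii := dm_mem aM (i x).
have [rfe ee] := Ve _ Vx; rewrite (fr_to aX dx) in ee.
have [eta0 Heta0] : exists eta, xi *m (cc (i (xs a)) (i x) (i x))^T = eta *m e (xs a) (to (xs a) x).
 apply: frame_complete rfe ee _ _.
  rewrite mxrankMfree ?rC; last by rewrite row_free_unit cc_unit.
  rewrite /n /r subnKC// -(rC x); exact: rank_leq_col.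
 by apply: (ann_change (cc_inv aM ii dix)); apply/ann_subP.
pose c : cotangent M := (i (xs a), 0).
pose V0 : set 'rV[R]_(m + r) := lsubmx @^-1` VO (xs a).
have oV0 : open V0 by exact: smooth_lsub.
pose sg (u : 'rV[R]_(m + r)) : 'rV[R]_(n + n) :=
 row_mx (rep i (xs a) (i (xs a)) (lsubmx u)) (rsubmx u *m e (xs a) (lsubmx u)).
have ssg : smooth_on V0 sg.
 apply: smooth_row_mx => //; last first.
  apply: smooth_mulmx => //; first exact: smooth_rsubT.
  exact: (smooth_comp oV0 oV (fun _ h => h) (smooth_lsubT oV0) se).
 have [oD sD] := rep_smooth (xs a) (i (xs a)) si.
 apply: (smooth_comp oV0 oD _ (smooth_lsubT oV0) sD) => u Vu; apply/(rep_domP aX).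
 by split => //; [exact: Vim|exact: Vi].
have Hsg x' eta' (b : cotangent M) : OXs (xs a) x' -> b.1 = i x' ->
  b.2 *m (cc (i (xs a)) (i x') (i x'))^T = eta' *m e (xs a) (to (xs a) x') ->
  dm (M := cotangent M) c b /\ to c b = sg (row_mx (to (xs a) x') eta').
 move=> [dx' Vx'] b1 b2; have dix' := Vi _ Vx'; rewrite (fr_to aX dx') in dix'; split.
  by rewrite -b1 in dix'.
 rewrite cot_to /sg !row_mxKl !row_mxKr /rep (fr_to aX dx') -b2 b1; exact: erefl.
(* The curves entering a piece are chosen independently of each other; this map nevertheless makes
   the endpoint a smooth function of the initial covector. *)
have [F0 [F [oF Fg sF HF]]] := endpoint_map aT sT sv ig.
pose q0 : M := (g 1).1.
have q0E : q0 = j p by rewrite /q0 -g1.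
have dq : dm q0 (j p) by rewrite q0E; exact: dm_mem.
have [OP [VM [lam [[oOP oVM OPp VMp] [_ VMi] sl lamj HVM]]]] := embedding_retract aP aM ej dp dq.
pose T1 := V0 `&` sg @^-1` ov (M := cotangent M) c (g 0).
have oT1 : open T1 by exact: open_preimS oV0 (open_ov aT _ _) ssg.
pose f1 u : 'rV[R]_(n + n) := tr (M := cotangent M) c (g 0) (sg u).
have sf1 : smooth_on T1 f1.
 apply: (smooth_comp oT1 (open_ov aT c (g 0)) _ _ (smooth_tr_chart aT c (g 0))); first by move=> u [].
 by apply: smooth_sub ssg => u [].
pose T2 := T1 `&` f1 @^-1` F0; have oT2 : open T2 by exact: open_preimS.
pose f2 u : 'rV[R]_n := lsubmx (F (f1 u) : 'rV[R]_(n + n)).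
have sf2 : smooth_on T2 f2.
 apply: smooth_lsubmx => //; apply: (smooth_comp oT2 oF _ _ sF); first by move=> u [].
 by apply: smooth_sub sf1 => u [].
pose T3 := T2 `&` f2 @^-1` VM; have oT3 : open T3 by exact: open_preimS.
have sf3 : smooth_on T3 (fun u => lam (f2 u)).
 apply: (smooth_comp oT3 oVM _ _ sl); first by move=> u [].
 by apply: smooth_sub sf2 => u [].
have gg0 := dm_mem aT (g 0); have gg1 := dm_mem aT (g 1).
have [g01 g02] : (g 0).1 = i x /\ (g 0).2 *m (cc (i (xs a)) (i x) (i x))^T = eta0 *m e (xs a) (to (xs a) x).
 by rewrite g0.
have [dc0 ec0] := Hsg x eta0 (g 0) Ox g01 g02.
pose u0 : 'rV[R]_(m + r) := row_mx (to (xs a) x) eta0.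
have f1u : f1 u0 = to (g 0) (g 0) by exact: (tr_of aT (g 0) dc0 ec0).
have [_ F1u] := HF g ig gg0 Fg.
have f2u : f2 u0 = to q0 (j p) by rewrite /f2 f1u -F1u cot_to row_mxKl -q0E.
have T3u : T3 u0.
 split; last by rewrite /= f2u.
 split; last by rewrite /= f1u.
 split; first by rewrite /V0 /= row_mxKl.
 by rewrite /= -ec0; apply: ov_to.
have [d [L [d0 L0 HL]]] := smooth_lipschitz oT3 T3u sf3.
have [b [b0 bu Hb]] := HQ u0 d d0.
exists a, b; split.
 split; first exact: yr.
 by exists x, eta0, g; split; [exact: Ox|exact: bu|exact: ig|exact: conj g01 g02|exact: g1].
exists (Q b).1, (Q b).2, L, (fun u => lam (f2 u)); split; [exact: b0|exact: L0| |].
 by move=> u u' /Hb h1 /Hb h2; exact: (HL u u' h1 h2).2.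
move=> y' [yr' [x' [eta' [g' [Ox' ub ig' [g01' g02'] g1']]]]].
exists (row_mx (to (xs a) x') eta'); first exact: ltW.
have [[[[V0u ou] F0u] VMu] _] := HL _ _ (Hb _ (ltW ub)) (Hb _ (ltW ub)).
have [dc' ec'] := Hsg x' eta' (g' 0) Ox' g01' g02'.
have d0' : dm (M := cotangent M) (g 0) (g' 0).
 by have /(ovP aT)[_] := ou; rewrite -ec' fr_to.
have f1u' : f1 (row_mx (to (xs a) x') eta') = to (g 0) (g' 0).
 exact: (tr_of aT (g 0) dc' ec').
have F0u' : F0 (to (g 0) (g' 0)) := eq_ind _ F0 F0u _ f1u'.
have [d1' e1'] := HF g' ig' d0' F0u'.
have dq' : dm q0 (j (fr p0 y')) := eq_ind _ (dm q0) d1' _ g1'.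
have f2u' : f2 (row_mx (to (xs a) x') eta') = to q0 (j (fr p0 y')).
 have h : f2 (row_mx (to (xs a) x') eta') = lsubmx (to (g 1) (g' 1) : 'rV[R]_(n + n)) by rewrite /f2 f1u' -e1'.
 by apply: etrans h _; rewrite cot_to row_mxKl; exact: (congr1 (to q0) g1').
have VMq : VM (to q0 (j (fr p0 y'))) := eq_ind _ VM VMu _ f2u'.
have [dp' OPp'] := HVM _ dq' VMq; have [_ ey'] := to_fr aP (Hr0 y' yr').
have [_ lj] := lamj _ OPp'; rewrite ey' in lj.
exact: etrans (congr1 lam f2u') lj.
Qed.

End Dimension.

(** * Coordinates from the splitting *)

Section Algebra.
Variable R : realType.

(** v e e^T = 0 forces |v e|^2 = 0. The Gram matrix serves to express coordinates in a frame by a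
    smooth formula. *)
Lemma gram_unit r n (e : 'M[R]_(r, n)) : row_free e -> e *m e^T \in unitmx.
Proof.
move=> rf; rewrite -row_free_unit; apply: inj_row_free => v h.
have : v *m e = 0.
 have : (v *m e) *m (v *m e)^T = 0 by rewrite trmx_mul mulmxA -(mulmxA v) h mul0mx.
 move: (v *m e) => w hw; apply/rowP => j; rewrite mxE; apply/eqP.
 have := congr1 (fun A : 'M[R]_1 => A 0 0) hw; rewrite /= mulmx_trE mxE => /eqP.
 rewrite psumr_eq0 => [/allP/(_ j)|l _]; last by rewrite -expr2 sqr_ge0.
 by rewrite mem_index_enum => /(_ isT); rewrite mulf_eq0 orbb.
by move/eqP; rewrite mulmx_free_eq0// => /eqP.
Qed.

(* A covector annihilating W whose sharp lies in TX annihilates TX^perp, hence everything. *)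
Lemma transverse_frame m n r rho (T : 'M[R]_(m, n)) (pi : 'M[R]_n) (e : 'M[R]_(r, n)) (H W K : 'M[R]_n) :
 row_free T -> row_free e -> pi^T = - pi -> e *m W^T = 0 ->
 (ann T *m pi :=: K + H)%MS -> (K + H + W :=: 1%:M)%MS ->
 \rank W = rho -> row_free (col_mx T (e *m pi)).
Proof.
move=> rT re aP eW tp full _; apply: inj_row_free => u; rewrite -[u]hsubmxK mul_row_col mulmxA => h.
set v := lsubmx u in h *; set y := rsubmx u in h *.
have kW : (W <= kermx (y *m e)^T)%MS.
 by apply/sub_kermxP; apply: (can_inj trmxK); rewrite trmx_mul trmxK -mulmxA eW mulmx0 trmx0.
have kT : (ann T *m pi <= kermx (y *m e)^T)%MS.
 apply/sub_kermxP; rewrite -mulmxA; have -> : pi *m (y *m e)^T = (v *m T)^T.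
  have -> : v *m T = - (y *m e *m pi) by apply/eqP; rewrite -addr_eq0 h.
  by rewrite linearN/= [in RHS]trmx_mul aP mulNmx opprK.
 by rewrite trmx_mul mulmxA mulmx_ker mul0mx.
have : (1%:M <= kermx (y *m e)^T)%MS by rewrite -full addsmx_sub kW andbT -tp.
move=> /sub_kermxP; rewrite mul1mx => /(congr1 trmx); rewrite trmxK trmx0 => ye.
have y0 : y = 0 by move/eqP: ye; rewrite mulmx_free_eq0// => /eqP.
move: h; rewrite ye mul0mx addr0 => /eqP; rewrite mulmx_free_eq0// => /eqP v0.
by rewrite v0 y0 row_mx0.
Qed.

(** The relation defining i^! L is independent of charts: [A] and [C] are changes of coordinates on
    X and M. *)
Lemma dirac_conj m n (A Ai : 'M[R]_m) (T : 'M[R]_(m, n)) (C Ci pi : 'M[R]_n) (v c : 'rV[R]_m) :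
 A *m Ai = 1%:M -> Ai *m A = 1%:M -> C *m Ci = 1%:M -> Ci *m C = 1%:M ->
 (exists b, v *m (A *m T *m C) = b *m (C^T *m pi *m C) /\ c = b *m (A *m T *m C)^T) <->
 (exists b, (v *m A) *m T = b *m pi /\ c *m Ai^T = b *m T^T).
Proof.
move=> hA hA' hC hC'; have tA : A^T *m Ai^T = 1%:M by rewrite -trmx_mul hA' trmx1.
have tA' : Ai^T *m A^T = 1%:M by rewrite -trmx_mul hA trmx1.
have tC : Ci^T *m C^T = 1%:M by rewrite -trmx_mul hC trmx1.
split=> [[b [h1 h2]]|[b [h1 h2]]].
 exists (b *m C^T); split.
  have := congr1 (fun X => X *m Ci) h1; rewrite -!mulmxA hC !mulmx1 => ->.
  by [].
 by rewrite h2 !trmx_mul -!mulmxA tA mulmx1.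
exists (b *m Ci^T); split.
 rewrite !mulmxA h1 -!mulmxA; congr (_ *m _).
 by rewrite mulmxA tC mul1mx.
rewrite !trmx_mul !mulmxA -(mulmxA b) tC mulmx1 -h2 -mulmxA tA' mulmx1.
by [].
Qed.

End Algebra.

Section System.
Variable R : realType.
Variables (X M P : charted R) (pi : bivec M) (i : X -> M) (j : P -> M) (piP : bivec P) (k : X -> P).
Variable chi : cotangent M -> 'rV[R]_(mdim (cotangent M)).
Hypotheses (hX : is_manifold X) (hM : is_manifold M) (hP : is_manifold P).
Hypotheses (hpi : is_poisson pi) (ei : is_embedding i) (ps : poisson_submanifold pi j piP).
Hypothesis jk : forall x, j (k x) = i x.
Hypothesis spr : poisson_spray pi chi.

Let aX := atlasP hX.
Let aM := atlasP hM.
Let aP := atlasP hP.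
Let si := emb_smooth ei.
Let ej : is_embedding j. Proof. by case: ps. Qed.
Let sj := emb_smooth ej.

(** [k] is only known as a map of sets with j o k = i; its continuity comes from the topology of the
    embedding [j]. *)
Lemma k_preim (VO : set P) : mopen VO -> mopen (k @^-1` VO).
Proof.
move=> oVO; have [VM [oVM e]] := emb_topology ej oVO.
have := smooth_map_cont aX aM si oVM; congr mopen.
by rewrite e; apply/seteqP; split => x; rewrite /= jk.
Qed.

Record frame_ok (W : X -> 'M[R]_(mdim M)) r (x0 : X) (VO : set 'rV[R]_(mdim X))
  (e : 'rV[R]_(mdim X) -> 'M[R]_(r, mdim M)) : Prop := FrameOk {
 fo_open : open VO; fo_mem : VO (to x0 x0); fo_im : VO `<=` im x0;
 fo_dm : forall y, VO y -> dm (i x0) (i (fr x0 y)); fo_smooth : smooth_on VO e;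
 fo_free : forall y, VO y -> row_free (e y);
 fo_ann : forall y, VO y -> let x := fr x0 y in e y *m (W x *m cc (i x) (i x0) (i x))^T = 0 }.

Record retract_ok (x0 : X) (OP : set 'rV[R]_(mdim P)) (VM : set 'rV[R]_(mdim M))
  (lam : 'rV[R]_(mdim M) -> 'rV[R]_(mdim P)) : Prop := RetractOk {
 ro_openP : open OP; ro_openM : open VM; ro_mem : OP (to (k x0) (k x0));
 ro_OP : OP `<=` rep_dom setT j (k x0) (i x0); ro_VM : VM `<=` im (i x0);
 ro_smooth : smooth_on VM lam;
 ro_lam : forall y, OP y -> VM (rep j (k x0) (i x0) y) /\ lam (rep j (k x0) (i x0) y) = y }.

Lemma retract_ex x0 : exists OP VM lam, retract_ok x0 OP VM lam.
Proof.
have dq : dm (i x0) (j (k x0)) by rewrite jk; exact: dm_mem.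
have [OP [VM [lam [[h1 h2 h3 h4] [h5 h6] s h7 _]]]] := embedding_retract aP aM ej (dm_mem aP (k x0)) dq.
by exists OP, VM, lam.
Qed.

Section At.
Variables (W : X -> 'M[R]_(mdim M)) (r : nat) (x0 : X) (VO : set 'rV[R]_(mdim X))
 (e : 'rV[R]_(mdim X) -> 'M[R]_(r, mdim M)).
Variables (OP : set 'rV[R]_(mdim P)) (VM : set 'rV[R]_(mdim M)) (lam : 'rV[R]_(mdim M) -> 'rV[R]_(mdim P)).

Definition exp_OX : set 'rV[R]_(mdim X) :=
 VO `&` to x0 @` (dm x0 `&` k @^-1` [set p | dm (k x0) p /\ OP (to (k x0) p)]).

(** All charts are the preferred ones at x0, k x0 and i x0; the covector (i x0, 0) merely selects
    the bundle chart. *)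
Definition exp_at : exp_data R (mdim X) r (mdim P) (mdim M) :=
 ExpData VM (pihat pi (i x0)) OP (rep j (k x0) (i x0)) lam (ghat chi (i x0, 0))
  exp_OX (rep k x0 (k x0)) e.

Hypothesis fo : frame_ok W x0 VO e.
Hypothesis ro : retract_ok x0 OP VM lam.

Lemma exp_OXP y : exp_OX y <-> [/\ VO y, dm (k x0) (k (fr x0 y)) & OP (rep k x0 (k x0) y)].
Proof.
split=> [[Vy /(mopen_imE aX)[iy [dk Ok]]]|[Vy dk Ok]]; first by split.
by split => //; apply/(mopen_imE aX); split; [exact: fo_im fo _ Vy|split].
Qed.

Lemma open_exp_OX : open exp_OX.
Proof.
have h := k_preim (mopen_chart aP (k x0) OP (ro_openP ro)).
exact: openI (fo_open fo) (h x0).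
Qed.

Lemma exp_OX_mem : exp_OX (to x0 x0).
Proof.
apply/exp_OXP; rewrite /rep (fr_to aX (dm_mem aX x0)).
by split; [exact: fo_mem fo|exact: dm_mem|exact: ro_mem ro].
Qed.

Lemma exp_rep_i y : exp_OX y -> rep j (k x0) (i x0) (rep k x0 (k x0) y) = rep i x0 (i x0) y.
Proof. by move=> /exp_OXP[_ dk _]; rewrite /rep (fr_to aP dk) jk. Qed.

Lemma smooth_rep_i : smooth_on VO (rep i x0 (i x0)).
Proof.
have [_ s] := rep_smooth x0 (i x0) si; apply: smooth_sub s => y Vy; apply/(rep_domP aX).
by split => //; [exact: fo_im fo _ Vy|exact: fo_dm fo _ Vy].
Qed.

Lemma exp_at_ok : exp_ok exp_at.
Proof.
have oOP := ro_openP ro; have oVM := ro_openM ro; have oOX := open_exp_OX.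
have sOX : smooth_on exp_OX (rep i x0 (i x0)) by apply: smooth_sub smooth_rep_i => y [].
have oD : open (lsubmx @^-1` VM : set 'rV[R]_(mdim M + mdim M)) by exact: smooth_lsub.
split=> //=.
- by apply: smooth_sub (pihat_smooth (i x0) hpi); exact: ro_VM ro.
- by have [_ s] := rep_smooth (k x0) (i x0) sj; apply: smooth_sub s; exact: ro_OP ro.
- exact: ro_smooth ro.
- by apply: smooth_sub (smooth_ghat aM spr (i x0, 0)) => u /(ro_VM ro).
(* Smoothness of [k]: in charts it is [lam] composed with the representative of [i]. *)
- apply: (smooth_ext oOX (f := fun y => lam (rep i x0 (i x0) y))).
  move=> y Oy; rewrite -(exp_rep_i Oy); have /exp_OXP[_ _ Ok] := Oy.
  by have [_] := ro_lam ro Ok.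
 apply: (smooth_comp oOX oVM _ sOX (ro_smooth ro)) => y Oy; rewrite -(exp_rep_i Oy).
 by have /exp_OXP[_ _ Ok] := Oy; have [] := ro_lam ro Ok.
- by apply: smooth_sub (fo_smooth fo) => y [].
- by move=> y /exp_OXP[].
- by move=> p /(ro_lam ro)[].
- by move=> q _; exact: pihat_antisym.
- have h : jacobi (im (i x0)) (pihat pi (i x0)) by exact: jacobi_chart.
 by move=> q /(ro_VM ro) /h.
- by move=> p /(ro_lam ro)[].
- move=> y Oy; have /(rep_domP aP)[iy _ qy] := ro_OP ro Oy; have [dy ey] := to_fr aP iy.
 set p := fr (k x0) y; have pp := dm_mem aP p; have jp := dm_mem aM (j p).
 rewrite -[y in 'J _ y]ey (rep_jac aP aM sj I dy qy) /pihat /rep -/p (fr_to aM qy).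
 have [_ /(_ p)/submxP[Y eY] _] := ps.
 apply/submxP; exists ((cc (j p) (i x0) (j p))^T *m Y *m cc p (k x0) p).
 have := cc_inv aP pp dy; have := eY; rewrite -/p.
 move: (cc p (k x0) p) (cc (k x0) p p) (cc (j p) (i x0) (j p)) (tmap j p) (pi (j p)) => S T C J Q -> ST.
 by rewrite !mulmxA -(mulmxA _ S) ST mulmx1.
by move=> q /(ro_VM ro) iq; exact: (ghat_zero aM spr (c := (i x0, 0))).
Qed.

Lemma exp_jac_i y : exp_OX y -> let x := fr x0 y in
 'J (ed_i exp_at) y = cc x0 x x *m tmap i x *m cc (i x) (i x0) (i x) /\
 Pi exp_at (ed_i exp_at y) = (cc (i x) (i x0) (i x))^T *m pi (i x) *m cc (i x) (i x0) (i x).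
Proof.
move=> Oy x; have [Vy _] := Oy; have [dx ex] := to_fr aX (fo_im fo Vy); have di := fo_dm fo Vy.
split; last by rewrite /= /ed_i /= (exp_rep_i Oy) /pihat /rep (fr_to aM di).
rewrite -(rep_jac aX aM si (I : setT x) dx di) ex.
apply: esym; apply: (jac_ext open_exp_OX Oy).
 exact: smooth_diff (fo_open fo) smooth_rep_i Vy.
by move=> z Oz; rewrite /ed_i /= exp_rep_i.
Qed.

(** At the centre all changes of charts are the identity, and the claim becomes
    [transverse_frame]. *)
Lemma exp_row_free H : splitting pi i H W ->
 row_free (col_mx ('J (ed_i exp_at) (to x0 x0)) (ee exp_at (to x0 x0) *m Pi exp_at (ed_i exp_at (to x0 x0)))).
Proof.
move=> sp; have [] := exp_jac_i exp_OX_mem; have fx := fr_to aX (dm_mem aX x0); rewrite fx.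
rewrite (cc_id aX (dm_mem aX x0)) (cc_id aM (dm_mem aM (i x0))) mul1mx !mulmx1 trmx1 mul1mx => -> ->.
have ann := fo_ann fo (fo_mem fo); rewrite /= fx (cc_id aM (dm_mem aM (i x0))) mulmx1 in ann.
apply: (transverse_frame (rho := \rank (W x0)) (emb_immersion ei x0) (fo_free fo (fo_mem fo)) _ ann (split_Tperp sp x0) (split_full sp x0)) => //.
exact: poisson_antisym hpi (i x0).
Qed.

Lemma exp_QP p : dm (k x0) p -> OP (to (k x0) p) ->
 ed_QP exp_at (to (k x0) p) = (cc p (k x0) p)^T *m piP p *m cc p (k x0) p.
Proof.
move=> dp Op; have pp := dm_mem aP p; apply: esym.
apply: (QP_uniq exp_at_ok Op) => /=.
have /(rep_domP aP)[_ _ qy] := ro_OP ro Op; rewrite (fr_to aP dp) in qy.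
rewrite (rep_jac aP aM sj I dp qy) /pihat /rep (fr_to aP dp) (fr_to aM qy).
have [_ _ /(_ p)] := ps; rewrite /poisson_at => <-.
have := cc_inv aP pp dp.
move: (cc p (k x0) p) (cc (k x0) p p) (cc (j p) (i x0) (j p)) (tmap j p) (piP p) => S T C J Q ST.
have TS : T^T *m S^T = 1%:M by rewrite -trmx_mul ST trmx1.
rewrite !trmx_mul !mulmxA -(mulmxA _ T^T) TS mulmx1 -(mulmxA _ S T) ST mulmx1.
by [].
Qed.

End At.
End System.

(** * Changes of charts and of frames *)

Section Transition.
Variable R : realType.
Variables (X M P : charted R) (pi : bivec M) (i : X -> M) (j : P -> M) (piP : bivec P) (k : X -> P).
Variable chi : cotangent M -> 'rV[R]_(mdim (cotangent M)).
Hypotheses (hX : is_manifold X) (hM : is_manifold M) (hP : is_manifold P).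
Hypotheses (hpi : is_poisson pi) (ei : is_embedding i) (ps : poisson_submanifold pi j piP).
Hypothesis jk : forall x, j (k x) = i x.
Hypothesis spr : poisson_spray pi chi.

Let aX := atlasP hX.
Let aM := atlasP hM.
Let aP := atlasP hP.
Let aT := atlas_cotangent aM.

Variables (W : X -> 'M[R]_(mdim M)) (r : nat) (x0 x0' : X) (VO VO' : set 'rV[R]_(mdim X))
 (e e' : 'rV[R]_(mdim X) -> 'M[R]_(r, mdim M)).
Variables (OP OP' : set 'rV[R]_(mdim P)) (VM VM' : set 'rV[R]_(mdim M)) (lam lam' : 'rV[R]_(mdim M) -> 'rV[R]_(mdim P)).
Hypotheses (fo : frame_ok i W x0 VO e) (fo' : frame_ok i W x0' VO' e').
Hypotheses (ro : retract_ok i j k x0 OP VM lam) (ro' : retract_ok i j k x0' OP' VM' lam').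
Variables (VG : set 'rV[R]_(mdim X)) (g : 'rV[R]_(mdim X) -> 'M[R]_r).

Let E := exp_at pi i j k chi x0 VO e OP VM lam.
Let E' := exp_at pi i j k chi x0' VO' e' OP' VM' lam'.

(** The domains are built from M upwards, so that the one in X is mapped into the one in P, and that
    into the one in M. *)
Definition tr_UM : set 'rV[R]_(mdim M) := VM `&` (ov (i x0) (i x0') `&` tr (i x0) (i x0') @^-1` VM').
Definition tr_UP : set 'rV[R]_(mdim P) :=
 OP `&` (ov (k x0) (k x0') `&` tr (k x0) (k x0') @^-1` OP') `&` rep j (k x0) (i x0) @^-1` tr_UM.
Definition tr_UX : set 'rV[R]_(mdim X) :=
 (VG `&` exp_OX k x0 VO OP) `&` (ov x0 x0' `&` tr x0 x0' @^-1` exp_OX k x0' VO' OP') `&` rep k x0 (k x0) @^-1` tr_UP.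

Lemma pihat_tr (p q : M) y : ov p q y ->
 pihat pi q (tr p q y) = ('J (tr p q) y)^T *m pihat pi p y *m 'J (tr p q) y.
Proof.
move=> /(ovP aM)[iy dy]; have [dp ep] := to_fr aM iy; have xx := dm_mem aM (fr p y).
rewrite /pihat /tr (fr_to aM dy) -/(tr p q).
have := cc_comp aM xx dp dy; rewrite (ccE p q) ep => <-.
by rewrite trmx_mul !mulmxA.
Qed.

(** The frame relation stays a hypothesis because the lemma is applied to frames of the second
    submanifold as well as to those transferred by [Phi]. *)
Lemma exp_transition : open VG -> smooth_on VG g ->
 (forall y, VG y -> ov x0 x0' y -> VO y -> VO' (tr x0 x0' y) ->
   e y = g y *m e' (tr x0 x0' y) *m ('J (tr (i x0) (i x0')) (rep i x0 (i x0) y))^T) ->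
 transition E E' (tr x0 x0') g (tr (k x0) (k x0')) (tr (i x0) (i x0')) tr_UX tr_UP tr_UM.
Proof.
move=> oVG sg He.
have oOX := open_exp_OX hX hM hP ei ps jk fo ro; have oOX' := open_exp_OX hX hM hP ei ps jk fo' ro'.
have oUM : open tr_UM.
 apply: openI (ro_openM ro) _.
 exact: open_preimS (open_ov aM _ _) (ro_openM ro') (smooth_tr_chart aM _ _).
have oUP : open tr_UP.
 apply: open_preimS oUM _; last by apply: smooth_sub (ok_j (exp_at_ok hX hM hP hpi ei ps jk spr fo ro)) => y [].
 apply: openI (ro_openP ro) _.
 exact: open_preimS (open_ov aP _ _) (ro_openP ro') (smooth_tr_chart aP _ _).
have oUX : open tr_UX.
 apply: open_preimS oUP _; last by apply: smooth_sub (ok_k (exp_at_ok hX hM hP hpi ei ps jk spr fo ro)) => y [[]].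
 apply: openI; first exact: openI oVG oOX.
 exact: open_preimS (open_ov aX _ _) oOX' (smooth_tr_chart aX _ _).
have riE y : exp_OX k x0 VO OP y -> rep j (k x0) (i x0) (rep k x0 (k x0) y) = rep i x0 (i x0) y.
 by move=> Oy; exact: (exp_rep_i hX hP jk fo Oy).
split.
- by split.
- move=> y [[[Gy Oy] [oy Oy']] Uy]; split => //=.
 have /(ovP aX)[iy dy] := oy.
 have /(exp_OXP k hX _ fo)[_ dk _] := Oy.
 by rewrite /rep /tr (fr_to aX dy) (fr_to aP dk).
- move=> p [[Op [op Op']] Up]; split => //=.
 have /(ovP aP)[ip dp] := op; have /(rep_domP aP)[_ _ qp] := ro_OP ro Op.
 by rewrite /rep /tr (fr_to aP dp) (fr_to aM qp).
- move=> q [Vq [oq Vq']]; split; [exact: Vq|exact: Vq'|exact: (unit_tr aM oq)|exact: (pihat_tr oq)].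
- split.
 + by apply: smooth_sub (smooth_tr_chart aX x0 x0') => y [[_ []]].
 + by apply: smooth_sub (smooth_tr_chart aP (k x0) (k x0')) => y [[_ []]].
 + by apply: smooth_sub (smooth_tr_chart aM (i x0) (i x0')) => y [_ []].
 + by apply: smooth_sub sg => y [[[]]].
- move=> y [[[Gy Oy] [oy Oy']] Uy] /=; rewrite /ed_i /= (riE _ Oy).
 by apply: He => //; [case: Oy|case: Oy'].
move=> u [Vu [ou Vu']] /=.
have iu := ro_VM ro Vu; have iu' := ro_VM ro' Vu'.
pose c : cotangent M := (i x0, 0); pose c' : cotangent M := (i x0', 0).
have oc : ov (M := cotangent M) c c' u by apply/(cot_ov aM).
have et : tr (M := cotangent M) c c' u = cot_lift (tr (i x0) (i x0')) u by exact: cot_tr.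
have il : im c'.1 (lsubmx (cot_lift (tr (i x0) (i x0')) u)) by rewrite /cot_lift row_mxKl.
have v1 := vhat_split aM spr (c := c) iu; have v2 := vhat_split aM spr (c := c') il.
have v3 := vhat_tr aT chi oc; rewrite et v1 v2 {1}/cot_lift row_mxKl in v3.
have -> : 'J (cot_lift (tr (i x0) (i x0'))) u = 'J (tr (M := cotangent M) c c') u.
 have oD : open (lsubmx @^-1` ov (i x0) (i x0') : set 'rV[R]_(mdim M + mdim M)) by apply: smooth_lsub; exact: open_ov.
 apply: esym; apply: (jac_ext (F := tr (M := cotangent M) c c') oD (ou : (lsubmx @^-1` ov (i x0) (i x0')) u)).
  by apply: smooth_diff (open_ov aT c c') (smooth_tr_chart aT c c') oc.
 by move=> w ow; exact: cot_tr.
exact: v3.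
Qed.

Lemma tr_UX_to x : dm x0 x -> dm x0' x -> VG (to x0 x) -> exp_OX k x0 VO OP (to x0 x) ->
 exp_OX k x0' VO' OP' (to x0' x) -> tr_UX (to x0 x).
Proof.
move=> dx dx' Gx Ox Ox'.
have /(exp_OXP k hX _ fo)[Vx dk Ok] := Ox; have /(exp_OXP k hX _ fo')[Vx' dk' Ok'] := Ox'.
have tx : tr x0 x0' (to x0 x) = to x0' x by rewrite /tr fr_to.
have riE := exp_rep_i hX hP jk fo Ox; have riE' := exp_rep_i hX hP jk fo' Ox'.
have [h1 _] := ro_lam ro Ok; have [h1' _] := ro_lam ro' Ok'.
have di := fo_dm fo Vx; have di' := fo_dm fo' Vx'.
rewrite riE in h1; rewrite riE' in h1'; rewrite /rep (fr_to aX dx) in dk Ok h1 di; rewrite /rep (fr_to aX dx') in dk' Ok' h1' di'.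
split; first by split; [split|split; [exact: ov_to|rewrite /= tx]].
rewrite /= /rep (fr_to aX dx); split.
 by split => //; split; [exact: ov_to|rewrite /= /tr (fr_to aP dk)].
rewrite /= /rep (fr_to aP dk) jk; split => //; split; first exact: ov_to.
by rewrite /= /tr (fr_to aM di).
Qed.

End Transition.

Section FrameChange.
Variable R : realType.
Variables (X M : charted R) (i : X -> M).
Hypotheses (hX : is_manifold X) (hM : is_manifold M) (ei : is_embedding i).
Let aX := atlasP hX.
Let aM := atlasP hM.
Variables (W : X -> 'M[R]_(mdim M)) (r : nat) (x0 x0' : X) (VO VO' : set 'rV[R]_(mdim X))
 (e e' : 'rV[R]_(mdim X) -> 'M[R]_(r, mdim M)).
Hypotheses (fo : frame_ok i W x0 VO e) (fo' : frame_ok i W x0' VO' e').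
Hypothesis rW : forall x, (\rank (W x) + r = mdim M)%N.

Definition fc_dom : set 'rV[R]_(mdim X) := VO `&` (ov x0 x0' `&` tr x0 x0' @^-1` VO').
Definition fc_J (y : 'rV[R]_(mdim X)) := 'J (tr (i x0) (i x0')) (rep i x0 (i x0) y).
(** Both frames span the annihilator of [W], so one is a matrix times the other; the Gram matrix of
    e' yields this matrix by a smooth formula. *)
Definition fc_g (y : 'rV[R]_(mdim X)) : 'M[R]_r :=
 e y *m (invmx (fc_J y))^T *m (e' (tr x0 x0' y))^T *m invmx (e' (tr x0 x0' y) *m (e' (tr x0 x0' y))^T).

Lemma fc_open : open fc_dom.
Proof. by apply: openI (fo_open fo) _; exact: open_preimS (open_ov aX _ _) (fo_open fo') (smooth_tr_chart aX _ _). Qed.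

Lemma fc_ov y : fc_dom y -> ov (i x0) (i x0') (rep i x0 (i x0) y).
Proof.
move=> [Vy [/(ovP aX)[iy dy] Vy']]; have d1 := fo_dm fo Vy; have d2 := fo_dm fo' Vy'.
by rewrite /tr (fr_to aX dy) in d2; rewrite /rep; exact: ov_to.
Qed.

Lemma fc_JE y : fc_dom y -> fc_J y = cc (i x0) (i x0') (i (fr x0 y)) /\ fc_J y \in unitmx.
Proof. by move=> dy; split; [exact: erefl|exact: (unit_tr aM (fc_ov dy))]. Qed.

Lemma fc_smooth : smooth_on fc_dom fc_g.
Proof.
have oD := fc_open.
have se : smooth_on fc_dom e by apply: smooth_sub (fo_smooth fo) => y [].
have se' : smooth_on fc_dom (fun y => e' (tr x0 x0' y)).
 apply: (smooth_comp oD (fo_open fo') _ _ (fo_smooth fo')); first by move=> y [_ []].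
 by apply: smooth_sub (smooth_tr_chart aX x0 x0') => y [_ []].
have sJ : smooth_on fc_dom fc_J.
 have sr : smooth_on fc_dom (rep i x0 (i x0)) by apply: smooth_sub (smooth_rep_i hX ei fo) => y [].
 apply: (smooth_comp oD (open_ov aM (i x0) (i x0')) fc_ov sr).
 by apply: smooth_jac; [exact: open_ov|exact: smooth_tr_chart].
apply: smooth_mulmx => //; last first.
 apply: smooth_invmx => //.
  by move=> y [_ [_ Vy']]; apply: gram_unit; exact: fo_free fo' _ Vy'.
 by apply: smooth_mulmx => //; exact: smooth_tr.
apply: smooth_mulmx => //; last exact: smooth_tr.
apply: smooth_mulmx => //; apply: smooth_tr => //; apply: smooth_invmx => //.
by move=> y /fc_JE[].
Qed.

Lemma gram_div n (A : 'M[R]_(r, n)) (J : 'M[R]_n) (B : 'M[R]_(r, n)) (h : 'M[R]_r) : J \in unitmx -> row_free B ->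
 A *m (invmx J)^T = h *m B -> A = (A *m (invmx J)^T *m B^T *m invmx (B *m B^T)) *m B *m J^T.
Proof.
move=> uJ rB e1; have uB := gram_unit rB.
rewrite e1 -(mulmxA h) mulmxK// -e1 -mulmxA -trmx_mul mulmxV// trmx1 mulmx1.
by [].
Qed.

Lemma fc_eq y : fc_dom y -> e y = fc_g y *m e' (tr x0 x0' y) *m (fc_J y)^T.
Proof.
move=> dy; have [Vy [/(ovP aX)[iy dy'] Vy']] := dy; have [eJ uJ] := fc_JE dy.
have a1 := fo_ann fo Vy; have a2 := fo_ann fo' Vy'; have d1 := fo_dm fo Vy; have d2 := fo_dm fo' Vy'.
have ii := dm_mem aM (i (fr x0 y)).
have ef : fr x0' (tr x0 x0' y) = fr x0 y by rewrite /tr (fr_to aX dy').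
rewrite /= in a1; rewrite /= ef in a2; rewrite ef in d2.
have rE : (\rank (W (fr x0 y) *m cc (i (fr x0 y)) (i x0') (i (fr x0 y))) + r = mdim M)%N.
 rewrite mxrankMfree; [exact: rW|rewrite row_free_unit; exact: (cc_unit aM ii d2)].
have h0 : e y *m (invmx (fc_J y))^T *m (W (fr x0 y) *m cc (i (fr x0 y)) (i x0') (i (fr x0 y)))^T = 0.
 have := cc_comp aM ii d1 d2; rewrite -eJ => <-.
 by move: a1 uJ; move: (fc_J y) (cc _ _ _) (W _) (e y) => J C V A a uJ; rewrite -mulmxA -trmx_mul -!mulmxA mulmxV// mulmx1.
have [h eh] := frame_complete (fo_free fo' Vy') a2 rE h0.
exact: gram_div uJ (fo_free fo' Vy') eh.
Qed.

End FrameChange.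

(** * Matching the two submanifolds *)

Section Pair.
Variable R : realType.
Variables (X M1 M2 : charted R).
Variables (pi1 : bivec M1) (i1 : X -> M1) (H1 W1 : X -> 'M[R]_(mdim M1)).
Variables (pi2 : bivec M2) (i2 : X -> M2) (H2 W2 : X -> 'M[R]_(mdim M2)).
Variable Phi : X -> 'M[R]_(mdim M1, mdim M2).
Hypotheses (hX : is_manifold X) (hM1 : is_manifold M1) (hM2 : is_manifold M2).
Hypotheses (ei1 : is_embedding i1) (ei2 : is_embedding i2).
Hypothesis hq : same_quadruple pi1 i1 H1 W1 pi2 i2 H2 W2 Phi.
Let aX := atlasP hX.
Let aM1 := atlasP hM1.
Let aM2 := atlasP hM2.
Variable r : nat.

Definition phat (x0 : X) (y : 'rV[R]_(mdim X)) : 'M[R]_(mdim M1, mdim M2) :=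
 let x := fr x0 y in cc (i1 x0) (i1 x) (i1 x) *m Phi x *m cc (i2 x) (i2 x0) (i2 x).

Definition dom1 (x0 : X) (VO : set 'rV[R]_(mdim X)) : set 'rV[R]_(mdim X) :=
 VO `&` to x0 @` (dm x0 `&` i1 @^-1` dm (i1 x0)).

(** [Phi] maps W1 onto W2, so its dual maps the annihilator of W2 isomorphically to that of W1, and
    a frame on one side determines a frame on the other. *)
Lemma frame_transfer x0 VO (e : 'rV[R]_(mdim X) -> 'M[R]_(r, mdim M2)) : frame_ok i2 W2 x0 VO e ->
 frame_ok i1 W1 x0 (dom1 x0 VO) (fun y => e y *m (phat x0 y)^T).
Proof.
move=> fo; have oD : open (dom1 x0 VO).
 apply: openI (fo_open fo) _.
 have h := smooth_map_cont aX aM1 (emb_smooth ei1) (mopen_dm aM1 (i1 x0)).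
 exact: (h x0).
have facts y : dom1 x0 VO y -> [/\ VO y, dm (i1 x0) (i1 (fr x0 y)) & dm (i2 x0) (i2 (fr x0 y))].
 by move=> [Vy /(mopen_imE aX)[_ d1]]; split => //; exact: fo_dm fo _ Vy.
split=> //.
- split; first exact: fo_mem fo.
 by exists x0 => //; split; exact: dm_mem.
- by move=> y [/(fo_im fo)].
- by move=> y /facts[].
- apply: smooth_mulmx => //; first by apply: smooth_sub (fo_smooth fo) => y [].
 apply: smooth_tr => //; apply: smooth_sub (sq_smooth hq x0 (i1 x0) (i2 x0)) => y Dy.
 have [Vy d1 d2] := facts y Dy; have [dx ex] := to_fr aX (fo_im fo Vy).
 by exists (fr x0 y).
- move=> y Dy; have [Vy d1 d2] := facts y Dy; have /andP[_ fP] := sq_iso hq (fr x0 y).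
 have u1 := cc_unit aM1 d1 (dm_mem aM1 (i1 (fr x0 y))); have u2 := cc_unit aM2 (dm_mem aM2 (i2 (fr x0 y))) d2.
 have rP : row_full (phat x0 y).
  rewrite /phat /row_full mxrankMfree; last by rewrite row_free_unit.
  by rewrite eqmxMfull; [exact: fP|rewrite row_full_unit].
 rewrite /row_free mxrankMfree; first exact: fo_free fo _ Vy.
 by move: rP; rewrite /row_free /row_full mxrank_tr.
move=> y Dy /=; have [Vy d1 d2] := facts y Dy; have := fo_ann fo Vy; rewrite /= /phat.
have cI := cc_inv aM1 (dm_mem aM1 (i1 (fr x0 y))) d1; move: cI.
have /submxP[Y eY] : (W1 (fr x0 y) *m Phi (fr x0 y) <= W2 (fr x0 y))%MS by rewrite (sq_W hq).
move: eY; move: (cc (i1 x0) _ _) (cc _ (i1 x0) _) (cc _ (i2 x0) _) (W1 _) (W2 _) (Phi _) (e y) => A B C V V' F f eY BA h.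
have -> : f *m (A *m F *m C)^T *m (V *m B)^T = f *m (V *m (B *m A) *m F *m C)^T.
 by rewrite -mulmxA -trmx_mul !mulmxA.
by rewrite BA mulmx1 eY -mulmxA trmx_mul mulmxA h mul0mx.
Qed.

Lemma phat_alg n1 n2 (A A' D : 'M[R]_n1) (F : 'M[R]_(n1, n2)) (B C E : 'M[R]_n2) :
 B *m C = E -> D *m A' = A -> A *m F *m B *m C = D *m (A' *m F *m E).
Proof. by move=> <- <-; rewrite !mulmxA. Qed.

Lemma conj_alg n (K : 'M[R]_(r, n)) (B p : 'M[R]_n) : K *m (B^T *m p *m B) *m K^T = (K *m B^T) *m p *m (K *m B^T)^T.
Proof. by rewrite trmx_mul trmxK !mulmxA. Qed.

Lemma pull_alg m n1 n2 (A : 'M[R]_m) (T1 : 'M[R]_(m, n1)) (T2 : 'M[R]_(m, n2)) (B B' : 'M[R]_n1) (F : 'M[R]_(n1, n2))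
  (C : 'M[R]_n2) (f : 'M[R]_(r, n2)) : B *m B' = 1%:M -> T1 *m F = T2 ->
 f *m (B' *m F *m C)^T *m (A *m T1 *m B)^T = f *m (A *m T2 *m C)^T.
Proof.
move=> BB <-; rewrite -mulmxA -trmx_mul !mulmxA -(mulmxA _ B) BB mulmx1.
by [].
Qed.

Lemma phat_tr x0 x0' y : dm (i1 x0) (i1 (fr x0 y)) -> dm (i2 x0) (i2 (fr x0 y)) ->
 dm (i1 x0') (i1 (fr x0 y)) -> dm (i2 x0') (i2 (fr x0 y)) -> ov x0 x0' y ->
 phat x0 y *m cc (i2 x0) (i2 x0') (i2 (fr x0 y)) = cc (i1 x0) (i1 x0') (i1 (fr x0 y)) *m phat x0' (tr x0 x0' y).
Proof.
move=> d1 d2 d1' d2' /(ovP aX)[iy dy]; have ef : fr x0' (tr x0 x0' y) = fr x0 y by rewrite /tr (fr_to aX dy).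
rewrite /phat ef.
have c1 := cc_comp aM1 d1 d1' (dm_mem aM1 (i1 (fr x0 y))).
have c2 := cc_comp aM2 (dm_mem aM2 (i2 (fr x0 y))) d2 d2'.
exact: phat_alg c2 c1.
Qed.

(** One matrix [g] changes the frames on both sides, so both transitions induce the same map of X x
    R^r. *)
Lemma gauge_transfer (e2 e2' : 'M[R]_(r, mdim M2)) (g : 'M[R]_r) (p p' : 'M[R]_(mdim M1, mdim M2)) J1 J2 :
 p *m J2 = J1 *m p' -> e2 = g *m e2' *m J2^T -> e2 *m p^T = g *m (e2' *m p'^T) *m J1^T.
Proof.
by move=> h ->; rewrite -(mulmxA _ J2^T) -trmx_mul h trmx_mul !mulmxA.
Qed.

Variables (P1 P2 : charted R) (j1 : P1 -> M1) (piP1 : bivec P1) (k1 : X -> P1) (j2 : P2 -> M2) (piP2 : bivec P2) (k2 : X -> P2).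
Variables (chi1 : cotangent M1 -> 'rV[R]_(mdim (cotangent M1))) (chi2 : cotangent M2 -> 'rV[R]_(mdim (cotangent M2))).
Hypotheses (hP1 : is_manifold P1) (hP2 : is_manifold P2).
Hypotheses (ps1 : poisson_submanifold pi1 j1 piP1) (ps2 : poisson_submanifold pi2 j2 piP2).
Hypotheses (jk1 : forall x, j1 (k1 x) = i1 x) (jk2 : forall x, j2 (k2 x) = i2 x).

Lemma form_ext n1 n2 (p1 : 'M[R]_n1) (p2 : 'M[R]_n2) (F : 'M[R]_(n1, n2)) (a : 'M[R]_(r, n2)) (V : 'M[R]_n2) :
 a *m V^T = 0 ->
 (forall b c : 'rV[R]_n2, (b <= ann V)%MS -> (c <= ann V)%MS ->
   ((b *m F^T) *m p1 *m (c *m F^T)^T) 0 0 = (b *m p2 *m c^T) 0 0) ->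
 (a *m F^T) *m p1 *m (a *m F^T)^T = a *m p2 *m a^T.
Proof.
move=> aV H; apply/matrixP => s t.
have rV0 l : (row l a <= ann V)%MS by apply/ann_subP; rewrite -row_mul aV row0.
have E n (q : 'M[R]_n) (f : 'M[R]_(r, n)) : (f *m q *m f^T) s t = (row s f *m q *m (row t f)^T) 0 0.
 by rewrite !mulmx_trE; apply: eq_bigr => l _; rewrite -row_mul; apply: f_equal2; rewrite [RHS]mxE.
by apply: etrans (E _ _ _) _; apply: etrans _ (esym (E _ _ _)); rewrite row_mul; have := H _ _ (rV0 s) (rV0 t); rewrite -!row_mul.
Qed.

(** i^! L is compared through [dirac_conj]. The pairings of the frames with TX agree since [Phi] is
    the identity on TX, and the forms by [sq_form] on covectors annihilating W2. *)
Lemma exp_compat x0 VO (e : 'rV[R]_(mdim X) -> 'M[R]_(r, mdim M2)) OP1 VM1 lam1 OP2 VM2 lam2 :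
 frame_ok i2 W2 x0 VO e ->
 retract_ok i1 j1 k1 x0 OP1 VM1 lam1 -> retract_ok i2 j2 k2 x0 OP2 VM2 lam2 ->
 compat (exp_at pi1 i1 j1 k1 chi1 x0 (dom1 x0 VO) (fun y => e y *m (phat x0 y)^T) OP1 VM1 lam1)
     (exp_at pi2 i2 j2 k2 chi2 x0 VO e OP2 VM2 lam2).
Proof.
move=> fo2 ro1 ro2 y Oy1 Oy2; have fo1 := frame_transfer fo2.
have [J1 Q1] := exp_jac_i chi1 hX hM1 hP1 ei1 ps1 jk1 fo1 ro1 Oy1.
have [J2 Q2] := exp_jac_i chi2 hX hM2 hP2 ei2 ps2 jk2 fo2 ro2 Oy2.
rewrite J1 Q1 J2 Q2 /=.
have /(exp_OXP k2 hX _ fo2)[Vy _ _] := Oy2; have /(exp_OXP k1 hX _ fo1)[Vy1 _ _] := Oy1.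
set x := fr x0 y; have [dx ex] := to_fr aX (fo_im fo2 Vy).
have d1 := fo_dm fo1 Vy1; have d2 := fo_dm fo2 Vy; rewrite -/x in dx d1 d2.
have xx := dm_mem aX x; have ii1 := dm_mem aM1 (i1 x); have ii2 := dm_mem aM2 (i2 x).
have [A1' A2'] := (cc_inv aX dx xx, cc_inv aX xx dx).
have [B1 B2] := (cc_inv aM1 ii1 d1, cc_inv aM1 d1 ii1); have [C1 C2] := (cc_inv aM2 ii2 d2, cc_inv aM2 d2 ii2).
have sd := sq_dirac hq x; have sT := sq_TX hq x; have sF a b := sq_form hq (x := x) (a := a) (b := b).
have an := fo_ann fo2 Vy; rewrite /= -/x in an.
rewrite /phat -/x.
have dE (M : charted R) (i : X -> M) (p : bivec M) (v c : 'rV[R]_(mdim X)) :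
  dirac_pullback i (dirac_of p) x (v, c) <-> exists b, v *m tmap i x = b *m p (i x) /\ c = b *m (tmap i x)^T.
 split=> [[b [[a [/= h1 h2]] /= h3]]|[b [h1 h2]]].
  by exists b; split; [rewrite h2; exact: h1|exact: h3].
 by exists b; split; [exists b; rewrite /= h1|exact: h2].
split.
- move=> v c.
 have h1 := dirac_conj (tmap i1 x) (pi1 (i1 x)) v c A1' A2' B1 B2.
 have h2 := dirac_conj (tmap i2 x) (pi2 (i2 x)) v c A1' A2' C1 C2.
 split=> [/h1/dE h|/h2/dE h].
  by apply/h2/dE; rewrite -sd.
 by apply/h1/dE; rewrite sd.
- exact: pull_alg B1 sT.
rewrite !conj_alg; have h0 : e y *m (cc (i2 x) (i2 x0) (i2 x))^T *m (W2 x)^T = 0 by rewrite -mulmxA -trmx_mul.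
have := form_ext h0 sF; clear -B1.
move: (cc (i1 x) (i1 x0) _) (cc (i1 x0) (i1 x) _) (cc (i2 x) (i2 x0) _) B1 => B B' C BB <-.
have -> : e y *m (B' *m Phi x *m C)^T *m B^T = e y *m C^T *m (Phi x)^T.
 by rewrite -!mulmxA -!trmx_mul !mulmxA BB mul1mx.
by [].
Qed.

End Pair.

(** * Smooth maps given locally *)

Section MapLocal.
Variable R : realType.
Variables (M N : charted R).
Hypotheses (aM : atlas M) (aN : atlas N).
Implicit Types (U Y : set M) (f g : M -> N).

Lemma smooth_map_sub U Y g : smooth_map_on U g -> mopen Y -> Y `<=` U -> smooth_map_on Y g.
Proof.
move=> sg oY YU p q; have [oD sD] := rep_smooth p q sg.
have e : rep_dom Y g p q = rep_dom U g p q `&` to p @` (dm p `&` Y).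
 apply/seteqP; split => y.
  by move=> /(rep_domP aM)[h1 h2 h3]; split; [apply/(rep_domP aM); split => //; exact: YU|exact/(mopen_imE aM)].
 by move=> [/(rep_domP aM)[h1 h2 h3] /(mopen_imE aM)[h4 h5]]; apply/(rep_domP aM).
rewrite -[X in let D := X in _]/(rep_dom Y g p q) e; split; first exact: openI oD (oY p).
by apply: smooth_sub sD => y [].
Qed.

Lemma smooth_map_local U f : (forall p, U p -> exists Y g, [/\ mopen Y, Y p, Y `<=` U, smooth_map_on Y g &
 forall y, Y y -> f y = g y]) -> smooth_map_on U f.
Proof.
move=> H p q; rewrite -[X in let D := X in _]/(rep_dom U f p q).
have loc y : rep_dom U f p q y -> exists Y g, [/\ rep_dom Y g p q y, rep_dom Y g p q `<=` rep_dom U f p q,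
  smooth_map_on Y g & forall z, rep_dom Y g p q z -> rep f p q z = rep g p q z].
 move=> /(rep_domP aM)[h1 h2 h3]; have [Y [g [oY Yy YU sg e]]] := H _ h2.
 exists Y, g; split => //.
 - by apply/(rep_domP aM); split => //; rewrite -e.
 - by move=> z /(rep_domP aM)[h4 h5 h6]; apply/(rep_domP aM); split => //; [exact: YU|rewrite e].
 - by move=> z /(rep_domP aM)[h4 h5 h6]; rewrite /rep e.
split.
 apply/open_rV => y /loc[Y [g [Dy DD sg _]]]; have [oD _] := rep_smooth p q sg.
 by have [e e0 He] := (open_rV _).1 oD _ Dy; exists e => // z /He /DD.
apply: smooth_local => y /loc[Y [g [Dy DD sg e]]]; have [oD sD] := rep_smooth p q sg.
by exists (rep_dom Y g p q); split => //; apply: (smooth_ext oD _ sD) => z /e.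
Qed.

Lemma tmap_local Y f g p : mopen Y -> Y p -> smooth_map_on Y g -> (forall y, Y y -> f y = g y) -> tmap f p = tmap g p.
Proof.
move=> oY Yp sg e; have ep := e p Yp; have [oD sD] := rep_smooth p (g p) sg.
have Dp : rep_dom Y g p (g p) (to p p) by exists p => //; split; [split => //; exact: dm_mem|exact: dm_mem].
rewrite /tmap ep; apply: esym; apply: (jac_ext oD Dp); first exact: smooth_diff oD sD Dp.
move=> y /(rep_domP aM)[_ Yy _]; by rewrite /= -[cof (chart_at p) y]/(fr p y) (e _ Yy).
Qed.

Lemma chart_map (p0 : M) (q0 : N) (Y : set M) (W : set 'rV[R]_(mdim M)) (psi : 'rV[R]_(mdim M) -> 'rV[R]_(mdim N)) :
 mopen Y -> Y `<=` dm p0 -> open W -> smooth_on W psi ->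
 (forall p, Y p -> W (to p0 p) /\ im q0 (psi (to p0 p))) ->
 let f p := fr q0 (psi (to p0 p)) in
 smooth_map_on Y f /\ forall p, Y p -> tmap f p = cc p p0 p *m 'J psi (to p0 p) *m cc q0 (f p) (f p).
Proof.
move=> oY Yd oW sp HY f.
have sf : smooth_map_on Y f.
 move=> p q; rewrite -[X in let D := X in _]/(rep_dom Y f p q).
 pose A := to p @` (dm p `&` Y); have oA : open A := oY p.
 have AP y : A y -> [/\ ov p p0 y, W (tr p p0 y), im q0 (psi (tr p p0 y)) & f (fr p y) = fr q0 (psi (tr p p0 y))].
  by move=> /(mopen_imE aM)[iy Yy]; have [h1 h2] := HY _ Yy; split => //; apply/(ovP aM); split => //; exact: Yd.
 have sh : smooth_on A (fun y => psi (tr p p0 y)).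
  apply: (smooth_comp oA oW _ _ sp); first by move=> y /AP[].
  by apply: smooth_sub (smooth_tr_chart aM p p0) => y /AP[].
 have e : rep_dom Y f p q = A `&` (fun y => psi (tr p p0 y)) @^-1` ov q0 q.
  apply/seteqP; split => y.
   move=> /(rep_domP aM)[h1 h2 h3]; have Ay : A y by apply/(mopen_imE aM).
   by have [_ _ h4 h5] := AP y Ay; split => //; apply/(ovP aN); rewrite /= -h5.
  move=> [Ay /(ovP aN)[h1 h2]]; have [_ _ _ h5] := AP y Ay; have /(mopen_imE aM)[h3 h4] := Ay.
  by apply/(rep_domP aM); rewrite h5.
 have oD : open (rep_dom Y f p q) by rewrite e; apply: open_preimS => //; exact: open_ov.
 split=> //; have sc : smooth_on (rep_dom Y f p q) (fun y => tr q0 q (psi (tr p p0 y))).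
  rewrite e; rewrite e in oD; apply: (smooth_comp oD (open_ov aN q0 q) _ _ (smooth_tr_chart aN q0 q)); first by move=> y [].
  by apply: smooth_sub sh => y [].
 apply: (smooth_ext oD _ sc) => y; rewrite e => -[/AP[_ _ _ h5] _].
 by rewrite /= -[cof (chart_at p) y]/(fr p y) h5.
split=> // p Yp; have [Wp ip] := HY p Yp; have dp := Yd p Yp; have [dq eq] := to_fr aN ip.
have j1 := rep_jac aM aN sf Yp dp (dq : dm q0 (f p)).
have oA : open (to p0 @` (dm p0 `&` Y)) := oY p0.
have Ap : (to p0 @` (dm p0 `&` Y)) (to p0 p) by exists p.
have j2 : 'J psi (to p0 p) = 'J (rep f p0 q0) (to p0 p).
 apply: (jac_ext oA Ap); first exact: smooth_diff oW sp Wp.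
 move=> y /(mopen_imE aM)[iy Yy]; have [d e] := to_fr aM iy; have [_] := HY _ Yy; rewrite e => h.
 by rewrite /rep /f e; have [_ ->] := to_fr aN h.
rewrite j2 j1; have c1 := cc_inv aM (dm_mem aM p) dp; have c2 := cc_inv aN (dm_mem aN (f p)) (dq : dm q0 (f p)).
move: (cc p p0 p) (cc p0 p p) (cc (f p) q0 _) (cc q0 (f p) _) (tmap f p) c1 c2 => A B C D T c1 c2.
by rewrite !mulmxA c1 mul1mx -mulmxA c2 mulmx1.
Qed.

End MapLocal.

(** * Gluing *)

Section Glue.
Variable R : realType.

Lemma mopen_finite (M : charted R) (aM : atlas M) (z : M) (Q : nat -> M -> Prop) n :
 (forall m, (m < n)%N -> exists Y, [/\ mopen Y, Y z & forall y, Y y -> Q m y]) ->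
 exists Y, [/\ mopen Y, Y z & forall y, Y y -> forall m, (m < n)%N -> Q m y].
Proof.
elim: n => [|n IH] H; first by exists setT; split => //; exact: mopenT.
have [Y [oY Yz HY]] := IH (fun m h => H m (ltnW h)); have [Y' [oY' Yz' HY']] := H n (ltnSn n).
exists (Y `&` Y'); split => //; first exact: mopenI.
by move=> y [h1 h2] m; rewrite ltnS leq_eqVlt => /predU1P[->|]; [exact: HY'|exact: HY].
Qed.

(* The n-th piece is restricted to the points near which it agrees with the earlier
   pieces wherever these are defined. *)
Lemma glue (P1 P2 : charted R) (hP1 : is_manifold P1) (d : P1 -> P2) (K : set P1) (I : Type)
  (N : I -> set P1) (f : I -> P1 -> P2) :
 (forall a, mopen (N a)) -> (forall p, K p -> exists a, N a p) ->
 (forall p a b, K p -> N a p -> N b p -> exists Y, [/\ mopen Y, Y p & forall y, Y y -> f a y = f b y]) ->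
 exists (V : set P1) (F : P1 -> P2), [/\ mopen V, K `<=` V & forall p, V p -> exists a Y,
  [/\ mopen Y, Y p, Y `<=` V, Y `<=` N a & forall y, Y y -> F y = f a y]].
Proof.
move=> oN covN germ; have aP := atlasP hP1; have [B [oB HB]] := countable_basis hP1.
(* A piece is used on an open ball whose closed ball lies in its domain. The closed ball being
   compact, a point outside the domain has a neighbourhood that misses the open ball; see [sepO]. *)
pose good (t : P1 * I * R) := 0 < t.2 /\ forall y : 'rV[R]_(mdim P1), `|y - to t.1.1 t.1.1| <= t.2 ->
 im t.1.1 y /\ N t.1.2 (fr t.1.1 y).
pose obj (t : P1 * I * R) : set P1 := [set x | dm t.1.1 x /\ `|to t.1.1 x - to t.1.1 t.1.1| < t.2].
have obj_open t : mopen (obj t).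
 apply: (mopen_chart aP t.1.1 [set y : 'rV[R]_(mdim P1) | `|y - to t.1.1 t.1.1| < t.2]).
 exact: open_nball.
(* For the n-th basis set one admissible ball containing it is selected, if there is any; this
   replaces the family of pieces by a countable one. *)
have [D HD] : exists D : nat -> option (P1 * I * R), forall n,
  (if D n is Some t then good t else True) /\
  ((exists t, good t /\ B n `<=` obj t) -> if D n is Some t then B n `<=` obj t else False).
 have h n : exists o : option (P1 * I * R), (if o is Some t then good t else True) /\
  ((exists t, good t /\ B n `<=` obj t) -> if o is Some t then B n `<=` obj t else False).
  have [[t [gt Bt]]|nt] := pselect (exists t, good t /\ B n `<=` obj t); first by exists (Some t).
  by exists None; split => // /nt.
 by have [D hD] := choice h; exists D.
pose On n := if D n is Some t then obj t else set0.
pose fn n := if D n is Some t then f t.1.2 else d.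
have OnN n x : On n x -> exists t, [/\ D n = Some t, N t.1.2 x & fn n = f t.1.2].
 rewrite /On /fn; have [+ _] := HD n; case: (D n) => // t [t0 gt] [dx xt]; exists t; split => //.
 by have [_] := gt _ (ltW xt); rewrite fr_to.
have oOn n : mopen (On n) by rewrite /On; case: (D n) => // ; apply: (mopen_local aP) => x.
have sepO n x : (forall t, D n = Some t -> ~ N t.1.2 x) -> exists Y, [/\ mopen Y, Y x & forall y, Y y -> ~ On n y].
 rewrite /On; have [+ _] := HD n; case: (D n) => [t [t0 gt] nN|_ _]; last first.
  by exists setT; split => //; [exact: mopenT|move=> y _ []].
 have [||V [oV Vx HV]] := ball_sep hP1 (p := t.1.1) (x := x) (c := to t.1.1 t.1.1) (r := t.2).
 - by move=> y /gt[].
 - by move=> [dx xt]; apply: (nN t erefl); have [_] := gt _ xt; rewrite fr_to.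
 exists V; split => // y Vy [dy yt]; have := HV y Vy dy; move: yt; clear; lra.
have covO p : K p -> exists n, On n p.
 move=> Kp; have [a Na] := covN p Kp.
 have /(mopenP aP)/(_ p p (dm_mem aP p) Na)[e e0 He] := oN a.
 have gt : good (p, a, e / 2).
  by split => [|y /= yr]; [rewrite divr_gt0|apply: He; move: yr e0; clear; lra].
 have op : obj (p, a, e / 2) p by split; [exact: dm_mem|rewrite /= subrr normr0 divr_gt0].
 have [n [Bp BO]] := HB _ p (obj_open _) op; exists n.
 by rewrite /On; have [_] := HD n; case: (D n) => [t|] h; [apply: h Bp|apply: h]; exists (p, a, e / 2).
(* Only finitely many earlier pieces are involved, so [T n] is open; two of these sets carry equal
   values where they overlap. *)
pose T n : set P1 := [set z | On n z /\ forall m, (m < n)%N ->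
 exists Y, [/\ mopen Y, Y z & forall y, Y y -> On m y -> fn m y = fn n y]].
have oT n : mopen (T n).
 apply: (mopen_local aP) => z [Oz Hz]; have [Y [oY Yz HY]] := mopen_finite aP (Q := fun m y => On m y -> fn m y = fn n y) Hz.
 exists (On n `&` Y); split => //; first exact: mopenI.
 by move=> y [Oy Yy]; split => // m mn; exists Y; split => // w Yw; exact: HY.
have cons n m z : T n z -> T m z -> fn n z = fn m z.
 move=> [On' Hn] [Om' Hm]; have [h|h|->//] := ltngtP n m.
  by have [Y [_ Yz HY]] := Hm n h; exact: HY.
 by have [Y [_ Yz HY]] := Hn m h; apply: esym; exact: HY.
have [F HF] : exists F : P1 -> P2, forall z n, T n z -> F z = fn n z.
 have h z : exists w, forall n, T n z -> w = fn n z.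
  have [[n Tn]|nT] := pselect (exists n, T n z); first by exists (fn n z) => m; exact: cons.
  by exists (d z) => n Tn; case: nT; exists n.
 by have [F hF] := choice h; exists F.
exists [set z | exists n, T n z], F; split.
- exact: mopen_bigcup.
- move=> p Kp; have [n On'] := covO p Kp; exists n; split => // m mn.
 have [[t [Dt Nt]]|nN] := pselect (exists t, D m = Some t /\ N t.1.2 p).
  have [t' [Dt' Nt' ft']] := OnN n p On'; have [Y [oY Yp HY]] := germ p t.1.2 t'.1.2 Kp Nt Nt'.
  by exists Y; split => // y Yy _; rewrite ft' /fn Dt; exact: HY.
 have [|Y [oY Yp HY]] := sepO m p; first by move=> t Dt Nt; apply: nN; exists t.
 by exists Y; split => // y Yy /(HY y Yy).
move=> p [n Tn]; have [t [Dt Nt ft]] := OnN n p Tn.1.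
exists t.1.2, (T n); split => //; first by move=> y Ty; exists n.
 by move=> y [/OnN[t' [Dt' Nt' _]] _]; move: Dt'; rewrite Dt => -[->].
by move=> y Ty; rewrite (HF y n Ty) ft.
Qed.

(** A glued map need not be injective, so the maps and their inverses are glued separately and then
    restricted to where the results are mutually inverse. Germs of the inverses agree because those
    of the maps do. *)
Theorem glue_diffeo (X P1 P2 : charted R) (pi1 : bivec P1) (pi2 : bivec P2) (k1 : X -> P1) (k2 : X -> P2)
  (d1 : P1 -> P2) (d2 : P2 -> P1) (N : X -> set P1) (N' : X -> set P2) (f : X -> P1 -> P2) (f' : X -> P2 -> P1) :
 is_manifold P1 -> is_manifold P2 ->
 (forall x, [/\ mopen (N x), mopen (N' x), N x (k1 x), smooth_map_on (N x) (f x) & smooth_map_on (N' x) (f' x)]) ->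
 (forall x p, N x p -> [/\ N' x (f x p), f' x (f x p) = p & poisson_at pi1 pi2 (f x) p]) ->
 (forall x q, N' x q -> N x (f' x q) /\ f x (f' x q) = q) ->
 (forall x y, (N x (k1 y) -> f x (k1 y) = k2 y) /\ (N' x (k2 y) -> N x (k1 y))) ->
 (forall x x' y, N x (k1 y) -> N x' (k1 y) -> exists Y, [/\ mopen Y, Y (k1 y) & forall p, Y p -> f x p = f x' p]) ->
 exists U1 U2 psi psi', [/\ forall x, U1 (k1 x), forall x, U2 (k2 x), poisson_diffeo pi1 pi2 U1 U2 psi psi' &
  forall x, psi (k1 x) = k2 x].
Proof.
move=> hP1 hP2 H1 Hf Hf' Hk germ; have a1 := atlasP hP1; have a2 := atlasP hP2.
have k2N x y : N' x (k2 y) -> [/\ N x (k1 y), f x (k1 y) = k2 y & f' x (k2 y) = k1 y].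
 move=> h; have n1 := (Hk x y).2 h; have e1 := (Hk x y).1 n1; split => //.
 by have [_ e2 _] := Hf x _ n1; rewrite -e1.
have germ' x x' y : N' x (k2 y) -> N' x' (k2 y) -> exists Y, [/\ mopen Y, Y (k2 y) & forall q, Y q -> f' x q = f' x' q].
 move=> h h'; have [n1 e1 e1'] := k2N x y h; have [n2 e2 e2'] := k2N x' y h'.
 have [Y [oY Yy HY]] := germ x x' y n1 n2; have [_ oN' _ _ sf'] := H1 x; have [oN2 _ _ _ _] := H1 x'.
 exists (N' x `&` f' x @^-1` (Y `&` N x')); split.
 - apply: (smooth_map_preim a2 a1 sf' oN'); exact: mopenI.
 - by split => //; rewrite /= e1'.
 move=> q [Nq [Yq Nq']]; have [_ e3] := Hf' x q Nq; have [_ e4 _] := Hf x' _ Nq'.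
 by rewrite -e4 -(HY _ Yq) e3.
have [|||V [F [oV KV HV]]] := @glue P1 P2 hP1 d1 (range k1) X N f.
- by move=> x; have [] := H1 x.
- by move=> p [x _ <-]; exists x; have [] := H1 x.
- by move=> p x x' [y _ <-]; exact: germ.
have Nk2 x : N' x (k2 x).
 by have [_ _ n1 _ _] := H1 x; have [+ _ _] := Hf x _ n1; rewrite (Hk x x).1.
have [|||V' [F' [oV' KV' HV']]] := @glue P2 P1 hP2 d2 (range k2) X N' f'.
- by move=> x; have [] := H1 x.
- by move=> p [x _ <-]; exists x.
- by move=> p x x' [y _ <-]; exact: germ'.
have sF : smooth_map_on V F.
 apply: (smooth_map_local a1) => p /HV[x [Y [oY Yp YV YN e]]]; exists Y, (f x); split => //.
 by apply: (smooth_map_sub a1) oY YN; have [] := H1 x.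
have sF' : smooth_map_on V' F'.
 apply: (smooth_map_local a2) => p /HV'[x [Y [oY Yp YV YN e]]]; exists Y, (f' x); split => //.
 by apply: (smooth_map_sub a2) oY YN; have [] := H1 x.
have pF p : V p -> poisson_at pi1 pi2 F p.
 move=> /HV[x [Y [oY Yp YV YN e]]]; have [_ _ pf] := Hf x p (YN p Yp); have [_ _ _ sf _] := H1 x.
 rewrite /poisson_at (tmap_local a1 a2 oY Yp (smooth_map_sub a1 sf oY YN) e).
 exact: etrans pf (congr1 pi2 (esym (e p Yp))).
have Fk y : F (k1 y) = k2 y.
 have [|x [Y [oY Yp _ YN e]]] := HV (k1 y); first by apply: KV; exists y.
 by rewrite (e _ Yp); exact: (Hk x y).1 (YN _ Yp).
have Fk' y : F' (k2 y) = k1 y.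
 have [|x [Y [oY Yp _ YN e]]] := HV' (k2 y); first by apply: KV'; exists y.
 by rewrite (e _ Yp); have [] := k2N x y (YN _ Yp).
(* [U0] asks for F' o F = id near the point, and [U2] for F o F' = id near it with values of F' in
   [U0]; this makes [U2] and the part of [U0] mapped into it correspond bijectively. *)
pose U0 : set P1 := [set p | exists Y, [/\ mopen Y, Y p, Y `<=` V & forall y, Y y -> V' (F y) /\ F' (F y) = y]].
pose U2 : set P2 := [set q | exists Y, [/\ mopen Y, Y q, Y `<=` V' & forall y, Y y -> U0 (F' y) /\ F (F' y) = y]].
have oU0 : mopen U0.
 by apply: (mopen_local a1) => p [Y [oY Yp YV HY]]; exists Y; split => // y Yy; exists Y.
have oU2 : mopen U2.
 by apply: (mopen_local a2) => p [Y [oY Yp YV HY]]; exists Y; split => // y Yy; exists Y.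
have U0V : U0 `<=` V by move=> p [Y [_ Yp YV _]]; exact: YV.
have kU0 y : U0 (k1 y).
 have Vk : V (k1 y) by apply: KV; exists y.
 have Vk' : V' (k2 y) by apply: KV'; exists y.
 have [x [Y [oY Yp YV YN e]]] := HV (k1 y) Vk; have [x' [Y' [oY' Yp' YV' YN' e']]] := HV' (k2 y) Vk'.
 have nx := YN _ Yp; have nx' : N' x (k2 y) by have [+ _ _] := Hf x _ nx; rewrite (Hk x y).1.
 have [Z [oZ Zy HZ]] := germ' x x' y nx' (YN' _ Yp').
 have sFY : smooth_map_on Y F by exact: (smooth_map_sub a1 sF oY YV).
 exists (Y `&` F @^-1` (Y' `&` Z)); split.
 - by apply: (smooth_map_preim a1 a2 sFY oY); exact: mopenI.
 - by split => //; rewrite /= Fk.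
 - by move=> z [/YV].
 move=> z [Yz [Yz' Zz]]; split; first exact: YV'.
 rewrite (e' _ Yz') -(HZ _ Zz) (e _ Yz).
 by have [_ -> _] := Hf x _ (YN _ Yz).
have kU2 y : U2 (k2 y).
 have Vk : V (k1 y) by apply: KV; exists y.
 have Vk' : V' (k2 y) by apply: KV'; exists y.
 have [x [Y [oY Yp YV YN e]]] := HV (k1 y) Vk; have [x' [Y' [oY' Yp' YV' YN' e']]] := HV' (k2 y) Vk'.
 have nx := YN _ Yp; have [nx' _ _] := k2N x' y (YN' _ Yp').
 have [Z [oZ Zy HZ]] := germ x x' y nx nx'.
 have sFY : smooth_map_on Y' F' by exact: (smooth_map_sub a2 sF' oY' YV').
 exists (Y' `&` F' @^-1` ((Y `&` Z) `&` U0)); split.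
 - by apply: (smooth_map_preim a2 a1 sFY oY'); apply: (mopenI a1) => //; exact: mopenI.
 - by split => //; rewrite /= Fk'.
 - by move=> z [/YV'].
 move=> z [Yz [[Yz' Zz] Uz]]; split => //.
 rewrite (e _ Yz') (HZ _ Zz) (e' _ Yz).
 by have [_ ->] := Hf' x' _ (YN' _ Yz).
exists (U0 `&` F @^-1` U2), U2, F, F'; split => //.
- by move=> x; split => //; rewrite /= Fk.
split => //.
- apply: (smooth_map_preim a1 a2 _ oU0 oU2); exact: (smooth_map_sub a1 sF oU0 U0V).
- by move=> p [[Y [_ Yp _ HY]] U2p]; have [] := HY p Yp.
- move=> q U2q; have [Y [_ Yq _ HY]] := U2q; have [h1 h2] := HY q Yq.
 by split => //; split => //; rewrite /= h2.
- apply: (smooth_map_sub a1 sF); last by move=> p [/U0V].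
 apply: (smooth_map_preim a1 a2 _ oU0 oU2); exact: (smooth_map_sub a1 sF oU0 U0V).
- by apply: (smooth_map_sub a2 sF' oU2) => q [Y [_ Yq YV _]]; exact: YV.
by move=> p [/U0V Vp _]; exact: pF.
Qed.

End Glue.

Section Iso.
Variable R : realType.

(** The outcome of [local_iso] in one record, so that choice can select a piece for every point of
    X. *)
Record iso_data m r D1 n1 D2 n2 := IsoData {
 iX1 : R -> 'rV[R]_(m + r) -> 'rV[R]_(D1 + n1); iX2 : R -> 'rV[R]_(m + r) -> 'rV[R]_(D2 + n2);
 iTh1 : 'rV[R]_(m + r) -> 'rV[R]_(m + r); iTh2 : 'rV[R]_(m + r) -> 'rV[R]_(m + r);
 iG1 : 'rV[R]_D1 -> 'rV[R]_(m + r); iG2 : 'rV[R]_D2 -> 'rV[R]_(m + r);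
 iOF1 : set 'rV[R]_D1; iOF2 : set 'rV[R]_D2; iZ : set 'rV[R]_(m + r); iZ0 : set 'rV[R]_(m + r);
 imu : 'rV[R]_(m + r) -> 'rV[R]_(m + r); iO1 : set 'rV[R]_D1; iO2 : set 'rV[R]_D2;
 ipsi' : 'rV[R]_D2 -> 'rV[R]_D1 }.

Definition ipsi m r D1 n1 D2 n2 (d : iso_data m r D1 n1 D2 n2) p := es_F (iX2 d) (imu d (iG1 d p)).

Record iso_ok m r D1 n1 D2 n2 (E1 : exp_data R m r D1 n1) (E2 : exp_data R m r D2 n2) (z0 : 'rV[R]_(m + r))
  (d : iso_data m r D1 n1 D2 n2) : Prop := IsoOk {
 io_S1 : exp_solution E1 (iZ d) (iX1 d) (iTh1 d) (iG1 d) (iOF1 d);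
 io_S2 : exp_solution E2 (iZ d) (iX2 d) (iTh2 d) (iG2 d) (iOF2 d);
 io_oZ0 : open (iZ0 d); io_z0 : iZ0 d z0; io_Z0Z : iZ0 d `<=` iZ d;
 io_mu : forall z, iZ0 d z -> exists c,
  [/\ moser_curve (iZ d) (es_Q E1 (iX1 d) (iG1 d)) (fun z => iTh2 d z - iTh1 d z) c, c 0 = z & c 1 = imu d z];
 io_tube : forall z1 (W : set 'rV[R]_(m + r)), iZ0 d z1 -> rsubmx z1 = 0 -> open W -> W z1 ->
  exists W', [/\ open W', W' z1, W' `<=` iZ0 d & forall z, W' z -> exists c,
   [/\ moser_curve (iZ d) (es_Q E1 (iX1 d) (iG1 d)) (fun z => iTh2 d z - iTh1 d z) c, c 0 = z, c 1 = imu d z &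
     forall t : R, 0 <= t <= 1 -> W (c t)]];
 io_oO1 : open (iO1 d); io_oO2 : open (iO2 d); io_F0 : iO1 d (es_F (iX1 d) z0);
 io_O1 : forall p, iO1 d p -> iOF1 d p /\ iZ0 d (iG1 d p);
 io_12 : forall p, iO1 d p -> iO2 d (ipsi d p) /\ ipsi' d (ipsi d p) = p;
 io_21 : forall q, iO2 d q -> iO1 d (ipsi' d q) /\ ipsi d (ipsi' d q) = q;
 io_s1 : smooth_on (iO1 d) (ipsi d); io_s2 : smooth_on (iO2 d) (ipsi' d);
 io_pois : forall p, iO1 d p -> ('J (ipsi d) p)^T *m ed_QP E1 p *m 'J (ipsi d) p = ed_QP E2 (ipsi d p);
 io_X : forall z, iZ0 d z -> rsubmx z = 0 -> ipsi d (es_F (iX1 d) z) = es_F (iX2 d) z }.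

Lemma iso_exists m r D1 n1 D2 n2 (E1 : exp_data R m r D1 n1) (E2 : exp_data R m r D2 n2) (x0 : 'rV[R]_m) :
 exp_ok E1 -> exp_ok E2 -> (D1 <= m + r)%N -> (D2 <= m + r)%N -> OX E1 x0 -> OX E2 x0 ->
 row_free (col_mx ('J (ed_i E1) x0) (ee E1 x0 *m Pi E1 (ed_i E1 x0))) ->
 row_free (col_mx ('J (ed_i E2) x0) (ee E2 x0 *m Pi E2 (ed_i E2 x0))) ->
 compat E1 E2 -> exists d, iso_ok E1 E2 (row_mx x0 0) d.
Proof.
move=> ok1 ok2 h1 h2 Ox1 Ox2 rf1 rf2 co.
have [Z1 [X1 [Th1 [G1 [OF1 [S1 Zz1]]]]]] := exp_exists ok1 h1 Ox1 rf1.
have [Z2 [X2 [Th2 [G2 [OF2 [S2 Zz2]]]]]] := exp_exists ok2 h2 Ox2 rf2.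
have oZ : open (Z1 `&` Z2) by apply: openI; [exact: es_oZ S1|exact: es_oZ S2].
have {}S1 := exp_solution_sub oZ (@subIsetl _ _ _) S1; have {}S2 := exp_solution_sub oZ (@subIsetr _ _ _) S2.
have [Z0 [mu [VA [VB [psi' [[a1 a2 a3 a4 a5] [b1 b2 b3 b4] [c1 c2 c3 c4] d1 e1]]]]]] :=
 local_iso S1 S2 co (conj Zz1 Zz2) (row_mxKr _ _).
exists (IsoData X1 X2 Th1 Th2 G1 G2 (OF1 `&` G1 @^-1` (Z1 `&` Z2)) (OF2 `&` G2 @^-1` (Z1 `&` Z2)) (Z1 `&` Z2) Z0 mu VA VB psi').
split; [exact: S1|exact: S2|exact: a1|exact: a2|exact: a3|exact: a4|exact: a5|exact: b1|exact: b2|exact: b3|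
 exact: b4|exact: c1|exact: c2|exact: c3|exact: c4|exact: d1|].
by move=> z Hz zz; have [_] := e1 z Hz zz.
Qed.

Lemma io_dom1 m r D1 n1 D2 n2 (E1 : exp_data R m r D1 n1) (E2 : exp_data R m r D2 n2) z0 (d : iso_data m r D1 n1 D2 n2) p :
 iso_ok E1 E2 z0 d -> iO1 d p -> OP E1 p /\ OP E2 (ipsi d p).
Proof.
move=> ok Op; have [OFp Zp] := io_O1 ok Op; have [Zg e] := es_GF (io_S1 ok) OFp; split.
 by rewrite -e; exact: (es_OP (es_pf (io_S1 ok)) Zg).
have [c [mc _ c1]] := io_mu ok Zp; apply: (es_OP (es_pf (io_S2 ok))); rewrite -c1.
have h11 : 0 <= (1 : R) <= 1 by rewrite ler01 lexx.
by have [] := mc 1 h11.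
Qed.

Lemma io_zero m r D1 n1 D2 n2 (E1 : exp_data R m r D1 n1) (E2 : exp_data R m r D2 n2) z0 (d : iso_data m r D1 n1 D2 n2) x :
 iso_ok E1 E2 z0 d -> iZ0 d (row_mx x 0) -> [/\ OX E1 x, OX E2 x, es_F (iX1 d) (row_mx x 0) = kk E1 x &
  ipsi d (kk E1 x) = kk E2 x].
Proof.
move=> ok Zx; have Hz := io_Z0Z ok Zx; have rz := row_mxKr x (0 : 'rV[R]_r).
have o1 := es_dom (io_S1 ok) Hz; have o2 := es_dom (io_S2 ok) Hz; rewrite row_mxKl in o1 o2.
have e1 := es_F_zero (es_ok (io_S1 ok)) (es_pf (io_S1 ok)) (es_dom (io_S1 ok)) Hz rz.
have e2 := es_F_zero (es_ok (io_S2 ok)) (es_pf (io_S2 ok)) (es_dom (io_S2 ok)) Hz rz.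
rewrite row_mxKl in e1 e2; split => //; rewrite -e1 -e2; exact: io_X ok _ Zx rz.
Qed.

(** On the zero section the Jacobian is block diagonal with blocks J tX and g, since the derivative
    of g is multiplied by the fibre coordinate 0. *)
Lemma jac_tau m r (tX : 'rV[R]_m -> 'rV[R]_m) (g : 'rV[R]_m -> 'M[R]_r) (U : set 'rV[R]_m) (x : 'rV[R]_m) :
 open U -> U x -> smooth_on U tX -> smooth_on U g -> 'J tX x \in unitmx -> g x \in unitmx ->
 'J (tau_map tX g) (row_mx x 0) \in unitmx.
Proof.
move=> oU Ux st sg uJ ug; pose W : set 'rV[R]_(m + r) := lsubmx @^-1` U.
have oW : open W by exact: smooth_lsub.
have Wz : W (row_mx x 0) by rewrite /W /= row_mxKl.
have sl := smooth_lsubT oW; have sr := smooth_rsubT oW.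
have s1 : smooth_on W (fun z => tX (lsubmx z)) by exact: (smooth_comp oW oU (fun _ h => h) sl st).
have s2 : smooth_on W (fun z => g (lsubmx z)) by exact: (smooth_comp oW oU (fun _ h => h) sl sg).
have s3 : smooth_on W (fun z => rsubmx z *m g (lsubmx z)) by exact: smooth_mulmx.
rewrite -row_free_unit; apply: inj_row_free => v.
have -> : 'J (tau_map tX g) (row_mx x 0) = row_mx ('J (fun z : 'rV[R]_(m + r) => tX (lsubmx z)) (row_mx x 0)) ('J (fun z : 'rV[R]_(m + r) => rsubmx z *m g (lsubmx z)) (row_mx x 0)).
 exact: jac_row_mx oW s1 s3 Wz.
rewrite mul_mx_row (jac_compS oW oU sl st Wz Wz) jac_lsub row_mxKl.
rewrite -(derJ v oW s3 Wz) (derive_mulmx v oW sr s2 Wz) row_mxKr mul0mx addr0 row_mxKl.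
have [_ ->] := rsub_affine (row_mx x 0 : 'rV[R]_(m + r)) v.
rewrite -[v]hsubmxK row_mxKr mulmxA mul_row_col mulmx1 mulmx0 addr0 -row_mx0 => /eq_row_mx[h1 h2].
have -> : lsubmx v = 0 by rewrite -[LHS](mulmxK uJ) h1 mul0mx.
by have -> : rsubmx v = 0 by rewrite -[LHS](mulmxK ug) h2 mul0mx.
Qed.

(** The comparison of pieces at a point of X. Invertibility of [g] is read off from the frame
    relation: the frame on its left side has full rank. *)
Lemma iso_natural m r D1 n1 D2 n2 (E1 E1' : exp_data R m r D1 n1) (E2 E2' : exp_data R m r D2 n2) z0 z0'
  (d d' : iso_data m r D1 n1 D2 n2) tX g UX1 UX2 kP1 kP2 kM1 kM2 UP1 UP2 UM1 UM2 (x : 'rV[R]_m) :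
 transition E1 E1' tX g kP1 kM1 UX1 UP1 UM1 -> transition E2 E2' tX g kP2 kM2 UX2 UP2 UM2 ->
 iso_ok E1 E2 z0 d -> iso_ok E1' E2' z0' d' -> UX1 x -> UX2 x -> iZ0 d (row_mx x 0) -> iZ0 d' (row_mx (tX x) 0) ->
 iO1 d (kk E1 x) -> 'J tX x \in unitmx -> row_free (ee E1 x) ->
 exists V, [/\ open V, V (kk E1 x) & forall p, V p -> [/\ iO1 d p, UP1 p, UP2 (ipsi d p) &
  ipsi d' (kP1 p) = kP2 (ipsi d p)]].
Proof.
move=> T1 T2 ok ok' U1 U2 Zx Zx' Ok uJ rf.
have [_ _ F1 psi1] := io_zero ok Zx.
have [oU1 oUP1 _] := tr_open T1; have [_ oUP2 _] := tr_open T2; have [stX _ _ sg] := tr_smooth T1.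
have ug : g x \in unitmx.
 rewrite -row_free_unit /row_free eqn_leq rank_leq_row /=.
 move: rf; rewrite (tr_e T1 U1) /row_free => /eqP {1}<-.
 by rewrite -mulmxA mxrankM_maxl.
have uT := jac_tau oU1 U1 stX sg uJ ug.
have eT : tau_map tX g (row_mx x 0) = row_mx (tX x) 0 by rewrite /tau_map row_mxKl row_mxKr mul0mx.
have U1' : UX1 (lsubmx (row_mx x 0 : 'rV[R]_(m + r))) by rewrite row_mxKl.
have U2' : UX2 (lsubmx (row_mx x 0 : 'rV[R]_(m + r))) by rewrite row_mxKl.
have Zx2 : iZ0 d' (tau_map tX g (row_mx x 0)) by rewrite eT.
have [V [oV Vx _ HV]] := local_iso_natural T1 T2 (io_S1 ok) (io_S1 ok') (io_S2 ok) (io_S2 ok') Zx (row_mxKr _ _)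
 U1' U2' Zx2 uT (io_Z0Z ok) (io_oZ0 ok') (io_Z0Z ok') (io_mu ok') (io_tube ok).
rewrite F1 in Vx.
exists (V `&` (iO1 d `&` ipsi d @^-1` UP2)); split.
- apply: openI => //; exact: open_preimS (io_oO1 ok) oUP2 (io_s1 ok).
- by split => //; split => //; rewrite /= psi1; have [] := tr_X T2 U2.
by move=> p [/HV[_ h1 h2] [h3 h4]].
Qed.

End Iso.

(** K + H complements W; the bound matches the dimension estimate of the saturation with the number
    of covectors in a frame of the annihilator of W. *)
Lemma annihilator_rank (R : realType) n (K H W T : 'M[R]_n) :
 mxdirect (K + H + W) -> (K + H + W :=: 1%:M)%MS -> (T :=: K + H)%MS -> (\rank T <= n - \rank W)%N.
Proof.
move=> /mxdirectP/= dr full eT; rewrite full mxrank1 in dr.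
rewrite eT; apply: leq_trans (mxrank_adds_leqif K H).1 _.
by move: dr; move: (\rank K) (\rank H) (\rank W) => a b c ->; rewrite addnK.
Qed.

(** * The local pieces and their union *)

Section Main.
Variable R : realType.
Variables (X M1 M2 P1 P2 : charted R).
Variables (pi1 : bivec M1) (i1 : X -> M1) (H1 W1 : X -> 'M[R]_(mdim M1)).
Variables (pi2 : bivec M2) (i2 : X -> M2) (H2 W2 : X -> 'M[R]_(mdim M2)).
Variables (j1 : P1 -> M1) (piP1 : bivec P1) (j2 : P2 -> M2) (piP2 : bivec P2).
Variable Phi : X -> 'M[R]_(mdim M1, mdim M2).
Hypotheses (hX : is_manifold X) (hM1 : is_manifold M1) (hM2 : is_manifold M2).
Hypotheses (hpi1 : is_poisson pi1) (hpi2 : is_poisson pi2).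
Hypotheses (ei1 : is_embedding i1) (ei2 : is_embedding i2).
Hypotheses (sp1 : splitting pi1 i1 H1 W1) (sp2 : splitting pi2 i2 H2 W2).
Hypothesis hq : same_quadruple pi1 i1 H1 W1 pi2 i2 H2 W2 Phi.
Hypotheses (sat1 : local_poisson_saturation pi1 i1 j1 piP1) (sat2 : local_poisson_saturation pi2 i2 j2 piP2).
Hypotheses (hP1 : is_manifold P1) (hP2 : is_manifold P2).
Hypotheses (ps1 : poisson_submanifold pi1 j1 piP1) (ps2 : poisson_submanifold pi2 j2 piP2).
Variables (chi1 : cotangent M1 -> 'rV[R]_(mdim (cotangent M1))) (chi2 : cotangent M2 -> 'rV[R]_(mdim (cotangent M2))).
Hypotheses (spr1 : poisson_spray pi1 chi1) (spr2 : poisson_spray pi2 chi2).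
Variables (k1 : X -> P1) (k2 : X -> P2).
Hypotheses (jk1 : forall x, j1 (k1 x) = i1 x) (jk2 : forall x, j2 (k2 x) = i2 x).
Variables (rho : nat) (VO : X -> set 'rV[R]_(mdim X)) (e : X -> 'rV[R]_(mdim X) -> 'M[R]_(mdim M2 - rho, mdim M2)).
Hypotheses (rW : forall x, \rank (W2 x) = rho) (fo2 : forall x, frame_ok i2 W2 x (VO x) (e x)).
Variables (OP1 : X -> set 'rV[R]_(mdim P1)) (VM1 : X -> set 'rV[R]_(mdim M1)) (lam1 : X -> 'rV[R]_(mdim M1) -> 'rV[R]_(mdim P1)).
Variables (OP2 : X -> set 'rV[R]_(mdim P2)) (VM2 : X -> set 'rV[R]_(mdim M2)) (lam2 : X -> 'rV[R]_(mdim M2) -> 'rV[R]_(mdim P2)).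
Hypotheses (ro1 : forall x, retract_ok i1 j1 k1 x (OP1 x) (VM1 x) (lam1 x))
 (ro2 : forall x, retract_ok i2 j2 k2 x (OP2 x) (VM2 x) (lam2 x)).

Let aX := atlasP hX.
Let aM1 := atlasP hM1.
Let aM2 := atlasP hM2.
Let aP1 := atlasP hP1.
Let aP2 := atlasP hP2.
Let r := (mdim M2 - rho)%N.
Let e1 x y := e x y *m (phat i1 i2 Phi x y)^T.
Let E1 x := exp_at pi1 i1 j1 k1 chi1 x (dom1 i1 x (VO x)) (e1 x) (OP1 x) (VM1 x) (lam1 x).
Let E2 x := exp_at pi2 i2 j2 k2 chi2 x (VO x) (e x) (OP2 x) (VM2 x) (lam2 x).

Let fo1 x : frame_ok i1 W1 x (dom1 i1 x (VO x)) (e1 x).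
Proof. exact: (frame_transfer hX hM1 hM2 ei1 hq (fo2 x)). Qed.

Let ok1 x : exp_ok (E1 x). Proof. exact: (exp_at_ok hX hM1 hP1 hpi1 ei1 ps1 jk1 spr1 (fo1 x) (ro1 x)). Qed.
Let ok2 x : exp_ok (E2 x). Proof. exact: (exp_at_ok hX hM2 hP2 hpi2 ei2 ps2 jk2 spr2 (fo2 x) (ro2 x)). Qed.

Let rW2 x : (\rank (W2 x) + r = mdim M2)%N.
Proof. by rewrite /r -(rW x) subnKC// rank_leq_col. Qed.

Let dim_eq (x : X) : mdim M1 = mdim M2 /\ \rank (W1 x) = rho.
Proof.
have /andP[f1 f2] := sq_iso hq x; split.
 by move: f1 f2; rewrite /row_free /row_full => /eqP -> /eqP.
by rewrite -(rW x) -(sq_W hq x) mxrankMfree.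
Qed.

Let dim1 (x : X) : (mdim P1 <= mdim X + r)%N.
Proof.
apply: leq_trans (saturation_dim hX hM1 ei1 sat1 x) _; rewrite leq_add2l.
apply: leq_trans (annihilator_rank (split_direct sp1 x) (split_full sp1 x) (split_Tperp sp1 x)) _.
by have [h1 h2] := dim_eq x; rewrite h2 h1.
Qed.

Let dim2 (x : X) : (mdim P2 <= mdim X + r)%N.
Proof.
apply: leq_trans (saturation_dim hX hM2 ei2 sat2 x) _; rewrite leq_add2l.
apply: leq_trans (annihilator_rank (split_direct sp2 x) (split_full sp2 x) (split_Tperp sp2 x)) _.
by rewrite rW.
Qed.

Lemma local_pieces : exists d : X -> iso_data R (mdim X) r (mdim P1) (mdim M1) (mdim P2) (mdim M2),
 forall x, iso_ok (E1 x) (E2 x) (row_mx (to x x) 0) (d x).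
Proof.
suff h x : exists d : iso_data R (mdim X) r (mdim P1) (mdim M1) (mdim P2) (mdim M2), iso_ok (E1 x) (E2 x) (row_mx (to x x) 0) d.
 by have [d hd] := choice h; exists d.
apply: (iso_exists (ok1 x) (ok2 x) (dim1 x) (dim2 x)).
- exact: (exp_OX_mem hX hP1 (fo1 x) (ro1 x)).
- exact: (exp_OX_mem hX hP2 (fo2 x) (ro2 x)).
- exact: (exp_row_free chi1 hX hM1 hP1 hpi1 ei1 ps1 jk1 (fo1 x) (ro1 x) sp1).
- exact: (exp_row_free chi2 hX hM2 hP2 hpi2 ei2 ps2 jk2 (fo2 x) (ro2 x) sp2).
have h := @exp_compat R X M1 M2 pi1 i1 H1 W1 pi2 i2 H2 W2 Phi hX hM1 hM2 ei1 ei2 hq _ P1 P2 j1 piP1 k1 j2 piP2 k2 chi1 chi2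
 hP1 hP2 ps1 ps2 jk1 jk2 x _ _ _ _ _ _ _ _ (fo2 x) (ro1 x) (ro2 x).
exact: h.
Qed.

Section Pieces.
Variable d : X -> iso_data R (mdim X) r (mdim P1) (mdim M1) (mdim P2) (mdim M2).
Hypothesis dok : forall x, iso_ok (E1 x) (E2 x) (row_mx (to x x) 0) (d x).

(** The points of X where the piece around x is under control; there it restricts to the identity of
    X by [pc_fk]. *)
Definition pc_D (x : X) : set X := [set y | [/\ dm x y, iZ0 (d x) (row_mx (to x y) 0), dm (k1 x) (k1 y) &
 iO1 (d x) (to (k1 x) (k1 y))]].
Definition pc_f (x : X) (p : P1) : P2 := fr (k2 x) (ipsi (d x) (to (k1 x) p)).
Definition pc_f' (x : X) (q : P2) : P1 := fr (k1 x) (ipsi' (d x) (to (k2 x) q)).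

Lemma pc_Dmem x : pc_D x x.
Proof.
have [_ _ F1 _] := io_zero (dok x) (io_z0 (dok x)); have O1x := io_F0 (dok x).
rewrite F1 /= /rep (fr_to aX (dm_mem aX x)) in O1x.
by split; [exact: dm_mem|exact: (io_z0 (dok x))|exact: dm_mem|exact: O1x].
Qed.

Lemma pc_Dopen x : mopen (pc_D x).
Proof.
have sI : smooth_on setT (fun y : 'rV[R]_(mdim X) => row_mx y 0 : 'rV[R]_(mdim X + r)).
 by apply: smooth_row_mx; [exact: openT|exact: smooth_id openT|by apply: smooth_cst; exact: openT].
have oA := open_preimS openT (io_oZ0 (dok x)) sI.
have mA := mopen_chart aX x _ oA.
have mB := k_preim hX hM1 ei1 ps1 jk1 (mopen_chart aP1 (k1 x) _ (io_oO1 (dok x))).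
have := mopenI aX mA mB; congr mopen; apply/seteqP; split => y.
 by move=> [[h1 [_ h2]] [h3 h4]].
by move=> [h1 h2 h3 h4].
Qed.

Lemma pc_DE x y : pc_D x y -> [/\ exp_OX k1 x (dom1 i1 x (VO x)) (OP1 x) (to x y), exp_OX k2 x (VO x) (OP2 x) (to x y),
 dm (k2 x) (k2 y), ipsi (d x) (to (k1 x) (k1 y)) = to (k2 x) (k2 y) & iO2 (d x) (to (k2 x) (k2 y))].
Proof.
move=> [h1 h2 h3 h4]; have [w1 w2 _ ps] := io_zero (dok x) h2.
have /(exp_OXP k2 hX _ (fo2 x))[_ dk _] := w2; rewrite (fr_to aX h1) in dk.
rewrite /= /rep (fr_to aX h1) in ps.
by split; [exact: w1|exact: w2|exact: dk|exact: ps|rewrite -ps; have [] := io_12 (dok x) h4].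
Qed.

Lemma pc_im1 x y : iO1 (d x) y -> im (k1 x) y /\ im (k2 x) (ipsi (d x) y).
Proof.
move=> Oy; have [Op1 Op2] := io_dom1 (dok x) Oy; split.
 by have /(rep_domP aP1)[] := ro_OP (ro1 x) Op1.
by have /(rep_domP aP2)[] := ro_OP (ro2 x) Op2.
Qed.

Variables (VA : X -> set M1) (VB : X -> set M2).
Hypotheses (oVA : forall x, mopen (VA x) /\ pc_D x = i1 @^-1` VA x) (oVB : forall x, mopen (VB x) /\ pc_D x = i2 @^-1` VB x).

(** The domain of the piece in P1 may meet X in points where it is not under control. Intersecting
    with the preimage of [VA x], an open set of M1 that meets X in [pc_D x], excludes them; compare
    [pc_Ak]. *)
Definition pc_A (x : X) : set P1 := [set p | dm (k1 x) p /\ iO1 (d x) (to (k1 x) p)] `&` j1 @^-1` VA x.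
Definition pc_B (x : X) : set P2 := [set p | dm (k2 x) p /\ iO2 (d x) (to (k2 x) p)] `&` j2 @^-1` VB x.
Definition pc_N (x : X) : set P1 := pc_A x `&` pc_f x @^-1` pc_B x.
Definition pc_N' (x : X) : set P2 := pc_B x `&` pc_f' x @^-1` pc_A x.

Let sj1 : smooth_map j1. Proof. by have [h _ _] := ps1; exact: emb_smooth h. Qed.
Let sj2 : smooth_map j2. Proof. by have [h _ _] := ps2; exact: emb_smooth h. Qed.

Lemma pc_Aopen x : mopen (pc_A x).
Proof.
apply: (mopenI aP1); first exact: (mopen_chart aP1 (k1 x) _ (io_oO1 (dok x))).
exact: (smooth_map_cont aP1 aM1 sj1 (oVA x).1).
Qed.

Lemma pc_Bopen x : mopen (pc_B x).
Proof.
apply: (mopenI aP2); first exact: (mopen_chart aP2 (k2 x) _ (io_oO2 (dok x))).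
exact: (smooth_map_cont aP2 aM2 sj2 (oVB x).1).
Qed.

Lemma pc_Ak x y : pc_A x (k1 y) <-> pc_D x y.
Proof.
have [_ /seteqP[h1 h2]] := oVA x; split=> [[_ h]|Dy].
 by apply: h2; rewrite /= -jk1.
by split; [have [_ _ ? ?] := Dy|rewrite /= jk1; exact: (h1 y Dy)].
Qed.

Lemma pc_Bk x y : pc_B x (k2 y) <-> pc_D x y.
Proof.
have [_ /seteqP[h1 h2]] := oVB x; split=> [[_ h]|Dy].
 by apply: h2; rewrite /= -jk2.
by split; [have [_ _ ? _ ?] := pc_DE Dy|rewrite /= jk2; exact: (h1 y Dy)].
Qed.

Lemma pc_fk x y : pc_D x y -> pc_f x (k1 y) = k2 y.
Proof. by move=> /pc_DE[_ _ dk ps _]; rewrite /pc_f ps (fr_to aP2 dk). Qed.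

Lemma pc_fmap x : smooth_map_on (pc_A x) (pc_f x) /\ forall p, pc_A x p ->
 tmap (pc_f x) p = cc p (k1 x) p *m 'J (ipsi (d x)) (to (k1 x) p) *m cc (k2 x) (pc_f x p) (pc_f x p).
Proof.
have oA : mopen (pc_A x) by exact: pc_Aopen.
apply: (chart_map aP1 aP2 oA _ (io_oO1 (dok x)) (io_s1 (dok x))); first by move=> p [[]].
by move=> p [[_ Op] _]; split => //; exact: (pc_im1 Op).2.
Qed.

Lemma pc_fmap' x : smooth_map_on (pc_B x) (pc_f' x).
Proof.
have oB : mopen (pc_B x) by exact: pc_Bopen.
have [h _] := chart_map aP2 aP1 (q0 := k1 x) oB (p0 := k2 x) (fun p h => h.1.1) (io_oO2 (dok x)) (io_s2 (dok x))
 (fun p h => conj h.1.2 (pc_im1 (io_21 (dok x) h.1.2).1).1).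
exact: h.
Qed.

Lemma pc_inv x p : pc_A x p -> pc_f' x (pc_f x p) = p.
Proof.
move=> [[dp Op] _]; have [_ iq] := pc_im1 Op; have [_ eq] := to_fr aP2 iq.
by rewrite /pc_f' /pc_f eq (io_12 (dok x) Op).2 (fr_to aP1 dp).
Qed.

Lemma pc_inv' x q : pc_B x q -> pc_f x (pc_f' x q) = q.
Proof.
move=> [[dq Oq] _]; have [Op e2] := io_21 (dok x) Oq; have [ip _] := pc_im1 Op; have [_ ep] := to_fr aP1 ip.
by rewrite /pc_f /pc_f' ep e2 (fr_to aP2 dq).
Qed.

Lemma poisson_alg n1 n2 (C : 'M[R]_n1) (J : 'M[R]_(n1, n2)) (B Bi : 'M[R]_n2) (p : 'M[R]_n1) (q : 'M[R]_n2) :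
 B *m Bi = 1%:M -> J^T *m (C^T *m p *m C) *m J = B^T *m q *m B -> (C *m J *m Bi)^T *m p *m (C *m J *m Bi) = q.
Proof.
move=> BB h; have BB' : Bi^T *m B^T = 1%:M by rewrite -trmx_mul BB trmx1.
have -> : (C *m J *m Bi)^T *m p *m (C *m J *m Bi) = Bi^T *m (J^T *m (C^T *m p *m C) *m J) *m Bi.
 by rewrite !trmx_mul !mulmxA.
by rewrite h !mulmxA BB' mul1mx -mulmxA BB mulmx1.
Qed.

Lemma pc_poisson x p : pc_A x p -> poisson_at piP1 piP2 (pc_f x) p.
Proof.
move=> Ap; have [_ /(_ p Ap) tE] := pc_fmap x; have [[dp Op] _] := Ap.
have [Op1 Op2] := io_dom1 (dok x) Op; have [_ iq] := pc_im1 Op; have [dq eq] := to_fr aP2 iq.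
have dq' : dm (k2 x) (pc_f x p) by exact: dq.
have eq' : to (k2 x) (pc_f x p) = ipsi (d x) (to (k1 x) p) by exact: eq.
have Op2' : OP2 x (to (k2 x) (pc_f x p)) by rewrite eq'.
have h1 := exp_QP hX hM1 hP1 hpi1 ei1 ps1 jk1 spr1 (fo1 x) (ro1 x) dp Op1.
have h2 := exp_QP hX hM2 hP2 hpi2 ei2 ps2 jk2 spr2 (fo2 x) (ro2 x) dq' Op2'.
have h3 := io_pois (dok x) Op; rewrite -eq' in h3.
have h4 : ('J (ipsi (d x)) (to (k1 x) p))^T *m ((cc p (k1 x) p)^T *m piP1 p *m cc p (k1 x) p) *m 'J (ipsi (d x)) (to (k1 x) p) =
  (cc (pc_f x p) (k2 x) (pc_f x p))^T *m piP2 (pc_f x p) *m cc (pc_f x p) (k2 x) (pc_f x p).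
 by rewrite -h1 -h2; exact: h3.
have h5 := cc_inv aP2 (dm_mem aP2 (pc_f x p)) dq'.
by rewrite /poisson_at tE; exact: (poisson_alg h5 h4).
Qed.

(** Around a common point of X the two pieces are related by changes of charts and one frame change
    valid on both sides, so [iso_natural] identifies their germs. *)
Lemma pc_germ x x' y : pc_D x y -> pc_D x' y ->
 exists Y, [/\ mopen Y, Y (k1 y) & forall p, Y p -> pc_f x p = pc_f x' p].
Proof.
move=> Dx Dx'; have [w1 w2 dk2 ps _] := pc_DE Dx; have [w1' w2' _ _ _] := pc_DE Dx'.
have [dx Zx dk1 Ok] := Dx; have [dx' Zx' dk1' _] := Dx'.
pose VG := fc_dom x x' (VO x) (VO x').
pose g := fc_g i2 x x' (e x) (e x').
have oVG : open VG := fc_open hX (fo2 x) (fo2 x').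
have sg : smooth_on VG g := fc_smooth hX hM2 ei2 (fo2 x) (fo2 x').
have eq2 y' : VG y' -> ov x x' y' -> VO x y' -> VO x' (tr x x' y') ->
  e x y' = g y' *m e x' (tr x x' y') *m ('J (tr (i2 x) (i2 x')) (rep i2 x (i2 x) y'))^T.
 by move=> Gy _ _ _; exact: (fc_eq hX hM2 (fo2 x) (fo2 x') rW2 Gy).
have T2 := exp_transition hX hM2 hP2 hpi2 ei2 ps2 jk2 spr2 (fo2 x) (fo2 x') (ro2 x) (ro2 x') oVG sg eq2.
have eq1 y' : VG y' -> ov x x' y' -> dom1 i1 x (VO x) y' -> dom1 i1 x' (VO x') (tr x x' y') ->
  e1 x y' = g y' *m e1 x' (tr x x' y') *m ('J (tr (i1 x) (i1 x')) (rep i1 x (i1 x) y'))^T.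
 move=> Gy oy Dy Dy'; have d1 := fo_dm (fo1 x) Dy; have d1' := fo_dm (fo1 x') Dy'.
 have d2 := fo_dm (fo2 x) Dy.1; have d2' := fo_dm (fo2 x') Dy'.1.
 have /(ovP aX)[_ dy] := oy; have ef : fr x' (tr x x' y') = fr x y' by rewrite /tr (fr_to aX dy).
 rewrite ef in d1' d2'.
 exact: (gauge_transfer (phat_tr Phi hX hM1 hM2 d1 d2 d1' d2' oy) (eq2 y' Gy oy Dy.1 Dy'.1)).
have T1 := exp_transition hX hM1 hP1 hpi1 ei1 ps1 jk1 spr1 (fo1 x) (fo1 x') (ro1 x) (ro1 x') oVG sg eq1.
have tx : tr x x' (to x y) = to x' y by rewrite /tr (fr_to aX dx).
have Gy : VG (to x y).
 split; first by have /(exp_OXP k2 hX _ (fo2 x))[] := w2.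
 split; first exact: ov_to.
 by rewrite /= tx; have /(exp_OXP k2 hX _ (fo2 x'))[] := w2'.
have U1 := tr_UX_to hX hM1 hP1 jk1 (fo1 x) (fo1 x') (ro1 x) (ro1 x') dx dx' Gy w1 w1'.
have U2 := tr_UX_to hX hM2 hP2 jk2 (fo2 x) (fo2 x') (ro2 x) (ro2 x') dx dx' Gy w2 w2'.
have Zt : iZ0 (d x') (row_mx (tr x x' (to x y)) 0) by rewrite tx.
have kE : kk (E1 x) (to x y) = to (k1 x) (k1 y) by rewrite /= /rep (fr_to aX dx).
have Ok' : iO1 (d x) (kk (E1 x) (to x y)) by rewrite kE.
have uJ : 'J (tr x x') (to x y) \in unitmx by exact: (unit_tr aX (ov_to dx dx')).
have rf : row_free (ee (E1 x) (to x y)) by apply: (fo_free (fo1 x)); have /(exp_OXP k1 hX _ (fo1 x))[] := w1.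
have [V [oV Vy HV]] := iso_natural T1 T2 (dok x) (dok x') U1 U2 Zx Zt Ok' uJ rf.
exists [set p | dm (k1 x) p /\ V (to (k1 x) p)]; split.
- exact: mopen_chart.
- by split => //; rewrite -kE.
move=> p [dp Vp]; have [Op Up1 Up2 eN] := HV _ Vp.
have [[_ [op1 _]] _] := Up1; have [[_ [op2 _]] _] := Up2.
have tp : tr (k1 x) (k1 x') (to (k1 x) p) = to (k1 x') p by rewrite /tr (fr_to aP1 dp).
have /(ovP aP2)[iq dq] := op2.
by rewrite /pc_f -tp eN /tr (fr_to aP2 dq).
Qed.

Theorem pieces_glue (d1 : P1 -> P2) (d2 : P2 -> P1) :
 exists U1 U2 psi psi', [/\ forall x, U1 (k1 x), forall x, U2 (k2 x), poisson_diffeo piP1 piP2 U1 U2 psi psi' &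
  forall x, psi (k1 x) = k2 x].
Proof.
have Nk x y : pc_N x (k1 y) <-> pc_D x y.
 split=> [[/pc_Ak]//|Dy]; split; first exact/pc_Ak.
 by rewrite /= (pc_fk Dy); exact/pc_Bk.
have oA x : mopen (pc_A x) by exact: pc_Aopen.
have oB x : mopen (pc_B x) by exact: pc_Bopen.
have oN x : mopen (pc_N x) by exact: (smooth_map_preim aP1 aP2 (pc_fmap x).1 (oA x) (oB x)).
have oN' x : mopen (pc_N' x) by exact: (smooth_map_preim aP2 aP1 (pc_fmap' x) (oB x) (oA x)).
apply: (glue_diffeo d1 d2 (N := pc_N) (N' := pc_N') (f := pc_f) (f' := pc_f') hP1 hP2).
- move=> x; split => //.
 + by apply/Nk; exact: pc_Dmem.
 + by apply: (smooth_map_sub aP1 (pc_fmap x).1 (oN x)) => p [].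
 + by apply: (smooth_map_sub aP2 (pc_fmap' x) (oN' x)) => p [].
- move=> x p [Ap Bp]; split; [|exact: pc_inv|exact: pc_poisson].
 by split => //; rewrite /= pc_inv.
- by move=> x q [Bq Aq]; split; [split => //; rewrite /= pc_inv'|exact: pc_inv'].
- move=> x y; split=> [/Nk/pc_fk//|[/pc_Bk Dy _]]; exact/Nk.
by move=> x x' y /Nk Dx /Nk Dx'; exact: pc_germ.
Qed.

End Pieces.
End Main.

Theorem corollary4p3 (R : realType) (X M1 M2 P1 P2 : charted R)
    (pi1 : bivec M1) (i1 : X -> M1) (H1 W1 : X -> 'M[R]_(mdim M1))
    (pi2 : bivec M2) (i2 : X -> M2) (H2 W2 : X -> 'M[R]_(mdim M2))
    (j1 : P1 -> M1) (piP1 : bivec P1) (j2 : P2 -> M2) (piP2 : bivec P2)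
    (Phi : X -> 'M[R]_(mdim M1, mdim M2))
    (hX : is_manifold X) (hM1 : is_manifold M1) (hM2 : is_manifold M2)
    (hpi1 : is_poisson pi1) (hpi2 : is_poisson pi2)
    (hi1 : is_embedding i1) (hi2 : is_embedding i2)
    (hcor1 : coregular pi1 i1) (hcor2 : coregular pi2 i2)
    (hpre1 : pre_poisson pi1 i1) (hpre2 : pre_poisson pi2 i2)
    (hsplit1 : splitting pi1 i1 H1 W1) (hsplit2 : splitting pi2 i2 H2 W2)
    (hquad : same_quadruple pi1 i1 H1 W1 pi2 i2 H2 W2 Phi)
    (hP1 : local_poisson_saturation pi1 i1 j1 piP1)
    (hP2 : local_poisson_saturation pi2 i2 j2 piP2) :
  exists (U1 : set P1) (U2 : set P2) (psi : P1 -> P2) (psi' : P2 -> P1),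
    [/\ range i1 `<=` j1 @` U1,
        range i2 `<=` j2 @` U2,
        poisson_diffeo piP1 piP2 U1 U2 psi psi' &
        forall (x : X) (p : P1), j1 p = i1 x -> j2 (psi p) = i2 x].
Proof.
have [chi1 [Sg1 [C1 [spr1 _ _ rj1 [mP1 ps1 ij1]]]]] := hP1.
have [chi2 [Sg2 [C2 [spr2 _ _ rj2 [mP2 ps2 ij2]]]]] := hP2.
have k1ex x : exists p, j1 p = i1 x by have [p _ e] := ij1 _ (imageP i1 (I : setT x)); exists p.
have k2ex x : exists p, j2 p = i2 x by have [p _ e] := ij2 _ (imageP i2 (I : setT x)); exists p.
have [k1 jk1] := choice k1ex; have [k2 jk2] := choice k2ex.
(* A point of P1 is reached from a covector over X, so X is then inhabited; this supplies total maps
   as default values outside the glued domains. *)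
have xP1 (p : P1) : exists x : X, True.
 have : (range j1) (j1 p) by exists p.
 by rewrite rj1 => -[x _]; exists x.
have xP2 (p : P2) : exists x : X, True.
 have : (range j2) (j2 p) by exists p.
 by rewrite rj2 => -[x _]; exists x.
have [x1 _] := choice xP1; have [x2 _] := choice xP2.
have aX := atlasP hX; have aM2 := atlasP hM2.
have [rho [rW HW]] := local_frame aX aM2 (emb_smooth hi2) (split_W hsplit2).
have [VO HVO] := choice HW; have {HVO}[e He] := choice HVO.
have fo2 x : frame_ok i2 W2 x (VO x) (e x).
 by have [[a1 a2 a3] b c h] := He x; split => //; move=> y /h[].
have [OP1 h1] := choice (retract_ex hM1 mP1 ps1 jk1); have {h1}[VM1 h1] := choice h1; have {h1}[lam1 ro1] := choice h1.
have [OP2 h2] := choice (retract_ex hM2 mP2 ps2 jk2); have {h2}[VM2 h2] := choice h2; have {h2}[lam2 ro2] := choice h2.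
have [d dok] := local_pieces hX hM1 hM2 hpi1 hpi2 hi1 hi2 hsplit1 hsplit2 hquad hP1 hP2 mP1 mP2 ps1 ps2 spr1 spr2 jk1 jk2 rW fo2 ro1 ro2.
have oD := pc_Dopen hX hM1 hi1 mP1 ps1 jk1 dok.
have [VA oVA] := choice (fun x => emb_topology hi1 (oD x)).
have [VB oVB] := choice (fun x => emb_topology hi2 (oD x)).
have [U1 [U2 [psi [psi' [kU1 kU2 pd pk]]]]] := pieces_glue hX hM1 hM2 hpi1 hpi2 hi1 hi2 hquad mP1 mP2 ps1 ps2 spr1 spr2 jk1 jk2
 rW fo2 ro1 ro2 dok oVA oVB (fun p => k2 (x1 p)) (fun q => k1 (x2 q)).
exists U1, U2, psi, psi'; split => //.
- by move=> _ [x _ <-]; exists (k1 x) => //; exact: jk1.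
- by move=> _ [x _ <-]; exists (k2 x) => //; exact: jk2.
move=> x p e1; have [ej1 _ _] := ps1.
have -> : p = k1 x by apply: (emb_inj ej1); rewrite jk1.
by rewrite pk jk2.
Qed.
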